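(* Assume the Generalized Riemann Hypothesis. Let $s=\sigma+it$ where $1/2< \sigma<1$ and $t\in \mathbb{R}$, and let $x$ be large. Then there are $\gg x^{1/2}$ primes $p\leq x$ such that $$ \log |L(s,\chi_p)|\geq (\beta(s)+o(1))(\log x)^{1-\sigma}(\log_2 x)^{-\sigma},$$ and $\gg x^{1/2}$ primes $q\leq x$ such that $$ \log |L(s,\chi_q)|\leq -(\beta(s)+o(1))(\log x)^{1-\sigma}(\log_2 x)^{-\sigma},$$ where $\beta(\sigma)=(2\log 2)^{\sigma-1}/(1-\sigma)$ (the case $t=0$), and $\beta(s)=\beta(\sigma)t^2/\left((1-\sigma)^2+4 t^2\right)$ if $t\neq 0$.
   Context: For a prime $p$, $\chi_p=\left(\frac{\cdot}{p}\right)$ is the Legendre symbol modulo $p$ and $L(s,\chi_p)$ its Dirichlet $L$-function. $\log_2=\log\log$. *)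

(* Defs.v *)
From Stdlib Require Import Reals Lra ZArith Znumtheory List Arith.
From Coquelicot Require Import Coquelicot.
Open Scope R_scope.

Definition cpow_neg (n : nat) (s : C) : C :=
  (exp (- Re s * ln (INR n)) * cos (Im s * ln (INR n)),
   - (exp (- Re s * ln (INR n)) * sin (Im s * ln (INR n)))).

Fixpoint DS_partial (a : nat -> C) (s : C) (N : nat) : C :=
  match N with
  | O => RtoC 0
  | S N' => Cplus (DS_partial a s N') (Cmult (a N) (cpow_neg N s))
  end.

(* l is the value of the Dirichlet series sum_{n>=1} a(n) n^{-s}, defined as
   the limit of its partial sums.  For a non-principal Dirichlet character and
   Re s > 0 this series converges and its sum is L(s,chi) (analytic continuation). *)
Definition is_DSval (a : nat -> C) (s : C) (l : C) : Prop :=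
  filterlim (DS_partial a s) eventually (locally l).

Definition dirichlet_char (q : nat) (chi : nat -> C) : Prop :=
  (1 <= q)%nat /\
  (forall m n, chi (m * n)%nat = Cmult (chi m) (chi n)) /\
  (forall n, chi (n + q)%nat = chi n) /\
  (forall n, chi n <> RtoC 0 <-> Nat.gcd n q = 1%nat).

Definition nonprincipal (chi : nat -> C) : Prop :=
  exists n, chi n <> RtoC 0 /\ chi n <> RtoC 1.

(* Dirichlet eta function coefficients: eta(s) = (1 - 2^{1-s}) zeta(s). *)
Definition eta_coef (n : nat) : C := RtoC ((-1) ^ (n - 1)).

(* Generalized Riemann Hypothesis: no zeros of zeta (through eta, whose extra
   zeros lie on Re s = 1) nor of L(s,chi) (chi non-principal) with
   1/2 < Re s < 1.  (The principal case reduces to zeta, and zeros in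
   0 < Re s < 1/2 are excluded by the functional equation.) *)
Definition GRH : Prop :=
  (forall s l, 1/2 < Re s < 1 -> is_DSval eta_coef s l -> l <> RtoC 0) /\
  (forall q chi, dirichlet_char q chi -> nonprincipal chi ->
     forall s l, 1/2 < Re s < 1 -> is_DSval chi s l -> l <> RtoC 0).

Definition legendre (p n : nat) : Z :=
  if Nat.eqb (n mod p) 0 then 0%Z
  else if existsb (fun x => Nat.eqb ((x * x) mod p) (n mod p)) (seq 0 p)
       then 1%Z else (-1)%Z.

Definition chi_leg (p : nat) : nat -> C := fun n => RtoC (IZR (legendre p n)).

Definition beta_sigma (sigma : R) : R :=
  Rpower (2 * ln 2) (sigma - 1) / (1 - sigma).

Definition beta (sigma t : R) : R :=
  if Req_EM_T t 0 then beta_sigma sigma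
  else beta_sigma sigma * t ^ 2 / ((1 - sigma) ^ 2 + 4 * t ^ 2).

Definition scale (sigma x : R) : R :=
  Rpower (ln x) (1 - sigma) * Rpower (ln (ln x)) (- sigma).

(* Main.v *)
(** Expand [L(s, chi)], or [(s - 1) zeta(s)], in powers of [s - s0] with [Re s0 >= 3]. Since there are no zeros with
    [Re s > 1/2] (GRH, and the classical arguments on [Re s >= 1]), a Borel-Caratheodory estimate bounds the Taylor
    coefficients of the logarithmic derivative, i.e. the sums of [mangoldt n * chi n * n^(-s0) * (log n)^j]. For
    [s0 = D] large, the partial sums of the exponential series turn these into smoothly truncated sums of
    [mangoldt n * chi n] with square-root error; this gives the prime number theorem and, by quadratic reciprocity,
    cancellation in the average of [(q_1 ... q_k / p)] over primes [p <= x].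

    Averaging the nonnegative weight [prod_(q <= Y) (1 + eps_q (q / p))] over [p], where
    [Y ~ log x loglog x / (2 log 2)] keeps [2^pi(Y)] below [x^(1/2)], yields at least [x^(1/2)] primes [p] with
    [(q / p) = eps_q] for all odd primes [q <= Y]; a second moment shows that for most of them the primes
    [Y < q <= (log x)^c] contribute little. For such [p], [log |L(s, chi_p)|] is
    [sum_(q <= Y) eps_q cos(t log q) q^(-sigma) + O(1)]. Take [eps_q] to be plus or minus the sign of
    [cos(t log q)] and use [|cos| >= cos^2]. *)

Require Import Defs.
From Stdlib Require Import Reals ZArith Znumtheory List Permutation Lra Lia ClassicalEpsilon.
From Coquelicot Require Import Coquelicot.
From HB Require structures.
From mathcomp Require all_boot all_order all_algebra all_fingroup all_solvable all_field.
Open Scope nat_scope.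
Open Scope R_scope.

Notation lg n := (ln (INR n)).

Ltac pos := first
  [ lra | apply lt_0_INR; lia | apply pos_INR | apply Rabs_pos | apply pow2_ge_0 | apply INR_fact_lt_0 | apply exp_pos
  | apply Rinv_0_lt_compat; pos | apply pow_lt; pos | apply pow_le; pos
  | apply Rmult_lt_0_compat; pos | apply Rmult_le_pos; pos | left; pos ].

(** * Logarithmic derivatives of power series *)

Lemma is_derive_0_const_on (g : R -> R) (u v x y : R) :
  (forall z, u < z < v -> is_derive g z 0) -> u < x < v -> u < y < v -> g x = g y.
Proof.
intros Hg Hx Hy. destruct (Rtotal_order x y) as [Hlt|[->|Hgt]]; [|reflexivity|symmetry];
  apply (eq_is_derive g); try assumption; intros z Hz; apply Hg; lra.
Qed.

Lemma pow_le_1 (x : R) n : 0 <= x <= 1 -> x ^ n <= 1.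
Proof. intros Hx. rewrite <- (pow1 n). apply pow_incr; lra. Qed.

Lemma ln_nonneg (x : R) : 1 <= x -> 0 <= ln x.
Proof. intros Hx. rewrite <- ln_1. apply ln_le; lra. Qed.

Lemma is_lim_seq_ge_const u (l c : R) : eventually (fun n => c <= u n) -> is_lim_seq u l -> c <= l.
Proof. intros Hu Hl. exact (is_lim_seq_le_loc (fun _ => c) u c l Hu (is_lim_seq_const c) Hl). Qed.

Lemma is_lim_seq_le_const u (l c : R) : eventually (fun n => u n <= c) -> is_lim_seq u l -> l <= c.
Proof. intros Hu Hl. exact (is_lim_seq_le_loc u (fun _ => c) l c Hu Hl (is_lim_seq_const c)). Qed.

Lemma is_lim_seq_Rabs_le u (l B : R) :
  (forall n, Rabs (u n) <= B) -> is_lim_seq u l -> Rabs l <= B.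
Proof.
intros Hu Hl. apply (is_lim_seq_le_const (fun n => Rabs (u n))); [exists 0%nat; auto|exact (is_lim_seq_abs _ (Finite l) Hl)].
Qed.

Lemma is_lim_seq_unique_R f (u v : R) : is_lim_seq f u -> is_lim_seq f v -> u = v.
Proof.
intros Hu Hv. apply is_lim_seq_unique in Hu. apply is_lim_seq_unique in Hv. rewrite Hu in Hv. injection Hv. auto.
Qed.

Lemma is_lim_seq_scal_R f (x c : R) : is_lim_seq f x -> is_lim_seq (fun n => c * f n) (c * x).
Proof. apply (is_lim_seq_scal_l f c x). Qed.

Lemma Rabs_cos_le (x : R) : Rabs (cos x) <= 1.
Proof. apply Rabs_le, COS_bound. Qed.

Lemma Rabs_sin_le (x : R) : Rabs (sin x) <= 1.
Proof. apply Rabs_le, SIN_bound. Qed.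

Definition geom_bound (a : nat -> R) (C rho : R) : Prop :=
  forall m, Rabs (a m) <= C / rho ^ m.

Lemma geom_bound_of_scaled a (C rho : R) :
  0 < rho -> (forall m, rho ^ m * Rabs (a m) <= C) -> geom_bound a C rho.
Proof.
intros Hrho Ha m. apply Rle_div_r; [pos|]. rewrite Rmult_comm. apply Ha.
Qed.

Lemma geom_bound_lim (a : nat -> nat -> R) (l : nat -> R) (C rho : R) :
  (forall N, geom_bound (a N) C rho) -> (forall m, is_lim_seq (fun N => a N m) (l m)) -> geom_bound l C rho.
Proof. intros Ha Hl m. apply (is_lim_seq_Rabs_le (fun N => a N m)); [intros N; apply Ha|apply Hl]. Qed.

Lemma geom_bound_weaken a (C C' rho rho' : R) :
  0 < rho' <= rho -> 0 <= C <= C' -> geom_bound a C rho -> geom_bound a C' rho'.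
Proof.
intros Hrho HC Ha m. eapply Rle_trans; [apply Ha|].
apply Rmult_le_compat; [lra|pos|lra|]. apply Rinv_le_contravar; [pos|apply pow_incr; lra].
Qed.

Lemma geom_bound_radius a (C rho x : R) :
  0 < rho -> geom_bound a C rho -> Rabs x < rho -> Rbar_lt (Rabs x) (CV_radius a).
Proof.
intros Hrho Ha Hx.
apply Rbar_lt_le_trans with (Finite rho); [exact Hx|].
destruct (CV_radius_bounded a) as [H _]. apply H.
exists C. intros n. rewrite Rabs_mult, <- RPow_abs, (Rabs_pos_eq rho) by lra.
apply Rle_div_r; [pos|apply Ha].
Qed.

Lemma geom_bound_term a (C rho x : R) m :
  0 < rho -> geom_bound a C rho -> Rabs (a m * x ^ m) <= C * (Rabs x / rho) ^ m.
Proof.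
intros Hrho Ha. rewrite Rabs_mult, <- RPow_abs.
unfold Rdiv. rewrite Rpow_mult_distr, pow_inv.
assert (0 <= Rabs x ^ m) by pos.
specialize (Ha m). unfold Rdiv in Ha. nra.
Qed.

Definition oppseq (a : nat -> R) (m : nat) : R := - a m.

Lemma geom_bound_opp a (C rho : R) :
  geom_bound a C rho -> geom_bound (oppseq a) C rho.
Proof. intros Ha m. unfold oppseq. rewrite Rabs_Ropp. apply Ha. Qed.

(* [(p + i q)] is the formal logarithmic derivative of [(a + i b)]. *)
Definition is_log_derivative (a b p q : nat -> R) : Prop :=
  (forall m, PS_derive a m = PS_mult p a m - PS_mult q b m) /\
  (forall m, PS_derive b m = PS_mult p b m + PS_mult q a m).

Record log_derivative_on (a b p q : nat -> R) (C rho : R) : Prop := {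
  log_derivative_radius : 0 < rho;
  log_derivative_const : 0 <= C;
  log_derivative_re : geom_bound a C rho;
  log_derivative_im : geom_bound b C rho;
  log_derivative_quot_re : geom_bound p C rho;
  log_derivative_quot_im : geom_bound q C rho;
  log_derivative_eq : is_log_derivative a b p q
}.

Section Modulus.
Variables (a b p q : nat -> R) (C rho : R).
Hypothesis Hab : log_derivative_on a b p q C rho.

Lemma is_derive_PSeries_log_derivative (x : R) : Rabs x < rho ->
  is_derive (PSeries a) x (PSeries p x * PSeries a x - PSeries q x * PSeries b x) /\
  is_derive (PSeries b) x (PSeries p x * PSeries b x + PSeries q x * PSeries a x).
Proof.
intros Hx. destruct Hab as [Hrho _ Ba Bb Bp Bq [Ha Hb]].
assert (Hrad : forall f, geom_bound f C rho -> Rbar_lt (Rabs x) (CV_radius f))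
  by (intros f Bf; apply (geom_bound_radius f C rho); assumption).
split; (evar_last; [apply is_derive_PSeries; apply Hrad; assumption|]).
- rewrite (PSeries_ext _ (PS_plus (PS_mult p a) (PS_opp (PS_mult q b)))) by exact Ha.
  rewrite PSeries_plus, PSeries_opp, !PSeries_mult;
    try apply (ex_pseries_opp (PS_mult q b)); try apply ex_pseries_mult; auto.
- rewrite (PSeries_ext _ (PS_plus (PS_mult p b) (PS_mult q a))) by exact Hb.
  rewrite PSeries_plus, !PSeries_mult; try apply ex_pseries_mult; auto.
Qed.

Lemma is_derive_PSeries_Int (x : R) : Rabs x < rho -> is_derive (PSeries (PS_Int p)) x (PSeries p x).
Proof.
intros Hx. evar_last.
- apply is_derive_PSeries. rewrite CV_radius_Int. apply (geom_bound_radius p C rho); [apply Hab..|exact Hx].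
- apply PSeries_ext. intros n. unfold PS_derive, PS_Int. field. apply not_0_INR. lia.
Qed.

(* The relation [l' = (p + i q) l] makes [|l|^2 exp (-2 Re log)] constant. *)
Lemma modulus_along_ray (x : R) : Rabs x < rho ->
  PSeries a x ^ 2 + PSeries b x ^ 2 =
  (a 0%nat ^ 2 + b 0%nat ^ 2) * exp (2 * PSeries (PS_Int p) x).
Proof.
intros Hx. pose proof (log_derivative_radius _ _ _ _ _ _ Hab) as Hrho.
set (A := PSeries a). set (B := PSeries b). set (P := PSeries (PS_Int p)).
set (g := fun x => (A x ^ 2 + B x ^ 2) * exp (- 2 * P x)).
assert (Hg : forall y, - rho < y < rho -> is_derive g y 0).
{ intros y Hy. assert (Hy' : Rabs y < rho) by (apply Rabs_def1; lra).
  destruct (is_derive_PSeries_log_derivative y Hy') as [DA DB]. pose proof (is_derive_PSeries_Int y Hy') as DP.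
  fold A B in DA, DB. fold P in DP. unfold g. auto_derive.
  - repeat split; eexists; eassumption.
  - change (Derive (fun x => A x) y) with (Derive A y). change (Derive (fun x => B x) y) with (Derive B y).
    change (Derive (fun x => P x) y) with (Derive P y).
    rewrite (is_derive_unique _ _ _ DA), (is_derive_unique _ _ _ DB), (is_derive_unique _ _ _ DP). ring. }
assert (Hg0 : g 0 = a 0%nat ^ 2 + b 0%nat ^ 2).
{ unfold g, A, B, P. rewrite !PSeries_0. simpl. rewrite Rmult_0_r, exp_0. ring. }
apply Rabs_def2 in Hx.
rewrite <- Hg0, <- (is_derive_0_const_on g _ _ x 0 Hg) by lra. unfold g.
rewrite Rmult_assoc, <- exp_plus.
replace (-2 * P x + 2 * P x) with 0 by ring. rewrite exp_0; ring.
Qed.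

End Modulus.

(* Coefficients of the power series [(a + i b)] and of its log-derivative seen along the ray of angle [th]. *)
Definition rot (a b : nat -> R) (th : R) (m : nat) : R :=
  a m * cos (INR m * th) - b m * sin (INR m * th).
Definition rot_succ (p q : nat -> R) (th : R) (m : nat) : R :=
  p m * cos (INR (S m) * th) - q m * sin (INR (S m) * th).

Lemma Rabs_rotation_le (u v y B : R) : Rabs u <= B -> Rabs v <= B -> Rabs (u * cos y - v * sin y) <= 2 * B.
Proof.
intros Hu Hv. unfold Rminus. eapply Rle_trans; [apply Rabs_triang|]. rewrite Rabs_Ropp, !Rabs_mult.
pose proof (Rabs_cos_le y). pose proof (Rabs_sin_le y).
pose proof (Rabs_pos u). pose proof (Rabs_pos v). nra.
Qed.

Lemma rot_bound a b (C rho th : R) :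
  geom_bound a C rho -> geom_bound b C rho -> geom_bound (rot a b th) (2 * C) rho.
Proof. intros Ha Hb m. unfold Rdiv. rewrite Rmult_assoc. apply Rabs_rotation_le; [apply Ha|apply Hb]. Qed.

Lemma rot_succ_bound p q (C rho th : R) :
  geom_bound p C rho -> geom_bound q C rho -> geom_bound (rot_succ p q th) (2 * C) rho.
Proof. intros Hp Hq m. unfold Rdiv. rewrite Rmult_assoc. apply Rabs_rotation_le; [apply Hp|apply Hq]. Qed.

(* [rot b (oppseq a)] is the imaginary part along the ray, as [Im ((a+ib)e^{iy}) = b cos y + a sin y]. *)
Lemma is_log_derivative_rot (a b p q : nat -> R) (th : R) : is_log_derivative a b p q ->
  is_log_derivative (rot a b th) (rot b (oppseq a) th) (rot_succ p q th) (rot_succ q (oppseq p) th).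
Proof.
intros [Ha Hb].
assert (Hadd : forall m k, (k <= m)%nat ->
  cos (INR (S m) * th) = cos (INR (S k) * th) * cos (INR (m - k) * th)
      - sin (INR (S k) * th) * sin (INR (m - k) * th) /\
  sin (INR (S m) * th) = sin (INR (S k) * th) * cos (INR (m - k) * th)
      + cos (INR (S k) * th) * sin (INR (m - k) * th)).
{ intros m k Hk. rewrite <- cos_plus, <- sin_plus.
  replace (INR (S k) * th + INR (m - k) * th) with (INR (S m) * th); [split; reflexivity|].
  rewrite <- Rmult_plus_distr_r, <- plus_INR. repeat f_equal. lia. }
split; intros m; unfold PS_mult; [rewrite <- minus_sum | rewrite <- plus_sum].
- transitivity (PS_derive a m * cos (INR (S m) * th) - PS_derive b m * sin (INR (S m) * th)).
  { unfold PS_derive, rot. ring. }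
  rewrite Ha, Hb. unfold PS_mult. rewrite <- minus_sum, <- plus_sum, !(Rmult_comm (sum_f_R0 _ _)).
  rewrite !scal_sum, <- minus_sum. apply sum_eq. intros k Hk.
  destruct (Hadd m k Hk) as [-> ->]. unfold rot, rot_succ, oppseq. ring.
- transitivity (PS_derive b m * cos (INR (S m) * th) + PS_derive a m * sin (INR (S m) * th)).
  { unfold PS_derive, rot, oppseq. ring. }
  rewrite Ha, Hb. unfold PS_mult. rewrite <- minus_sum, <- plus_sum, !(Rmult_comm (sum_f_R0 _ _)).
  rewrite !scal_sum, <- plus_sum. apply sum_eq. intros k Hk.
  destruct (Hadd m k Hk) as [-> ->]. unfold rot, rot_succ, oppseq. ring.
Qed.

Lemma log_derivative_on_rot (a b p q : nat -> R) (C rho th : R) : log_derivative_on a b p q C rho ->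
  log_derivative_on (rot a b th) (rot b (oppseq a) th) (rot_succ p q th) (rot_succ q (oppseq p) th) (2 * C) rho.
Proof.
intros [Hrho HC Ba Bb Bp Bq Hlog]. split; [exact Hrho|lra| | | | |apply is_log_derivative_rot, Hlog].
- apply rot_bound; assumption.
- apply rot_bound; [|apply geom_bound_opp]; assumption.
- apply rot_succ_bound; assumption.
- apply rot_succ_bound; [|apply geom_bound_opp]; assumption.
Qed.

(** * Power series with geometrically bounded coefficients *)

Lemma exp_term_le (y : R) m : 0 <= y -> y ^ m / INR (fact m) <= exp y.
Proof.
intros Hy. eapply Rle_trans; [|apply (exp_ge_taylor y m Hy)].
destruct m; simpl sum_f_R0; [apply Rle_refl|].
assert (0 <= sum_f_R0 (fun k => y ^ k / INR (fact k)) m) by (apply cond_pos_sum; intros k; pos).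
simpl in *; lra.
Qed.

Lemma CV_radius_over_fact f (x : R) : (forall m, Rabs (f m) <= 1) ->
  Rbar_lt (Rabs x) (CV_radius (fun m => f m / INR (fact m))).
Proof.
intros Hf. pose proof (Rabs_pos x). set (rho := Rabs x + 1).
apply (geom_bound_radius _ (exp rho) rho); [unfold rho; lra| |unfold rho; lra].
apply geom_bound_of_scaled; [unfold rho; lra|]. intros m.
eapply Rle_trans; [|apply (exp_term_le rho m); unfold rho; lra].
unfold Rdiv. rewrite Rabs_mult, (Rabs_pos_eq (/ _)) by pos.
rewrite <- Rmult_assoc. apply Rmult_le_compat_r; [pos|].
rewrite <- (Rmult_1_r (rho ^ m)) at 2. apply Rmult_le_compat_l; [|apply Hf].
apply pow_le. unfold rho; lra.
Qed.

Definition exp_cos (th : R) (m : nat) := cos (INR m * th) / INR (fact m).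
Definition exp_sin (th : R) (m : nat) := sin (INR m * th) / INR (fact m).

Lemma is_derive_exp_cos_exp_sin (th x : R) :
  is_derive (PSeries (exp_cos th)) x (cos th * PSeries (exp_cos th) x - sin th * PSeries (exp_sin th) x) /\
  is_derive (PSeries (exp_sin th)) x (sin th * PSeries (exp_cos th) x + cos th * PSeries (exp_sin th) x).
Proof.
assert (Rc : Rbar_lt (Rabs x) (CV_radius (exp_cos th))) by (apply CV_radius_over_fact; intros; apply Rabs_cos_le).
assert (Rs : Rbar_lt (Rabs x) (CV_radius (exp_sin th))) by (apply CV_radius_over_fact; intros; apply Rabs_sin_le).
assert (Hfact : forall n, INR (S n) / INR (fact (S n)) = / INR (fact n)).
{ intros n. rewrite fact_simpl, mult_INR. field. split; [apply INR_fact_neq_0|apply not_0_INR; lia]. }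
assert (Hscal : forall c f, Rbar_lt (Rabs x) (CV_radius f) -> ex_pseries (PS_scal c f) x).
{ intros c f Hf. apply (ex_pseries_scal c f x); [apply Rmult_comm|apply CV_radius_inside, Hf]. }
split; (evar_last; [apply is_derive_PSeries; assumption|]).
- rewrite (PSeries_ext _ (PS_plus (PS_scal (cos th) (exp_cos th)) (PS_scal (- sin th) (exp_sin th)))).
  + rewrite PSeries_plus, !PSeries_scal by auto. ring.
  + intros n. change (INR (S n) * (cos (INR (S n) * th) / INR (fact (S n))) =
      cos th * (cos (INR n * th) / INR (fact n)) + - sin th * (sin (INR n * th) / INR (fact n))).
    transitivity (cos (INR (S n) * th) * (INR (S n) / INR (fact (S n)))); [unfold Rdiv; ring|].
    rewrite Hfact, S_INR, Rmult_plus_distr_r, Rmult_1_l, cos_plus. unfold Rdiv; ring.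
- rewrite (PSeries_ext _ (PS_plus (PS_scal (sin th) (exp_cos th)) (PS_scal (cos th) (exp_sin th)))).
  + rewrite PSeries_plus, !PSeries_scal by auto. ring.
  + intros n. change (INR (S n) * (sin (INR (S n) * th) / INR (fact (S n))) =
      sin th * (cos (INR n * th) / INR (fact n)) + cos th * (sin (INR n * th) / INR (fact n))).
    transitivity (sin (INR (S n) * th) * (INR (S n) / INR (fact (S n)))); [unfold Rdiv; ring|].
    rewrite Hfact, S_INR, Rmult_plus_distr_r, Rmult_1_l, sin_plus. unfold Rdiv; ring.
Qed.

(* Uniqueness for [y' = (c + i s) y]: the squared distance to the explicit solution, times [exp (- 2 c y)], is constant. *)
Lemma rotation_ode_unique (A B : R -> R) (c s x : R) :
  (forall y, is_derive A y (c * A y - s * B y)) -> (forall y, is_derive B y (s * A y + c * B y)) ->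
  A 0 = 1 -> B 0 = 0 -> A x = exp (x * c) * cos (x * s) /\ B x = exp (x * c) * sin (x * s).
Proof.
intros DA DB A0 B0.
set (dist2 := fun y => ((A y - exp (y * c) * cos (y * s)) ^ 2 + (B y - exp (y * c) * sin (y * s)) ^ 2) *
  exp (- (2 * (c * y)))).
assert (Hconst : dist2 x = dist2 0).
{ apply (is_derive_0_const_on dist2 (- Rabs x - 1) (Rabs x + 1));
    [|pose proof (Rle_abs x); pose proof (Rle_abs (- x)); rewrite Rabs_Ropp in *; lra|pose proof (Rabs_pos x); lra].
  intros y _. unfold dist2. auto_derive.
  - repeat split; eexists; [apply DA|apply DB].
  - change (Derive (fun x => A x) y) with (Derive A y). change (Derive (fun x => B x) y) with (Derive B y).
    rewrite (is_derive_unique _ _ _ (DA y)), (is_derive_unique _ _ _ (DB y)). ring. }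
unfold dist2 in Hconst. rewrite A0, B0, !Rmult_0_l, exp_0, cos_0, sin_0 in Hconst.
replace (((1 - 1 * 1) ^ 2 + (0 - 1 * 0) ^ 2) * exp (- (2 * (c * 0)))) with 0 in Hconst by ring.
apply Rmult_integral in Hconst. destruct Hconst as [Hsq|Hexp]; [|pose proof (exp_pos (- (2 * (c * x)))); lra].
rewrite <- !Rsqr_pow2 in Hsq. apply Rplus_sqr_eq_0 in Hsq. lra.
Qed.

Lemma exp_polar_PSeries (th x : R) :
  PSeries (exp_cos th) x = exp (x * cos th) * cos (x * sin th) /\
  PSeries (exp_sin th) x = exp (x * cos th) * sin (x * sin th).
Proof.
apply rotation_ode_unique; try (intros y; apply is_derive_exp_cos_exp_sin); rewrite PSeries_0.
- unfold exp_cos. simpl. rewrite Rmult_0_l, cos_0. field.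
- unfold exp_sin. simpl. rewrite Rmult_0_l, sin_0. field.
Qed.

Lemma Rabs_div_lt_1 (x rho : R) : 0 < rho -> Rabs x < rho -> 0 <= Rabs x / rho < 1.
Proof.
intros Hr Hx. split; [apply Rmult_le_pos; pos|]. apply Rlt_div_l; lra.
Qed.

Section GeometricTails.
Variables (a : nat -> R) (C rho x : R).
Hypothesis Hrho : 0 < rho.
Hypothesis HC : 0 <= C.
Hypothesis Ha : geom_bound a C rho.
Hypothesis Hx : Rabs x < rho.

Lemma PSeries_geom_tail M :
  Rabs (PSeries a x - sum_f_R0 (fun m => a m * x ^ m) M)
    <= C * (Rabs x / rho) ^ (S M) / (1 - Rabs x / rho).
Proof.
pose proof (Rabs_div_lt_1 x rho Hrho Hx) as Ht. set (t := Rabs x / rho) in *.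
assert (Ex : ex_series (fun m => Rabs (a m * x ^ m))) by
  (apply CV_disk_inside, (geom_bound_radius a C rho); assumption).
unfold PSeries. rewrite (Series_incr_n _ (S M)); [|lia|apply ex_series_Rabs; exact Ex].
simpl pred. rewrite Rplus_comm. unfold Rminus. rewrite Rplus_assoc, Rplus_opp_r, Rplus_0_r.
assert (Hgeom : ex_series (fun k => C * t ^ (S M) * t ^ k)).
{ apply (ex_series_scal (C * t ^ S M) (fun k => t ^ k)), ex_series_geom. rewrite Rabs_pos_eq; lra. }
assert (Hterm : forall k, Rabs (a (S M + k)%nat * x ^ (S M + k)) <= C * t ^ (S M) * t ^ k).
{ intros k. rewrite Rmult_assoc, <- pow_add. apply geom_bound_term; assumption. }
eapply Rle_trans; [apply Series_Rabs|].
{ apply (@ex_series_le R_AbsRing R_CompleteNormedModule _ (fun k => C * t ^ (S M) * t ^ k)); [|exact Hgeom].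
  intros k. unfold norm; simpl. unfold abs; simpl. rewrite Rabs_Rabsolu. apply (Hterm k). }
eapply Rle_trans; [apply Series_le; [intros k; split; [apply Rabs_pos|apply (Hterm k)]|exact Hgeom]|].
rewrite Series_scal_l, Series_geom by (rewrite Rabs_pos_eq; lra). apply Rle_refl.
Qed.

Lemma sum_geom_bound M :
  Rabs (sum_f_R0 (fun m => a m * x ^ m) M) <= C / (1 - Rabs x / rho).
Proof.
pose proof (Rabs_div_lt_1 x rho Hrho Hx) as Ht.
eapply Rle_trans; [apply Rsum_abs|].
eapply Rle_trans; [apply sum_Rle; intros n _; apply (geom_bound_term a C rho x n Hrho Ha)|].
set (t := Rabs x / rho) in *. rewrite (sum_eq _ (fun n => t ^ n * C)) by (intros; ring).
rewrite <- scal_sum, tech3 by lra. unfold Rdiv. apply Rmult_le_compat_l; [exact HC|].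
assert (0 < / (1 - t)) by pos. assert (0 <= t ^ S M) by pos. nra.
Qed.

End GeometricTails.

Lemma is_lim_seq_geom_tail (C t : R) : 0 <= t < 1 ->
  is_lim_seq (fun M => C * t ^ (S M) / (1 - t)) 0.
Proof.
intros Ht.
apply is_lim_seq_ext with (fun M => (C * / (1 - t)) * t ^ (S M)); [intros; unfold Rdiv; ring|].
rewrite <- (Rmult_0_r (C * / (1 - t))). apply is_lim_seq_scal_R. apply -> (is_lim_seq_incr_1 (fun n => t ^ n)).
apply is_lim_seq_geom. rewrite Rabs_pos_eq; lra.
Qed.

Lemma PSeries_truncation_uniform (C rho x1 eps : R) :
  0 < rho -> 0 <= C -> 0 <= x1 < rho -> 0 < eps ->
  exists M0, forall M a x, (M0 <= M)%nat -> geom_bound a C rho -> Rabs x <= x1 ->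
    Rabs (PSeries a x - sum_f_R0 (fun m => a m * x ^ m) M) < eps.
Proof.
intros Hrho HC Hx1 Heps.
assert (Ht1 : 0 <= x1 / rho < 1) by (rewrite <- (Rabs_pos_eq x1) by lra; apply Rabs_div_lt_1; [|rewrite Rabs_pos_eq]; lra).
pose proof (is_lim_seq_geom_tail C _ Ht1) as Hlim.
apply is_lim_seq_spec in Hlim. destruct (Hlim (mkposreal _ Heps)) as [M0 HM0]. simpl in HM0.
exists M0. intros M a x HM Ha Hx. specialize (HM0 M HM). rewrite Rminus_0_r in HM0. apply Rabs_def2 in HM0.
eapply Rle_lt_trans; [apply (PSeries_geom_tail a C rho x); try assumption; lra|].
eapply Rle_lt_trans; [|apply HM0].
assert (Ht0 : 0 <= Rabs x / rho) by (apply Rmult_le_pos; pos).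
assert (Ht : Rabs x / rho <= x1 / rho) by (apply Rmult_le_compat_r; [left; pos|lra]).
assert (0 <= (Rabs x / rho) ^ S M) by (apply pow_le, Ht0).
unfold Rdiv at 1 3. apply Rmult_le_compat; [nra|pos| |apply Rinv_le_contravar; lra].
apply Rmult_le_compat_l; [lra|]. apply (pow_incr _ _ (S M)). lra.
Qed.

Lemma PSeries_geom_bound a (C rho x : R) :
  0 < rho -> 0 <= C -> geom_bound a C rho -> Rabs x < rho ->
  Rabs (PSeries a x) <= C / (1 - Rabs x / rho).
Proof.
intros Hrho HC Ha Hx. apply Rle_plus_epsilon. intros eps Heps.
destruct (PSeries_truncation_uniform C rho (Rabs x) eps) as [M HM]; try lra; [split; [apply Rabs_pos|exact Hx]|].
specialize (HM M a x (Nat.le_refl M) Ha (Rle_refl _)).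
pose proof (sum_geom_bound a C rho x Hrho HC Ha Hx M).
pose proof (Rabs_triang_inv (PSeries a x) (sum_f_R0 (fun m => a m * x ^ m) M)). lra.
Qed.

Lemma is_lim_seq_PSeries_dominated (a : nat -> nat -> R) (l : nat -> R) (C rho x : R) :
  0 < rho -> 0 <= C -> (forall N, geom_bound (a N) C rho) ->
  (forall m, is_lim_seq (fun N => a N m) (l m)) -> Rabs x < rho ->
  is_lim_seq (fun N => PSeries (a N) x) (PSeries l x).
Proof.
intros Hrho HC Ha Hl Hx. pose proof (geom_bound_lim a l C rho Ha Hl) as Bl.
apply is_lim_seq_spec. intros eps.
assert (Heps : 0 < eps / 3) by (destruct eps; simpl; lra).
destruct (PSeries_truncation_uniform C rho (Rabs x) (eps / 3)) as [M HM]; try lra; [split; [apply Rabs_pos|exact Hx]|].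
assert (Hpoly : forall k, is_lim_seq (fun N => sum_f_R0 (fun m => a N m * x ^ m) k) (sum_f_R0 (fun m => l m * x ^ m) k)).
{ induction k as [|k IH]; simpl.
  - apply (is_lim_seq_scal_r (fun N => a N 0%nat) 1 (l 0%nat)), Hl.
  - apply (is_lim_seq_plus' _ _ _ _ IH).
    apply (is_lim_seq_scal_r (fun N => a N (S k)) (x * x ^ k) (l (S k))), Hl. }
specialize (Hpoly M). apply is_lim_seq_spec in Hpoly. destruct (Hpoly (mkposreal _ Heps)) as [N0 HN0].
exists N0. intros N HN. specialize (HN0 N HN). simpl in HN0.
pose proof (HM M (a N) x (Nat.le_refl M) (Ha N) (Rle_refl _)) as Htail.
pose proof (HM M l x (Nat.le_refl M) Bl (Rle_refl _)) as Htail_l.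
apply Rabs_def2 in HN0. apply Rabs_def2 in Htail. apply Rabs_def2 in Htail_l. apply Rabs_def1; lra.
Qed.

Lemma continuity_2d_snd (f : R -> R -> R) (x y : R) :
  continuity_2d_pt f x y -> continuous (fun t => f x t) y.
Proof.
intros H. apply filterlim_locally. intros eps. destruct (H eps) as [d Hd].
exists d. intros t Ht. apply Hd; [|exact Ht].
rewrite Rminus_diag, Rabs_R0. apply cond_pos.
Qed.

Lemma ex_RInt_continuous_R (f : R -> R) (a b : R) : (forall x, continuous f x) -> ex_RInt f a b.
Proof. intros H. apply (ex_RInt_continuous (V := R_CompleteNormedModule)). intros; apply H. Qed.

Lemma is_derive_RInt_below (f f' : R -> R -> R) (r0 a b r : R) :
  (forall x t, x < r0 -> is_derive (fun z => f z t) x (f' x t)) ->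
  (forall x t, x < r0 -> continuous (fun t => f x t) t) ->
  (forall x t, x < r0 -> continuity_2d_pt f' x t) ->
  r < r0 ->
  is_derive (fun x => RInt (fun t => f x t) a b) r (RInt (fun t => f' r t) a b).
Proof.
intros Hd Hc H2 Hr.
assert (E : RInt (fun t => f' r t) a b = RInt (fun t => Derive (fun u => f u t) r) a b).
{ apply RInt_ext. intros t _. symmetry. apply is_derive_unique, Hd, Hr. }
rewrite E. apply is_derive_RInt_param.
- apply (filter_imp (fun z => z < r0)); [|exact (open_lt r0 r Hr)].
  intros z Hz t _. eexists; apply Hd, Hz.
- intros t _. apply (continuity_2d_pt_ext_loc f'); [|apply H2, Hr].
  assert (Hp : 0 < r0 - r) by lra. exists (mkposreal _ Hp). intros u v Hu _. simpl in Hu.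
  symmetry. apply is_derive_unique, Hd. apply Rabs_def2 in Hu; lra.
- apply (filter_imp (fun z => z < r0)); [|exact (open_lt r0 r Hr)].
  intros z Hz. apply ex_RInt_continuous_R. intros t. apply Hc, Hz.
Qed.

Lemma continuous_is_derive (f : R -> R) (x l : R) : is_derive f x l -> continuous f x.
Proof. intros H. apply (ex_derive_continuous (K := R_AbsRing) (V := R_NormedModule)). exists l. exact H. Qed.

Lemma continuous_cos_lin (w ph x : R) : continuous (fun t => cos (w * t + ph)) x.
Proof. eapply continuous_is_derive. auto_derive; [exact I|reflexivity]. Qed.

Lemma continuous_mul_cos (f : R -> R) k (ph t : R) : continuous f t -> continuous (fun t => f t * cos (INR k * t + ph)) t.
Proof. intros H. apply (continuous_mult (K := R_AbsRing) f); [exact H|apply continuous_cos_lin]. Qed.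

Lemma continuity_2d_cos_lin (w ph x y : R) : continuity_2d_pt (fun _ t => cos (w * t + ph)) x y.
Proof.
apply (continuity_1d_2d_pt_comp cos (fun _ t => w * t + ph)).
- apply continuity_cos.
- apply continuity_2d_pt_plus; [apply continuity_2d_pt_mult|]; try apply continuity_2d_pt_const.
  apply continuity_2d_pt_id2.
Qed.

(* [u] is harmonic in the coordinates (log radius, angle): [u_r = d], [u_th = - v], [d_r = v_th = h]. *)
Section Harmonic.
Variables (u d v h : R -> R -> R) (r0 : R).
Hypothesis Hur : forall r t, r < r0 -> is_derive (fun x => u x t) r (d r t).
Hypothesis Hdr : forall r t, r < r0 -> is_derive (fun x => d x t) r (h r t).
Hypothesis Hut : forall r t, r < r0 -> is_derive (fun x => u r x) t (- v r t).
Hypothesis Hvt : forall r t, r < r0 -> is_derive (fun x => v r x) t (h r t).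
Hypothesis Cd : forall r t, r < r0 -> continuity_2d_pt d r t.
Hypothesis Ch : forall r t, r < r0 -> continuity_2d_pt h r t.
Hypothesis Pu : forall r, u r (2 * PI) = u r 0.
Hypothesis Pv : forall r, v r (2 * PI) = v r 0.

Definition fourier_coef (k : nat) (ph r : R) : R :=
  RInt (fun t => u r t * cos (INR k * t + ph)) 0 (2 * PI).

Lemma cos_period_nat k (ph : R) : cos (INR k * (2 * PI) + ph) = cos ph.
Proof.
replace (INR k * (2 * PI) + ph) with (ph + 2 * INR k * PI) by ring. apply cos_period.
Qed.

Lemma sin_period_nat k (ph : R) : sin (INR k * (2 * PI) + ph) = sin ph.
Proof.
replace (INR k * (2 * PI) + ph) with (ph + 2 * INR k * PI) by ring. apply sin_period.
Qed.

Lemma is_derive_fourier_coef k (ph r : R) : r < r0 ->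
  is_derive (fourier_coef k ph) r (RInt (fun t => d r t * cos (INR k * t + ph)) 0 (2 * PI)).
Proof.
intros Hr. unfold fourier_coef.
apply (is_derive_RInt_below (fun r t => u r t * cos (INR k * t + ph))
   (fun r t => d r t * cos (INR k * t + ph)) r0); [| | |exact Hr].
- intros x t Hx. apply (is_derive_scal_l (fun z => u z t) x (d x t) (cos (INR k * t + ph))). apply Hur, Hx.
- intros x t Hx. apply (continuous_mult (K := R_AbsRing) (fun t => u x t) (fun t => cos (INR k * t + ph))).
  + eapply continuous_is_derive. apply Hut, Hx.
  + apply continuous_cos_lin.
- intros x t Hx. apply continuity_2d_pt_mult; [apply Cd, Hx|apply continuity_2d_cos_lin].
Qed.

(* Green's identity: integrate by parts twice in the angle. *)
Lemma RInt_laplacian_fourier_coef k (ph r : R) : r < r0 ->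
  RInt (fun t => h r t * cos (INR k * t + ph)) 0 (2 * PI) = INR k ^ 2 * fourier_coef k ph r.
Proof.
intros Hr.
assert (Cu : ex_RInt (fun t => u r t * cos (INR k * t + ph)) 0 (2 * PI)).
{ apply ex_RInt_continuous_R. intros t. apply continuous_mul_cos. eapply continuous_is_derive, Hut, Hr. }
assert (Chr : ex_RInt (fun t => h r t * cos (INR k * t + ph)) 0 (2 * PI)).
{ apply ex_RInt_continuous_R. intros t. apply continuous_mul_cos, continuity_2d_snd, Ch, Hr. }
set (w := fun t => v r t * cos (INR k * t + ph) - INR k * (u r t * sin (INR k * t + ph))).
assert (Hw : is_RInt (fun t => h r t * cos (INR k * t + ph) - INR k ^ 2 * (u r t * cos (INR k * t + ph)))
           0 (2 * PI) (minus (w (2 * PI)) (w 0))).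
{ apply (is_RInt_derive w).
  - intros t _. unfold w. pose proof (Hvt r t Hr) as Dv. pose proof (Hut r t Hr) as Du. auto_derive.
    + repeat split; eexists; [exact Dv|exact Du].
    + rewrite (is_derive_unique (fun x : R => v r x) _ _ Dv), (is_derive_unique (fun x : R => u r x) _ _ Du). ring.
  - intros t _. apply (continuous_minus (V := R_NormedModule)).
    + apply continuous_mul_cos, continuity_2d_snd, Ch, Hr.
    + apply (continuous_mult (K := R_AbsRing) (fun t => INR k ^ 2)); [apply continuous_const|].
      apply continuous_mul_cos. eapply continuous_is_derive, Hut, Hr. }
pose proof (is_RInt_minus (V := R_NormedModule) _ _ _ _ _ _ (RInt_correct (V := R_CompleteNormedModule) _ _ _ Chr)
  (is_RInt_scal (V := R_NormedModule) _ _ _ (INR k ^ 2) _ (RInt_correct (V := R_CompleteNormedModule) _ _ _ Cu))) as Hparts.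
pose proof (eq_trans (eq_sym (is_RInt_unique (V := R_CompleteNormedModule) _ _ _ _ Hparts))
  (is_RInt_unique (V := R_CompleteNormedModule) _ _ _ _ Hw)) as Hboundary.
unfold w in Hboundary. rewrite Pu, Pv, cos_period_nat, sin_period_nat, Rmult_0_r, Rplus_0_l, minus_eq_zero in Hboundary.
exact (Rminus_diag_uniq _ _ Hboundary).
Qed.

Lemma is_derive2_fourier_coef k (ph r : R) : r < r0 ->
  is_derive (fun r => RInt (fun t => d r t * cos (INR k * t + ph)) 0 (2 * PI)) r
    (INR k ^ 2 * fourier_coef k ph r).
Proof.
intros Hr. rewrite <- RInt_laplacian_fourier_coef by exact Hr.
apply (is_derive_RInt_below (fun r t => d r t * cos (INR k * t + ph))
   (fun r t => h r t * cos (INR k * t + ph)) r0); [| | |exact Hr].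
- intros x t Hx. apply (is_derive_scal_l (fun z => d z t) x (h x t) (cos (INR k * t + ph))). apply Hdr, Hx.
- intros x t Hx. apply continuous_mul_cos, continuity_2d_snd, Cd, Hx.
- intros x t Hx. apply continuity_2d_pt_mult; [apply Ch, Hx|apply continuity_2d_cos_lin].
Qed.

End Harmonic.

Lemma is_derive_0_const_below (g : R -> R) (r0 x y : R) :
  (forall r, r < r0 -> is_derive g r 0) -> x < r0 -> y < r0 -> g x = g y.
Proof.
intros Hg Hx Hy. pose proof (Rmin_l x y). pose proof (Rmin_r x y).
apply (is_derive_0_const_on g (Rmin x y - 1) r0); [intros z Hz; apply Hg|..]; lra.
Qed.

Lemma exp_mul_exp_opp (x : R) : exp x * exp (- x) = 1.
Proof. rewrite <- exp_plus, Rplus_opp_r. apply exp_0. Qed.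

Lemma exp_le_compat x y : x <= y -> exp x <= exp y.
Proof. intros [H|H]; [left; apply exp_increasing, H|rewrite H; lra]. Qed.

Lemma slope_bounded_affine (b c r1 B : R) : (forall z, z < r1 -> Rabs (c + b * z) <= B) -> b = 0.
Proof.
intros HB. apply NNPP. intros Hb. apply Rabs_pos_lt in Hb.
pose proof (HB (r1 - 1) ltac:(lra)) as Hnear.
assert (Hstep : 0 <= (2 * B + 1) / Rabs b) by (apply Rmult_le_pos; [pose proof (Rabs_pos (c + b * (r1 - 1))); lra|pos]).
pose proof (HB (r1 - 1 - (2 * B + 1) / Rabs b) ltac:(lra)) as Hfar.
pose proof (Rabs_triang (c + b * (r1 - 1)) (- (c + b * (r1 - 1 - (2 * B + 1) / Rabs b)))) as Htri.
rewrite Rabs_Ropp in Htri.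
replace (c + b * (r1 - 1) + - (c + b * (r1 - 1 - (2 * B + 1) / Rabs b)))
  with (b * ((2 * B + 1) / Rabs b)) in Htri by ring.
rewrite Rabs_mult, (Rabs_pos_eq (_ / _)) in Htri by exact Hstep.
replace (Rabs b * ((2 * B + 1) / Rabs b)) with (2 * B + 1) in Htri by (field; lra). lra.
Qed.

Lemma exp_growth_bounded (c K r1 B : R) :
  0 < K -> (forall z, z < r1 -> Rabs c * exp (- K * z) <= B) -> c = 0.
Proof.
intros HK HB. apply NNPP. intros Hc. apply Rabs_pos_lt in Hc.
set (z := Rmin (r1 - 1) (- (B / Rabs c / K))).
assert (Hz : z <= r1 - 1) by apply Rmin_l. assert (HzB : z <= - (B / Rabs c / K)) by apply Rmin_r.
specialize (HB z ltac:(lra)). pose proof (exp_ineq1_le (- K * z)) as Hexp.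
assert (HKz : B / Rabs c <= - K * z).
{ replace (B / Rabs c) with (K * (B / Rabs c / K)) by (field; lra). nra. }
assert (Rabs c * (1 + B / Rabs c) <= B) by nra.
replace (Rabs c * (1 + B / Rabs c)) with (Rabs c + B) in * by (field; lra). lra.
Qed.

Section ExponentialODE.
Variables (U A : R -> R) (r0 r1 B : R).
Hypothesis HU : forall r, r < r0 -> is_derive U r (A r).
Hypothesis HB : forall r, r < r1 -> Rabs (U r) <= B.

Lemma bounded_affine_ode (x y : R) : (forall r, r < r0 -> is_derive A r 0) -> x < r0 -> y < r0 -> U x = U y.
Proof.
intros HA Hx Hy.
assert (HAx : forall r, r < r0 -> A r = A x) by (intros r Hr; apply (is_derive_0_const_below A r0); assumption).
assert (Haffine : forall r, r < r0 -> U r - A x * r = U x - A x * x).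
{ intros r Hr. apply (is_derive_0_const_below (fun r => U r - A x * r) r0); [|exact Hr|exact Hx].
  intros z Hz. evar_last.
  - apply (is_derive_minus (V := R_NormedModule) U (fun r => A x * r)); [apply HU, Hz|].
    apply (is_derive_scal (fun r => r)). apply (is_derive_id (K := R_AbsRing)).
  - rewrite (HAx z Hz). unfold minus, plus, opp, one; simpl. ring. }
assert (Hslope : A x = 0).
{ apply (slope_bounded_affine (A x) (U x - A x * x) (Rmin r0 r1) B). intros z Hz.
  pose proof (Rmin_l r0 r1). pose proof (Rmin_r r0 r1).
  rewrite <- (Haffine z) by lra. replace (U z - A x * z + A x * z) with (U z) by ring. apply HB; lra. }
pose proof (Haffine y Hy) as Hy'. rewrite Hslope in Hy'. lra.
Qed.

Lemma exponential_ode_solution (K x : R) : (forall r, r < r0 -> is_derive A r (K ^ 2 * U r)) -> x < r0 ->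
  exists c1 c2, forall r, r < r0 -> 2 * K * U r = c2 * exp (K * r) - c1 * exp (- K * r).
Proof.
intros HA Hx.
assert (Hconst : forall c, c ^ 2 = K ^ 2 -> forall r, r < r0 ->
  (A r - c * U r) * exp (c * r) = (A x - c * U x) * exp (c * x)).
{ intros c Hc r Hr. apply (is_derive_0_const_below (fun r => (A r - c * U r) * exp (c * r)) r0); [|exact Hr|exact Hx].
  intros z Hz. auto_derive.
  - repeat split; eexists; [apply HA|apply HU]; exact Hz.
  - change (Derive (fun x => A x) z) with (Derive A z); change (Derive (fun x => U x) z) with (Derive U z).
    rewrite (is_derive_unique _ _ _ (HA z Hz)), (is_derive_unique _ _ _ (HU z Hz)), <- Hc. ring. }
exists ((A x - K * U x) * exp (K * x)), ((A x - - K * U x) * exp (- K * x)). intros r Hr.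
rewrite <- (Hconst K eq_refl r Hr), <- (Hconst (- K) ltac:(ring) r Hr).
pose proof (exp_mul_exp_opp (K * r)) as Hexp.
transitivity (((A r + K * U r) - (A r - K * U r)) * (exp (K * r) * exp (- (K * r)))); [rewrite Hexp; ring|].
rewrite <- !Ropp_mult_distr_l. ring.
Qed.

Lemma bounded_exponential_ode k (x y : R) : (forall r, r < r0 -> is_derive A r (INR k ^ 2 * U r)) ->
  x < r0 -> y < r0 -> U x * exp (- INR k * x) = U y * exp (- INR k * y).
Proof.
intros HA Hx Hy. destruct (Nat.eq_0_gt_0_cases k) as [->|Hk].
{ simpl INR in *. rewrite !Ropp_0, !Rmult_0_l, exp_0, !Rmult_1_r. apply bounded_affine_ode; [|exact Hx|exact Hy].
  intros r Hr. evar_last; [apply HA, Hr|simpl; ring]. }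
assert (HK : 0 < INR k) by pos. set (K := INR k) in *.
destruct (exponential_ode_solution K x HA Hx) as (c1 & c2 & HUr).
assert (Hc1 : c1 = 0).
{ set (r2 := Rmin 0 (Rmin r0 r1)).
  apply (exp_growth_bounded c1 K r2 (Rabs c2 + 2 * K * B) HK). intros z Hz.
  assert (Hr2 : r2 <= 0 /\ r2 <= r0 /\ r2 <= r1).
  { unfold r2. pose proof (Rmin_l 0 (Rmin r0 r1)). pose proof (Rmin_r 0 (Rmin r0 r1)).
    pose proof (Rmin_l r0 r1). pose proof (Rmin_r r0 r1). lra. }
  specialize (HUr z ltac:(lra)). specialize (HB z ltac:(lra)).
  rewrite <- (Rabs_pos_eq (exp (- K * z))), <- Rabs_mult by pos.
  replace (c1 * exp (- K * z)) with (c2 * exp (K * z) + - (2 * K * U z)) by lra.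
  eapply Rle_trans; [apply Rabs_triang|]. rewrite Rabs_Ropp, !Rabs_mult.
  rewrite (Rabs_pos_eq 2), (Rabs_pos_eq K), (Rabs_pos_eq (exp (K * z))) by pos.
  assert (exp (K * z) <= 1) by (rewrite <- exp_0; apply exp_le_compat; nra).
  pose proof (Rabs_pos c2). nra. }
assert (HU0 : forall r, r < r0 -> U r * exp (- K * r) = c2 / (2 * K)).
{ intros r Hr. specialize (HUr r Hr). rewrite Hc1 in HUr.
  pose proof (exp_mul_exp_opp (K * r)) as Hexp. rewrite Ropp_mult_distr_l in Hexp.
  replace (U r) with (c2 * exp (K * r) / (2 * K)) by (apply (Rmult_eq_reg_l (2 * K)); [rewrite HUr; field|]; lra).
  transitivity (c2 / (2 * K) * (exp (K * r) * exp (- K * r))); [field; lra|rewrite Hexp; ring]. }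
rewrite (HU0 x Hx), (HU0 y Hy). reflexivity.
Qed.

End ExponentialODE.

(* Real part of [sum_{m<=M} m^i (a_m + i b_m) z^m] at [z = exp (r + i t)]; with [(b, oppseq a)] in
   place of [(a, b)] it is the imaginary part. *)
Definition polar_sum (a b : nat -> R) (i M : nat) (r t : R) : R :=
  sum_f_R0 (fun m => INR m ^ i * exp (INR m * r) * rot a b t m) M.

Lemma is_derive_polar_sum_r a b i M r t : is_derive (fun x => polar_sum a b i M x t) r (polar_sum a b (S i) M r t).
Proof.
unfold polar_sum. induction M as [|M IH].
- simpl sum_f_R0. auto_derive; [exact I|]. simpl. ring.
- simpl sum_f_R0. apply (is_derive_plus (V := R_NormedModule) _ _ _ _ _ IH).
  auto_derive; [exact I|]. simpl pow. ring.
Qed.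

Lemma is_derive_rot a b m t : is_derive (fun x => rot a b x m) t (- INR m * rot b (oppseq a) t m).
Proof. unfold rot, oppseq. auto_derive; [exact I|]. ring. Qed.

Lemma is_derive_polar_sum_t a b i M r t : is_derive (fun x => polar_sum a b i M r x) t (- polar_sum b (oppseq a) (S i) M r t).
Proof.
assert (T : forall m, is_derive (fun x => INR m ^ i * exp (INR m * r) * rot a b x m) t
   (- (INR m ^ S i * exp (INR m * r) * rot b (oppseq a) t m))).
{ intros m. evar_last; [apply (is_derive_scal (fun x => rot a b x m)), is_derive_rot|]. simpl. ring. }
unfold polar_sum. induction M as [|M IH]; simpl sum_f_R0; [exact (T 0%nat)|].
evar_last; [apply (is_derive_plus (V := R_NormedModule) _ _ _ _ _ IH (T (S M)))|].
unfold plus; simpl. ring.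
Qed.

Lemma polar_sum_opp a b i M r t : polar_sum (oppseq a) (oppseq b) i M r t = - polar_sum a b i M r t.
Proof.
unfold polar_sum. induction M as [|M IH]; simpl sum_f_R0; [|rewrite IH]; unfold rot, oppseq; ring.
Qed.

Lemma is_derive_polar_sum_conj_t a b i M r t :
  is_derive (fun x => polar_sum b (oppseq a) i M r x) t (polar_sum a b (S i) M r t).
Proof. evar_last; [apply is_derive_polar_sum_t|]. rewrite polar_sum_opp. ring. Qed.

Lemma continuity_2d_rot a b m r t : continuity_2d_pt (fun _ y => rot a b y m) r t.
Proof.
apply (continuity_1d_2d_pt_comp (fun y => rot a b y m) (fun _ y => y)); [|apply continuity_2d_pt_id2].
apply continuity_pt_filterlim. eapply continuous_is_derive, is_derive_rot.
Qed.

Lemma continuity_2d_exp c r t : continuity_2d_pt (fun x _ => exp (c * x)) r t.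
Proof.
apply (continuity_1d_2d_pt_comp exp (fun x _ => c * x)).
- apply derivable_continuous_pt, derivable_pt_exp.
- apply continuity_2d_pt_mult; [apply continuity_2d_pt_const|apply continuity_2d_pt_id1].
Qed.

Lemma continuity_2d_polar_sum a b i M r t : continuity_2d_pt (polar_sum a b i M) r t.
Proof.
assert (T : forall m, continuity_2d_pt (fun x y => INR m ^ i * exp (INR m * x) * rot a b y m) r t).
{ intros m. apply continuity_2d_pt_mult; [apply continuity_2d_pt_mult|apply continuity_2d_rot].
  - apply continuity_2d_pt_const.
  - apply continuity_2d_exp. }
unfold polar_sum. induction M as [|M IH]; simpl sum_f_R0; [exact (T 0%nat)|].
apply continuity_2d_pt_plus; [exact IH|exact (T (S M))].
Qed.

Lemma polar_sum_period a b i M r : polar_sum a b i M r (2 * PI) = polar_sum a b i M r 0.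
Proof.
unfold polar_sum. apply sum_eq. intros m _. f_equal. unfold rot.
rewrite <- (Rplus_0_r (INR m * (2 * PI))), cos_period_nat, sin_period_nat, Rmult_0_r. reflexivity.
Qed.

Definition polar_norm2 (a b : nat -> R) (M : nat) (r t : R) : R :=
  polar_sum a b 0 M r t ^ 2 + polar_sum b (oppseq a) 0 M r t ^ 2.

Lemma is_derive_half_ln_norm2 (f g : R -> R) (f' g' x : R) :
  is_derive f x f' -> is_derive g x g' -> 0 < f x ^ 2 + g x ^ 2 ->
  is_derive (fun y => / 2 * ln (f y ^ 2 + g y ^ 2)) x ((f x * f' + g x * g') / (f x ^ 2 + g x ^ 2)).
Proof.
intros Df Dg Hpos. simpl in Hpos. auto_derive.
- repeat split; [eexists; exact Df|eexists; exact Dg|lra].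
- rewrite (is_derive_unique (fun y : R => f y) _ _ Df), (is_derive_unique (fun y : R => g y) _ _ Dg). field. lra.
Qed.

Lemma is_derive_inner_over_norm2 (f g h k : R -> R) (f' g' h' k' x : R) :
  is_derive f x f' -> is_derive g x g' -> is_derive h x h' -> is_derive k x k' -> 0 < f x ^ 2 + g x ^ 2 ->
  is_derive (fun y => (f y * h y + g y * k y) / (f y ^ 2 + g y ^ 2)) x
    ((f' * h x + f x * h' + (g' * k x + g x * k')) / (f x ^ 2 + g x ^ 2)
      - 2 * (f x * h x + g x * k x) * (f x * f' + g x * g') / (f x ^ 2 + g x ^ 2) ^ 2).
Proof.
intros Df Dg Dh Dk Hpos. simpl in Hpos. auto_derive.
- repeat split; [eexists; exact Df|eexists; exact Dh|eexists; exact Dg|eexists; exact Dk|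
    eexists; exact Df|eexists; exact Dg|lra].
- rewrite (is_derive_unique (fun y : R => f y) _ _ Df), (is_derive_unique (fun y : R => g y) _ _ Dg),
    (is_derive_unique (fun y : R => h y) _ _ Dh), (is_derive_unique (fun y : R => k y) _ _ Dk). field. lra.
Qed.

Definition log_modulus (a b : nat -> R) (M : nat) (r t : R) : R := / 2 * ln (polar_norm2 a b M r t).

Section LogModulus.
Variables (a b : nat -> R) (M : nat) (r0 : R).
Hypothesis Hpos : forall r t, r < r0 -> 0 < polar_norm2 a b M r t.

Let A i := polar_sum a b i M.
Let B i := polar_sum b (oppseq a) i M.
Let norm2 r t := A 0%nat r t ^ 2 + B 0%nat r t ^ 2.
Let d r t := (A 0%nat r t * A 1%nat r t + B 0%nat r t * B 1%nat r t) / norm2 r t.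
Let v r t := (A 0%nat r t * B 1%nat r t + B 0%nat r t * - A 1%nat r t) / norm2 r t.
Let h r t := (A 0%nat r t * A 2%nat r t + B 0%nat r t * B 2%nat r t) / norm2 r t - (d r t ^ 2 - v r t ^ 2).

Let DA i r t : is_derive (fun x => A i x t) r (A (S i) r t) := is_derive_polar_sum_r a b i M r t.
Let DB i r t : is_derive (fun x => B i x t) r (B (S i) r t) := is_derive_polar_sum_r b (oppseq a) i M r t.
Let TA i r t : is_derive (fun x => A i r x) t (- B (S i) r t) := is_derive_polar_sum_t a b i M r t.
Let TB i r t : is_derive (fun x => B i r x) t (A (S i) r t) := is_derive_polar_sum_conj_t a b i M r t.

Lemma is_derive_log_modulus_r (r t : R) : r < r0 -> is_derive (fun x => log_modulus a b M x t) r (d r t).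
Proof.
intros Hr. apply (is_derive_half_ln_norm2 (fun x => A 0%nat x t) (fun x => B 0%nat x t)); [apply DA|apply DB|].
apply (Hpos r t Hr).
Qed.

Lemma is_derive_log_modulus_t (r t : R) : r < r0 -> is_derive (fun x => log_modulus a b M r x) t (- v r t).
Proof.
intros Hr. evar_last.
- apply (is_derive_half_ln_norm2 (fun x => A 0%nat r x) (fun x => B 0%nat r x)); [apply TA|apply TB|apply (Hpos r t Hr)].
- unfold v, norm2, Rdiv. ring.
Qed.

Lemma is_derive_log_modulus_rr (r t : R) : r < r0 -> is_derive (fun x => d x t) r (h r t).
Proof.
intros Hr. pose proof (Hpos r t Hr : 0 < norm2 r t) as Hn. evar_last.
- apply (is_derive_inner_over_norm2 (fun x => A 0%nat x t) (fun x => B 0%nat x t) (fun x => A 1%nat x t)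
    (fun x => B 1%nat x t));
    [apply DA|apply DB|apply DA|apply DB|exact Hn].
- unfold h, d, v, norm2 in *. field. lra.
Qed.

Lemma is_derive_log_modulus_conj_t (r t : R) : r < r0 -> is_derive (fun x => v r x) t (h r t).
Proof.
intros Hr. pose proof (Hpos r t Hr : 0 < norm2 r t) as Hn. evar_last.
- apply (is_derive_inner_over_norm2 (fun x => A 0%nat r x) (fun x => B 0%nat r x) (fun x => B 1%nat r x)
    (fun x => - A 1%nat r x));
    [apply TA|apply TB|apply TB|apply (is_derive_opp (V := R_NormedModule)), TA|exact Hn].
- unfold h, d, v, norm2 in *. unfold opp; simpl. field. lra.
Qed.

Lemma continuity_2d_over_norm2 (f : R -> R -> R) (r t : R) :
  r < r0 -> continuity_2d_pt f r t -> continuity_2d_pt (fun r t => f r t / norm2 r t) r t.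
Proof.
intros Hr Hf. apply continuity_2d_pt_mult; [exact Hf|].
pose proof (Hpos r t Hr : 0 < norm2 r t). apply continuity_2d_pt_inv; [|lra].
apply (continuity_2d_pt_ext (fun r t => A 0%nat r t * A 0%nat r t + B 0%nat r t * B 0%nat r t));
  [intros; unfold norm2; ring|].
apply continuity_2d_pt_plus; apply continuity_2d_pt_mult; apply continuity_2d_polar_sum.
Qed.

Lemma log_modulus_fourier_const k (ph K r1 : R) :
  (forall r, r < r1 -> Rabs (fourier_coef (log_modulus a b M) k ph r) <= K) ->
  forall x y, x < r0 -> y < r0 ->
  fourier_coef (log_modulus a b M) k ph x * exp (- INR k * x) =
  fourier_coef (log_modulus a b M) k ph y * exp (- INR k * y).
Proof.
intros HK x y Hx Hy.
assert (CA : forall i r t, continuity_2d_pt (A i) r t) by (intros; apply continuity_2d_polar_sum).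
assert (CB : forall i r t, continuity_2d_pt (B i) r t) by (intros; apply continuity_2d_polar_sum).
assert (Cd : forall r t, r < r0 -> continuity_2d_pt d r t).
{ intros r t Hr. apply continuity_2d_over_norm2; [exact Hr|].
  apply continuity_2d_pt_plus; apply continuity_2d_pt_mult; auto. }
assert (Cv : forall r t, r < r0 -> continuity_2d_pt v r t).
{ intros r t Hr. apply continuity_2d_over_norm2; [exact Hr|].
  apply continuity_2d_pt_plus; apply continuity_2d_pt_mult; auto. apply continuity_2d_pt_opp; auto. }
assert (Ch : forall r t, r < r0 -> continuity_2d_pt h r t).
{ intros r t Hr. apply (continuity_2d_pt_ext (fun r t =>
    (A 0%nat r t * A 2%nat r t + B 0%nat r t * B 2%nat r t) / norm2 r t - (d r t * d r t - v r t * v r t)));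
    [intros; unfold h; ring|].
  apply continuity_2d_pt_minus; [|apply continuity_2d_pt_minus; apply continuity_2d_pt_mult; auto].
  apply continuity_2d_over_norm2; [exact Hr|]. apply continuity_2d_pt_plus; apply continuity_2d_pt_mult; auto. }
assert (Pu : forall r, log_modulus a b M r (2 * PI) = log_modulus a b M r 0)
  by (intros; unfold log_modulus, polar_norm2; rewrite !polar_sum_period; reflexivity).
assert (Pv : forall r, v r (2 * PI) = v r 0)
  by (intros; unfold v, norm2, A, B; rewrite !polar_sum_period; reflexivity).
pose proof is_derive_log_modulus_r. pose proof is_derive_log_modulus_t.
pose proof is_derive_log_modulus_rr. pose proof is_derive_log_modulus_conj_t.
apply (bounded_exponential_ode (fourier_coef (log_modulus a b M) k ph)
   (fun r => RInt (fun t => d r t * cos (INR k * t + ph)) 0 (2 * PI)) r0 r1 K);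
  [|exact HK| |exact Hx|exact Hy]; intros r Hr.
- apply (is_derive_fourier_coef _ d v r0); assumption.
- apply (is_derive2_fourier_coef _ d v h r0); assumption.
Qed.

Lemma continuous_log_modulus_cos k (ph r t : R) : r < r0 ->
  continuous (fun t => log_modulus a b M r t * cos (INR k * t + ph)) t.
Proof.
intros Hr. apply continuous_mul_cos. eapply continuous_is_derive, is_derive_log_modulus_t, Hr.
Qed.

End LogModulus.

Lemma ln_le_minus_1 (x : R) : 0 < x -> ln x <= x - 1.
Proof. intros Hx. pose proof (exp_ineq1_le (ln x)) as Hexp. rewrite exp_ln in Hexp by exact Hx. lra. Qed.

Lemma ln_lipschitz (x y m : R) : 0 < m -> m <= x -> m <= y -> Rabs (ln x - ln y) <= Rabs (x - y) / m.
Proof.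
intros Hm.
assert (Hone_sided : forall x y, m <= x -> m <= y -> ln x - ln y <= Rabs (x - y) / m).
{ clear x y. intros x y Hx Hy. rewrite <- ln_div by lra.
  eapply Rle_trans; [apply ln_le_minus_1; pos|].
  replace (x / y - 1) with ((x - y) * / y) by (field; lra).
  eapply Rle_trans; [apply Rmult_le_compat_r; [pos|apply Rle_abs]|].
  unfold Rdiv. apply Rmult_le_compat_l; [apply Rabs_pos|]. apply Rinv_le_contravar; lra. }
intros Hx Hy. apply Rabs_le. split.
- pose proof (Hone_sided y x Hy Hx) as Hyx. rewrite Rabs_minus_sym in Hyx. lra.
- apply Hone_sided; assumption.
Qed.

Lemma is_RInt_cos_nat k (ph : R) : (1 <= k)%nat ->
  is_RInt (fun t => cos (INR k * t + ph)) 0 (2 * PI) 0.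
Proof.
intros Hk. assert (HK : INR k <> 0) by (apply not_0_INR; lia).
evar_last.
{ apply (is_RInt_derive (fun t => / INR k * sin (INR k * t + ph))).
  - intros t _. auto_derive; [exact I|field; exact HK].
  - intros t _. apply continuous_cos_lin. }
rewrite sin_period_nat, Rmult_0_r, Rplus_0_l. unfold minus, plus, opp; simpl. ring.
Qed.

Lemma is_RInt_const_R (a b c : R) : is_RInt (fun _ => c) a b ((b - a) * c).
Proof. apply (is_RInt_const (V := R_NormedModule)). Qed.

Lemma is_RInt_plus_R (f g : R -> R) (a b lf lg : R) :
  is_RInt f a b lf -> is_RInt g a b lg -> is_RInt (fun x => f x + g x) a b (lf + lg).
Proof. apply (is_RInt_plus (V := R_NormedModule)). Qed.

Lemma is_RInt_scal_R (f : R -> R) (a b k lf : R) :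
  is_RInt f a b lf -> is_RInt (fun x => k * f x) a b (k * lf).
Proof. apply (is_RInt_scal (V := R_NormedModule)). Qed.

Lemma is_RInt_ext_R (f g : R -> R) (a b l : R) :
  (forall x, f x = g x) -> is_RInt f a b l -> is_RInt g a b l.
Proof. intros H. apply (is_RInt_ext (V := R_NormedModule)). intros x _. apply H. Qed.

Lemma is_RInt_cos_cos m k (p q ph : R) : (1 <= m <= k)%nat ->
  is_RInt (fun t => (p * cos (INR m * t) - q * sin (INR m * t)) * cos (INR k * t + ph)) 0 (2 * PI)
    (if Nat.eqb m k then PI * (p * cos ph + q * sin ph) else 0).
Proof.
intros Hm.
apply (is_RInt_ext_R (fun t =>
   (/ 2 * p) * cos (INR (k + m) * t + ph) + ((/ 2 * - q) * cos (INR (k + m) * t + (ph - PI / 2)) +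
   ((/ 2 * p) * cos (INR (k - m) * t + ph) + (/ 2 * q) * cos (INR (k - m) * t + (ph - PI / 2)))))).
{ intros t. rewrite plus_INR, minus_INR by lia.
  replace ((INR k + INR m) * t + (ph - PI / 2)) with ((INR k + INR m) * t + ph - PI / 2) by ring.
  replace ((INR k - INR m) * t + (ph - PI / 2)) with ((INR k - INR m) * t + ph - PI / 2) by ring.
  rewrite !(cos_minus _ (PI / 2)), cos_PI2, sin_PI2.
  replace ((INR k + INR m) * t + ph) with ((INR k * t + ph) + INR m * t) by ring.
  replace ((INR k - INR m) * t + ph) with ((INR k * t + ph) - INR m * t) by ring.
  set (y := INR k * t + ph). set (z := INR m * t).
  rewrite cos_plus, cos_minus, sin_plus, sin_minus. field. }
destruct (Nat.eqb_spec m k) as [E|E].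
- subst m. rewrite Nat.sub_diag.
  evar_last.
  { apply is_RInt_plus_R; [apply is_RInt_scal_R, is_RInt_cos_nat; lia|].
    apply is_RInt_plus_R; [apply is_RInt_scal_R, is_RInt_cos_nat; lia|].
    apply is_RInt_plus_R; apply is_RInt_scal_R.
    - apply (is_RInt_ext_R (fun _ => cos ph)); [|apply is_RInt_const_R].
      intros; simpl. rewrite Rmult_0_l, Rplus_0_l; reflexivity.
    - apply (is_RInt_ext_R (fun _ => sin ph)); [|apply is_RInt_const_R].
      intros; simpl. rewrite Rmult_0_l, Rplus_0_l, cos_minus, cos_PI2, sin_PI2. ring. }
  field.
- evar_last.
  { apply is_RInt_plus_R; [apply is_RInt_scal_R, is_RInt_cos_nat; lia|].
    apply is_RInt_plus_R; [apply is_RInt_scal_R, is_RInt_cos_nat; lia|].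
    apply is_RInt_plus_R; apply is_RInt_scal_R, is_RInt_cos_nat; lia. }
  ring.
Qed.

Lemma PS_Int_bound p (C rho : R) : 0 < rho -> 0 <= C ->
  geom_bound p C rho -> geom_bound (PS_Int p) (C * rho) rho.
Proof.
intros Hr HC Hp m. unfold PS_Int. destruct m as [|m].
- rewrite Rabs_R0. simpl. rewrite Rdiv_1_r. nra.
- unfold Rdiv. rewrite Rabs_mult, (Rabs_pos_eq (/ INR (S m))) by pos.
  simpl pow. rewrite Rinv_mult.
  replace (C * rho * (/ rho * / rho ^ m)) with (C * / rho ^ m) by (field; split; [apply pow_nonzero|]; lra).
  specialize (Hp m).
  apply Rle_trans with (Rabs (p m) * 1); [|unfold Rdiv in Hp; lra].
  apply Rmult_le_compat_l; [apply Rabs_pos|].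
  rewrite <- Rinv_1. apply Rinv_le_contravar; [lra|]. rewrite S_INR. pose proof (pos_INR m); lra.
Qed.

Lemma half_ln_close (x y m : R) : 0 < m -> m <= y -> Rabs (x - y) <= m / 2 ->
  Rabs (/ 2 * ln x - / 2 * ln y) <= Rabs (x - y) / m.
Proof.
intros Hm Hy Hxy. pose proof (proj1 (Rabs_le_between _ _) Hxy) as Hx.
rewrite <- Rmult_minus_distr_l, Rabs_mult, (Rabs_pos_eq (/ 2)) by lra.
pose proof (ln_lipschitz x y (m / 2) ltac:(lra) ltac:(lra) ltac:(lra)) as Hlip.
replace (Rabs (x - y) / (m / 2)) with (2 * (Rabs (x - y) / m)) in Hlip by (field; lra). lra.
Qed.

Lemma norm2_close (x y x' y' E eps : R) :
  Rabs x <= E -> Rabs y <= E -> Rabs x' <= E -> Rabs y' <= E -> Rabs (x - x') <= eps -> Rabs (y - y') <= eps ->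
  Rabs (x' ^ 2 + y' ^ 2 - (x ^ 2 + y ^ 2)) <= 4 * E * eps.
Proof.
assert (Hsquare : forall u u', Rabs u <= E -> Rabs u' <= E -> Rabs (u - u') <= eps -> Rabs (u' ^ 2 - u ^ 2) <= 2 * E * eps).
{ intros u u' Hu Hu' Hd. replace (u' ^ 2 - u ^ 2) with (- ((u + u') * (u - u'))) by ring. rewrite Rabs_Ropp, Rabs_mult.
  apply Rmult_le_compat; try apply Rabs_pos; [|exact Hd]. eapply Rle_trans; [apply Rabs_triang|lra]. }
intros Hx Hy Hx' Hy' Hdx Hdy.
replace (x' ^ 2 + y' ^ 2 - (x ^ 2 + y ^ 2)) with ((x' ^ 2 - x ^ 2) + (y' ^ 2 - y ^ 2)) by ring.
eapply Rle_trans; [apply Rabs_triang|].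
pose proof (Hsquare x x' Hx Hx' Hdx). pose proof (Hsquare y y' Hy Hy' Hdy). lra.
Qed.

Lemma PSeries_half_radius f (C rho x : R) M :
  0 < rho -> 0 <= C -> geom_bound f C rho -> Rabs x <= rho / 2 ->
  Rabs (PSeries f x) <= 2 * C /\ Rabs (sum_f_R0 (fun m => f m * x ^ m) M) <= 2 * C /\
  Rabs (PSeries f x - sum_f_R0 (fun m => f m * x ^ m) M) <= 2 * C * (Rabs x / rho) ^ S M.
Proof.
intros Hrho HC Hf Hx. assert (Hx' : Rabs x < rho) by lra.
assert (Ht : 0 <= Rabs x / rho <= / 2) by (split; [apply Rabs_div_lt_1; assumption|apply Rle_div_l; lra]).
assert (Hhalf : forall K, 0 <= K -> K / (1 - Rabs x / rho) <= 2 * K) by (intros K HK; apply Rle_div_l; nra).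
split; [|split].
- eapply Rle_trans; [apply (PSeries_geom_bound f C rho x); assumption|apply Hhalf, HC].
- eapply Rle_trans; [apply (sum_geom_bound f C rho x); assumption|apply Hhalf, HC].
- eapply Rle_trans; [apply (PSeries_geom_tail f C rho x); assumption|]. rewrite Rmult_assoc.
  apply Hhalf, Rmult_le_pos; [exact HC|apply pow_le, Ht].
Qed.

Lemma exp_INR_mult m (r : R) : exp (INR m * r) = exp r ^ m.
Proof.
induction m as [|m IH]; [simpl; rewrite Rmult_0_l; apply exp_0|].
rewrite S_INR, Rmult_plus_distr_r, Rmult_1_l, exp_plus, IH. simpl. ring.
Qed.

Lemma polar_sum_pow M c e (r t : R) :
  polar_sum c e 0 M r t = sum_f_R0 (fun m => rot c e t m * exp r ^ m) M.
Proof. unfold polar_sum. apply sum_eq. intros m _. rewrite exp_INR_mult. simpl. ring. Qed.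

Lemma exists_exp_div_small (rho K c : R) : 0 < rho -> 0 <= K -> 0 < c ->
  exists r1, forall r, r < r1 -> 0 < exp r / rho <= / 2 /\ K * (exp r / rho) <= c / 2.
Proof.
intros Hrho HK Hc. set (delta := Rmin (/ 2) (c / (2 * (K + 1)))).
assert (Hdelta : 0 < delta) by (apply Rmin_glb_lt; [lra|apply Rdiv_lt_0_compat; lra]).
exists (ln (delta * rho)). intros r Hr. set (tau := exp r / rho).
assert (Htau : 0 < tau < delta).
{ split; [apply Rdiv_lt_0_compat; pos|]. apply Rlt_div_l; [lra|].
  rewrite <- (exp_ln (delta * rho)) by pos. apply exp_increasing, Hr. }
assert (Hhalf : delta <= / 2) by apply Rmin_l. assert (Hdc : delta <= c / (2 * (K + 1))) by apply Rmin_r.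
assert (Hstep : (K + 1) * tau <= (K + 1) * (c / (2 * (K + 1)))) by (apply Rmult_le_compat_l; lra).
replace ((K + 1) * (c / (2 * (K + 1)))) with (c / 2) in Hstep by (field; lra). split; lra.
Qed.

Section BorelCaratheodory.
Variables (a b p q : nat -> R) (C rho : R).
Hypothesis Hlog : log_derivative_on a b p q C rho.
Hypothesis H0 : 0 < a 0%nat ^ 2 + b 0%nat ^ 2.

Let lam := / 2 * ln (a 0%nat ^ 2 + b 0%nat ^ 2).

Definition log_truncation (k : nat) (x t : R) : R := sum_f_R0 (fun m => PS_Int (rot_succ p q t) m * x ^ m) k.

Lemma log_modulus_along_ray k (x t : R) : Rabs x <= rho / 2 ->
  exists F, PSeries (rot a b t) x ^ 2 + PSeries (rot b (oppseq a) t) x ^ 2 = (a 0%nat ^ 2 + b 0%nat ^ 2) * exp (2 * F) /\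
    Rabs F <= 4 * (C * rho) /\ Rabs (F - log_truncation k x t) <= 4 * (C * rho) * (Rabs x / rho) ^ S k.
Proof.
intros Hx. destruct (log_derivative_on_rot a b p q C rho t Hlog) as [Hrho HC _ _ Bp _ _].
exists (PSeries (PS_Int (rot_succ p q t)) x).
destruct (PSeries_half_radius (PS_Int (rot_succ p q t)) (2 * C * rho) rho x k) as (HF & _ & HFk);
  [exact Hrho|nra|apply PS_Int_bound; assumption|exact Hx|].
replace (4 * (C * rho)) with (2 * (2 * C * rho)) by ring.
split; [|split; assumption].
rewrite (modulus_along_ray _ _ _ _ _ _ (log_derivative_on_rot a b p q C rho t Hlog)) by lra.
f_equal. unfold rot, oppseq. simpl INR. rewrite Rmult_0_l, cos_0, sin_0. ring.
Qed.

Lemma polar_norm2_close M (r t : R) : exp r <= rho / 2 ->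
  Rabs (polar_norm2 a b M r t - (PSeries (rot a b t) (exp r) ^ 2 + PSeries (rot b (oppseq a) t) (exp r) ^ 2))
    <= 64 * C ^ 2 * (exp r / rho) ^ S M.
Proof.
intros Hx. destruct (log_derivative_on_rot a b p q C rho t Hlog) as [Hrho HC Ba Bb _ _ _].
assert (Habs : Rabs (exp r) = exp r) by (apply Rabs_pos_eq; pos).
assert (Hx' : Rabs (exp r) <= rho / 2) by (rewrite Habs; exact Hx).
unfold polar_norm2. rewrite !polar_sum_pow, <- Habs at 1.
destruct (PSeries_half_radius _ _ _ _ M Hrho HC Ba Hx') as (Ha & Ha_M & Ha_tail).
destruct (PSeries_half_radius _ _ _ _ M Hrho HC Bb Hx') as (Hb & Hb_M & Hb_tail).
rewrite Habs in *.
replace (64 * C ^ 2 * (exp r / rho) ^ S M) with (4 * (2 * (2 * C)) * (2 * (2 * C) * (exp r / rho) ^ S M)) by ring.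
apply norm2_close; assumption.
Qed.

Lemma log_modulus_expansion k M : (k <= M)%nat ->
  exists K r1, 0 <= K /\ forall r t, r < r1 ->
    0 < polar_norm2 a b M r t /\ Rabs (log_modulus a b M r t - (lam + log_truncation k (exp r) t)) <= K * exp r ^ (S k).
Proof.
intros HkM. pose proof (log_derivative_radius _ _ _ _ _ _ Hlog) as Hrho.
pose proof (log_derivative_const _ _ _ _ _ _ Hlog) as HC.
set (norm0 := a 0%nat ^ 2 + b 0%nat ^ 2) in *.
set (c := norm0 * exp (- (8 * (C * rho)))). assert (Hc : 0 < c) by (apply Rmult_lt_0_compat; pos).
set (K1 := 64 * C ^ 2). assert (HK1 : 0 <= K1) by (unfold K1; nra).
destruct (exists_exp_div_small rho K1 c Hrho HK1 Hc) as [r1 Hr1].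
exists ((K1 / c + 4 * (C * rho)) * (/ rho) ^ S k), r1. split.
{ apply Rmult_le_pos; [|pos]. apply Rplus_le_le_0_compat; [apply Rmult_le_pos; pos|nra]. }
intros r t Hr. destruct (Hr1 r Hr) as [Htau Htau_c]. set (tau := exp r / rho) in *.
assert (Hpow : forall n m, (n <= m)%nat -> 0 < tau ^ S m <= tau ^ S n).
{ intros n m Hnm. split; [pos|]. replace (S m) with (S n + (m - n))%nat by lia. rewrite pow_add.
  assert (0 < tau ^ S n) by pos. assert (tau ^ (m - n) <= 1) by (apply pow_le_1; lra). nra. }
assert (Hx : exp r <= rho / 2) by (replace (exp r) with (tau * rho) by (unfold tau; field; lra); nra).
assert (Habs : Rabs (exp r) = exp r) by (apply Rabs_pos_eq; pos).
destruct (log_modulus_along_ray k (exp r) t) as (F & Hnorm & HF & HFk); [rewrite Habs; exact Hx|].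
pose proof (polar_norm2_close M r t Hx) as Hclose.
rewrite Hnorm in Hclose. rewrite Habs in HFk. fold norm0 K1 tau in Hclose, HFk.
assert (Hlow : c <= norm0 * exp (2 * F)).
{ apply Rmult_le_compat_l; [lra|]. apply exp_le_compat. apply Rabs_le_between in HF. lra. }
assert (Hsmall : Rabs (polar_norm2 a b M r t - norm0 * exp (2 * F)) <= c / 2).
{ pose proof (Hpow 0%nat M ltac:(lia)) as HM. simpl (tau ^ 1) in HM. rewrite Rmult_1_r in HM. nra. }
split; [apply Rabs_le_between in Hsmall; lra|].
pose proof (half_ln_close _ _ c Hc Hlow Hsmall) as Hln.
rewrite ln_mult, ln_exp in Hln by pos. fold (log_modulus a b M r t) in Hln.
replace (/ 2 * (ln norm0 + 2 * F)) with (lam + F) in Hln by (unfold lam; fold norm0; field).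
replace (log_modulus a b M r t - (lam + log_truncation k (exp r) t)) with
  ((log_modulus a b M r t - (lam + F)) + (F - log_truncation k (exp r) t)) by ring.
eapply Rle_trans; [apply Rabs_triang|].
rewrite Rmult_assoc, <- Rpow_mult_distr, (Rmult_comm (/ rho)). fold (exp r / rho) tau.
assert (Rabs (polar_norm2 a b M r t - norm0 * exp (2 * F)) / c <= K1 / c * tau ^ S k).
{ apply Rle_div_l; [exact Hc|]. pose proof (Hpow k M HkM).
  replace (K1 / c * tau ^ S k * c) with (K1 * tau ^ S k) by (field; lra). nra. }
lra.
Qed.

Lemma is_RInt_log_expansion k n (x ph : R) : (n <= k)%nat -> (1 <= k)%nat ->
  is_RInt (fun t => (lam + log_truncation n x t) * cos (INR k * t + ph)) 0 (2 * PI)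
    (if Nat.eqb n k then PI * (p (k - 1)%nat * cos ph + q (k - 1)%nat * sin ph) / INR k * x ^ k else 0).
Proof.
intros Hn Hk. induction n as [|n IH].
- unfold log_truncation. simpl sum_f_R0. destruct k; [lia|]. simpl Nat.eqb. cbv iota.
  evar_last.
  + apply (is_RInt_ext_R (fun t => lam * cos (INR (S k) * t + ph))).
    * intros t. ring.
    * apply is_RInt_scal_R, is_RInt_cos_nat; lia.
  + ring.
- specialize (IH ltac:(lia)). destruct (Nat.eqb_spec n k) as [E|_]; [lia|].
  pose proof (is_RInt_cos_cos (S n) k (p n) (q n) ph ltac:(lia)) as Hterm.
  apply (is_RInt_ext_R (fun t => (lam + log_truncation n x t) * cos (INR k * t + ph) +
     (x ^ S n / INR (S n)) * ((p n * cos (INR (S n) * t) - q n * sin (INR (S n) * t)) * cos (INR k * t + ph)))).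
  + intros t. unfold log_truncation. rewrite tech5. unfold PS_Int at 3, rot_succ. unfold Rdiv. ring.
  + evar_last; [apply is_RInt_plus_R; [exact IH|apply is_RInt_scal_R, Hterm]|].
    destruct (Nat.eqb_spec (S n) k) as [E|E]; [|ring].
    subst k. replace (S n - 1)%nat with n by lia. field. apply not_0_INR; lia.
Qed.

Lemma is_RInt_log_expansion_0 (x : R) : is_RInt (fun t => (lam + log_truncation 0 x t) * cos (INR 0 * t + 0)) 0 (2 * PI)
  (2 * PI * lam).
Proof.
evar_last.
- apply (is_RInt_ext_R (fun t => lam)); [|apply is_RInt_const_R].
  intros t. unfold log_truncation. simpl. replace (0 * t + 0) with 0 by ring. rewrite cos_0. ring.
- ring.
Qed.

Section FourierCoefficient.
Variables (M k : nat) (r0 ph L : R).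
Hypothesis HkM : (k <= M)%nat.
Hypothesis Hpos : forall r t, r < r0 -> 0 < polar_norm2 a b M r t.
Hypothesis HL : forall x, is_RInt (fun t => (lam + log_truncation k x t) * cos (INR k * t + ph)) 0 (2 * PI) (L * x ^ k).

Lemma log_modulus_fourier_near : exists K r1, 0 <= K /\ forall x, x < r0 -> x < r1 ->
  Rabs (fourier_coef (log_modulus a b M) k ph x - L * exp x ^ k) <= K * exp x ^ S k.
Proof.
destruct (log_modulus_expansion k M HkM) as (K & r1 & HK & Hexp).
exists (2 * PI * K), r1. split; [pose proof PI_RGT_0; nra|]. intros x Hx0 Hx1.
assert (Hint : is_RInt (fun t => log_modulus a b M x t * cos (INR k * t + ph) - (lam + log_truncation k (exp x) t) *
  cos (INR k * t + ph))
  0 (2 * PI) (fourier_coef (log_modulus a b M) k ph x - L * exp x ^ k)).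
{ apply (is_RInt_minus (V := R_NormedModule)); [|apply HL].
  apply (RInt_correct (V := R_CompleteNormedModule)), ex_RInt_continuous_R. intros t.
  apply (continuous_log_modulus_cos a b M r0 Hpos), Hx0. }
replace (2 * PI * K * exp x ^ S k) with ((2 * PI - 0) * (K * exp x ^ S k)) by ring.
refine (norm_RInt_le_const (V := R_NormedModule) _ _ _ _ _ _ _ Hint); [pose proof PI_RGT_0; lra|].
intros t _. change norm with Rabs. rewrite <- Rmult_minus_distr_r, Rabs_mult.
destruct (Hexp x t Hx1) as [_ Hclose]. pose proof (Rabs_cos_le (INR k * t + ph)).
pose proof (Rabs_pos (log_modulus a b M x t - (lam + log_truncation k (exp x) t))). nra.
Qed.

Lemma log_modulus_fourier_coef (r : R) : r < r0 ->
  fourier_coef (log_modulus a b M) k ph r * exp (- INR k * r) = L.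
Proof.
intros Hr. destruct log_modulus_fourier_near as (K & r1 & HK & Hnear).
set (u := fourier_coef (log_modulus a b M) k ph) in *. set (r2 := Rmin (Rmin r0 r1) 0).
assert (Hr2 : r2 <= r0 /\ r2 <= r1 /\ r2 <= 0).
{ unfold r2. pose proof (Rmin_l (Rmin r0 r1) 0). pose proof (Rmin_r (Rmin r0 r1) 0).
  pose proof (Rmin_l r0 r1). pose proof (Rmin_r r0 r1). lra. }
assert (Hbound : forall x, x < r2 -> Rabs (u x) <= Rabs L + K).
{ intros x Hx. specialize (Hnear x ltac:(lra) ltac:(lra)).
  assert (Hexp : forall n, 0 <= exp x ^ n <= 1).
  { intros n. split; [pos|]. apply pow_le_1. split; [pos|]. rewrite <- exp_0. apply exp_le_compat. lra. }
  replace (u x) with ((u x - L * exp x ^ k) + L * exp x ^ k) by ring.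
  eapply Rle_trans; [apply Rabs_triang|]. rewrite Rabs_mult, (Rabs_pos_eq (exp x ^ k)) by apply Hexp.
  pose proof (Hexp k). pose proof (Hexp (S k)). pose proof (Rabs_pos L). nra. }
apply Rminus_diag_uniq, (exp_growth_bounded _ 1 r2 K); [lra|]. intros x Hx.
pose proof (log_modulus_fourier_const a b M r0 Hpos k ph _ _ Hbound r x Hr ltac:(lra)) as Hconst.
fold u in Hconst. rewrite Hconst.
specialize (Hnear x ltac:(lra) ltac:(lra)).
assert (Hexp : exp x ^ k * exp (- INR k * x) = 1).
{ rewrite <- exp_INR_mult, <- Ropp_mult_distr_l. apply exp_mul_exp_opp. }
replace (u x * exp (- INR k * x) - L) with ((u x - L * exp x ^ k) * exp (- INR k * x))
  by (rewrite Rmult_minus_distr_r, Rmult_assoc, Hexp; ring).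
rewrite Rabs_mult, (Rabs_pos_eq (exp (- INR k * x))), Rmult_assoc by pos.
apply Rle_trans with (K * exp x ^ S k * (exp (- INR k * x) * exp (- 1 * x)));
  [apply Rmult_le_compat_r; [left; pos|exact Hnear]|].
right. transitivity (K * (exp x * exp (- x)) * (exp x ^ k * exp (- INR k * x)));
  [simpl pow; replace (- 1 * x) with (- x) by ring; ring|rewrite exp_mul_exp_opp, Hexp; ring].
Qed.

End FourierCoefficient.

Section PolynomialBound.
Variables (M k : nat) (r0 r A : R).
Hypothesis Hk : (1 <= k <= M)%nat.
Hypothesis Hpos : forall r t, r < r0 -> 0 < polar_norm2 a b M r t.
Hypothesis Hr : r < r0.
Hypothesis HA : forall t, log_modulus a b M r t <= A.

Lemma is_RInt_log_modulus_cos j (ph : R) :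
  is_RInt (fun t => log_modulus a b M r t * cos (INR j * t + ph)) 0 (2 * PI) (fourier_coef (log_modulus a b M) j ph r).
Proof.
apply (RInt_correct (V := R_CompleteNormedModule)), ex_RInt_continuous_R. intros t.
apply (continuous_log_modulus_cos a b M r0 Hpos), Hr.
Qed.

Lemma log_modulus_mean : is_RInt (log_modulus a b M r) 0 (2 * PI) (2 * PI * lam).
Proof.
pose proof (log_modulus_fourier_coef M 0 r0 0 (2 * PI * lam) ltac:(lia) Hpos) as Hmean.
specialize (Hmean ltac:(intros x; evar_last; [apply is_RInt_log_expansion_0|simpl; ring]) r Hr).
simpl INR in Hmean. rewrite Ropp_0, Rmult_0_l, exp_0, Rmult_1_r in Hmean. rewrite <- Hmean.
apply (is_RInt_ext_R (fun t => log_modulus a b M r t * cos (INR 0 * t + 0))); [|apply is_RInt_log_modulus_cos].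
intros t. simpl. rewrite Rmult_0_l, Rplus_0_l, cos_0. ring.
Qed.

(* [A - log |f|] is nonnegative, so its [k]-th Fourier coefficient is at most its mean. *)
Lemma fourier_coef_log_modulus_bound (ph : R) : Rabs (fourier_coef (log_modulus a b M) k ph r) <= 2 * PI * (A - lam).
Proof.
assert (Hint : is_RInt (fun t => log_modulus a b M r t * cos (INR k * t + ph) + - A * cos (INR k * t + ph)) 0 (2 * PI)
  (fourier_coef (log_modulus a b M) k ph r)).
{ evar_last; [apply is_RInt_plus_R; [apply is_RInt_log_modulus_cos|apply is_RInt_scal_R, is_RInt_cos_nat; lia]|ring]. }
assert (Hmean : is_RInt (fun t => A + -1 * log_modulus a b M r t) 0 (2 * PI) (2 * PI * (A - lam))).
{ evar_last; [apply is_RInt_plus_R; [apply is_RInt_const_R|apply is_RInt_scal_R, log_modulus_mean]|ring]. }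
refine (norm_RInt_le (V := R_NormedModule) _ _ _ _ _ _ _ _ Hint Hmean); [pose proof PI_RGT_0; lra|].
intros t _. change norm with Rabs. rewrite <- Rmult_plus_distr_r, Rabs_mult. specialize (HA t).
pose proof (Rabs_cos_le (INR k * t + ph)). rewrite (Rabs_left1 (_ + - A)) by lra. nra.
Qed.

Lemma poly_borel_caratheodory :
  Rabs (p (k - 1)%nat) <= 2 * INR k * (A - lam) * exp (- INR k * r) /\
  Rabs (q (k - 1)%nat) <= 2 * INR k * (A - lam) * exp (- INR k * r).
Proof.
pose proof PI_RGT_0 as HPI. assert (HkR : 0 < INR k) by pos.
assert (Hrotated : forall ph, Rabs (p (k - 1)%nat * cos ph + q (k - 1)%nat * sin ph) <=
  2 * INR k * (A - lam) * exp (- INR k * r)).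
{ intros ph. set (w := p (k - 1)%nat * cos ph + q (k - 1)%nat * sin ph).
  pose proof (log_modulus_fourier_coef M k r0 ph (PI * w / INR k) ltac:(lia) Hpos) as Hcoef.
  specialize (Hcoef ltac:(intros x; evar_last; [apply (is_RInt_log_expansion k k x ph); lia|rewrite Nat.eqb_refl; unfold w;
    field; lra]) r Hr).
  assert (Hw : w = fourier_coef (log_modulus a b M) k ph r * (exp (- INR k * r) * INR k / PI)).
  { transitivity (PI * w / INR k * (INR k / PI)); [field; lra|rewrite <- Hcoef; field; lra]. }
  rewrite Hw.
  rewrite Rabs_mult, (Rabs_pos_eq (_ / PI)) by pos.
  replace (2 * INR k * (A - lam) * exp (- INR k * r)) with (2 * PI * (A - lam) * (exp (- INR k * r) * INR k / PI))
    by (field; lra).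
  apply Rmult_le_compat_r; [pos|apply fourier_coef_log_modulus_bound]. }
split.
- specialize (Hrotated 0). rewrite cos_0, sin_0, Rmult_1_r, Rmult_0_r, Rplus_0_r in Hrotated. exact Hrotated.
- specialize (Hrotated (PI / 2)). rewrite cos_PI2, sin_PI2, Rmult_0_r, Rplus_0_l, Rmult_1_r in Hrotated. exact Hrotated.
Qed.

End PolynomialBound.
End BorelCaratheodory.

Lemma rot_period a b (t : R) k m :
  rot a b (t + 2 * INR k * PI) m = rot a b t m.
Proof.
unfold rot. replace (INR m * (t + 2 * INR k * PI)) with (INR m * t + 2 * INR (m * k) * PI) by (rewrite mult_INR; ring).
rewrite cos_period, sin_period. reflexivity.
Qed.

Lemma angle_reduction (t : R) : exists t0 k, 0 <= t0 <= 2 * PI /\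
  (t = t0 + 2 * INR k * PI \/ t0 = t + 2 * INR k * PI).
Proof.
pose proof PI_RGT_0 as HP.
set (y := t / (2 * PI)). destruct (base_Int_part y) as [Hfloor Hfrac].
set (z := Int_part y) in *.
assert (Ht : t = y * (2 * PI)) by (unfold y; field; lra).
destruct (Z_le_gt_dec 0 z) as [Hz|Hz].
- exists (t - 2 * INR (Z.to_nat z) * PI), (Z.to_nat z).
  rewrite INR_IZR_INZ, Z2Nat.id by lia. split; [|left; ring]. rewrite Ht. nra.
- exists (t + 2 * INR (Z.to_nat (- z)) * PI), (Z.to_nat (- z)).
  rewrite INR_IZR_INZ, Z2Nat.id by lia. split; [|right; ring]. rewrite opp_IZR, Ht. nra.
Qed.

Lemma continuity_2d_pow m (x t : R) : continuity_2d_pt (fun x _ => x ^ m) x t.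
Proof.
apply (continuity_1d_2d_pt_comp (fun y => y ^ m) (fun x _ => x)); [|apply continuity_2d_pt_id1].
apply derivable_continuous_pt, derivable_pt_pow.
Qed.

Lemma continuity_2d_sum_rot a b M (x t : R) :
  continuity_2d_pt (fun x t => sum_f_R0 (fun m => rot a b t m * x ^ m) M) x t.
Proof.
assert (Hterm : forall m, continuity_2d_pt (fun x t => rot a b t m * x ^ m) x t).
{ intros m. apply continuity_2d_pt_mult; [apply continuity_2d_rot|apply continuity_2d_pow]. }
induction M as [|M IH]; simpl sum_f_R0; [exact (Hterm 0%nat)|].
apply continuity_2d_pt_plus; [exact IH|exact (Hterm (S M))].
Qed.

Lemma continuity_2d_PSeries_rot a b (C rho x t : R) :
  0 < rho -> 0 <= C -> geom_bound a C rho -> geom_bound b C rho -> Rabs x < rho ->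
  continuity_2d_pt (fun x t => PSeries (rot a b t) x) x t.
Proof.
intros Hrho HC Ha Hb Hx eps.
set (x2 := (Rabs x + rho) / 2). assert (Hx2 : Rabs x < x2 < rho) by (unfold x2; lra).
assert (Heps : 0 < eps / 3) by (destruct eps; simpl; lra).
pose proof (Rabs_pos x).
destruct (PSeries_truncation_uniform (2 * C) rho x2 (eps / 3)) as [M HM]; try lra.
destruct (continuity_2d_sum_rot a b M x t (mkposreal _ Heps)) as [d Hd]. simpl in Hd.
assert (Hd2 : 0 < Rmin d (x2 - Rabs x)) by (apply Rmin_glb_lt; [apply cond_pos|lra]).
exists (mkposreal _ Hd2). simpl. intros u v Hu Hv.
pose proof (Rmin_l d (x2 - Rabs x)). pose proof (Rmin_r d (x2 - Rabs x)).
assert (Hux : Rabs u <= x2).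
{ pose proof (Rabs_triang (u - x) x) as Htri. replace (u - x + x) with u in Htri by ring. lra. }
specialize (Hd u v ltac:(lra) ltac:(lra)).
pose proof (HM M (rot a b v) u (Nat.le_refl M) (rot_bound a b C rho v Ha Hb) Hux) as Hu_tail.
pose proof (HM M (rot a b t) x (Nat.le_refl M) (rot_bound a b C rho t Ha Hb) ltac:(lra)) as Hx_tail.
apply Rabs_def2 in Hd. apply Rabs_def2 in Hu_tail. apply Rabs_def2 in Hx_tail. apply Rabs_def1; lra.
Qed.

Lemma positive_inf_rectangle (G : R -> R -> R) (x1 y1 : R) :
  (forall x y, 0 <= x <= x1 -> 0 <= y <= y1 -> continuity_2d_pt G x y /\ 0 < G x y) ->
  exists e, 0 < e /\ forall x y, 0 <= x <= x1 -> 0 <= y <= y1 -> e <= G x y.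
Proof.
intros HG.
assert (Hlocal : forall x y, exists d : posreal, 0 <= x <= x1 -> 0 <= y <= y1 ->
   forall u v, Rabs (u - x) < d -> Rabs (v - y) < d -> pos d <= G u v).
{ intros x y. destruct (classic (0 <= x <= x1 /\ 0 <= y <= y1)) as [[Hx Hy]|Hout];
    [|exists (mkposreal 1 Rlt_0_1); tauto].
  destruct (HG x y Hx Hy) as [Hc Hp]. assert (Hp2 : 0 < G x y / 2) by lra.
  destruct (Hc (mkposreal _ Hp2)) as [d Hd].
  assert (Hm : 0 < Rmin d (G x y / 2)) by (apply Rmin_glb_lt; [apply cond_pos|lra]).
  exists (mkposreal _ Hm). simpl. intros _ _ u v Hu Hv.
  pose proof (Rmin_l d (G x y / 2)). pose proof (Rmin_r d (G x y / 2)).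
  specialize (Hd u v ltac:(lra) ltac:(lra)). simpl in Hd. apply Rabs_def2 in Hd. lra. }
pose (delta := fun x y => proj1_sig (constructive_indefinite_description _ (Hlocal x y))).
pose proof (fun x y => proj2_sig (constructive_indefinite_description _ (Hlocal x y))) as Hdelta.
destruct (compactness_value_2d 0 x1 0 y1 delta) as [e He].
exists e. split; [apply cond_pos|]. intros x y Hx Hy.
apply NNPP. intros Hlt. apply (He x y Hx Hy). intros (u & v & Hu & Hv & Hxu & Hyv & Hsize).
apply Hlt. eapply Rle_trans; [exact Hsize|]. apply (Hdelta u v Hu Hv); assumption.
Qed.

Lemma continuous_le_left (f : R -> R) (u x0 B : R) :
  u < x0 -> (forall x, u < x < x0 -> f x <= B) -> continuous f x0 -> f x0 <= B.
Proof.
intros Hu Hf Hc. apply Rnot_lt_le. intros HB. destruct (Hc _ (open_gt B (f x0) HB)) as [d Hd].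
pose proof (cond_pos d). set (x := Rmax ((u + x0) / 2) (x0 - d / 2)).
assert (Hx : (u + x0) / 2 <= x /\ x0 - d / 2 <= x < x0).
{ unfold x. repeat split; [apply Rmax_l|apply Rmax_r|apply Rmax_lub_lt; lra]. }
apply (Rle_not_lt _ _ (Hf x ltac:(lra))), Hd. apply (Rabs_def1 (x - x0)); lra.
Qed.

Section PowerSeries.
Variables (a b p q : nat -> R) (C0 R1 C rho R0 : R).
Hypothesis HR : 0 < R0 < R1.
Hypothesis HC0 : 0 < C0.
Hypothesis Ba : geom_bound a C0 R1.
Hypothesis Bb : geom_bound b C0 R1.
Hypothesis Hrho : 0 < rho.
Hypothesis HC : 0 <= C.
Hypothesis Bp : geom_bound p C rho.
Hypothesis Bq : geom_bound q C rho.
Hypothesis Hlog : is_log_derivative a b p q.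
Hypothesis Hnonzero : forall x t, 0 <= x < R0 ->
  ~ (PSeries (rot a b t) x = 0 /\ PSeries (rot b (oppseq a) t) x = 0).

Lemma PSeries_rot_norm2_lower (x1 : R) : 0 < x1 < R0 ->
  exists e, 0 < e /\ forall x t, 0 <= x <= x1 ->
    e <= PSeries (rot a b t) x * PSeries (rot a b t) x + PSeries (rot b (oppseq a) t) x * PSeries (rot b (oppseq a) t) x.
Proof.
intros Hx1.
set (norm2 := fun x t => PSeries (rot a b t) x * PSeries (rot a b t) x
             + PSeries (rot b (oppseq a) t) x * PSeries (rot b (oppseq a) t) x).
pose proof (geom_bound_opp a C0 R1 Ba) as Bna.
destruct (positive_inf_rectangle norm2 x1 (2 * PI)) as (e & He & Hlow).
{ intros x t Hx Ht. split.
  - apply continuity_2d_pt_plus; apply continuity_2d_pt_mult;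
      (apply (continuity_2d_PSeries_rot _ _ C0 R1); [lra|lra|assumption|assumption|rewrite Rabs_pos_eq; lra]).
  - pose proof (Hnonzero x t ltac:(lra)) as Hnz. unfold norm2.
    destruct (Req_dec (PSeries (rot a b t) x) 0) as [Hre|]; [|nra].
    destruct (Req_dec (PSeries (rot b (oppseq a) t) x) 0) as [Him|]; [tauto|nra]. }
exists e. split; [exact He|]. intros x t Hx. change (e <= norm2 x t).
destruct (angle_reduction t) as (t0 & k & Ht0 & [Ht|Ht]); (replace (norm2 x t) with (norm2 x t0); [apply Hlow; assumption|]);
  unfold norm2; rewrite Ht, !(PSeries_ext (rot _ _ (_ + _)) _ x (rot_period _ _ _ _)); reflexivity.
Qed.

Lemma truncations_nonzero (x1 : R) : 0 < x1 < R0 ->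
  exists M0, forall M, (M0 <= M)%nat -> forall r t, exp r <= x1 -> 0 < polar_norm2 a b M r t.
Proof.
intros Hx1. destruct (PSeries_rot_norm2_lower x1 Hx1) as (e & He & Hlow).
pose proof (sqrt_lt_R0 e He) as Hsqrt. pose proof (sqrt_sqrt e ltac:(lra)) as Hsquare. set (s := sqrt e) in *.
destruct (PSeries_truncation_uniform (2 * C0) R1 x1 (s / 2)) as [M0 HM0]; try lra.
exists M0. intros M HM r t Hr. set (x := exp r) in *. assert (Hx : 0 < x) by apply exp_pos.
assert (Hclose : forall f g, geom_bound f C0 R1 -> geom_bound g C0 R1 ->
   Rabs (PSeries (rot f g t) x - polar_sum f g 0 M r t) < s / 2).
{ intros f g Bf Bg. rewrite polar_sum_pow. fold x.
  apply HM0; [exact HM|apply rot_bound; assumption|rewrite Rabs_pos_eq; lra]. }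
pose proof (Hclose a b Ba Bb) as Hre. pose proof (Hclose b (oppseq a) Bb (geom_bound_opp a C0 R1 Ba)) as Him.
specialize (Hlow x t ltac:(lra)). unfold polar_norm2.
destruct (Req_dec (polar_sum a b 0 M r t) 0) as [Hre0|]; [|nra].
destruct (Req_dec (polar_sum b (oppseq a) 0 M r t) 0) as [Him0|]; [|nra].
exfalso. rewrite Hre0, Rminus_0_r in Hre. rewrite Him0, Rminus_0_r in Him.
apply Rabs_def2 in Hre. apply Rabs_def2 in Him. nra.
Qed.

Lemma log_modulus_upper_bound M (r t : R) : exp r < R0 -> 0 < polar_norm2 a b M r t ->
  log_modulus a b M r t <= ln (4 * C0 * R1 / (R1 - R0)).
Proof.
intros Hr Hpos. set (x := exp r) in *. assert (Hx : 0 < x) by apply exp_pos.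
set (D := 2 * C0 * R1 / (R1 - R0)).
assert (HD : 0 < D) by (apply Rdiv_lt_0_compat; [|lra]; pos).
assert (Hsum : forall f g, geom_bound f C0 R1 -> geom_bound g C0 R1 -> polar_sum f g 0 M r t ^ 2 <= D ^ 2).
{ intros f g Bf Bg. rewrite polar_sum_pow. fold x. apply pow_maj_Rabs.
  eapply Rle_trans; [apply (sum_geom_bound _ (2 * C0) R1 x ltac:(lra) ltac:(lra) (rot_bound f g C0 R1 t Bf Bg));
    rewrite Rabs_pos_eq; lra|].
  rewrite Rabs_pos_eq by lra. unfold D.
  replace (2 * C0 / (1 - x / R1)) with (2 * C0 * R1 / (R1 - x)) by (field; lra).
  unfold Rdiv. apply Rmult_le_compat_l; [pos|]. apply Rinv_le_contravar; lra. }
pose proof (Hsum a b Ba Bb) as Hre. pose proof (Hsum b (oppseq a) Bb (geom_bound_opp _ _ _ Ba)) as Him.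
replace (4 * C0 * R1 / (R1 - R0)) with (2 * D) by (unfold D; field; lra).
apply Rle_trans with (/ 2 * ln ((2 * D) ^ 2)).
- apply Rmult_le_compat_l; [lra|]. apply ln_le; [exact Hpos|]. unfold polar_norm2. nra.
- rewrite ln_pow by lra. simpl INR. lra.
Qed.

Let A := ln (4 * C0 * R1 / (R1 - R0)) - / 2 * ln (a 0%nat ^ 2 + b 0%nat ^ 2).

Lemma log_derivative_coef_bound_below j (x : R) : 0 < a 0%nat ^ 2 + b 0%nat ^ 2 -> 0 < x < R0 ->
  Rabs (p j) * x ^ S j <= 2 * INR (S j) * A /\ Rabs (q j) * x ^ S j <= 2 * INR (S j) * A.
Proof.
intros H0 Hx.
assert (Hlog_on : log_derivative_on a b p q (Rmax C C0) (Rmin rho R1)).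
{ pose proof (Rmax_l C C0). pose proof (Rmax_r C C0). pose proof (Rmin_l rho R1). pose proof (Rmin_r rho R1).
  assert (0 < Rmin rho R1) by (apply Rmin_glb_lt; lra).
  split; [assumption|lra|apply (geom_bound_weaken _ C0 _ R1)|apply (geom_bound_weaken _ C0 _ R1)|
    apply (geom_bound_weaken _ C _ rho)|apply (geom_bound_weaken _ C _ rho)|exact Hlog]; (lra || assumption). }
destruct (truncations_nonzero ((x + R0) / 2) ltac:(lra)) as [M0 HM0].
set (M := Nat.max M0 (S j)). set (r := ln x). assert (Hexp_r : exp r = x) by (apply exp_ln; lra).
assert (Hpos : forall r t, r < ln ((x + R0) / 2) -> 0 < polar_norm2 a b M r t).
{ intros r' t Hr'. apply HM0; [unfold M; lia|]. rewrite <- (exp_ln ((x + R0) / 2)) by lra. left; apply exp_increasing, Hr'. }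
assert (Hr : r < ln ((x + R0) / 2)) by (apply ln_increasing; lra).
destruct (poly_borel_caratheodory a b p q _ _ Hlog_on H0 M (S j) _ r (ln (4 * C0 * R1 / (R1 - R0)))
  ltac:(unfold M; lia) Hpos Hr) as [Hp Hq].
{ intros t. apply log_modulus_upper_bound; [lra|apply Hpos, Hr]. }
replace (S j - 1)%nat with j in * by lia. fold A in Hp, Hq.
assert (Hcancel : exp (- INR (S j) * r) * x ^ S j = 1).
{ rewrite <- Hexp_r, <- exp_INR_mult, <- Ropp_mult_distr_l, Rmult_comm. apply exp_mul_exp_opp. }
split; rewrite <- (Rmult_1_r (2 * INR (S j) * A)), <- Hcancel, <- Rmult_assoc;
  (apply Rmult_le_compat_r; [left; pos|assumption]).
Qed.

Theorem log_derivative_coef_bound j : 0 < a 0%nat ^ 2 + b 0%nat ^ 2 ->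
  Rabs (p j) <= 2 * INR (S j) * A / R0 ^ S j /\ Rabs (q j) <= 2 * INR (S j) * A / R0 ^ S j.
Proof.
intros H0. assert (HRj : 0 < R0 ^ S j) by pos.
assert (Hlimit : forall c, (forall x, 0 < x < R0 -> c * x ^ S j <= 2 * INR (S j) * A) -> c <= 2 * INR (S j) * A / R0 ^ S j).
{ intros c Hc. apply Rle_div_r; [exact HRj|]. apply (continuous_le_left (fun x => c * x ^ S j) 0); [lra|exact Hc|].
  eapply continuous_is_derive. auto_derive; [exact I|reflexivity]. }
split; apply Hlimit; intros x Hx; apply (log_derivative_coef_bound_below j x H0 Hx).
Qed.

End PowerSeries.

(** * Taylor coefficients of Dirichlet series *)

(* [sum1 f N = f 1 + ... + f N], the indexing of [DS_partial]. *)
Fixpoint sum1 (f : nat -> R) (N : nat) : R :=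
  match N with O => 0 | S N' => sum1 f N' + f N end.

Lemma sum1_succ f N : sum1 f (S N) = sum1 f N + f (S N).
Proof. reflexivity. Qed.

Lemma sum1_ext f g N :
  (forall n, (1 <= n <= N)%nat -> f n = g n) -> sum1 f N = sum1 g N.
Proof.
induction N; intros H; simpl; [reflexivity|].
rewrite IHN by (intros; apply H; lia). rewrite H by lia. reflexivity.
Qed.

Lemma sum1_plus f g N : sum1 (fun n => f n + g n) N = sum1 f N + sum1 g N.
Proof. induction N; simpl; [ring|rewrite IHN; ring]. Qed.

Lemma sum1_minus f g N : sum1 (fun n => f n - g n) N = sum1 f N - sum1 g N.
Proof. induction N; simpl; [ring|rewrite IHN; ring]. Qed.

Lemma sum1_scal (c : R) f N : sum1 (fun n => c * f n) N = c * sum1 f N.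
Proof. induction N; simpl; [ring|rewrite IHN; ring]. Qed.

Lemma sum1_opp f N : sum1 (fun n => - f n) N = - sum1 f N.
Proof. induction N; simpl; [ring|rewrite IHN; ring]. Qed.

Lemma sum1_le f g N :
  (forall n, (1 <= n <= N)%nat -> f n <= g n) -> sum1 f N <= sum1 g N.
Proof.
induction N; intros H; simpl; [lra|].
apply Rplus_le_compat; [apply IHN; intros; apply H; lia|apply H; lia].
Qed.

Lemma sum1_0 N : sum1 (fun _ => 0) N = 0.
Proof. induction N; simpl; lra. Qed.

Lemma sum1_nonneg f N : (forall n, (1 <= n <= N)%nat -> 0 <= f n) -> 0 <= sum1 f N.
Proof. intros H. rewrite <- (sum1_0 N). apply sum1_le. exact H. Qed.

Lemma Rabs_sum1 f N : Rabs (sum1 f N) <= sum1 (fun n => Rabs (f n)) N.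
Proof.
induction N; simpl; [rewrite Rabs_R0; lra|].
eapply Rle_trans; [apply Rabs_triang|lra].
Qed.

Lemma Rabs_sum1_le f g N :
  (forall n, (1 <= n <= N)%nat -> Rabs (f n) <= g n) -> Rabs (sum1 f N) <= sum1 g N.
Proof. intros H. eapply Rle_trans; [apply Rabs_sum1|apply sum1_le; exact H]. Qed.

Lemma sum1_exchange (f : nat -> nat -> R) M N :
  sum1 (fun i => sum1 (fun j => f i j) M) N = sum1 (fun j => sum1 (fun i => f i j) N) M.
Proof.
induction N; simpl; [symmetry; apply sum1_0|]. rewrite IHN, <- sum1_plus. reflexivity.
Qed.

Lemma sum1_incr f M N : (M <= N)%nat ->
  (forall n, (M < n <= N)%nat -> 0 <= f n) -> sum1 f M <= sum1 f N.
Proof.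
intros H. induction H as [|N H IH]; intros Hf; [lra|]. simpl.
assert (0 <= f (S N)) by (apply Hf; lia). assert (sum1 f M <= sum1 f N) by (apply IH; intros; apply Hf; lia). lra.
Qed.

Lemma sum1_const (c : R) N : sum1 (fun _ => c) N = INR N * c.
Proof. induction N; [simpl; ring|]. rewrite S_INR. simpl sum1. rewrite IHN. ring. Qed.

Lemma sum1_single f k N : (1 <= k <= N)%nat ->
  (forall n, (1 <= n <= N)%nat -> n <> k -> f n = 0) -> sum1 f N = f k.
Proof.
intros Hk H. induction N; [lia|]. simpl.
destruct (Nat.eq_dec k (S N)) as [->|E].
- rewrite (sum1_ext f (fun _ => 0) N), sum1_0 by (intros; apply H; lia). ring.
- rewrite IHN, (H (S N)) by (try lia; intros; apply H; lia). ring.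
Qed.

Lemma ex_lim_sum1 f g (B : R) :
  (forall n, (1 <= n)%nat -> Rabs (f n) <= g n) -> (forall N, sum1 g N <= B) ->
  exists l : R, is_lim_seq (sum1 f) l.
Proof.
intros Hf Hg.
assert (Hmono : forall h, (forall n, (1 <= n)%nat -> 0 <= h n) -> (forall N, sum1 h N <= 2 * B) ->
  ex_finite_lim_seq (sum1 h)).
{ intros h Hh HB. apply ex_finite_lim_seq_incr with (2 * B); [|exact HB].
  intros n. simpl. specialize (Hh (S n) ltac:(lia)). lra. }
destruct (Hmono (fun n => f n + Rabs (f n))) as [l1 Hl1].
{ intros n _. pose proof (Rle_abs (- f n)) as Habs. rewrite Rabs_Ropp in Habs. lra. }
{ intros N. eapply Rle_trans; [|apply Rmult_le_compat_l; [lra|apply (Hg N)]]. rewrite <- sum1_scal. apply sum1_le.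
  intros n Hn. specialize (Hf n ltac:(lia)). pose proof (Rle_abs (f n)). lra. }
destruct (Hmono (fun n => Rabs (f n))) as [l2 Hl2].
{ intros n _. apply Rabs_pos. }
{ intros N. eapply Rle_trans; [|apply Rmult_le_compat_l; [lra|apply (Hg N)]]. rewrite <- sum1_scal. apply sum1_le.
  intros n Hn. specialize (Hf n ltac:(lia)). pose proof (Rabs_pos (f n)). lra. }
exists (l1 - l2). apply (is_lim_seq_ext (fun N => sum1 (fun n => f n + Rabs (f n)) N - sum1 (fun n => Rabs (f n)) N)).
- intros N. rewrite <- sum1_minus. apply sum1_ext. intros; ring.
- apply is_lim_seq_minus'; assumption.
Qed.

Definition sum1_inf (f : nat -> R) : R := real (Lim_seq (sum1 f)).

Lemma is_lim_seq_sum1_inf f g (B : R) :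
  (forall n, (1 <= n)%nat -> Rabs (f n) <= g n) -> (forall N, sum1 g N <= B) ->
  is_lim_seq (sum1 f) (sum1_inf f).
Proof.
intros Hf Hg. destruct (ex_lim_sum1 f g B Hf Hg) as [l Hl].
unfold sum1_inf. rewrite (is_lim_seq_unique _ _ Hl). exact Hl.
Qed.

Definition pow_neg (n : nat) (s : R) : R := exp (- s * lg n).

Lemma pow_neg_pos n s : 0 < pow_neg n s. Proof. apply exp_pos. Qed.

Lemma ln_0 : ln 0 = 0.
Proof. unfold ln. destruct (Rlt_dec 0 0) as [Hlt|_]; [destruct (Rlt_irrefl 0 Hlt)|reflexivity]. Qed.

Lemma ln_INR_nonneg n : 0 <= lg n.
Proof.
destruct n as [|n].
- simpl. rewrite ln_0. apply Rle_refl.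
- rewrite <- ln_1. apply ln_le; [lra|]. rewrite S_INR. pose proof (pos_INR n); lra.
Qed.

Lemma pow_neg_antitone n s s' : s <= s' -> pow_neg n s' <= pow_neg n s.
Proof. intros H. apply exp_le_compat. pose proof (ln_INR_nonneg n). nra. Qed.

Lemma pow_neg_plus n s s' : pow_neg n (s + s') = pow_neg n s * pow_neg n s'.
Proof. unfold pow_neg. rewrite <- exp_plus. f_equal. ring. Qed.

Lemma pow_neg_mult m n s : (1 <= m)%nat -> (1 <= n)%nat -> pow_neg (m * n) s = pow_neg m s * pow_neg n s.
Proof.
intros Hm Hn. unfold pow_neg. rewrite mult_INR, ln_mult, <- exp_plus by pos. f_equal. ring.
Qed.

Lemma pow_neg_1_l s : pow_neg 1 s = 1.
Proof. unfold pow_neg. simpl. rewrite ln_1, Rmult_0_r. apply exp_0. Qed.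

Lemma pow_neg_le_1 n s : 0 <= s -> pow_neg n s <= 1.
Proof. intros H. unfold pow_neg. rewrite <- exp_0. apply exp_le_compat. pose proof (ln_INR_nonneg n). nra. Qed.

Lemma pow_neg_1_r n : (1 <= n)%nat -> pow_neg n 1 = / INR n.
Proof.
intros H. unfold pow_neg. replace (- (1) * lg n) with (- lg n) by ring.
rewrite exp_Ropp, exp_ln by pos. reflexivity.
Qed.

Lemma pow_neg_decr m n s : 0 <= s -> (1 <= m <= n)%nat -> pow_neg n s <= pow_neg m s.
Proof.
intros Hs H. unfold pow_neg. apply exp_le_compat.
assert (lg m <= lg n) by (apply ln_le; [pos|apply le_INR; lia]). nra.
Qed.

Lemma ln_INR_succ_minus n : (1 <= n)%nat -> lg (S n) - lg n <= / INR n.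
Proof.
intros H. assert (0 < INR n) by pos.
rewrite S_INR, <- ln_div by lra. eapply Rle_trans; [apply ln_le_minus_1, Rdiv_lt_0_compat; lra|].
right. field. lra.
Qed.

Lemma pow_neg_telescope n s : 0 < s -> (1 <= n)%nat -> pow_neg (S n) (1 + s) <= / s * (pow_neg n s - pow_neg (S n) s).
Proof.
intros Hs Hn. rewrite pow_neg_plus, pow_neg_1_r by lia.
assert (HN : 0 < INR n) by pos.
assert (HS : 0 < INR (S n)) by pos.
assert (Hln : / INR (S n) <= lg (S n) - lg n).
{ assert (lg n - lg (S n) <= - / INR (S n)); [|lra].
  rewrite <- ln_div by lra. eapply Rle_trans; [apply ln_le_minus_1, Rdiv_lt_0_compat; lra|].
  right. rewrite S_INR. field. rewrite <- S_INR. lra. }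
replace (pow_neg n s) with (pow_neg (S n) s * exp (s * (lg (S n) - lg n)))
  by (unfold pow_neg; rewrite <- exp_plus; f_equal; ring). pose proof (pow_neg_pos (S n) s) as Hp.
assert (Hexp : 1 + s * / INR (S n) <= exp (s * (lg (S n) - lg n))).
{ eapply Rle_trans; [|apply exp_ineq1_le]. nra. }
assert (0 < / s) by pos.
apply Rle_trans with (/ s * (pow_neg (S n) s * (1 + s * / INR (S n)) - pow_neg (S n) s)).
- right. field. split; lra.
- apply Rmult_le_compat_l; [lra|]. nra.
Qed.

Lemma sum1_pow_neg_le s N : 0 < s -> sum1 (fun n => pow_neg n (1 + s)) N <= 1 + / s.
Proof.
intros Hs. assert (0 < / s) by pos.
destruct N as [|N]; [simpl; lra|].
assert (sum1 (fun n => pow_neg n (1 + s)) (S N) <= 1 + / s * (1 - pow_neg (S N) s)).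
{ induction N as [|N IH].
  - simpl sum1. rewrite !pow_neg_1_l. lra.
  - rewrite sum1_succ.
    pose proof (pow_neg_telescope (S N) s Hs ltac:(lia)). lra. }
pose proof (pow_neg_pos (S N) s). nra.
Qed.

Lemma sum1_tail_le f (K s : R) M N : 0 <= K -> 0 < s -> (1 <= M <= N)%nat ->
  (forall n, (M < n <= N)%nat -> Rabs (f n) <= K * pow_neg n (1 + s)) ->
  Rabs (sum1 f N - sum1 f M) <= K * (/ s * pow_neg M s).
Proof.
intros HK Hs H Hf. assert (0 < / s) by pos.
assert (Htel : Rabs (sum1 f N - sum1 f M) <= K * (/ s * (pow_neg M s - pow_neg N s))).
{ destruct H as [HM H]. induction H as [|N H IH].
  - rewrite !Rminus_diag, Rabs_R0. lra.
  - simpl. replace (sum1 f N + f (S N) - sum1 f M) with ((sum1 f N - sum1 f M) + f (S N)) by ring.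
    eapply Rle_trans; [apply Rabs_triang|].
    pose proof (IH ltac:(intros; apply Hf; lia)). pose proof (Hf (S N) ltac:(lia)).
    pose proof (pow_neg_telescope N s Hs ltac:(lia)) as Hstep. apply (Rmult_le_compat_l K) in Hstep; [lra|exact HK]. }
eapply Rle_trans; [exact Htel|]. apply Rmult_le_compat_l; [exact HK|]. pose proof (pow_neg_pos N s). nra.
Qed.

Lemma sum1_by_parts (al g : nat -> R) N :
  sum1 (fun n => al n * g n) (S N) = sum1 al (S N) * g (S N) + sum1 (fun n => sum1 al n * (g n - g (S n))) N.
Proof.
induction N as [|N IH]; [simpl; ring|].
rewrite sum1_succ, IH, (sum1_succ (fun n => sum1 al n * (g n - g (S n)))), (sum1_succ al (S N)). ring.
Qed.

Definition exp_taylor (s : R) (m : nat) (x : R) : R := exp (- s * x) * ((- x) ^ m / INR (fact m)).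
Notation shift := (PS_incr_1 (V := R_NormedModule)).

Lemma is_derive_exp_taylor s m x :
  is_derive (exp_taylor s m) x (- s * exp_taylor s m x - shift (fun j => exp_taylor s j x) m).
Proof.
unfold exp_taylor. destruct m as [|m]; simpl PS_incr_1.
- simpl. unfold zero; simpl. auto_derive; [exact I|]. field.
- pose proof (INR_fact_neq_0 m). assert (INR (S m) <> 0) by (apply not_0_INR; lia).
  rewrite fact_simpl, mult_INR. set (k := INR (fact m)) in *. clearbody k.
  auto_derive; [exact I|]. simpl Nat.pred.
  change (match m with O => 1 | S _ => INR m + 1 end) with (INR (S m)). simpl pow. field. split; assumption.
Qed.

Lemma is_derive_shift_exp_taylor s m x :
  is_derive (fun x => shift (fun j => exp_taylor s j x) m) x
    (- s * shift (fun j => exp_taylor s j x) m - shift (shift (fun j => exp_taylor s j x)) m).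
Proof.
destruct m as [|m]; simpl.
- evar_last; [apply (is_derive_const (K := R_AbsRing) (V := R_NormedModule))|]. unfold zero; simpl; ring.
- apply is_derive_exp_taylor.
Qed.

Lemma exp_taylor_bound s m x r : 0 <= r -> 0 <= x -> r ^ m * Rabs (exp_taylor s m x) <= exp (- (s - r) * x).
Proof.
intros Hr Hx. unfold exp_taylor. rewrite Rabs_mult, (Rabs_pos_eq (exp _)) by pos.
unfold Rdiv. rewrite Rabs_mult, <- RPow_abs, Rabs_Ropp, (Rabs_pos_eq x) by exact Hx.
rewrite (Rabs_pos_eq (/ _)) by pos.
replace (- (s - r) * x) with (- s * x + r * x) by ring. rewrite exp_plus.
replace (r ^ m * (exp (- s * x) * (x ^ m * / INR (fact m)))) with (exp (- s * x) * ((r * x) ^ m / INR (fact m)))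
  by (rewrite Rpow_mult_distr; unfold Rdiv; ring).
apply Rmult_le_compat_l; [pos|]. apply exp_term_le. nra.
Qed.

Lemma shift_bound a (r B : R) m :
  0 <= r -> (forall j, r ^ j * Rabs (a j) <= B) -> r ^ m * Rabs (shift a m) <= r * B.
Proof.
intros Hr Ha. destruct m as [|m]; simpl.
- specialize (Ha 0%nat). pose proof (Rabs_pos (a 0%nat)). unfold zero; simpl. rewrite Rabs_R0. simpl in Ha. nra.
- rewrite Rmult_assoc. apply Rmult_le_compat_l; [exact Hr|apply Ha].
Qed.

Definition taylor_term (s t ph : R) (m n : nat) : R := exp_taylor s m (lg n) * cos (t * lg n + ph).

Lemma taylor_term_bound s t ph m n r : 0 <= r -> r ^ m * Rabs (taylor_term s t ph m n) <= pow_neg n (s - r).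
Proof.
intros Hr. unfold taylor_term. rewrite Rabs_mult, <- Rmult_assoc.
pose proof (exp_taylor_bound s m (lg n) r Hr (ln_INR_nonneg n)) as Hexp.
pose proof (Rabs_cos_le (t * lg n + ph)). fold (pow_neg n (s - r)) in Hexp.
assert (0 <= r ^ m * Rabs (exp_taylor s m (lg n))) by (apply Rmult_le_pos; [apply pow_le; exact Hr|apply Rabs_pos]).
nra.
Qed.

(* Mean value theorem on [ln n, ln (n+1)], an interval of length at most 1/n. *)
Lemma variation_bound (f f' : R -> R) (c D : R) n : (1 <= n)%nat -> 0 <= c -> 0 <= D ->
  (forall x, is_derive f x (f' x)) -> (forall x, 0 <= x -> Rabs (f' x) <= D * exp (- c * x)) ->
  forall y, lg n <= y <= lg (S n) -> Rabs (f (lg n) - f y) <= D * pow_neg n (1 + c).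
Proof.
intros Hn Hc HD Hf Hb y Hy.
destruct (MVT_gen f (lg n) y f') as (x & Hx & Hmvt).
- intros; apply Hf.
- intros z _. apply derivable_continuous_pt. exists (f' z). apply is_derive_Reals, Hf.
- rewrite Rabs_minus_sym, Hmvt, Rabs_mult.
  rewrite Rmin_left, Rmax_right in Hx by lra.
  pose proof (ln_INR_nonneg n) as Hl. specialize (Hb x ltac:(lra)).
  rewrite (Rabs_pos_eq (y - _)) by lra.
  pose proof (ln_INR_succ_minus n Hn) as Hd.
  rewrite pow_neg_plus, pow_neg_1_r by exact Hn.
  assert (exp (- c * x) <= pow_neg n c) by (apply exp_le_compat; nra).
  pose proof (Rabs_pos (f' x)). apply Rle_trans with (D * pow_neg n c * / INR n); [|right; ring].
  apply Rmult_le_compat; try lra. apply Rle_trans with (D * exp (- c * x)); [exact Hb|apply Rmult_le_compat_l; lra].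
Qed.

Lemma taylor_term_variation s t ph m n r : (1 <= n)%nat -> 0 <= r <= s ->
  r ^ m * Rabs (taylor_term s t ph m n - taylor_term s t ph m (S n)) <= (s + Rabs t + r) * pow_neg n (1 + (s - r)).
Proof.
intros Hn Hr.
set (f := fun x => r ^ m * (exp_taylor s m x * cos (t * x + ph))).
set (f' := fun x => r ^ m * ((- s * exp_taylor s m x - shift (fun j => exp_taylor s j x) m) * cos (t * x + ph)
  - t * exp_taylor s m x * sin (t * x + ph))).
assert (Hrm : 0 <= r ^ m) by pos. pose proof (Rabs_pos t).
replace (r ^ m * Rabs (taylor_term s t ph m n - taylor_term s t ph m (S n))) with (Rabs (f (lg n) - f (lg (S n))))
  by (unfold f, taylor_term; rewrite <- Rmult_minus_distr_l, Rabs_mult, (Rabs_pos_eq (r ^ m)) by exact Hrm; reflexivity).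
apply (variation_bound f f'); [exact Hn|lra|lra| | |split; [apply ln_le; [pos|apply le_INR; lia]|lra]].
- intros x. apply is_derive_scal. evar_last.
  + apply (is_derive_mult (exp_taylor s m) (fun x => cos (t * x + ph)));
      [apply is_derive_exp_taylor|auto_derive; [exact I|reflexivity]|apply Rmult_comm].
  + unfold plus, mult; simpl. ring.
- intros x Hx. unfold f'. rewrite Rabs_mult, (Rabs_pos_eq (r ^ m)) by exact Hrm.
  pose proof (exp_taylor_bound s m x r ltac:(lra) Hx) as Hg.
  pose proof (shift_bound (fun j => exp_taylor s j x) r _ m ltac:(lra)
    (fun j => exp_taylor_bound s j x r ltac:(lra) Hx)) as Hg'.
  pose proof (Rabs_cos_le (t * x + ph)) as Hcos. pose proof (Rabs_sin_le (t * x + ph)) as Hsin.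
  set (c := cos (t * x + ph)) in *. set (d := sin (t * x + ph)) in *.
  set (g := exp_taylor s m x) in *. set (g' := shift _ m) in *. set (e := exp (- (s - r) * x)) in *.
  assert (Htri : Rabs ((- s * g - g') * c - t * g * d) <= s * Rabs g + Rabs g' + Rabs t * Rabs g).
  { unfold Rminus at 1. eapply Rle_trans; [apply Rabs_triang|]. rewrite Rabs_Ropp, !Rabs_mult.
    assert (Rabs (- s * g - g') <= s * Rabs g + Rabs g').
    { unfold Rminus. eapply Rle_trans; [apply Rabs_triang|].
      rewrite !Rabs_Ropp, Rabs_mult, Rabs_Ropp, (Rabs_pos_eq s) by lra. lra. }
    pose proof (Rabs_pos (- s * g - g')). assert (0 <= Rabs t * Rabs g) by pos. nra. }
  eapply Rle_trans; [apply Rmult_le_compat_l; [exact Hrm|exact Htri]|].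
  replace (r ^ m * (s * Rabs g + Rabs g' + Rabs t * Rabs g)) with ((s + Rabs t) * (r ^ m * Rabs g) + r ^ m * Rabs g') by ring.
  nra.
Qed.

Definition taylor_coefN (al : nat -> R) (s t ph : R) (N m : nat) : R := sum1 (fun n => al n * taylor_term s t ph m n) N.
Definition taylor_coef (al : nat -> R) (s t ph : R) (m : nat) : R := sum1_inf (fun n => al n * taylor_term s t ph m n).

Lemma taylor_coefN_bound_of_bounded_sums al (B s t ph r : R) : (forall N, Rabs (sum1 al N) <= B) -> 0 < r < s ->
  forall N, geom_bound (taylor_coefN al s t ph N) (B * (1 + (s + Rabs t + r) * (1 + / (s - r)))) r.
Proof.
intros HB Hr N. apply geom_bound_of_scaled; [lra|]. intros m.
assert (HB0 : 0 <= B) by (eapply Rle_trans; [apply Rabs_pos|apply (HB 0%nat)]).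
assert (Hrm : 0 < r ^ m) by pos. assert (0 < / (s - r)) by pos. pose proof (Rabs_pos t).
set (D := s + Rabs t + r). assert (HD : 0 < D) by (unfold D; lra).
unfold taylor_coefN. destruct N as [|N].
- simpl. rewrite Rabs_R0, Rmult_0_r. apply Rmult_le_pos; [exact HB0|nra].
- rewrite sum1_by_parts.
  set (term := taylor_term s t ph m). set (step := fun n => Rabs (term n - term (S n))).
  apply Rle_trans with (r ^ m * (B * Rabs (term (S N)) + sum1 (fun n => B * step n) N)).
  { apply Rmult_le_compat_l; [lra|]. eapply Rle_trans; [apply Rabs_triang|]. apply Rplus_le_compat.
    - rewrite Rabs_mult. apply Rmult_le_compat_r; [apply Rabs_pos|apply HB].
    - apply Rabs_sum1_le. intros n _. rewrite Rabs_mult. apply Rmult_le_compat_r; [apply Rabs_pos|apply HB]. }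
  rewrite sum1_scal.
  replace (r ^ m * (B * Rabs (term (S N)) + B * sum1 step N))
    with (B * (r ^ m * Rabs (term (S N)) + sum1 (fun n => r ^ m * step n) N)) by (rewrite sum1_scal; ring).
  apply Rmult_le_compat_l; [exact HB0|]. apply Rplus_le_compat.
  + eapply Rle_trans; [apply taylor_term_bound; lra|]. apply pow_neg_le_1; lra.
  + apply Rle_trans with (sum1 (fun n => D * pow_neg n (1 + (s - r))) N).
    * apply sum1_le. intros n Hn. apply taylor_term_variation; [lia|lra].
    * rewrite sum1_scal. apply Rmult_le_compat_l; [lra|]. apply sum1_pow_neg_le; lra.
Qed.

Lemma is_lim_seq_taylor_coef (al : nat -> R) (K s t ph : R) m : (forall n, Rabs (al n) <= K) -> 3 <= s ->
  is_lim_seq (fun N => taylor_coefN al s t ph N m) (taylor_coef al s t ph m).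
Proof.
intros Hal Hs. assert (HK : 0 <= K) by (eapply Rle_trans; [apply Rabs_pos|apply (Hal 0%nat)]).
apply (is_lim_seq_sum1_inf _ (fun n => K * pow_neg n (1 + 1)) (K * (1 + / 1))).
- intros n _. rewrite Rabs_mult.
  pose proof (taylor_term_bound s t ph m n 1 ltac:(lra)) as Hterm. rewrite pow1, Rmult_1_l in Hterm.
  pose proof (pow_neg_antitone n (1 + 1) (s - 1) ltac:(lra)).
  apply Rmult_le_compat; [apply Rabs_pos|apply Rabs_pos|apply Hal|lra].
- intros N. rewrite sum1_scal. apply Rmult_le_compat_l; [exact HK|]. apply sum1_pow_neg_le; lra.
Qed.

(* [dirichlet_sum al s t ph N] is the real part of [exp (-i ph) * sum_{n<=N} al(n) n^{-(s+it)}]. *)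
Definition dirichlet_sum (al : nat -> R) (s t ph : R) (N : nat) : R :=
  sum1 (fun n => al n * (pow_neg n s * cos (t * lg n + ph))) N.

Lemma taylor_term_quarter_turn s t ph m n :
  taylor_term s t (ph + PI / 2) m n = - (exp_taylor s m (lg n) * sin (t * lg n + ph)).
Proof.
unfold taylor_term. rewrite <- Rplus_assoc, cos_plus, cos_PI2, sin_PI2. ring.
Qed.

Lemma is_series_ext_R (a b : nat -> R) (l : R) : (forall n, a n = b n) -> is_series a l -> is_series b l.
Proof. intros H. apply (is_series_ext (V := R_NormedModule)). exact H. Qed.

Lemma is_series_plus_R (a b : nat -> R) (la lb : R) :
  is_series a la -> is_series b lb -> is_series (fun n => a n + b n) (la + lb).
Proof. apply (is_series_plus (V := R_NormedModule)). Qed.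

Lemma is_series_scal_R (c : R) (a : nat -> R) (l : R) : is_series a l -> is_series (fun n => c * a n) (c * l).
Proof. apply (is_series_scal (V := R_NormedModule)). Qed.

Lemma is_series_0 : is_series (fun _ : nat => 0) 0.
Proof.
apply (filterlim_ext (fun _ => 0)); [|apply filterlim_const].
intros n. rewrite sum_n_const. symmetry; apply Rmult_0_r.
Qed.

Lemma is_series_taylor_term s t ph n x th :
  is_series (fun m => rot (fun m => taylor_term s t ph m n) (fun m => taylor_term s t (ph + PI / 2) m n) th m * x ^ m)
    (pow_neg n (s + x * cos th) * cos ((t + x * sin th) * lg n + ph)).
Proof.
set (L := lg n). set (y := t * L + ph).
destruct (exp_polar_PSeries th (- L * x)) as [Hre Him].
assert (Hcos : is_series (fun m => exp_cos th m * (- L * x) ^ m) (PSeries (exp_cos th) (- L * x))).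
{ apply Series_correct, ex_series_Rabs, CV_disk_inside, CV_radius_over_fact. intros; apply Rabs_cos_le. }
assert (Hsin : is_series (fun m => exp_sin th m * (- L * x) ^ m) (PSeries (exp_sin th) (- L * x))).
{ apply Series_correct, ex_series_Rabs, CV_disk_inside, CV_radius_over_fact. intros; apply Rabs_sin_le. }
rewrite Hre in Hcos. rewrite Him in Hsin.
evar_last.
- apply (is_series_ext_R (fun m => (exp (- s * L) * cos y) * (exp_cos th m * (- L * x) ^ m) +
      (exp (- s * L) * sin y) * (exp_sin th m * (- L * x) ^ m))).
  + intros m. unfold rot. rewrite taylor_term_quarter_turn. unfold taylor_term, exp_taylor, exp_cos, exp_sin. fold L y.
    rewrite Rpow_mult_distr. unfold Rdiv. ring.
  + apply is_series_plus_R; apply is_series_scal_R; [exact Hcos|exact Hsin].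
- unfold pow_neg. fold L.
  replace (- (s + x * cos th) * L) with (- s * L + - L * x * cos th) by ring. rewrite exp_plus.
  replace ((t + x * sin th) * L + ph) with (y - - L * x * sin th) by (unfold y; ring).
  rewrite cos_minus. ring.
Qed.

Lemma dirichlet_sum_PSeries (al : nat -> R) (s t ph x th : R) N :
  PSeries (rot (taylor_coefN al s t ph N) (taylor_coefN al s t (ph + PI / 2) N) th) x
  = dirichlet_sum al (s + x * cos th) (t + x * sin th) ph N.
Proof.
unfold PSeries. apply is_series_unique. induction N as [|N IH].
- apply (is_series_ext_R (fun _ => 0)); [intros; unfold rot, taylor_coefN; simpl; ring|].
  apply is_series_0.
- unfold dirichlet_sum. simpl sum1. fold (dirichlet_sum al (s + x * cos th) (t + x * sin th) ph N).
  apply (is_series_ext_R (fun m => rot (taylor_coefN al s t ph N) (taylor_coefN al s t (ph + PI / 2) N) th m * x ^ m +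
     al (S N) * (rot (fun m => taylor_term s t ph m (S N)) (fun m => taylor_term s t (ph + PI / 2) m (S N)) th m * x ^ m))).
  + intros m. unfold rot, taylor_coefN. simpl sum1. ring.
  + apply is_series_plus_R; [exact IH|apply is_series_scal_R, is_series_taylor_term].
Qed.

(** * The von Mangoldt function *)

Module VonMangoldt.
Import structures ssreflect ssrfun ssrbool eqtype ssrnat seq div fintype bigop prime.
Local Open Scope nat_scope.

Lemma prime_natP (p : nat) : Znumtheory.prime (Z.of_nat p) <-> prime.prime p.
Proof.
split.
- move/prime_alt => [Hp1 Hdiv]. apply/primeP; split; first by apply/ltP; lia.
  move=> d /dvdnP[k]; rewrite -multE => Ek; rewrite /= .
  have Hd0 : d <> 0 by move=> E; lia.
  case: (Nat.eq_dec d 1) => [->|d1]; first by rewrite eqxx.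
  case: (Nat.eq_dec d p) => [->|dp]; first by rewrite eqxx orbT.
  exfalso; apply: (Hdiv (Z.of_nat d)).
  + have k0 : k <> 0 by move=> E; rewrite E in Ek; lia.
    nia.
+ by exists (Z.of_nat k); lia.
- move=> Hp; apply/prime_alt; split; first by move/prime_gt1/ltP: Hp; lia.
  move=> n Hn [k Ek].
  have Hd : Z.to_nat n %| p.
    apply/dvdnP; exists (Z.to_nat k); rewrite -multE.
    have : (0 <= k)%Z by nia.
    by move=> Hk; rewrite -Z2Nat.inj_mul; lia.
  case/primeP: Hp => _ /(_ _ Hd) /orP[/eqP E|/eqP E]; lia.
Qed.

Definition mangoldt (n : nat) : R := if primes n is [:: p] then lg p else 0%R.

Lemma mangoldt_prime (p : nat) : Znumtheory.prime (Z.of_nat p) -> mangoldt p = lg p.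
Proof. by move/prime_natP=> Hp; rewrite /mangoldt primes_prime. Qed.

Lemma mangoldt_prime_power (n : nat) : mangoldt n <> 0%R ->
  exists p k : nat, [/\ prime.prime p, 0 < k, n = p ^ k & mangoldt n = lg p].
Proof.
rewrite /mangoldt. case Eprimes: (primes n) => [|p [|q s]] // _.
have Hp : p \in primes n by rewrite Eprimes inE.
move: (Hp); rewrite mem_primes => /and3P[pp n0 pn].
exists p, (logn p n); split=> //; first by rewrite logn_gt0.
by rewrite {1}(prod_prime_decomp n0) prime_decompE Eprimes /= big_cons big_nil muln1.
Qed.

Lemma expn_pow (p k : nat) : p ^ k = Nat.pow p k.
Proof. by elim: k => [|k IH] //; rewrite expnS IH. Qed.

Lemma exists_prime_factor (n : nat) : (2 <= n)%coq_nat -> exists p m k : nat,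
  Znumtheory.prime (Z.of_nat p) /\ ~ Nat.divide p m /\ ((1 <= m)%coq_nat /\ (m < n)%coq_nat) /\
    n = (Nat.pow p (S k) * m)%coq_nat.
Proof.
move=> /leP n2; have n0 := ltnW n2; have pp := pdiv_prime n2.
have [m pm En] := pfactor_coprime pp n0; have k0 : 0 < logn (pdiv n) n by rewrite logn_gt0 pi_pdiv.
have P1 : 1 < pdiv n ^ logn (pdiv n) n by rewrite -{1}(exp1n (logn (pdiv n) n)) ltn_exp2r // prime_gt1.
have m0 : 0 < m by move: n0; rewrite En muln_gt0 => /andP[].
exists (pdiv n), m, (logn (pdiv n) n).-1; rewrite -expn_pow prednK // multE mulnC -En; split; first exact/prime_natP.
split; last by split=> //; split; apply/leP=> //; rewrite [X in _ < X]En ltn_Pmulr.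
by move: pm; rewrite prime_coprime // => /negP pm [u Eu]; apply: pm; apply/dvdnP; exists u.
Qed.

Lemma mangoldt_prime_power_nat (n : nat) : mangoldt n <> 0%R ->
  exists p k : nat, Znumtheory.prime (Z.of_nat p) /\ (1 <= k)%coq_nat /\ n = Nat.pow p k /\ mangoldt n = lg p.
Proof.
move/mangoldt_prime_power=> [p [k [pp k0 En Ev]]]; exists p, k.
split; first exact/prime_natP. split; first exact/leP. split=> //.
by rewrite En expn_pow.
Qed.

Lemma mangoldt_pow (p k : nat) : prime.prime p -> 0 < k -> mangoldt (p ^ k) = lg p.
Proof. by move=> Hp Hk; rewrite /mangoldt primesX // primes_prime. Qed.

Lemma mangoldt_nonneg (n : nat) : (0 <= mangoldt n)%R.
Proof. rewrite /mangoldt; case: (primes n) => [|p [|q s]]; try lra. exact: ln_INR_nonneg. Qed.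

Lemma mangoldt_le_ln (n : nat) : (mangoldt n <= lg n)%R.
Proof.
case: (Req_dec (mangoldt n) 0) => [->|/mangoldt_prime_power[p [k [pp k0 -> ->]]]]; first exact: ln_INR_nonneg.
apply: ln_le; first by apply: lt_0_INR; apply/ltP; exact: prime_gt0.
apply: le_INR; apply/leP. rewrite -{1}(expn1 p). by rewrite leq_exp2l ?prime_gt1.
Qed.

Lemma Rplus_0_l' : left_id 0%R Rplus. Proof. move=> x; exact: Rplus_0_l. Qed.
Lemma Rplus_assoc' : associative Rplus. Proof. move=> x y z; by rewrite Rplus_assoc. Qed.
HB.instance Definition _ := Monoid.isComLaw.Build R 0%R Rplus Rplus_assoc' Rplus_comm Rplus_0_l'.

Lemma sum1_bigop (f : nat -> R) (N : nat) : sum1 f N = \big[Rplus/0%R]_(1 <= i < N.+1) f i.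
Proof. by elim: N => [|N IH]; [rewrite big_geq|rewrite big_nat_recr //= -IH]. Qed.

Lemma mangoldt_divisor_bigop (n N : nat) : 0 < n <= N ->
  \big[Rplus/0%R]_(1 <= d < N.+1 | d %| n) mangoldt d = lg n.
Proof.
elim/ltn_ind: n => n IH /andP[n0 nN].
case: (ltngtP n 1) => [|n1|->]; first by case: n n0 {IH nN}.
2:{ rewrite big1_seq ?ln_1 //= => d; rewrite dvdn1 => /andP[/eqP-> _] //. }
move: (pdiv_prime n1) (pdiv_dvd n); move: (pdiv n) => p pp /dvdnP[m Em].
have m0 : 0 < m by move: n0; rewrite Em; case: (m).
have mn : m < n by rewrite Em -{1}(muln1 m) ltn_pmul2l ?prime_gt1.
have {}IH := IH m mn _. rewrite m0 /= in IH. have {}IH := IH (leq_trans (ltnW mn) nN).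
set k := logn p n.
have Ek : k = (logn p m).+1 by rewrite /k Em (lognM p m0 (prime_gt0 pp)) (pfactorK 1 pp) addn1.
have pkn : p ^ k %| n by rewrite pfactor_dvdn.
have pkm : ~~ (p ^ k %| m) by rewrite pfactor_dvdn // Ek -ltnNge.
rewrite (bigID (fun d => d %| m)) /=.
have -> : \big[Rplus/0%R]_(1 <= d < N.+1 | (d %| n) && (d %| m)) mangoldt d = lg m.
  rewrite -IH; apply: eq_bigl => d; case dm: (d %| m); rewrite ?andbF ?andbT //.
  by rewrite Em dvdn_mulr.
have -> : \big[Rplus/0%R]_(1 <= d < N.+1 | (d %| n) && ~~ (d %| m)) mangoldt d = lg p.
  have Hin : p ^ k \in index_iota 1 N.+1.
    by rewrite mem_index_iota expn_gt0 prime_gt0 //= ltnS (leq_trans (dvdn_leq n0 pkn) nN).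
  rewrite big_mkcond (bigD1_seq (p ^ k)) ?iota_uniq //=.
  rewrite pkn pkm /= mangoldt_pow ?Ek // big1 ?Rplus_0_r // => d dk.
  case: ifP => // /andP[dn dm].
  case: (Req_dec (mangoldt d) 0) => // /mangoldt_prime_power[q [j [qp j0 Ed _]]].
  exfalso; move: dn dm dk; rewrite -?Ek Ed.
  have [->|npq] := eqVneq q p.
  - rewrite !pfactor_dvdn // -/k Ek -ltnNge => jk kj.
    have -> : j = (logn p m).+1 by apply/eqP; rewrite eqn_leq jk kj.
      by rewrite eqxx.
  - rewrite Em Gauss_dvdl; first by move=> ->.
    rewrite coprimeXl // prime_coprime // dvdn_prime2 //.
by rewrite Em mult_INR ln_mult //; apply: lt_0_INR; apply/ltP => //; exact: prime_gt0.
Qed.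

Lemma dvdn_mod (d n : nat) : (d %| n) = Nat.eqb (Nat.modulo n d) 0.
Proof.
apply/idP/idP.
- move/dvdnP=> [k ->]. apply/PeanoNat.Nat.eqb_spec. case: d => [|d]; first by rewrite muln0.
  by rewrite -multE PeanoNat.Nat.Div0.mod_mul.
- move/PeanoNat.Nat.eqb_spec => nd. case: d nd => [|d] nd; first by move: nd => /= ->.
  apply/dvdnP. exists (Nat.div n d.+1). rewrite -multE.
  have := PeanoNat.Nat.div_mod_eq n d.+1. lia.
Qed.

Lemma mangoldt_divisor_sum (n N : nat) : (1 <= n)%coq_nat /\ (n <= N)%coq_nat ->
  sum1 (fun d => if Nat.eqb (Nat.modulo n d) 0 then mangoldt d else 0%R) N = lg n.
Proof.
move=> [/leP n0 /leP nN]. rewrite sum1_bigop -(@mangoldt_divisor_bigop n N) ?n0 //.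
rewrite [in RHS]big_mkcond. by apply: eq_bigr => d _; rewrite dvdn_mod.
Qed.

(* Multiplication by a unit [a] permutes the residues, so the period sum is [f a] times itself. *)
Lemma period_sum_zero (f : nat -> R) (q a : nat) : 0 < q ->
  (forall m n, f (m * n) = (f m * f n)%R) -> (forall n, f (n + q) = f n) ->
  coprime a q -> f a <> 1%R -> \big[Rplus/0%R]_(i < q) f i = 0%R.
Proof.
move=> q0 fM fP ca fa.
have fmod n : f (n %% q) = f n.
  rewrite {2}(divn_eq n q). elim: (n %/ q) => [|k IH]; first by rewrite mul0n add0n.
  by rewrite mulSn -addnA addnC fP.
have Hlt (i : 'I_q) : (a * i) %% q < q by rewrite ltn_mod.
pose h (i : 'I_q) := Ordinal (Hlt i).
have hinj : injective h.
  move=> i j /(congr1 val) /= /eqP Eaij. apply: val_inj => /=. apply/eqP.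
  rewrite -(modn_small (ltn_ord i)) -(modn_small (ltn_ord j)).
  move: Eaij; case: (leqP i j) => [le|/ltnW le].
  - rewrite eq_sym eqn_mod_dvd ?leq_mul2l ?le ?orbT // -mulnBr Gauss_dvdr 1?coprime_sym //.
      by rewrite [in X in _ -> X]eq_sym eqn_mod_dvd.
  - rewrite eqn_mod_dvd ?leq_mul2l ?le ?orbT // -mulnBr Gauss_dvdr 1?coprime_sym //.
      by rewrite eqn_mod_dvd.
have Efa : \big[Rplus/0%R]_(i < q) f i = (f a * \big[Rplus/0%R]_(i < q) f i)%R.
  rewrite {1}(reindex_inj hinj) /=.
  apply: (big_rec2 (fun x y => x = (f a * y)%R)); first by rewrite Rmult_0_r.
  by move=> i x y _ ->; rewrite /= fmod fM Rmult_plus_distr_l.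
nra.
Qed.

Lemma sum1_period_0 (f : nat -> R) (q a : nat) : (1 <= q)%coq_nat ->
  (forall m n, f (m * n)%coq_nat = (f m * f n)%R) -> (forall n, f (n + q)%coq_nat = f n) ->
  Nat.gcd a q = 1 -> f a <> 1%R -> sum1 f q = 0%R.
Proof.
move=> /leP q0 fM fP ca fa.
have ca' : coprime a q.
  rewrite /coprime; apply/eqP.
  case/dvdnP: (dvdn_gcdl a q) => u Eu. case/dvdnP: (dvdn_gcdr a q) => v Ev.
  have : Nat.divide (gcdn a q) (Nat.gcd a q).
    apply: PeanoNat.Nat.gcd_greatest; [exists u|exists v]; rewrite multE; assumption.
  rewrite ca => /PeanoNat.Nat.divide_1_r //.
rewrite sum1_bigop. transitivity (\big[Rplus/0%R]_(i < q) f i); last exact: (@period_sum_zero f q a).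
rewrite -(big_mkord xpredT f) /=.
case: q q0 fP {ca ca'} => // q _ fP.
rewrite [RHS]big_nat_recl // [LHS]big_nat_recr //= Rplus_comm.
have -> : f q.+1 = f 0 by rewrite -(fP 0).
by congr Rplus; rewrite big_add1.
Qed.

End VonMangoldt.
Import VonMangoldt.

(** * Quadratic reciprocity *)

Module QuadraticReciprocity.
Import structures all_boot all_order all_algebra all_fingroup all_solvable all_field.
Import GRing.Theory.
Local Open Scope ring_scope.

Lemma modulo_modn (n p : nat) : Nat.modulo n p = (n %% p)%N.
Proof.
case: p => [|p]; first by rewrite modn0.
symmetry; apply: (PeanoNat.Nat.mod_unique _ _ (n %/ p.+1)%N).
- by apply/ltP; rewrite ltn_mod.
- by rewrite multE plusE mulnC -divn_eq.
Qed.

Section FiniteFieldRoots.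
Variable (K : finFieldType).

Lemma finField_prim_root : exists z : K, (#|K|.-1).-primitive_root z.
Proof.
have K1 : (0 < #|K|.-1)%N by rewrite -subn1 subn_gt0 finNzRing_gt1.
have := @has_prim_root K #|K|.-1 [seq x <- enum K | x != 0] K1.
case/(_ _ _ _)/hasP; last by move=> z _ Hz; exists z.
- apply/allP=> x; rewrite mem_filter => /andP[x0 _].
  rewrite unity_rootE. apply/eqP. apply: (mulfI x0).
  by rewrite -exprS prednK ?mulr1 ?expf_card // (leq_trans _ (finNzRing_gt1 K)).
  - by rewrite filter_uniq ?enum_uniq.
- rewrite size_filter. have := count_predC (fun x : K => x == 0) (enum K).
  rewrite -cardE. have -> : count (fun x : K => x == 0) (enum K) = 1%N.
    have := count_uniq_mem 0 (enum_uniq K). by rewrite mem_enum.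
  by move=> <-; rewrite add1n /= .
Qed.
End FiniteFieldRoots.

Section Legendre.
Variable (p : nat).
Hypothesis (pp : prime.prime p).
Hypothesis (podd : odd p).

Let F := 'F_p.

Lemma pchar_odd_one_neq_opp (K : fieldType) : p \in [pchar K] -> (1 : K) != -1.
Proof.
move=> ch; rewrite -subr_eq0 opprK -mulr2n -(dvdn_pcharf ch).
apply/negP=> /dvdn_leq => /(_ isT).
case: p pp podd => [|[|[|n]]] //.
Qed.

Lemma pred_half_double : p.-1 = (p.-1./2 * 2)%N.
Proof. rewrite muln2. case: p pp podd => // n _ /= H. by rewrite even_halfK //; move: H; case: (odd n). Qed.

Lemma euler_criterion_Fp (a : F) : a != 0 -> a ^+ (p.-1./2) = if [exists x : F, x ^+ 2 == a] then 1 else -1.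
Proof.
move=> a0. set h := p.-1./2.
have h0 : (0 < h)%N by rewrite /h; case: p pp podd => [|[|[|n]]] //.
have [z] := finField_prim_root F. rewrite card_Fp // => Hz.
have Fermat (x : F) : x != 0 -> x ^+ p.-1 = 1.
  move=> x0; apply: (mulfI x0). rewrite -exprS prednK ?prime_gt0 // mulr1.
  by have := expf_card x; rewrite card_Fp.
have Hzh : z ^+ h = -1.
  have : (z ^+ h) ^+ 2 == 1 by rewrite -exprM -pred_half_double (prim_expr_order Hz).
  rewrite sqrf_eq1 => /orP[|/eqP //].
  rewrite -(prim_order_dvd Hz) => /dvdn_leq => /(_ h0).
  rewrite {1}pred_half_double -/h -{2}(muln1 h) leq_pmul2l //.
have [i Ei] := prim_rootP Hz (Fermat a a0).
have Ha : a ^+ h = (-1) ^+ i by rewrite Ei -exprM mulnC exprM Hzh.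
case: ifP => [/existsP[x /eqP Ex]|/existsP Hn].
- rewrite -Ex -exprM mulnC -pred_half_double Fermat //.
  by apply: contraNneq a0 => x0; rewrite -Ex x0 expr0n.
- rewrite Ha -signr_odd. case iodd: (odd i) => //=. exfalso; apply: Hn.
  exists (z ^+ i./2). by rewrite Ei -exprM muln2 even_halfK ?iodd.
Qed.

Lemma legendreE (n : nat) :
  legendre p n = if (p %| n)%N then Z0 else if [exists x : F, x ^+ 2 == n%:R] then (Zpos xH) else (Zneg xH).
Proof.
rewrite /legendre !modulo_modn.
have -> : Nat.eqb (n %% p) 0 = (p %| n)%N by rewrite /dvdn; apply/PeanoNat.Nat.eqb_spec/eqP.
case: ifP => // _. 
suff -> : List.existsb (fun x => Nat.eqb (Nat.modulo (x * x)%coq_nat p) (n %% p)) (List.seq 0 p) =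
  [exists x : F, x ^+ 2 == n%:R] by [].
apply/idP/existsP.
- move/List.existsb_exists => [x [_ /PeanoNat.Nat.eqb_spec]]. rewrite modulo_modn multE => Exx.
  exists x%:R. apply/eqP. rewrite -natrX -mulnn.
  by rewrite -(Fp_nat_mod pp (x * x)) Exx Fp_nat_mod.
- move=> [x /eqP Ex]. apply/List.existsb_exists. exists (nat_of_ord x). split.
  + apply/List.in_seq. split; first by apply/leP.
    apply/ltP. change (0 + p)%coq_nat with p. apply: (leq_trans (ltn_ord x)). by rewrite (Fp_cast pp).
  + apply/PeanoNat.Nat.eqb_spec. rewrite modulo_modn multE mulnn.
    have := congr1 (@nat_of_ord _) Ex. rewrite val_Fp_nat // => <-.
    by rewrite -val_Fp_nat // natrX natr_Zp.
Qed.

Definition sign_in (K : nzRingType) (z : Z) : K := match z with Z0 => 0 | Zpos _ => 1 | Zneg _ => -1 end.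

Lemma legendre_cases (n : nat) : [\/ legendre p n = Z0, legendre p n = (Zpos xH) | legendre p n = (Zneg xH)].
Proof. rewrite legendreE; case: ifP => _; [exact: Or31|]. case: ifP => _; [exact: Or32|exact: Or33]. Qed.

Lemma euler_criterion (n : nat) : (n%:R : F) ^+ (p.-1./2) = sign_in F (legendre p n).
Proof.
rewrite legendreE. case: ifP => pn.
- have -> : (n%:R : F) = 0 by apply/eqP; rewrite -(dvdn_pcharf (pchar_Fp pp)).
  rewrite expr0n /=. case: p pp podd => [|[|[|m]]] //.
- rewrite euler_criterion_Fp; last by rewrite -(dvdn_pcharf (pchar_Fp pp)) pn.
  by case: ifP.
Qed.

Lemma sign_in_inj (K : fieldType) (y z : Z) : p \in [pchar K] ->
  [\/ y = Z0, y = (Zpos xH) | y = (Zneg xH)] -> [\/ z = Z0, z = (Zpos xH) | z = (Zneg xH)] ->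
  sign_in K y = sign_in K z -> y = z.
Proof.
move=> ch; have ne_opp := pchar_odd_one_neq_opp K ch; have ne_0 := oner_neq0 K.
case=> ->; case=> -> //= /eqP; rewrite ?oppr_eq0 ?(eq_sym 0) ?oppr_eq0 ?(negbTE ne_0) ?(negbTE ne_opp) // eq_sym
  (negbTE ne_opp) //.
Qed.

Lemma sign_inM (K : nzRingType) (y z : Z) : sign_in K (Z.mul y z) = sign_in K y * sign_in K z.
Proof. case: y => [|y|y]; case: z => [|z|z] /=; rewrite ?mulr0 ?mul0r ?mulr1 ?mul1r ?mulrNN ?mulr1 //. Qed.

Lemma legendre_mul (m n : nat) : legendre p (m * n)%coq_nat = Z.mul (legendre p m) (legendre p n).
Proof.
apply: (@sign_in_inj F _ _ (pchar_Fp pp)).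
- exact: legendre_cases.
- by case: (legendre_cases m) => ->; case: (legendre_cases n) => ->;
    [apply: Or31|apply: Or31|apply: Or31|apply: Or31|apply: Or32|apply: Or33|apply: Or31|apply: Or33|apply: Or32].
- by rewrite sign_inM -!euler_criterion multE natrM exprMn.
Qed.

Lemma legendre_nonresidue : exists n : nat, legendre p n = (Zneg xH).
Proof.
have [z] := finField_prim_root F. rewrite card_Fp // => Hz.
exists (nat_of_ord z). apply: (@sign_in_inj F _ _ (pchar_Fp pp)); first exact: legendre_cases.
- exact: Or33.
rewrite -euler_criterion natr_Zp /=.
have h0 : (0 < p.-1./2)%N by case: p pp podd => [|[|[|n]]] //.
have : (z ^+ p.-1./2) ^+ 2 == 1 by rewrite -exprM -pred_half_double (prim_expr_order Hz).
rewrite sqrf_eq1 => /orP[|/eqP //].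
rewrite -(prim_order_dvd Hz) => /dvdn_leq => /(_ h0).
by rewrite {1}pred_half_double -{2}(muln1 (p.-1./2)) leq_pmul2l.
Qed.

End Legendre.

Section Reciprocity.
Variables (p q : nat).
Hypotheses (pp : prime.prime p) (podd : odd p) (qp : prime.prime q) (qodd : odd q) (npq : p != q).

Lemma exists_field_with_root : exists (K : finFieldType) (w : K), p \in [pchar K] /\ q.-primitive_root w.
Proof.
have q0 : (0 < q.-1)%N by case: q qp => [|[|n]].
have [K ch cK] := pPrimePowerField pp q0.
have [z Hz] := finField_prim_root K.
have dq : (q %| #|K|.-1)%N.
  rewrite cK -subn1 -eqn_mod_dvd ?expn_gt0 ?prime_gt0 //.
  have cpq : coprime p q by rewrite prime_coprime // dvdn_prime2.
  by have := Euler_exp_totient cpq; rewrite totient_prime // => ->.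
exists K, (z ^+ (#|K|.-1 %/ q)); split=> //.
have := exp_prim_root Hz (#|K|.-1 %/ q).
have K1 : (0 < #|K|.-1)%N by rewrite -subn1 subn_gt0 finNzRing_gt1.
have [m Em] := dvdnP dq. have m0 : (0 < m)%N by move: K1; rewrite Em; case: (m).
by rewrite Em mulnK ?prime_gt0 // (gcdn_idPl (dvdn_mulr _ (dvdnn m))) mulKn.
Qed.

Section Gauss.
Variables (K : finFieldType) (w : K).
Hypotheses (ch : p \in [pchar K]) (Hw : q.-primitive_root w).

Let symb (a : 'F_q) : K := sign_in K (legendre q (nat_of_ord a)).

Lemma symb_nat (n : nat) : symb (n%:R) = sign_in K (legendre q n).
Proof.
rewrite /symb. congr sign_in. rewrite !legendreE // val_Fp_nat //.
have -> : (q %| n %% q)%N = (q %| n)%N by rewrite /dvdn modn_mod.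
by case: ifP => // _; rewrite Fp_nat_mod.
Qed.

Lemma symb_0 : symb 0 = 0. Proof. by rewrite -[0 : 'F_q]/(0%:R) symb_nat legendreE // dvdn0. Qed.

Lemma symbM (a b : 'F_q) : symb (a * b) = symb a * symb b.
Proof. by rewrite -(natr_Zp a) -(natr_Zp b) -natrM !symb_nat -multE legendre_mul // sign_inM. Qed.

Lemma symb_sq (a : 'F_q) : a != 0 -> symb a * symb a = 1.
Proof.
move=> a0. rewrite /symb legendreE //.
have -> : (q %| a)%N = false.
  apply/negbTE. by rewrite (dvdn_pcharf (pchar_Fp qp)) natr_Zp.
by case: ifP => _ /=; rewrite ?mulr1 ?mulrNN ?mulr1.
Qed.

Lemma symb_frobenius (a : 'F_q) : symb a ^+ p = symb a.
Proof.
rewrite /symb; case: (legendre q a) => [|u|u] /=; first by rewrite expr0n; case: p pp.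
- by rewrite expr1n.
- by rewrite -signr_odd podd expr1.
Qed.

Definition root_pow (a : 'F_q) : K := w ^+ (nat_of_ord a).
Arguments root_pow : simpl never.

Lemma root_pow0 : root_pow 0 = 1. Proof. by rewrite /root_pow expr0. Qed.

Lemma root_pow_nat (n : nat) : root_pow (n%:R) = w ^+ n.
Proof. by rewrite /root_pow val_Fp_nat // prim_expr_mod. Qed.

Lemma root_powD (a b : 'F_q) : root_pow (a + b) = root_pow a * root_pow b.
Proof. by rewrite {2 3}/root_pow -exprD -[in RHS]root_pow_nat natrD !natr_Zp. Qed.

Lemma sum_root_pow (d : 'F_q) : \sum_(a : 'F_q) root_pow (a * d) = if d == 0 then q%:R else 0.
Proof.
case: eqVneq => [->|d0].
  under eq_bigr do rewrite mulr0 root_pow0. by rewrite sumr_const card_Fp.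
set S := \sum_(a : 'F_q) _.
have S_rotated : S = w * S.
  rewrite /S [LHS](reindex_inj (addrI d^-1)) /= [RHS]mulr_sumr; apply: eq_bigr => a _.
  rewrite mulrDl mulVf // root_powD. congr (_ * _).
have w1 : w != 1.
  apply/negP=> /eqP w_eq1. have := prim_order_dvd Hw 1. rewrite w_eq1 expr1n eqxx dvdn1.
  by case: q qp => [|[|n]].
apply/eqP. have : (1 - w) * S == 0 by rewrite mulrBl mul1r -S_rotated subrr.
by rewrite mulf_eq0 subr_eq0 eq_sym (negbTE w1).
Qed.

Lemma sum_symb : \sum_(a : 'F_q) symb a = 0.
Proof.
have [n Hn] := legendre_nonresidue q qp qodd.
have n0 : (n%:R : 'F_q) != 0.
  rewrite -(dvdn_pcharf (pchar_Fp qp)). apply/negP=> qn. by move: Hn; rewrite legendreE // qn.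
set S := \sum_(a : 'F_q) _.
have S_opp : S = - S.
  rewrite /S [LHS](reindex_inj (mulfI n0)) /= -[RHS]sumrN; apply: eq_bigr => a _.
  by rewrite symbM symb_nat Hn /= mulN1r.
have ne_opp := pchar_odd_one_neq_opp p pp podd K ch.
apply/eqP. have : S *+ 2 == 0 by rewrite mulr2n {1}S_opp addNr.
rewrite -mulr_natl mulf_eq0 => /orP[|//].
by rewrite -[2%:R]/(1 + 1) addr_eq0 (negbTE ne_opp).
Qed.

Definition gauss_sum := \sum_(a : 'F_q) symb a * root_pow a.

Lemma gauss_sum_sq : gauss_sum ^+ 2 = symb (-1) * q%:R.
Proof.
rewrite expr2 {1}/gauss_sum mulr_suml.
have row (a : 'F_q) : symb a * root_pow a * gauss_sum =
    \sum_(c : 'F_q) (if a == 0 then 0 else symb c * root_pow (a * (1 + c))).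
  case: (eqVneq a 0) => [->|a0]; first by rewrite symb_0 !mul0r big1.
  rewrite /gauss_sum (reindex_inj (mulfI a0)) /= mulr_sumr; apply: eq_bigr => c _.
  rewrite symbM mulrDr mulr1 root_powD mulrACA. congr (_ * _). by rewrite mulrA symb_sq // mul1r.
under eq_bigr do rewrite row.
rewrite exchange_big /=.
have column (c : 'F_q) : \sum_(a : 'F_q) (if a == 0 then 0 else symb c * root_pow (a * (1 + c))) =
    symb c * (if 1 + c == 0 then q%:R else 0) - symb c.
  rewrite -sum_root_pow [in LHS](bigD1 (0 : 'F_q)) //= [in RHS](bigD1 (0 : 'F_q)) //= ?eqxx add0r mul0r root_pow0.
  rewrite mulrDr mulr1 addrAC subrr add0r mulr_sumr; apply: eq_bigr => a /negbTE -> //.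
under eq_bigr do rewrite column.
rewrite sumrB sum_symb subr0 (bigD1 (-1)) //= subrr eqxx big1 ?addr0 // => c Hc.
by rewrite addrC addr_eq0 (negbTE Hc) mulr0.
Qed.

Lemma gauss_sum_frobenius : gauss_sum ^+ p = symb p%:R * gauss_sum.
Proof.
rewrite -(pFrobenius_autE ch) /gauss_sum rmorph_sum /= mulr_sumr.
have p0 : (p%:R : 'F_q) != 0 by rewrite -(dvdn_pcharf (pchar_Fp qp)) dvdn_prime2 // eq_sym.
rewrite [in RHS](reindex_inj (mulfI p0)) /=. apply: eq_bigr => a _.
rewrite symbM mulrA mulrA symb_sq // mul1r rmorphM /= !pFrobenius_autE symb_frobenius. congr (_ * _).
by rewrite /root_pow -exprM -/(root_pow (p%:R * a)) -[in RHS](natr_Zp a) -natrM root_pow_nat mulnC.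
Qed.

Lemma reciprocity_in_K : sign_in K (legendre q p) = (symb (-1)) ^+ (p.-1./2) * sign_in K (legendre p q).
Proof.
have q0 : (q%:R : K) != 0 by rewrite -(dvdn_pcharf ch) dvdn_prime2.
have symb_neg1 : symb (-1) != 0.
  have : symb (-1) * symb (-1) = 1 by apply: symb_sq; rewrite oppr_eq0 oner_neq0.
  by move=> sq; apply/eqP => E0; move: sq; rewrite E0 mul0r => /eqP; rewrite eq_sym oner_eq0.
have gauss_neq0 : gauss_sum != 0.
  apply/eqP=> E0. have := gauss_sum_sq. rewrite E0 expr0n /= => /eqP.
  by rewrite eq_sym mulf_eq0 (negbTE symb_neg1) (negbTE q0).
have gauss_pow : gauss_sum ^+ p.-1 = symb p%:R.
  apply: (mulIf gauss_neq0). by rewrite -exprSr prednK ?prime_gt0 // gauss_sum_frobenius.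
rewrite -symb_nat -gauss_pow {1}(pred_half_double p pp podd) mulnC exprM gauss_sum_sq exprMn. congr (_ * _).
have transfer (m n : nat) : (m%:R : 'F_p) = n%:R -> (m%:R : K) = n%:R.
  move=> /(congr1 (@nat_of_ord _)). rewrite !val_Fp_nat // => Emod.
  by rewrite -(GRing.natr_mod_pchar ch m) Emod GRing.natr_mod_pchar.
have := euler_criterion p pp podd q; rewrite -!natrX.
case: (legendre_cases p pp q) => -> /= Euler.
- by rewrite (transfer _ 0%N Euler).
- by rewrite (transfer _ 1%N Euler).
- apply/eqP. rewrite -subr_eq0 opprK. apply/eqP.
  have := transfer (q ^ p.-1./2 + 1)%N 0%N. rewrite !natrD => -> //. by rewrite Euler addNr.
Qed.

End Gauss.

Lemma legendre_neg1 (K : nzRingType) : sign_in K (legendre q (nat_of_ord (-1 : 'F_q))) = (-1) ^+ (q.-1./2).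
Proof.
have Epred : (q.-1%:R : 'F_q) = -1.
  apply/eqP. rewrite -addr_eq0 -[1 : 'F_q]/(1%:R) -natrD addn1 prednK ?prime_gt0 //.
  by rewrite -(dvdn_pcharf (pchar_Fp qp)).
have -> : nat_of_ord (-1 : 'F_q) = q.-1.
  by rewrite -Epred val_Fp_nat // modn_small // prednK ?prime_gt0.
have Euler := euler_criterion q qp qodd q.-1; rewrite Epred -signr_odd in Euler.
rewrite -signr_odd; move: Euler.
have ne_opp := pchar_odd_one_neq_opp q qp qodd 'F_q (pchar_Fp qp).
case: (legendre_cases q qp q.-1) => ->; case: (odd _) => //= /eqP.
- by rewrite expr1 oppr_eq0 (negbTE (oner_neq0 _)).
- by rewrite expr1 eq_sym (negbTE ne_opp).
- by rewrite expr0 (negbTE ne_opp).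
Qed.

Lemma odd_half_pred (m : nat) : odd m -> odd (m.-1./2) = (m %% 4 == 3)%N.
Proof.
move=> om. rewrite {1}(divn_eq m 4). have : (m %% 4 < 4)%N by rewrite ltn_mod.
have : odd (m %% 4) by rewrite odd_mod.
case: (m %% 4)%N => [|[|[|[|]]]] // _ _.
- by rewrite addn1 /= -[4%N]/(2 * 2)%N mulnA muln2 doubleK muln2 odd_double.
- by rewrite addn3 /= -[4%N]/(2 * 2)%N mulnA muln2 doubleK muln2 /= odd_double.
Qed.

Lemma quadratic_reciprocity :
  legendre q p = if (p %% 4 == 3)%N && (q %% 4 == 3)%N then Z.opp (legendre p q) else legendre p q.
Proof.
have [K [w [ch Hw]]] := exists_field_with_root.
have := reciprocity_in_K K w ch Hw.
rewrite legendre_neg1 -exprM -signr_odd oddM (odd_half_pred p podd) (odd_half_pred q qodd) andbC => Erecip.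
have legendre_pq := legendre_cases p pp q.
apply: (sign_in_inj p pp podd K _ _ ch).
- exact: legendre_cases.
- by case: ifP => _ //; case: legendre_pq => -> /=; [apply: Or31|apply: Or33|apply: Or32].
- rewrite Erecip. case: ifP => _ /=; last by rewrite mul1r.
  by case: (legendre p q) => [|u|u] /=; rewrite ?mulr0 ?mulN1r ?opprK ?oppr0.
Qed.

End Reciprocity.

Lemma quadratic_reciprocity_nat (p q : nat) :
  prime.prime p -> odd p -> prime.prime q -> odd q -> p <> q ->
  legendre q p = if Nat.eqb (Nat.modulo p 4) 3 && Nat.eqb (Nat.modulo q 4) 3
    then Z.opp (legendre p q) else legendre p q.
Proof.
move=> pp po qp qo /eqP npq.
have eqbE (a b : nat) : Nat.eqb a b = (a == b) by apply/PeanoNat.Nat.eqb_spec/eqP.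
by rewrite !modulo_modn !eqbE quadratic_reciprocity.
Qed.

End QuadraticReciprocity.
Import QuadraticReciprocity.

(** * Real characters *)

Definition odd_prime (p : nat) : Prop := prime (Z.of_nat p) /\ (2 < p)%nat.

Record real_char (q : nat) (ch : nat -> R) : Prop := {
  real_char_modulus : (1 <= q)%nat;
  real_char_mul : forall m n, ch (m * n)%nat = ch m * ch n;
  real_char_period : forall n, ch (n + q)%nat = ch n;
  real_char_values : forall n, ch n = -1 \/ ch n = 0 \/ ch n = 1;
  real_char_neq_0 : forall n, ch n <> 0 <-> Nat.gcd n q = 1%nat;
  real_char_nonprincipal : exists n, ch n = -1
}.

Lemma real_char_dirichlet_char q ch : real_char q ch ->
  dirichlet_char q (fun n => RtoC (ch n)) /\ nonprincipal (fun n => RtoC (ch n)).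
Proof.
intros [Hq Hmul Hper _ Hneq (n & Hn)]. split.
- split; [exact Hq|split; [|split]].
  + intros a b. rewrite Hmul, RtoC_mult. reflexivity.
  + intros a. rewrite Hper. reflexivity.
  + intros a. rewrite <- Hneq. split; intros Ha Ha0; apply Ha.
    * rewrite Ha0; reflexivity.
    * apply (f_equal Re) in Ha0. exact Ha0.
- exists n. rewrite Hn. split; intros Hval; apply (f_equal Re) in Hval; simpl in Hval; lra.
Qed.

Lemma real_char_abs q ch n : real_char q ch -> Rabs (ch n) <= 1.
Proof.
intros Hch. destruct (real_char_values q ch Hch n) as [->|[->| ->]];
[rewrite Rabs_left; lra|rewrite Rabs_R0; lra|rewrite Rabs_R1; lra].
Qed.

Lemma real_char_1 q ch : real_char q ch -> ch 1%nat = 1.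
Proof.
intros Hch. pose proof (real_char_mul q ch Hch 1 1) as Hmul. simpl in Hmul.
assert (ch 1%nat <> 0) by (apply (real_char_neq_0 q ch Hch); apply Nat.divide_1_r, Nat.gcd_divide_l). nra.
Qed.

Lemma real_char_sum_bound q ch N : real_char q ch -> Rabs (sum1 ch N) <= INR q.
Proof.
intros Hch. pose proof Hch as [Hq Hmul Hper _ Hneq (a & Ha)].
assert (Hzero : sum1 ch q = 0).
{ apply (sum1_period_0 ch q a); [exact Hq|exact Hmul|exact Hper| |rewrite Ha; lra].
  apply Hneq. rewrite Ha; lra. }
assert (Hshift : forall M, sum1 ch (q + M) = sum1 ch M).
{ intros M. induction M as [|M IH]; [rewrite Nat.add_0_r; exact Hzero|].
  rewrite Nat.add_succ_r. simpl sum1. rewrite IH. f_equal.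
  replace (S (q + M)) with (S M + q)%nat by lia. apply Hper. }
assert (Hshifts : forall k M, sum1 ch (k * q + M) = sum1 ch M).
{ induction k as [|k IH]; intros M; [reflexivity|].
  replace (S k * q + M)%nat with (q + (k * q + M))%nat by lia. rewrite Hshift. apply IH. }
rewrite (Nat.div_mod_eq N q), Nat.mul_comm, Hshifts.
assert (Hmod : (N mod q < q)%nat) by (apply Nat.mod_upper_bound; lia).
eapply Rle_trans; [apply (Rabs_sum1_le _ (fun _ => 1)); intros; eapply real_char_abs; exact Hch|].
rewrite sum1_const, Rmult_1_r. apply le_INR. lia.
Qed.

Lemma odd_prime_ssrnat p : odd_prime p -> is_true (prime.prime p) /\ is_true (ssrnat.odd p).
Proof.
intros [Hp H2]. apply prime_natP in Hp. split; [exact Hp|].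
destruct (prime.even_prime Hp) as [Htwo|Hodd]; [lia|exact Hodd].
Qed.

Lemma legendre_multiplicative p m n : odd_prime p -> legendre p (m * n) = (legendre p m * legendre p n)%Z.
Proof. intros H. destruct (odd_prime_ssrnat p H) as [Hp Hodd]. apply legendre_mul; assumption. Qed.

Lemma legendre_values p n : legendre p n = (-1)%Z \/ legendre p n = 0%Z \/ legendre p n = 1%Z.
Proof. unfold legendre. destruct (Nat.eqb _ _); [tauto|]. destruct (existsb _ _); tauto. Qed.

Lemma legendre_mod p m n : (m mod p = n mod p)%nat -> legendre p m = legendre p n.
Proof. intros H. unfold legendre. rewrite H. reflexivity. Qed.

Lemma legendre_period p n : legendre p (n + p) = legendre p n.
Proof.
apply legendre_mod. destruct p as [|p]; [rewrite Nat.add_0_r; reflexivity|].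
rewrite <- (Nat.mul_1_l (S p)) at 1. rewrite Nat.Div0.mod_add. reflexivity.
Qed.

Lemma legendre_1 p : odd_prime p -> legendre p 1 = 1%Z.
Proof.
intros [_ H]. unfold legendre. rewrite (Nat.mod_small 1 p) by lia. simpl Nat.eqb. cbv iota.
replace (existsb _ _) with true; [reflexivity|]. symmetry. apply existsb_exists.
exists 1%nat. split; [apply in_seq; lia|]. rewrite Nat.mod_small by (simpl; lia). reflexivity.
Qed.

Lemma legendre_eq_0 p n : odd_prime p -> legendre p n = 0%Z <-> Nat.divide p n.
Proof.
intros [_ H]. unfold legendre. destruct (Nat.eqb_spec (n mod p) 0) as [Hmod|Hmod].
- split; [intros _; apply Nat.Lcm0.mod_divide; exact Hmod|reflexivity].
- split; [destruct (existsb _ _); discriminate|]. intros Hdiv. exfalso. apply Hmod. apply Nat.Lcm0.mod_divide; exact Hdiv.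
Qed.

Lemma exists_nonresidue p : odd_prime p -> exists n, legendre p n = (-1)%Z.
Proof. intros H. destruct (odd_prime_ssrnat p H) as [Hp Hodd]. apply legendre_nonresidue; assumption. Qed.

Lemma legendre_reciprocity p q : odd_prime p -> odd_prime q -> p <> q ->
  legendre q p = if (Nat.eqb (p mod 4) 3 && Nat.eqb (q mod 4) 3)%bool then (- legendre p q)%Z else legendre p q.
Proof.
intros Hp Hq Hpq. destruct (odd_prime_ssrnat p Hp). destruct (odd_prime_ssrnat q Hq).
apply quadratic_reciprocity_nat; assumption.
Qed.

Lemma prime_not_divide_gcd q n : prime (Z.of_nat q) -> ~ Nat.divide q n <-> Nat.gcd n q = 1%nat.
Proof.
intros Hq. pose proof (prime_ge_2 _ Hq). split; intros Hgcd.
- pose proof (Nat.gcd_divide_l n q) as Hn. destruct (Nat.gcd_divide_r n q) as [k Hk].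
  set (g := Nat.gcd n q) in *.
  assert (Hg : (Z.of_nat g | Z.of_nat q)%Z) by (exists (Z.of_nat k); lia).
  apply prime_divisors in Hg; [|exact Hq].
  destruct Hg as [Hg|[Hg|[Hg|Hg]]]; try lia. replace g with q in Hn by lia. contradiction.
- intros Hn. pose proof (Nat.gcd_greatest n q q Hn (Nat.divide_refl q)) as Hone.
  rewrite Hgcd in Hone. apply Nat.divide_1_r in Hone. lia.
Qed.

Lemma gcd_mult_eq_1 n a b : Nat.gcd n (a * b) = 1%nat <-> Nat.gcd n a = 1%nat /\ Nat.gcd n b = 1%nat.
Proof.
split.
- intros H. split; apply Nat.divide_1_r; rewrite <- H; apply Nat.gcd_greatest; try apply Nat.gcd_divide_l;
    (eapply Nat.divide_trans; [apply Nat.gcd_divide_r|]); [exists b|exists a]; lia.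
- intros [Ha Hb]. set (g := Nat.gcd n (a * b)).
  assert (Hgn : Nat.divide g n) by apply Nat.gcd_divide_l.
  assert (Hgab : Nat.divide g (a * b)) by apply Nat.gcd_divide_r.
  apply Nat.gauss in Hgab.
  + apply Nat.divide_1_r. rewrite <- Hb. apply Nat.gcd_greatest; assumption.
  + apply Nat.divide_1_r. rewrite <- Ha. apply Nat.gcd_greatest; [|apply Nat.gcd_divide_r].
    eapply Nat.divide_trans; [apply Nat.gcd_divide_l|exact Hgn].
Qed.

(* Quadratic character modulo 4 twisting [legendre q] into the symbol [(q / p)] as a function of [p]. *)
Definition twist4 (q n : nat) : Z :=
  match (n mod 4)%nat with
  | 1%nat => 1%Z
  | 3%nat => if Nat.eqb (q mod 4) 3 then (-1)%Z else 1%Z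
  | _ => 0%Z
  end.

Lemma twist4_mult q m n : twist4 q (m * n) = (twist4 q m * twist4 q n)%Z.
Proof.
unfold twist4. rewrite Nat.Div0.mul_mod.
assert (Hm : (m mod 4 < 4)%nat) by (apply Nat.mod_upper_bound; lia).
assert (Hn : (n mod 4 < 4)%nat) by (apply Nat.mod_upper_bound; lia).
destruct (m mod 4)%nat as [|[|[|[|]]]]; destruct (n mod 4)%nat as [|[|[|[|]]]]; try lia;
destruct (Nat.eqb (q mod 4) 3); reflexivity.
Qed.

Lemma twist4_values q n : twist4 q n = (-1)%Z \/ twist4 q n = 0%Z \/ twist4 q n = 1%Z.
Proof.
unfold twist4. destruct (n mod 4) as [|[|[|[|]]]]; try tauto. destruct (Nat.eqb (q mod 4) 3); tauto.
Qed.

Lemma twist4_zero q n : twist4 q n <> 0%Z <-> Nat.gcd n 4 = 1%nat.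
Proof.
unfold twist4. rewrite Nat.gcd_comm, <- Nat.Lcm0.gcd_mod, Nat.gcd_comm.
assert (Hn : (n mod 4 < 4)%nat) by (apply Nat.mod_upper_bound; lia).
destruct (n mod 4) as [|[|[|[|]]]]; try lia; destruct (Nat.eqb (q mod 4) 3);
split; intros H; first [reflexivity | exfalso; apply H; reflexivity | vm_compute in H; discriminate H | discriminate].
Qed.

Definition recip_legendre (q n : nat) : Z := (legendre q n * twist4 q n)%Z.
Definition recip_symbol (I : list nat) (n : nat) : Z := fold_right (fun q z => recip_legendre q n * z)%Z 1%Z I.
Definition list_product (I : list nat) : nat := fold_right Nat.mul 1%nat I.

Lemma recip_symbol_mult I m n : List.Forall odd_prime I -> recip_symbol I (m * n) = (recip_symbol I m * recip_symbol I n)%Z.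
Proof.
induction 1 as [|q I Hq HI IH]; [reflexivity|]. simpl. rewrite IH. unfold recip_legendre.
rewrite legendre_multiplicative, twist4_mult by exact Hq. ring.
Qed.

Lemma twist4_period q n k : twist4 q (n + 4 * k) = twist4 q n.
Proof. unfold twist4. rewrite (Nat.mul_comm 4), Nat.Div0.mod_add. reflexivity. Qed.

Lemma legendre_period_mult p n k : legendre p (n + p * k) = legendre p n.
Proof.
apply legendre_mod. destruct p as [|p]; [rewrite Nat.mul_0_l, Nat.add_0_r; reflexivity|].
rewrite (Nat.mul_comm (S p)), Nat.Div0.mod_add. reflexivity.
Qed.

Lemma recip_symbol_period I n k : recip_symbol I (n + 4 * list_product I * k) = recip_symbol I n.
Proof.
enough (H : forall J m, (exists k', m = 4 * list_product J * k')%nat -> recip_symbol J (n + m) = recip_symbol J n)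
  by (apply H; exists k; reflexivity).
induction J as [|q J IH]; intros m [k' Ek]; [reflexivity|]. simpl in *.
rewrite IH by (exists (q * k')%nat; rewrite Ek; ring). f_equal. unfold recip_legendre.
f_equal.
- rewrite <- (legendre_period_mult q n (4 * list_product J * k')). f_equal. rewrite Ek. ring.
- rewrite <- (twist4_period q n (q * list_product J * k')). f_equal. rewrite Ek. ring.
Qed.

Lemma recip_symbol_values I n : recip_symbol I n = (-1)%Z \/ recip_symbol I n = 0%Z \/ recip_symbol I n = 1%Z.
Proof.
induction I as [|q I IH]; simpl; [tauto|]. unfold recip_legendre.
destruct (legendre_values q n) as [->|[->| ->]]; destruct (twist4_values q n) as [->|[->| ->]];
destruct IH as [->|[->| ->]]; simpl; tauto.
Qed.

Lemma list_product_pos I : List.Forall odd_prime I -> (1 <= list_product I)%nat.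
Proof. induction 1 as [|q I [_ Hq] HI IH]; simpl; nia. Qed.

Lemma gcd_list_product_eq_1 n I : Nat.gcd n (list_product I) = 1%nat <-> List.Forall (fun q => Nat.gcd n q = 1%nat) I.
Proof.
induction I as [|q I IH]; simpl.
- split; [constructor|intros _; apply Nat.divide_1_r, Nat.gcd_divide_r].
- rewrite List.Forall_cons_iff, gcd_mult_eq_1, IH. tauto.
Qed.

Lemma recip_legendre_neq_0 q n : odd_prime q -> recip_legendre q n <> 0%Z <-> Nat.gcd n q = 1%nat /\ Nat.gcd n 4 = 1%nat.
Proof.
intros Hq. unfold recip_legendre.
rewrite <- (twist4_zero q n), <- (prime_not_divide_gcd q n) by apply Hq. rewrite <- (legendre_eq_0 q n Hq). nia.
Qed.

Lemma recip_symbol_neq_0_Forall I n :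
  recip_symbol I n <> 0%Z <-> List.Forall (fun q => recip_legendre q n <> 0%Z) I.
Proof.
induction I as [|q I IH]; simpl; [split; [constructor|discriminate]|].
rewrite List.Forall_cons_iff, <- IH. nia.
Qed.

Lemma recip_symbol_neq_0 I n : List.Forall odd_prime I -> I <> nil ->
  recip_symbol I n <> 0%Z <-> Nat.gcd n (4 * list_product I) = 1%nat.
Proof.
intros HI Hnil. rewrite recip_symbol_neq_0_Forall, gcd_mult_eq_1, gcd_list_product_eq_1.
rewrite !List.Forall_forall in *. split.
- intros H. split; [|intros q Hq; apply (recip_legendre_neq_0 q n (HI q Hq)), H, Hq].
  destruct I as [|q I]; [congruence|]. apply (recip_legendre_neq_0 q n (HI q (or_introl eq_refl))), H. left; reflexivity.
- intros [Hfour H] q Hq. apply (recip_legendre_neq_0 q n (HI q Hq)). auto.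
Qed.

Lemma odd_prime_coprime_4 q : odd_prime q -> Nat.gcd q 4 = 1%nat.
Proof.
intros [Hq H2]. rewrite Nat.gcd_comm. apply prime_not_divide_gcd; [exact Hq|].
intros [k Ek]. assert (k = 0 \/ k = 1 \/ 2 <= k)%nat by lia.
assert (q = 4)%nat by nia. subst q. apply prime_divisors with (a := 2%Z) in Hq; [lia|]. exists 2%Z; reflexivity.
Qed.

Lemma coprime_list_product q I : odd_prime q -> List.Forall odd_prime I -> ~ In q I -> Nat.gcd q (4 * list_product I) = 1%nat.
Proof.
intros Hq HI Hnotin. apply gcd_mult_eq_1. split; [apply odd_prime_coprime_4, Hq|].
induction HI as [|r I Hr HI IH]; simpl; [apply Nat.divide_1_r, Nat.gcd_divide_r|].
apply gcd_mult_eq_1. split; [|apply IH; intros H; apply Hnotin; right; exact H].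
rewrite Nat.gcd_comm. apply prime_not_divide_gcd; [apply Hq|]. intros [k Ek].
assert (Hdiv : (Z.of_nat q | Z.of_nat r)%Z) by (exists (Z.of_nat k); lia).
apply prime_divisors in Hdiv; [|apply Hr]. destruct Hq as [Hq Hq2]. destruct Hr as [Hr Hr2].
destruct Hdiv as [Hdiv|[Hdiv|[Hdiv|Hdiv]]]; try lia. apply Hnotin. left. lia.
Qed.

Lemma exists_cong_1_mod q m r : (1 <= q)%nat -> (1 <= m)%nat -> Nat.gcd q m = 1%nat ->
  exists n : nat, (n mod q = r mod q)%nat /\ exists k, (n = 1 + m * k)%nat.
Proof.
intros Hq Hm H.
destruct (Nat.gcd_bezout_pos m q ltac:(lia)) as (u & v & Hbezout). rewrite Nat.gcd_comm, H in Hbezout.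
exists (1 + m * (u * (r + (q - 1))))%nat. split; [|exists (u * (r + (q - 1)))%nat; ring].
replace (1 + m * (u * (r + (q - 1))))%nat with (1 + (u * m) * (r + (q - 1)))%nat by ring.
rewrite Hbezout. replace (1 + (1 + v * q) * (r + (q - 1)))%nat with (r + (1 + v * (r + (q - 1))) * q)%nat by nia.
apply Nat.Div0.mod_add.
Qed.

Lemma recip_symbol_1 I : List.Forall odd_prime I -> recip_symbol I 1 = 1%Z.
Proof.
induction 1 as [|q I Hq HI IH]; [reflexivity|]. simpl. rewrite IH. unfold recip_legendre.
rewrite legendre_1 by exact Hq. reflexivity.
Qed.

Lemma recip_symbol_nonprincipal I : List.Forall odd_prime I -> NoDup I -> I <> nil -> exists n, recip_symbol I n = (-1)%Z.
Proof.
intros HI Hdup Hnil. destruct I as [|q I]; [congruence|].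
apply List.Forall_cons_iff in HI. destruct HI as [Hq HI]. apply NoDup_cons_iff in Hdup. destruct Hdup as [Hnotin _].
destruct (exists_nonresidue q Hq) as [r Hr]. pose proof (list_product_pos I HI).
destruct (exists_cong_1_mod q (4 * list_product I) r) as (n & Hnr & k & Hn1);
  [destruct Hq; lia|lia|apply coprime_list_product; assumption|].
exists n. simpl. rewrite Hn1, recip_symbol_period, recip_symbol_1, <- Hn1 by exact HI.
unfold recip_legendre. rewrite (legendre_mod q n r Hnr), Hr.
rewrite Hn1. replace (1 + 4 * list_product I * k)%nat with (1 + 4 * (list_product I * k))%nat by ring.
rewrite twist4_period. reflexivity.
Qed.

Theorem real_char_recip_symbol I : List.Forall odd_prime I -> NoDup I -> I <> nil ->
  real_char (4 * list_product I) (fun n => IZR (recip_symbol I n)).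
Proof.
intros HI Hdup Hnil. split.
- pose proof (list_product_pos I HI). lia.
- intros m n. rewrite recip_symbol_mult, mult_IZR by exact HI. reflexivity.
- intros n. f_equal. rewrite <- (recip_symbol_period I n 1). f_equal. lia.
- intros n. destruct (recip_symbol_values I n) as [->|[->| ->]]; auto.
- intros n. rewrite <- (recip_symbol_neq_0 I n HI Hnil).
  split; intros H H0; apply H; [rewrite H0; reflexivity|apply eq_IZR; exact H0].
- destruct (recip_symbol_nonprincipal I HI Hdup Hnil) as [n Hn]. exists n. rewrite Hn. reflexivity.
Qed.

Lemma recip_symbol_prime I p : List.Forall odd_prime I -> odd_prime p ->
  recip_symbol I p = fold_right (fun q z => legendre p q * z)%Z 1%Z I.
Proof.
intros HI Hp. induction HI as [|q I Hq HI IH]; [reflexivity|]. simpl. rewrite IH. f_equal.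
unfold recip_legendre. destruct (Nat.eq_dec p q) as [->|Hpq].
- rewrite (proj2 (legendre_eq_0 q q Hq)) by apply Nat.divide_refl. reflexivity.
- rewrite (legendre_reciprocity p q Hp Hq Hpq).
  assert (Hcop : Nat.gcd p 4 = 1%nat) by (apply odd_prime_coprime_4, Hp).
  assert (Hm : (p mod 4 = 1 \/ p mod 4 = 3)%nat).
  { rewrite Nat.gcd_comm, <- Nat.Lcm0.gcd_mod, Nat.gcd_comm in Hcop.
    assert (Hn : (p mod 4 < 4)%nat) by (apply Nat.mod_upper_bound; lia).
    destruct (p mod 4) as [|[|[|[|]]]]; try lia; simpl in Hcop; lia. }
  unfold twist4. destruct Hm as [-> | ->]; destruct (Nat.eqb (q mod 4) 3); cbn [Nat.eqb andb]; ring.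
Qed.

Theorem real_char_legendre p : odd_prime p -> real_char p (fun n => IZR (legendre p n)).
Proof.
intros Hp. split.
- destruct Hp; lia.
- intros m n. rewrite legendre_multiplicative, mult_IZR by exact Hp. reflexivity.
- intros n. rewrite legendre_period. reflexivity.
- intros n. destruct (legendre_values p n) as [->|[->| ->]]; auto.
- intros n. rewrite <- (prime_not_divide_gcd p n) by apply Hp. rewrite <- (legendre_eq_0 p n Hp).
  split; intros H H0; apply H; [rewrite H0; reflexivity|apply eq_IZR; exact H0].
- destruct (exists_nonresidue p Hp) as [n Hn]. exists n. rewrite Hn. reflexivity.
Qed.

(** * The logarithmic derivative of a Dirichlet series *)

Lemma ln_INR_le_pow_neg n (e : R) : 0 < e -> lg n <= / e * pow_neg n (- e).
Proof.
intros He. unfold pow_neg. replace (- - e * lg n) with (e * lg n) by ring.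
pose proof (exp_ineq1_le (e * lg n)). apply Rmult_le_reg_l with e; [exact He|]. rewrite <- Rmult_assoc, Rinv_r; lra.
Qed.

Lemma sum1_multiples (f : nat -> R) d N : (1 <= d)%nat ->
  sum1 (fun n => if Nat.eqb (n mod d) 0 then f n else 0) N =
  sum1 (fun e => if Nat.leb (d * e) N then f (d * e)%nat else 0) N.
Proof.
intros Hd. transitivity (sum1 (fun e => f (d * e)%nat) (N / d)).
- induction N as [|N IH]; [rewrite Nat.Div0.div_0_l; reflexivity|].
  rewrite sum1_succ, IH.
  pose proof (Nat.div_mod_eq N d). pose proof (Nat.div_mod_eq (S N) d).
  pose proof (Nat.mod_upper_bound N d ltac:(lia)). pose proof (Nat.mod_upper_bound (S N) d ltac:(lia)).
  destruct (Nat.eqb_spec (S N mod d) 0).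
  + assert (Hquot : (S N / d = S (N / d))%nat) by nia. rewrite Hquot, sum1_succ, <- Hquot. do 2 f_equal. lia.
  + replace (S N / d)%nat with (N / d)%nat by nia. ring.
- assert (Hquot : forall M, (N / d <= M)%nat ->
    sum1 (fun e => if Nat.leb (d * e) N then f (d * e)%nat else 0) M = sum1 (fun e => f (d * e)%nat) (N / d)).
  { intros M HM. pose proof (Nat.div_mod_eq N d). pose proof (Nat.mod_upper_bound N d ltac:(lia)).
    induction HM as [|M HM IH].
    - apply sum1_ext. intros e He. destruct (Nat.leb_spec (d * e) N); [reflexivity|nia].
    - rewrite sum1_succ, IH. destruct (Nat.leb_spec (d * S M) N); [nia|ring]. }
  rewrite Hquot; [reflexivity|]. apply Nat.Div0.div_le_upper_bound; nia.
Qed.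

Lemma sum1_sum_f_R0 (f : nat -> nat -> R) m N :
  sum1 (fun n => sum_f_R0 (fun j => f j n) m) N = sum_f_R0 (fun j => sum1 (f j) N) m.
Proof.
induction m as [|m IH]; simpl; [reflexivity|]. rewrite <- IH, <- sum1_plus. reflexivity.
Qed.

Lemma sum1_mult f g M N : sum1 f M * sum1 g N = sum1 (fun d => sum1 (fun e => f d * g e) N) M.
Proof.
induction M as [|M IH]; simpl; [ring|]. rewrite Rmult_plus_distr_r, IH, sum1_scal. reflexivity.
Qed.

Lemma exp_taylor_plus s m x y : exp_taylor s m (x + y) = sum_f_R0 (fun j => exp_taylor s j x * exp_taylor s (m - j) y) m.
Proof.
unfold exp_taylor. replace (- s * (x + y)) with (- s * x + - s * y) by ring. rewrite exp_plus.
replace (- (x + y)) with (- x + - y) by ring. rewrite binomial. unfold Rdiv.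
rewrite (Rmult_comm (sum_f_R0 _ _)), !scal_sum. apply sum_eq. intros j Hj. unfold Binomial.C.
field. repeat split; apply INR_fact_neq_0.
Qed.

Lemma taylor_term_mult s t m d e : (1 <= d)%nat -> (1 <= e)%nat ->
  taylor_term s t 0 m (d * e) = sum_f_R0 (fun j => taylor_term s t 0 j d * taylor_term s t 0 (m - j) e
      - taylor_term s t (PI / 2) j d * taylor_term s t (PI / 2) (m - j) e) m /\
  taylor_term s t (PI / 2) m (d * e) = sum_f_R0 (fun j => taylor_term s t 0 j d * taylor_term s t (PI / 2) (m - j) e
      + taylor_term s t (PI / 2) j d * taylor_term s t 0 (m - j) e) m.
Proof.
intros Hd He. unfold taylor_term.
rewrite mult_INR, ln_mult by pos.
set (x := lg d). set (y := lg e). rewrite exp_taylor_plus.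
rewrite !(Rmult_comm (sum_f_R0 _ _)), !scal_sum.
rewrite !Rplus_0_r, Rmult_plus_distr_l.
split; apply sum_eq; intros j _.
- rewrite cos_plus. replace (t * x + PI / 2) with (PI / 2 + t * x) by ring.
  replace (t * y + PI / 2) with (PI / 2 + t * y) by ring.
  rewrite !(cos_plus (PI / 2)), cos_PI2, sin_PI2. ring.
- replace (t * x + t * y + PI / 2) with (PI / 2 + (t * x + t * y)) by ring.
  replace (t * x + PI / 2) with (PI / 2 + t * x) by ring. replace (t * y + PI / 2) with (PI / 2 + t * y) by ring.
  rewrite !(cos_plus (PI / 2)), cos_PI2, sin_PI2, sin_plus. ring.
Qed.

Lemma taylor_coefN_bound_of_terms be s t ph N r e K : 0 < r -> 0 < e -> 0 <= K ->
  (forall m n, r ^ m * Rabs (be n * taylor_term s t ph m n) <= K * pow_neg n (1 + e)) ->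
  geom_bound (taylor_coefN be s t ph N) (K * (1 + / e)) r.
Proof.
intros Hr He HK Hterm. apply geom_bound_of_scaled; [exact Hr|]. intros m.
apply Rle_trans with (K * sum1 (fun n => pow_neg n (1 + e)) N);
  [|apply Rmult_le_compat_l; [exact HK|apply sum1_pow_neg_le, He]].
unfold taylor_coefN. rewrite <- (Rabs_pos_eq (r ^ m)), <- Rabs_mult, <- !sum1_scal by pos.
apply Rabs_sum1_le. intros n _. rewrite Rabs_mult, (Rabs_pos_eq (r ^ m)) by pos. apply Hterm.
Qed.

Lemma sum1_ln_convolution (f : nat -> R) N :
  sum1 (fun n => - lg n * f n) N =
  sum1 (fun d => sum1 (fun e => if Nat.leb (d * e) N then - mangoldt d * f (d * e)%nat else 0) N) N.
Proof.
transitivity (sum1 (fun n => sum1 (fun d => if Nat.eqb (n mod d) 0 then - mangoldt d * f n else 0) N) N).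
- apply sum1_ext. intros n Hn. rewrite <- (mangoldt_divisor_sum n N) by lia.
  rewrite <- sum1_opp, Rmult_comm, <- sum1_scal. apply sum1_ext. intros d _. destruct (Nat.eqb (n mod d) 0); ring.
- rewrite sum1_exchange. apply sum1_ext. intros d Hd.
  apply (sum1_multiples (fun n => - mangoldt d * f n)). lia.
Qed.

Lemma PS_derive_taylor_coefN al s t ph N m :
  PS_derive (taylor_coefN al s t ph N) m = sum1 (fun n => - lg n * (al n * taylor_term s t ph m n)) N.
Proof.
unfold PS_derive, taylor_coefN. rewrite <- sum1_scal. apply sum1_ext. intros n _. unfold taylor_term, exp_taylor.
rewrite fact_simpl, mult_INR. simpl pow. field. split; [apply INR_fact_neq_0|apply not_0_INR; lia].
Qed.

Lemma is_lim_seq_PS_mult (f g : nat -> nat -> R) (lf lg : nat -> R) m :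
  (forall j, is_lim_seq (fun N => f N j) (lf j)) -> (forall j, is_lim_seq (fun N => g N j) (lg j)) ->
  is_lim_seq (fun N => PS_mult (f N) (g N) m) (PS_mult lf lg m).
Proof.
intros Hf Hg. unfold PS_mult.
enough (Hpartial : forall k, is_lim_seq (fun N => sum_f_R0 (fun j => f N j * g N (m - j)%nat) k)
  (sum_f_R0 (fun j => lf j * lg (m - j)%nat) k))
  by apply Hpartial.
induction k as [|k IH]; simpl; [apply is_lim_seq_mult'; auto|].
apply is_lim_seq_plus'; [exact IH|apply is_lim_seq_mult'; auto].
Qed.

Section CompletelyMultiplicative.
Variable (al : nat -> R).
Hypothesis Hmul : forall m n, al (m * n)%nat = al m * al n.
Hypothesis Habs : forall n, Rabs (al n) <= 1.

Definition log_coef (n : nat) : R := - (mangoldt n * al n).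

Lemma log_coef_abs n : Rabs (log_coef n) <= lg n.
Proof.
unfold log_coef. rewrite Rabs_Ropp, Rabs_mult, (Rabs_pos_eq (mangoldt n)) by apply mangoldt_nonneg.
pose proof (mangoldt_nonneg n). pose proof (mangoldt_le_ln n). pose proof (Habs n). nra.
Qed.

Lemma log_coef_term_bound s t ph m n r e : 0 <= r -> 0 < e ->
  r ^ m * Rabs (log_coef n * taylor_term s t ph m n) <= / e * pow_neg n (s - r - e).
Proof.
intros Hr He. rewrite Rabs_mult.
pose proof (taylor_term_bound s t ph m n r Hr) as Hterm.
pose proof (log_coef_abs n). pose proof (ln_INR_le_pow_neg n e He).
replace (s - r - e) with (- e + (s - r)) by ring. rewrite pow_neg_plus, <- (Rmult_assoc (/ e)).
replace (r ^ m * (Rabs (log_coef n) * Rabs (taylor_term s t ph m n)))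
  with (Rabs (log_coef n) * (r ^ m * Rabs (taylor_term s t ph m n))) by ring.
apply Rmult_le_compat; [apply Rabs_pos|apply Rmult_le_pos; [apply pow_le; exact Hr|apply Rabs_pos]|lra|exact Hterm].
Qed.

Lemma is_lim_seq_taylor_log_coef s t ph m : 3 <= s ->
  is_lim_seq (fun N => taylor_coefN log_coef s t ph N m) (taylor_coef log_coef s t ph m).
Proof.
intros Hs. apply (is_lim_seq_sum1_inf _ (fun n => / (1/2) * pow_neg n (1 + 1/2)) (/ (1/2) * (1 + / (1/2)))).
- intros n _. pose proof (log_coef_term_bound s t ph m n 1 (1/2) ltac:(lra) ltac:(lra)) as Hterm.
  rewrite pow1, Rmult_1_l in Hterm. eapply Rle_trans; [exact Hterm|]. apply Rmult_le_compat_l; [lra|].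
  apply pow_neg_antitone. lra.
- intros N. rewrite sum1_scal. apply Rmult_le_compat_l; [lra|]. apply sum1_pow_neg_le; lra.
Qed.

Lemma taylor_coefN_bound s t ph N r e : 0 < r -> 0 < e -> s - r >= 1 + e ->
  geom_bound (taylor_coefN al s t ph N) (1 + / e) r.
Proof.
intros Hr He Hs. rewrite <- (Rmult_1_l (1 + / e)). apply taylor_coefN_bound_of_terms; [exact Hr|exact He|lra|].
intros m n. rewrite Rabs_mult, Rmult_1_l.
pose proof (taylor_term_bound s t ph m n r ltac:(lra)). pose proof (Habs n).
pose proof (pow_neg_antitone n (1 + e) (s - r) ltac:(lra)).
assert (0 <= r ^ m * Rabs (taylor_term s t ph m n)) by (apply Rmult_le_pos; [pos|apply Rabs_pos]). nra.
Qed.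

Lemma taylor_coefN_log_coef_bound s t ph N r e : 0 < r -> 0 < e -> s - r >= 1 + 2 * e ->
  geom_bound (taylor_coefN log_coef s t ph N) (/ e * (1 + / e)) r.
Proof.
intros Hr He Hs. assert (0 < / e) by pos. apply taylor_coefN_bound_of_terms; [exact Hr|exact He|lra|].
intros m n. eapply Rle_trans; [apply (log_coef_term_bound s t ph m n r e); lra|].
apply Rmult_le_compat_l; [lra|]. apply pow_neg_antitone. lra.
Qed.

Lemma taylor_coef_bound s t ph r e : 3 <= s -> 0 < r -> 0 < e -> s - r >= 1 + e ->
  geom_bound (taylor_coef al s t ph) (1 + / e) r.
Proof.
intros H3 Hr He Hs. apply (geom_bound_lim (fun N => taylor_coefN al s t ph N)).
- intros N. apply taylor_coefN_bound; assumption.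
- intros m. apply (is_lim_seq_taylor_coef _ 1); assumption.
Qed.

Lemma taylor_log_coef_bound s t ph r e : 3 <= s -> 0 < r -> 0 < e -> s - r >= 1 + 2 * e ->
  geom_bound (taylor_coef log_coef s t ph) (/ e * (1 + / e)) r.
Proof.
intros H3 Hr He Hs. apply (geom_bound_lim (fun N => taylor_coefN log_coef s t ph N)).
- intros N. apply taylor_coefN_log_coef_bound; assumption.
- intros m. apply is_lim_seq_taylor_log_coef; assumption.
Qed.

Lemma mangoldt_taylor_term_bound s t ph m N d e : 3 <= s -> (1 <= d)%nat -> (1 <= e)%nat -> (1 <= N <= d * e)%nat ->
  Rabs (mangoldt d * (al (d * e)%nat * taylor_term s t ph m (d * e)))
    <= 4 * pow_neg N (1/4) * (pow_neg d (1 + 1/2) * pow_neg e (1 + 1/2)).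
Proof.
intros Hs Hd He HN.
assert (Hterm : Rabs (al (d * e)%nat * taylor_term s t ph m (d * e)) <=
  pow_neg N (1/4) * (pow_neg d (7/4) * pow_neg e (1 + 1/2))).
{ pose proof (taylor_term_bound s t ph m (d * e) 1 ltac:(lra)) as Hbound. rewrite pow1, Rmult_1_l in Hbound.
  apply Rle_trans with (pow_neg (d * e) (1/4 + 7/4)).
  - rewrite Rabs_mult. pose proof (Habs (d * e)). pose proof (pow_neg_antitone (d * e) (1/4 + 7/4) (s - 1) ltac:(lra)).
    pose proof (Rabs_pos (taylor_term s t ph m (d * e))). nra.
  - rewrite pow_neg_plus, (pow_neg_mult d e (7/4)) by lia.
    apply Rmult_le_compat; [left; apply pow_neg_pos|left; apply Rmult_lt_0_compat;
      apply pow_neg_pos|apply pow_neg_decr; [lra|lia]|].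
    apply Rmult_le_compat_l; [left; apply pow_neg_pos|apply pow_neg_antitone; lra]. }
assert (Hmangoldt : mangoldt d <= 4 * pow_neg d (- (1/4))).
{ eapply Rle_trans; [apply mangoldt_le_ln|]. eapply Rle_trans; [apply (ln_INR_le_pow_neg d (1/4)); lra|].
  right. f_equal. field. }
rewrite Rabs_mult, (Rabs_pos_eq (mangoldt d)) by apply mangoldt_nonneg.
replace (1 + 1/2) with (- (1/4) + 7/4) at 1 by lra. rewrite pow_neg_plus.
replace (4 * pow_neg N (1/4) * (pow_neg d (- (1/4)) * pow_neg d (7/4) * pow_neg e (1 + 1/2)))
  with (4 * pow_neg d (- (1/4)) * (pow_neg N (1/4) * (pow_neg d (7/4) * pow_neg e (1 + 1/2)))) by ring.
apply Rmult_le_compat; [apply mangoldt_nonneg|apply Rabs_pos|exact Hmangoldt|exact Hterm].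
Qed.

(* [log = mangoldt * 1] as a Dirichlet convolution, up to the pairs [d e > N]. *)
Lemma convolution_error s t ph m N : 3 <= s -> (1 <= N)%nat ->
  Rabs (sum1 (fun n => - lg n * (al n * taylor_term s t ph m n)) N
     - sum1 (fun d => sum1 (fun e => - mangoldt d * (al (d * e)%nat * taylor_term s t ph m (d * e))) N) N)
  <= 36 * pow_neg N (1/4).
Proof.
intros Hs HN. rewrite (sum1_ln_convolution (fun n => al n * taylor_term s t ph m n)), <- sum1_minus.
set (c := 4 * pow_neg N (1/4)). assert (Hc : 0 < c) by (unfold c; pose proof (pow_neg_pos N (1/4)); lra).
set (w := fun n => pow_neg n (1 + 1/2)).
apply Rle_trans with (c * (sum1 w N * sum1 w N)).
- rewrite sum1_mult, <- sum1_scal. apply Rabs_sum1_le. intros d Hd.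
  rewrite <- sum1_minus, <- sum1_scal. apply Rabs_sum1_le. intros e He.
  destruct (Nat.leb_spec (d * e) N).
  + rewrite Rminus_diag, Rabs_R0. apply Rmult_le_pos; [lra|]. left; apply Rmult_lt_0_compat; apply pow_neg_pos.
  + unfold Rminus. rewrite Rplus_0_l, <- Ropp_mult_distr_l, Ropp_involutive.
    apply mangoldt_taylor_term_bound; lia || exact Hs.
- pose proof (sum1_pow_neg_le (1/2) N ltac:(lra)) as Hw. fold w in Hw. replace (1 + / (1/2)) with 3 in Hw by field.
  assert (0 <= sum1 w N) by (apply sum1_nonneg; intros; left; apply pow_neg_pos).
  replace (36 * pow_neg N (1/4)) with (c * 9) by (unfold c; ring). apply Rmult_le_compat_l; [lra|nra].
Qed.

Lemma is_lim_seq_pow_neg c : 0 < c -> is_lim_seq (fun N => pow_neg N c) 0.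
Proof.
intros Hc. apply is_lim_seq_spec. intros eps.
destruct (nfloor_ex (exp (- ln eps / c) + 1)) as [n0 Hn0]; [pose proof (exp_pos (- ln eps / c)); lra|].
exists (S n0). intros n Hn. rewrite Rminus_0_r, Rabs_pos_eq by pos.
unfold pow_neg. rewrite <- (exp_ln eps) by apply cond_pos. apply exp_increasing.
assert (Hlg : - ln eps / c < lg n).
{ rewrite <- (ln_exp (- ln eps / c)). apply ln_increasing; [apply exp_pos|].
  apply le_INR in Hn. rewrite S_INR in Hn. lra. }
apply Rmult_lt_compat_l with (r := c) in Hlg; [|exact Hc].
replace (c * (- ln eps / c)) with (- ln eps) in Hlg by (field; lra). lra.
Qed.

Lemma is_lim_seq_mangoldt_convolution s t ph m : 3 <= s ->
  is_lim_seq (fun N => sum1 (fun d => sum1 (fun e => - mangoldt d * (al (d * e)%nat * taylor_term s t ph m (d * e))) N) N)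
    (PS_derive (taylor_coef al s t ph) m).
Proof.
intros Hs.
set (conv := fun N => sum1 (fun d => sum1 (fun e => - mangoldt d * (al (d * e)%nat * taylor_term s t ph m (d * e))) N) N).
apply is_lim_seq_ext with (fun N => PS_derive (taylor_coefN al s t ph N) m -
  (PS_derive (taylor_coefN al s t ph N) m - conv N));
  [intros; ring|].
rewrite <- (Rminus_0_r (PS_derive _ m)). apply is_lim_seq_minus'.
- apply is_lim_seq_scal_R, (is_lim_seq_taylor_coef _ 1); assumption.
- apply is_lim_seq_abs_0. apply is_lim_seq_le_le_loc with (fun _ => 0) (fun N => 36 * pow_neg N (1/4)).
  + exists 1%nat. intros N HN. split; [apply Rabs_pos|]. rewrite PS_derive_taylor_coefN. apply convolution_error; assumption.
  + apply is_lim_seq_const.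
  + rewrite <- (Rmult_0_r 36). apply is_lim_seq_scal_R, is_lim_seq_pow_neg. lra.
Qed.

Lemma PS_mult_taylor_coefN s t ph ph' N m :
  PS_mult (taylor_coefN log_coef s t ph N) (taylor_coefN al s t ph' N) m =
  sum1 (fun d => sum1 (fun e => - mangoldt d * al (d * e)%nat *
    sum_f_R0 (fun j => taylor_term s t ph j d * taylor_term s t ph' (m - j) e) m) N) N.
Proof.
unfold PS_mult.
rewrite (sum_eq _ (fun j => sum1 (fun d => sum1 (fun e => - mangoldt d * al (d * e)%nat *
  (taylor_term s t ph j d * taylor_term s t ph' (m - j) e)) N) N)).
- rewrite <- sum1_sum_f_R0. apply sum1_ext. intros d _. rewrite <- sum1_sum_f_R0. apply sum1_ext. intros e _.
  rewrite scal_sum. apply sum_eq. intros; ring.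
- intros j _. unfold taylor_coefN. rewrite sum1_mult. apply sum1_ext. intros d _. apply sum1_ext. intros e _.
  unfold log_coef. rewrite Hmul. ring.
Qed.

Theorem dirichlet_log_derivative s t : 3 <= s ->
  is_log_derivative (taylor_coef al s t 0) (taylor_coef al s t (PI / 2)) (taylor_coef log_coef s t 0)
    (taylor_coef log_coef s t (PI / 2)).
Proof.
intros Hs.
assert (Hprod : forall ph ph' m, is_lim_seq (fun N => PS_mult (taylor_coefN log_coef s t ph N) (taylor_coefN al s t ph' N) m)
  (PS_mult (taylor_coef log_coef s t ph) (taylor_coef al s t ph') m)).
{ intros ph ph' m. apply is_lim_seq_PS_mult; intros j;
    [apply is_lim_seq_taylor_log_coef, Hs|apply (is_lim_seq_taylor_coef _ 1); assumption]. }
split; intros m; (eapply is_lim_seq_unique_R; [apply is_lim_seq_mangoldt_convolution, Hs|]).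
- eapply is_lim_seq_ext; [|apply is_lim_seq_minus'; apply Hprod]. intros N. cbv beta.
  rewrite !PS_mult_taylor_coefN, <- sum1_minus.
  apply sum1_ext. intros d Hd. rewrite <- sum1_minus. apply sum1_ext. intros e He.
  rewrite (proj1 (taylor_term_mult s t m d e ltac:(lia) ltac:(lia))), minus_sum. ring.
- eapply is_lim_seq_ext; [|apply is_lim_seq_plus'; apply Hprod]. intros N. cbv beta.
  rewrite !PS_mult_taylor_coefN, <- sum1_plus.
  apply sum1_ext. intros d Hd. rewrite <- sum1_plus. apply sum1_ext. intros e He.
  rewrite (proj2 (taylor_term_mult s t m d e ltac:(lia) ltac:(lia))), sum_plus. ring.
Qed.

End CompletelyMultiplicative.

(** * The zeta function *)

Definition const1 (n : nat) : R := 1.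
Lemma const1_abs n : Rabs (const1 n) <= 1. Proof. unfold const1. rewrite Rabs_R1; lra. Qed.
Lemma const1_mult m n : const1 (m * n) = const1 m * const1 n. Proof. unfold const1; ring. Qed.

Definition linear_factor (w : R) (a : nat -> R) (m : nat) : R := w * a m + shift a m.

(* Coefficients at [s] of [(s-1) zeta_N(s) + N^(1-s)], which converge to those of [(s-1) zeta(s)]. *)
Definition zeta_taylorN (s : R) (N m : nat) : R :=
  linear_factor (s - 1) (taylor_coefN const1 s 0 0 N) m + exp_taylor (s - 1) m (lg N).
Definition zeta_taylor (s : R) : nat -> R := linear_factor (s - 1) (taylor_coef const1 s 0 0).

Lemma taylor_term_real s m n : taylor_term s 0 0 m n = exp_taylor s m (lg n).
Proof. unfold taylor_term. rewrite Rmult_0_l, Rplus_0_l, cos_0. ring. Qed.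

Lemma taylor_term_real_quarter_turn s m n : taylor_term s 0 (PI / 2) m n = 0.
Proof. unfold taylor_term. rewrite Rmult_0_l, Rplus_0_l, cos_PI2. ring. Qed.

Definition zeta_term (s : R) (m : nat) (x : R) : R := linear_factor (s - 1) (fun j => exp_taylor s j x) m.

Lemma zeta_taylorN_sum1 s N m : zeta_taylorN s N m = sum1 (fun n => zeta_term s m (lg n)) N + exp_taylor (s - 1) m (lg N).
Proof.
unfold zeta_taylorN. f_equal. unfold zeta_term, linear_factor, taylor_coefN. rewrite sum1_plus, sum1_scal. f_equal.
- f_equal. apply sum1_ext. intros n _. rewrite taylor_term_real. unfold const1. ring.
- destruct m as [|m]; simpl; [rewrite sum1_0; reflexivity|].
  apply sum1_ext. intros n _. rewrite taylor_term_real. unfold const1. ring.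
Qed.

Lemma zeta_taylorN_telescope s N m : zeta_taylorN s (S N) m = exp_taylor (s - 1) m 0 + zeta_term s m (lg (S N)) +
  sum1 (fun n => zeta_term s m (lg n) + exp_taylor (s - 1) m (lg (S n)) - exp_taylor (s - 1) m (lg n)) N.
Proof.
rewrite zeta_taylorN_sum1. induction N as [|N IH].
- simpl. rewrite ln_1. ring.
- rewrite (sum1_succ _ (S N)), (sum1_succ (fun n => zeta_term s m (lg n) + _ - _)). lra.
Qed.

Lemma exp_taylor_exp_factor s m x : exp_taylor s m x = exp (- x) * exp_taylor (s - 1) m x.
Proof.
unfold exp_taylor. rewrite <- Rmult_assoc, <- exp_plus. f_equal. f_equal. ring.
Qed.

Lemma zeta_term_increment s m n : (1 <= n)%nat -> exists y, lg n <= y <= lg (S n) /\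
  exp_taylor (s - 1) m (lg (S n)) - exp_taylor (s - 1) m (lg n) = - zeta_term s m y.
Proof.
intros Hn. assert (Hn0 : 0 < INR n) by pos.
set (f := fun u => exp_taylor (s - 1) m (ln u)).
destruct (MVT_gen f (INR n) (INR (S n)) (fun u => - zeta_term s m (ln u))) as (u & Hu & Hmvt).
- intros u Hu. rewrite Rmin_left in Hu by (apply le_INR; lia). unfold f.
  evar_last.
  { apply (is_derive_comp (exp_taylor (s - 1) m) ln); [apply is_derive_exp_taylor|apply is_derive_ln; lra]. }
  unfold scal; simpl; unfold mult; simpl. unfold zeta_term, linear_factor.
  rewrite (exp_taylor_exp_factor s m (ln u)), exp_Ropp, exp_ln by lra.
  destruct m as [|m]; simpl; [unfold zero; simpl; ring|].
  rewrite (exp_taylor_exp_factor s m (ln u)), exp_Ropp, exp_ln by lra. ring.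
- intros u Hu. rewrite Rmin_left in Hu by (apply le_INR; lia).
  apply continuity_pt_filterlim. unfold f. eapply (continuous_is_derive (fun u => exp_taylor (s - 1) m (ln u)) u).
  apply (is_derive_comp (exp_taylor (s - 1) m) ln u); [apply is_derive_exp_taylor|apply is_derive_ln; lra].
- rewrite Rmin_left, Rmax_right in Hu by (apply le_INR; lia).
  exists (ln u). split; [split; apply ln_le; lra|]. fold (f (INR (S n))). fold (f (INR n)).
  rewrite Hmvt, S_INR. ring.
Qed.

Lemma zeta_term_bound s m x r : 1 <= s -> 0 <= r -> 0 <= x ->
  r ^ m * Rabs (zeta_term s m x) <= (s - 1 + r) * exp (- (s - r) * x).
Proof.
intros Hs Hr Hx. unfold zeta_term, linear_factor. pose proof (exp_taylor_bound s m x r Hr Hx) as Hg.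
pose proof (shift_bound (fun j => exp_taylor s j x) r _ m Hr (fun j => exp_taylor_bound s j x r Hr Hx)) as Hg'.
set (g := exp_taylor s m x) in *. set (g' := shift _ m) in *.
apply Rle_trans with (r ^ m * ((s - 1) * Rabs g + Rabs g')).
- apply Rmult_le_compat_l; [pos|]. eapply Rle_trans; [apply Rabs_triang|].
  rewrite Rabs_mult, (Rabs_pos_eq (s - 1)) by lra. lra.
- replace (r ^ m * ((s - 1) * Rabs g + Rabs g')) with ((s - 1) * (r ^ m * Rabs g) + r ^ m * Rabs g') by ring. nra.
Qed.

Lemma zeta_term_variation s m n r y : 1 <= s -> 0 < r < s -> (1 <= n)%nat -> lg n <= y <= lg (S n) ->
  r ^ m * Rabs (zeta_term s m (lg n) - zeta_term s m y) <= (s - 1 + r) * (s + r) * pow_neg n (1 + (s - r)).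
Proof.
intros Hs Hr Hn Hy. assert (Hrm : 0 < r ^ m) by pos.
set (G := fun x j => exp_taylor s j x).
replace (r ^ m * Rabs (zeta_term s m (lg n) - zeta_term s m y))
  with (Rabs (r ^ m * zeta_term s m (lg n) - r ^ m * zeta_term s m y))
  by (rewrite <- Rmult_minus_distr_l, Rabs_mult, (Rabs_pos_eq (r ^ m)) by lra; reflexivity).
apply (variation_bound (fun x => r ^ m * zeta_term s m x)
  (fun x => r ^ m * ((s - 1) * (- s * G x m - shift (G x) m) + (- s * shift (G x) m - shift (shift (G x)) m))));
  [lia|lra|nra| | |exact Hy].
- intros x. apply is_derive_scal. apply (is_derive_plus (V := R_NormedModule) (fun x => (s - 1) * exp_taylor s m x));
    [apply is_derive_scal, is_derive_exp_taylor|apply is_derive_shift_exp_taylor].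
- intros x Hx. rewrite Rabs_mult, (Rabs_pos_eq (r ^ m)) by lra.
  pose proof (fun j => exp_taylor_bound s j x r ltac:(lra) Hx : r ^ j * Rabs (G x j) <= _) as Hg.
  pose proof (fun j => shift_bound (G x) r _ j ltac:(lra) Hg) as Hg'.
  pose proof (shift_bound (shift (G x)) r _ m ltac:(lra) Hg') as Hg''. specialize (Hg m). specialize (Hg' m).
  set (e := exp (- (s - r) * x)) in *. set (g'' := shift (shift (G x)) m) in *. set (g' := shift (G x) m) in *.
  set (g := G x m) in *.
  replace ((s - 1) * (- s * g - g') + (- s * g' - g'')) with (- ((s - 1) * s * g) + (- ((2 * s - 1) * g') + - g'')) by ring.
  apply Rle_trans with (r ^ m * ((s - 1) * s * Rabs g + ((2 * s - 1) * Rabs g' + Rabs g''))).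
  { apply Rmult_le_compat_l; [lra|]. eapply Rle_trans; [apply Rabs_triang|]. apply Rplus_le_compat.
    - rewrite Rabs_Ropp, Rabs_mult, (Rabs_pos_eq ((s - 1) * s)) by nra. lra.
    - eapply Rle_trans; [apply Rabs_triang|]. rewrite !Rabs_Ropp, Rabs_mult, (Rabs_pos_eq (2 * s - 1)) by lra. lra. }
  replace (r ^ m * ((s - 1) * s * Rabs g + ((2 * s - 1) * Rabs g' + Rabs g''))) with
    ((s - 1) * s * (r ^ m * Rabs g) + ((2 * s - 1) * (r ^ m * Rabs g') + r ^ m * Rabs g'')) by ring.
  replace ((s - 1 + r) * (s + r) * e) with ((s - 1) * s * e + ((2 * s - 1) * (r * e) + r * (r * e))) by ring.
  apply Rplus_le_compat; [apply Rmult_le_compat_l; nra|]. apply Rplus_le_compat; [apply Rmult_le_compat_l; nra|exact Hg''].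
Qed.

Definition zeta_taylor_const (s r : R) : R := 1 + (s - 1 + r) + (s - 1 + r) * (s + r) * (1 + / (s - r)).

Lemma zeta_taylorN_bound s r N : 1 <= s -> 0 < r < s -> geom_bound (zeta_taylorN s N) (zeta_taylor_const s r) r.
Proof.
intros Hs Hr. apply geom_bound_of_scaled; [lra|]. intros m. assert (Hrm : 0 < r ^ m) by pos.
assert (0 < / (s - r)) by pos. unfold zeta_taylor_const.
set (D := (s - 1 + r) * (s + r)). assert (HD : 0 <= D) by (unfold D; nra).
assert (H0 : r ^ m * Rabs (exp_taylor (s - 1) m 0) <= 1).
{ eapply Rle_trans; [apply exp_taylor_bound; lra|]. rewrite Rmult_0_r, exp_0. lra. }
destruct N as [|N].
- rewrite zeta_taylorN_sum1. simpl. rewrite ln_0, Rplus_0_l. assert (0 <= D * (1 + / (s - r))) by nra. lra.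
- rewrite zeta_taylorN_telescope.
  eapply Rle_trans; [apply Rmult_le_compat_l; [lra|]; eapply Rle_trans;
    [apply Rabs_triang|apply Rplus_le_compat_r, Rabs_triang]|].
  rewrite !Rmult_plus_distr_l. apply Rplus_le_compat; [apply Rplus_le_compat; [exact H0|]|].
  + eapply Rle_trans; [apply zeta_term_bound; [lra|lra|apply ln_INR_nonneg]|].
    pose proof (pow_neg_le_1 (S N) (s - r) ltac:(lra)) as Hle. unfold pow_neg in Hle. nra.
  + rewrite <- Rmult_plus_distr_l. apply Rle_trans with (sum1 (fun n => D * pow_neg n (1 + (s - r))) N);
      [|rewrite sum1_scal; apply Rmult_le_compat_l; [exact HD|apply sum1_pow_neg_le; lra]].
    rewrite <- (Rabs_pos_eq (r ^ m)), <- Rabs_mult, <- sum1_scal by lra.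
    apply Rabs_sum1_le. intros n Hn. rewrite Rabs_mult, (Rabs_pos_eq (r ^ m)) by lra.
    destruct (zeta_term_increment s m n ltac:(lia)) as (y & Hy & Hincr).
    replace (zeta_term s m (lg n) + exp_taylor (s - 1) m (lg (S n)) - exp_taylor (s - 1) m (lg n))
      with (zeta_term s m (lg n) - zeta_term s m y) by lra.
    apply zeta_term_variation; lia || assumption.
Qed.

Lemma is_lim_seq_zeta_taylor s m : 3 <= s -> is_lim_seq (fun N => zeta_taylorN s N m) (zeta_taylor s m).
Proof.
intros Hs. unfold zeta_taylorN, zeta_taylor, linear_factor. rewrite <- (Rplus_0_r (_ + shift _ m)).
apply is_lim_seq_plus'; [apply is_lim_seq_plus'|].
- apply is_lim_seq_scal_R, (is_lim_seq_taylor_coef _ 1); [apply const1_abs|exact Hs].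
- destruct m as [|m]; simpl; [apply is_lim_seq_const|apply (is_lim_seq_taylor_coef _ 1); [apply const1_abs|exact Hs]].
- apply is_lim_seq_abs_0. apply is_lim_seq_le_le with (fun _ => 0) (fun N => pow_neg N (s - 1 - 1)).
  + intros N. split; [apply Rabs_pos|].
    pose proof (exp_taylor_bound (s - 1) m (lg N) 1 ltac:(lra) (ln_INR_nonneg N)) as Hbound.
    rewrite pow1, Rmult_1_l in Hbound. exact Hbound.
  + apply is_lim_seq_const.
  + apply is_lim_seq_pow_neg. lra.
Qed.

Definition zero_seq (m : nat) : R := 0.

Lemma geom_bound_zero C r : 0 <= C -> 0 < r -> geom_bound zero_seq C r.
Proof.
intros HC Hr m. unfold zero_seq. rewrite Rabs_R0. apply Rmult_le_pos; [exact HC|].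
left; pos.
Qed.

(* Real and imaginary part of [(s-1) zeta_N(s) + N^(1-s)] at [s + i t]. *)
Definition zeta_sum_re (s t : R) (N : nat) : R :=
  (s - 1) * dirichlet_sum const1 s t 0 N - t * dirichlet_sum const1 s t (PI / 2) N + pow_neg N (s - 1) * cos (t * lg N + 0).
Definition zeta_sum_im (s t : R) (N : nat) : R :=
  (s - 1) * dirichlet_sum const1 s t (PI / 2) N + t * dirichlet_sum const1 s t 0 N + pow_neg N (s - 1) *
    cos (t * lg N + PI / 2).

Lemma is_series_exp_taylor s n x th :
  is_series (fun m => rot (fun m => exp_taylor s m (lg n)) zero_seq th m * x ^ m)
    (pow_neg n (s + x * cos th) * cos (x * sin th * lg n + 0)) /\
  is_series (fun m => rot zero_seq (oppseq (fun m => exp_taylor s m (lg n))) th m * x ^ m)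
    (pow_neg n (s + x * cos th) * cos (x * sin th * lg n + PI / 2)).
Proof.
split.
- pose proof (is_series_taylor_term s 0 0 n x th) as Hterm. rewrite ?Rplus_0_l in Hterm.
  eapply is_series_ext_R; [|exact Hterm]. intros m. unfold rot.
  rewrite taylor_term_real, ?Rplus_0_l, taylor_term_real_quarter_turn. reflexivity.
- pose proof (is_series_taylor_term s 0 (PI / 2) n x th) as Hterm. rewrite ?Rplus_0_l in Hterm.
  eapply is_series_ext_R; [|exact Hterm]. intros m. unfold rot, oppseq.
  rewrite taylor_term_real_quarter_turn, taylor_term_quarter_turn. replace (0 * lg n + PI / 2) with (PI / 2) by ring.
  rewrite sin_PI2.
  unfold zero_seq. ring.
Qed.

Lemma is_series_rot_shift g (x th A B : R) :
  is_series (fun m => rot g zero_seq th m * x ^ m) A ->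
  is_series (fun m => rot zero_seq (oppseq g) th m * x ^ m) B ->
  is_series (fun m => rot (shift g) zero_seq th m * x ^ m) (x * cos th * A - x * sin th * B) /\
  is_series (fun m => rot zero_seq (oppseq (shift g)) th m * x ^ m) (x * cos th * B + x * sin th * A).
Proof.
intros HA HB.
assert (Hdecr : forall f l, f 0%nat = 0 -> is_series (fun m => f (S m)) l -> is_series f l).
{ intros f l H0 Hf. apply (is_series_decr_1 (V := R_NormedModule) f l).
  unfold plus, opp; simpl. rewrite H0, Ropp_0, Rplus_0_r. exact Hf. }
split; (apply Hdecr; [unfold rot, zero_seq, oppseq, zero; simpl; rewrite ?Rmult_0_l, ?sin_0; unfold zero; simpl; ring|]).
- replace (x * cos th * A - x * sin th * B) with (x * cos th * A + - (x * sin th) * B) by ring.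
  eapply is_series_ext_R; [|apply is_series_plus_R; apply is_series_scal_R; [exact HA|exact HB]].
  intros m. unfold rot, zero_seq, oppseq. rewrite S_INR, Rmult_plus_distr_r, Rmult_1_l, cos_plus. simpl. ring.
- eapply is_series_ext_R; [|apply is_series_plus_R; apply is_series_scal_R; [exact HB|exact HA]].
  intros m. unfold rot, zero_seq, oppseq. rewrite S_INR, Rmult_plus_distr_r, Rmult_1_l, sin_plus. simpl. ring.
Qed.

Lemma is_series_taylor_coefN_const1 s x th N :
  is_series (fun m => rot (taylor_coefN const1 s 0 0 N) zero_seq th m * x ^ m)
    (dirichlet_sum const1 (s + x * cos th) (x * sin th) 0 N) /\
  is_series (fun m => rot zero_seq (oppseq (taylor_coefN const1 s 0 0 N)) th m * x ^ m)
    (dirichlet_sum const1 (s + x * cos th) (x * sin th) (PI / 2) N).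
Proof.
unfold taylor_coefN, dirichlet_sum. induction N as [|N [IHre IHim]].
- split; (eapply is_series_ext_R; [|apply is_series_0]); intros m; unfold rot, oppseq, zero_seq; simpl; ring.
- destruct (is_series_exp_taylor s (S N) x th) as [Hre Him].
  rewrite !sum1_succ. unfold const1 at 2 4. rewrite !Rmult_1_l.
  split; (eapply is_series_ext_R; [|apply is_series_plus_R; [apply IHre || apply IHim|apply Hre || apply Him]]);
    intros m; unfold rot, zero_seq, oppseq; rewrite sum1_succ, taylor_term_real; unfold const1; ring.
Qed.

Lemma zeta_sum_PSeries s x th N :
  PSeries (rot (zeta_taylorN s N) zero_seq th) x = zeta_sum_re (s + x * cos th) (x * sin th) N /\
  PSeries (rot zero_seq (oppseq (zeta_taylorN s N)) th) x = zeta_sum_im (s + x * cos th) (x * sin th) N.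
Proof.
destruct (is_series_taylor_coefN_const1 s x th N) as [Hre Him].
destruct (is_series_rot_shift _ _ _ _ _ Hre Him) as [Hre' Him'].
destruct (is_series_exp_taylor (s - 1) N x th) as [Hre_pow Him_pow].
unfold zeta_sum_re, zeta_sum_im. replace (s + x * cos th - 1) with (s - 1 + x * cos th) by ring.
set (u := dirichlet_sum const1 (s + x * cos th) (x * sin th) 0 N) in *.
set (v := dirichlet_sum const1 (s + x * cos th) (x * sin th) (PI / 2) N) in *.
split; unfold PSeries; apply is_series_unique.
- replace ((s - 1 + x * cos th) * u - x * sin th * v) with ((s - 1) * u + (x * cos th * u - x * sin th * v)) by ring.
  eapply is_series_ext_R; [|apply is_series_plus_R;
    [apply is_series_plus_R; [apply (is_series_scal_R (s - 1)), Hre|exact Hre']|exact Hre_pow]].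
  intros m. unfold rot, zero_seq, zeta_taylorN, linear_factor. ring.
- replace ((s - 1 + x * cos th) * v + x * sin th * u) with ((s - 1) * v + (x * cos th * v + x * sin th * u)) by ring.
  eapply is_series_ext_R; [|apply is_series_plus_R;
    [apply is_series_plus_R; [apply (is_series_scal_R (s - 1)), Him|exact Him']|exact Him_pow]].
  intros m. unfold rot, zero_seq, oppseq, zeta_taylorN, linear_factor. ring.
Qed.

(* Log-derivative coefficients of [(s-1) zeta(s)]: those of zeta plus those of [1/(s-1)]. *)
Definition zeta_log_coef (s : R) (j : nat) : R := taylor_coef (log_coef const1) s 0 0 j + (-1) ^ j / (s - 1) ^ S j.

Lemma PS_mult_0_l f m : PS_mult zero_seq f m = 0.
Proof. unfold PS_mult, zero_seq. rewrite (sum_eq _ (fun _ => 0)) by (intros; ring). rewrite sum_cte. ring. Qed.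

Lemma PS_mult_0_r f m : PS_mult f zero_seq m = 0.
Proof. unfold PS_mult, zero_seq. rewrite (sum_eq _ (fun _ => 0)) by (intros; ring). rewrite sum_cte. ring. Qed.

Lemma PS_mult_shift_r f g m : PS_mult f (shift g) m = shift (PS_mult f g) m.
Proof.
destruct m as [|m]; [unfold PS_mult; simpl; unfold zero; simpl; ring|].
change (shift (PS_mult f g) (S m)) with (PS_mult f g m). unfold PS_mult.
rewrite tech5, Nat.sub_diag. change (shift g 0) with 0. rewrite Rmult_0_r, Rplus_0_r.
apply sum_eq. intros k Hk. replace (S m - k)%nat with (S (m - k)) by lia. reflexivity.
Qed.

Lemma PS_mult_shift_l f g m : PS_mult (shift f) g m = shift (PS_mult f g) m.
Proof.
destruct m as [|m]; [unfold PS_mult; simpl; unfold zero; simpl; ring|].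
change (shift (PS_mult f g) (S m)) with (PS_mult f g m). unfold PS_mult.
rewrite decomp_sum by lia. change (shift f 0) with 0. rewrite Rmult_0_l, Rplus_0_l. reflexivity.
Qed.

Lemma PS_mult_linear_factor (w : R) (f g : nat -> R) m :
  PS_mult f (linear_factor w g) m = PS_mult (linear_factor w f) g m.
Proof.
transitivity (w * PS_mult f g m + shift (PS_mult f g) m).
- rewrite <- PS_mult_shift_r. unfold PS_mult, linear_factor. rewrite scal_sum, <- plus_sum. apply sum_eq. intros; ring.
- rewrite <- PS_mult_shift_l. unfold PS_mult, linear_factor. rewrite scal_sum, <- plus_sum. apply sum_eq. intros; ring.
Qed.

Lemma PS_derive_linear_factor (w : R) a m :
  PS_derive (linear_factor w a) m = a m + linear_factor w (PS_derive a) m.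
Proof.
unfold linear_factor, PS_derive. destruct m as [|m]; [simpl; unfold zero; simpl; ring|].
change (shift a (S (S m))) with (a (S m)). change (shift (fun n => INR (S n) * a (S n)) (S m)) with (INR (S m) * a (S m)).
rewrite (S_INR (S m)). ring.
Qed.

Lemma linear_factor_geom_inv (w : R) m : w <> 0 ->
  linear_factor w (fun j => (-1) ^ j / w ^ S j) m = if Nat.eqb m 0 then 1 else 0.
Proof.
intros Hw. unfold linear_factor. destruct m as [|m]; simpl; unfold zero; simpl; [field; exact Hw|].
field. split; [apply pow_nonzero|]; exact Hw.
Qed.

Lemma PS_mult_1_l f g m : (forall j, f j = if Nat.eqb j 0 then 1 else 0) -> PS_mult f g m = g m.
Proof.
intros Hf. unfold PS_mult. destruct m as [|m]; [simpl; rewrite Hf; simpl; ring|].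
rewrite decomp_sum, Hf by lia. simpl pred. rewrite (sum_eq _ (fun _ => 0)) by (intros j _; rewrite Hf; simpl; ring).
rewrite sum_cte, Nat.sub_0_r. simpl. ring.
Qed.

Lemma taylor_coef_const1_im s j : taylor_coef const1 s 0 (PI / 2) j = 0.
Proof.
unfold taylor_coef, sum1_inf. rewrite (Lim_seq_ext _ (fun _ => 0)).
- rewrite Lim_seq_const. reflexivity.
- intros N. transitivity (sum1 (fun _ => 0) N); [|apply sum1_0].
  apply sum1_ext. intros n _. rewrite taylor_term_real_quarter_turn. ring.
Qed.

Theorem zeta_log_derivative s : 3 <= s -> is_log_derivative (zeta_taylor s) zero_seq (zeta_log_coef s) zero_seq.
Proof.
intros Hs. split; intros m.
- rewrite PS_mult_0_l, Rminus_0_r.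
  set (z := taylor_coef const1 s 0 0). set (p := taylor_coef (log_coef const1) s 0 0).
  assert (Hz : forall k, PS_derive z k = PS_mult p z k).
  { intros k. destruct (dirichlet_log_derivative const1 const1_mult const1_abs s 0 Hs) as [Hre _].
    rewrite (Hre k : PS_derive z k = _), <- (Rminus_0_r (PS_mult p z k)). unfold Rminus. do 2 f_equal.
    unfold PS_mult. rewrite (sum_eq _ (fun _ => 0)) by (intros; rewrite taylor_coef_const1_im; ring). rewrite sum_cte. ring. }
  unfold zeta_taylor. fold z. rewrite PS_derive_linear_factor.
  set (i := fun j => (-1) ^ j / (s - 1) ^ S j).
  transitivity (PS_mult i (linear_factor (s - 1) z) m + PS_mult p (linear_factor (s - 1) z) m).
  + f_equal.
    * rewrite PS_mult_linear_factor, PS_mult_1_l; [reflexivity|]. intros j. apply linear_factor_geom_inv. lra.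
    * unfold linear_factor at 1 2. unfold PS_mult at 1.
      rewrite Hz. replace (shift (PS_derive z) m) with (shift (PS_mult p z) m)
        by (destruct m; [reflexivity|symmetry; apply Hz]).
      rewrite <- PS_mult_shift_r. unfold PS_mult. rewrite scal_sum, <- plus_sum. apply sum_eq. intros; ring.
  + unfold PS_mult, zeta_log_coef. fold p. rewrite <- plus_sum. apply sum_eq. intros j _. unfold i. ring.
- rewrite PS_mult_0_l, PS_mult_0_r. unfold PS_derive, zero_seq. ring.
Qed.
(** * Nonvanishing on the closed half-plane of absolute convergence *)

Lemma taylor_coefN_half_turn al s t N m : taylor_coefN al s t (PI / 2 + PI / 2) N m = - taylor_coefN al s t 0 N m.
Proof.
unfold taylor_coefN. rewrite <- sum1_opp. apply sum1_ext. intros n _. rewrite taylor_term_quarter_turn. unfold taylor_term.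
replace (t * lg n + PI / 2) with (PI / 2 + t * lg n) by ring.
rewrite sin_plus, cos_PI2, sin_PI2, Rplus_0_r. ring.
Qed.

Lemma is_lim_seq_rot (f g : nat -> nat -> R) (a b : nat -> R) th m :
  is_lim_seq (fun N => f N m) (a m) -> is_lim_seq (fun N => g N m) (b m) ->
  is_lim_seq (fun N => rot (f N) (g N) th m) (rot a b th m).
Proof.
intros Hf Hg. unfold rot. apply is_lim_seq_minus'.
- apply (is_lim_seq_scal_r _ (cos (INR m * th)) (a m)), Hf.
- apply (is_lim_seq_scal_r _ (sin (INR m * th)) (b m)), Hg.
Qed.

Record taylor_convergent (al : nat -> R) (C r s t : R) : Prop := {
  taylor_radius_pos : 0 < r;
  taylor_const_nonneg : 0 <= C;
  taylor_coefN_geom_bound : forall ph N, geom_bound (taylor_coefN al s t ph N) C r;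
  taylor_coefN_cvg : forall ph m, is_lim_seq (fun N => taylor_coefN al s t ph N m) (taylor_coef al s t ph m)
}.

Lemma taylor_convergent_coef_bound al C r s t ph : taylor_convergent al C r s t -> geom_bound (taylor_coef al s t ph) C r.
Proof. intros [_ _ Hb Hl]. apply (geom_bound_lim (fun N => taylor_coefN al s t ph N)); [apply Hb|apply Hl]. Qed.

(* The value [u + i v] is the complex conjugate of [sum al(n) n^{-(s+it)}]. *)
Definition is_dirichlet_value (al : nat -> R) (s t u v : R) : Prop :=
  is_lim_seq (dirichlet_sum al s t 0) u /\ is_lim_seq (dirichlet_sum al s t (PI / 2)) v.

Lemma is_dirichlet_value_unique al s t u v u' v' :
  is_dirichlet_value al s t u v -> is_dirichlet_value al s t u' v' -> u = u' /\ v = v'.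
Proof. intros [Hu Hv] [Hu' Hv']. split; eapply is_lim_seq_unique_R; eassumption. Qed.

Lemma dirichlet_value_polar al C r s t x th : taylor_convergent al C r s t -> Rabs x < r ->
  let a := taylor_coef al s t 0 in let b := taylor_coef al s t (PI / 2) in
  is_dirichlet_value al (s + x * cos th) (t + x * sin th) (PSeries (rot a b th) x) (PSeries (rot b (oppseq a) th) x).
Proof.
intros [Hr HC Hb Hl] Hx a b.
split; (eapply is_lim_seq_ext; [intros N; apply dirichlet_sum_PSeries|]);
  apply (is_lim_seq_PSeries_dominated (fun N => rot _ _ th) _ (2 * C) r x); try (exact Hr || exact Hx || lra).
- intros N. apply rot_bound; apply Hb.
- intros m. rewrite Rplus_0_l. apply is_lim_seq_rot; apply Hl.
- intros N. apply rot_bound; apply Hb.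
- intros m. apply is_lim_seq_rot; [apply Hl|].
  eapply is_lim_seq_ext; [intros N; symmetry; apply taylor_coefN_half_turn|].
  apply (is_lim_seq_opp _ (a m)), Hl.
Qed.

Lemma rot_0 a b m : rot a b 0 m = a m.
Proof. unfold rot. rewrite Rmult_0_r, cos_0, sin_0. ring. Qed.

Lemma dirichlet_value_real_shift al C r s t x : taylor_convergent al C r s t -> Rabs x < r ->
  is_dirichlet_value al (s + x) t (PSeries (taylor_coef al s t 0) x) (PSeries (taylor_coef al s t (PI / 2)) x).
Proof.
intros Hal Hx. pose proof (dirichlet_value_polar al C r s t x 0 Hal Hx) as Hval. cbv zeta in Hval.
rewrite cos_0, sin_0, Rmult_1_r, Rmult_0_r, Rplus_0_r in Hval.
rewrite !(PSeries_ext (rot _ _ 0) _ x (rot_0 _ _)) in Hval. exact Hval.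
Qed.

Lemma taylor_convergent_of_bounded_sums al B K s t r : (forall N, Rabs (sum1 al N) <= B) -> (forall n, Rabs (al n) <= K) ->
  3 <= s -> 0 < r < s -> taylor_convergent al (B * (1 + (s + Rabs t + r) * (1 + / (s - r)))) r s t.
Proof.
intros HB HK Hs Hr. split.
- lra.
- assert (0 <= B) by (eapply Rle_trans; [apply Rabs_pos|apply (HB 0%nat)]).
  assert (0 < / (s - r)) by pos. pose proof (Rabs_pos t).
  apply Rmult_le_pos; [assumption|]. nra.
- intros ph N. apply taylor_coefN_bound_of_bounded_sums; assumption.
- intros ph m. apply (is_lim_seq_taylor_coef _ K); assumption.
Qed.

Lemma taylor_convergent_abs al e s t r : (forall n, Rabs (al n) <= 1) -> 3 <= s -> 0 < e -> 0 < r -> s - r >= 1 + e ->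
  taylor_convergent al (1 + / e) r s t.
Proof.
intros Hal Hs He Hr Hsr. split.
- exact Hr.
- assert (0 < / e) by pos. lra.
- intros ph N. apply taylor_coefN_bound; assumption.
- intros ph m. apply (is_lim_seq_taylor_coef _ 1); assumption.
Qed.

Lemma exp_taylor_0 s x : exp_taylor s 0 x = exp (- s * x).
Proof. unfold exp_taylor. simpl. field. Qed.

Lemma taylor_coef_0_lower (al : nat -> R) s t : al 1%nat = 1 -> (forall n, Rabs (al n) <= 1) -> 3 <= s ->
  1 / 2 <= taylor_coef al s t 0 0.
Proof.
intros H1 Hal Hs.
apply (is_lim_seq_ge_const (fun N => taylor_coefN al s t 0 N 0%nat)); [|apply (is_lim_seq_taylor_coef _ 1); assumption].
exists 1%nat. intros N HN. unfold taylor_coefN. set (f := fun n => al n * taylor_term s t 0 0 n).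
assert (Hfirst : sum1 f 1 = 1).
{ unfold f. simpl. rewrite H1. unfold taylor_term. rewrite exp_taylor_0. simpl.
  rewrite ln_1, !Rmult_0_r, Rplus_0_r, exp_0, cos_0. ring. }
assert (Htail : Rabs (sum1 f N - sum1 f 1) <= 1 * (/ 2 * pow_neg 1 2)).
{ apply sum1_tail_le; [lra|lra|lia|]. intros n Hn. unfold f. rewrite Rabs_mult. specialize (Hal n).
  pose proof (taylor_term_bound s t 0 0 n 0 ltac:(lra)) as Hterm. simpl pow in Hterm. rewrite Rmult_1_l, Rminus_0_r in Hterm.
  pose proof (pow_neg_antitone n (1 + 2) s ltac:(lra)). pose proof (Rabs_pos (taylor_term s t 0 0 n)). nra. }
rewrite Hfirst, pow_neg_1_l in Htail. apply Rabs_le_between in Htail. lra.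
Qed.

(* The squared modulus of the Dirichlet series at [3 - y + i t]. *)
Definition taylor_norm2 (al : nat -> R) (t y : R) : R :=
  PSeries (taylor_coef al 3 t 0) (- y) ^ 2 + PSeries (taylor_coef al 3 t (PI / 2)) (- y) ^ 2.

Lemma taylor_norm2_nonneg al t y : 0 <= taylor_norm2 al t y.
Proof. unfold taylor_norm2. nra. Qed.

Section RightHalfPlane.
Variable (al : nat -> R).
Hypothesis Hmul : forall m n, al (m * n)%nat = al m * al n.
Hypothesis Habs : forall n, Rabs (al n) <= 1.
Hypothesis H1 : al 1%nat = 1.

Lemma modulus_right_of_one s t y : 3 <= s -> 0 <= y < s - 1 ->
  let a := taylor_coef al s t 0 in let b := taylor_coef al s t (PI / 2) in
  PSeries a (- y) ^ 2 + PSeries b (- y) ^ 2 =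
  (a 0%nat ^ 2 + b 0%nat ^ 2) * exp (2 * PSeries (PS_Int (taylor_coef (log_coef al) s t 0)) (- y)).
Proof.
intros Hs Hy a b. set (e := (s - 1 - y) / 4). assert (He : 0 < e) by (unfold e; lra). assert (0 < / e) by pos.
set (r := s - 1 - 2 * e). assert (Hr : y < r) by (unfold r, e; lra).
set (K := Rmax (1 + / e) (/ e * (1 + / e))).
assert (HK1 : 0 <= 1 + / e <= K) by (split; [lra|apply Rmax_l]).
assert (HK2 : 0 <= / e * (1 + / e) <= K) by (split; [nra|apply Rmax_r]).
apply (modulus_along_ray a b _ (taylor_coef (log_coef al) s t (PI / 2)) K r); [|rewrite Rabs_Ropp, Rabs_pos_eq; lra].
split; [lra|lra| | | | |apply dirichlet_log_derivative; assumption].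
- apply (geom_bound_weaken _ (1 + / e) _ r); [lra|exact HK1|].
  apply taylor_coef_bound; try assumption; (lra || (unfold r; lra)).
- apply (geom_bound_weaken _ (1 + / e) _ r); [lra|exact HK1|].
  apply taylor_coef_bound; try assumption; (lra || (unfold r; lra)).
- apply (geom_bound_weaken _ (/ e * (1 + / e)) _ r); [lra|exact HK2|].
  apply taylor_log_coef_bound; try assumption; (lra || (unfold r; lra)).
- apply (geom_bound_weaken _ (/ e * (1 + / e)) _ r); [lra|exact HK2|].
  apply taylor_log_coef_bound; try assumption; (lra || (unfold r; lra)).
Qed.

Lemma dirichlet_value_right_of_one s t : 1 < s -> exists u v, is_dirichlet_value al s t u v /\ 0 < u ^ 2 + v ^ 2.
Proof.
intros Hs. set (s0 := Rmax 3 s). assert (Hs0 : 3 <= s0) by apply Rmax_l. assert (Hs0' : s <= s0) by apply Rmax_r.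
set (y := s0 - s). assert (Hy : 0 <= y < s0 - 1) by (unfold y; lra).
set (e := (s0 - 1 - y) / 2).
assert (Hconv : taylor_convergent al (1 + / e) (s0 - 1 - e) s0 t)
  by (apply taylor_convergent_abs; try assumption; unfold e; lra).
pose proof (dirichlet_value_real_shift al _ _ s0 t (- y) Hconv ltac:(rewrite Rabs_Ropp, Rabs_pos_eq; unfold e; lra)) as Hval.
replace (s0 + - y) with s in Hval by (unfold y; ring).
eexists. eexists. split; [exact Hval|].
rewrite (modulus_right_of_one s0 t y Hs0 Hy). apply Rmult_lt_0_compat; [|apply exp_pos].
pose proof (taylor_coef_0_lower al s0 t H1 Habs Hs0). nra.
Qed.

Definition taylor_log (t y : R) : R := PSeries (PS_Int (taylor_coef (log_coef al) 3 t 0)) (- y).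

Lemma taylor_norm2_lower t y : 0 <= y < 2 -> 1 / 4 * exp (2 * taylor_log t y) <= taylor_norm2 al t y.
Proof.
intros Hy. unfold taylor_norm2. rewrite (modulus_right_of_one 3 t y ltac:(lra) ltac:(lra)).
apply Rmult_le_compat_r; [left; apply exp_pos|].
pose proof (taylor_coef_0_lower al 3 t H1 Habs ltac:(lra)). nra.
Qed.

Lemma ex_series_taylor_log t y : 0 <= y < 2 -> ex_series (fun k => PS_Int (taylor_coef (log_coef al) 3 t 0) k * (- y) ^ k).
Proof.
intros Hy. set (e := (2 - y) / 4). assert (He : 0 < e) by (unfold e; lra). assert (0 < / e) by pos.
apply ex_series_Rabs, CV_disk_inside.
apply (geom_bound_radius _ (/ e * (1 + / e) * (2 - 2 * e)) (2 - 2 * e));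
  [unfold e; lra| |rewrite Rabs_Ropp, Rabs_pos_eq; unfold e; lra].
apply PS_Int_bound; [unfold e; lra|nra|]. apply taylor_log_coef_bound; try assumption; unfold e; lra.
Qed.
End RightHalfPlane.

Section ThreeFourOne.
Variable (al : nat -> R).
Hypothesis Hmul : forall m n, al (m * n)%nat = al m * al n.
Hypothesis Hval : forall n, al n = -1 \/ al n = 0 \/ al n = 1.
Hypothesis H1 : al 1%nat = 1.

Lemma sign_value_abs n : Rabs (al n) <= 1.
Proof.
destruct (Hval n) as [-> | [-> | ->]]; [rewrite Rabs_left; lra|rewrite Rabs_R0; lra|rewrite Rabs_R1; lra].
Qed.

Lemma three_four_one_nonneg (c t L : R) : c = -1 \/ c = 0 \/ c = 1 ->
  0 <= 3 * cos (0 * L + 0) + 4 * (c * cos (t * L + 0)) + cos (2 * t * L + 0).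
Proof.
intros Hc. rewrite !Rplus_0_r, Rmult_0_l, cos_0. replace (2 * t * L) with (2 * (t * L)) by ring.
rewrite cos_2a_cos. pose proof (COS_bound (t * L)). destruct Hc as [-> | [-> | ->]]; nra.
Qed.

Lemma exp_taylor_sign s j x : 0 <= x -> 0 <= (-1) ^ j * exp_taylor s j x.
Proof.
intros Hx. unfold exp_taylor. replace (- x) with (-1 * x) by ring. rewrite Rpow_mult_distr.
replace ((-1) ^ j * (exp (- s * x) * ((-1) ^ j * x ^ j / INR (fact j)))) with
  ((-1 * -1) ^ j * (exp (- s * x) * (x ^ j / INR (fact j)))) by (rewrite Rpow_mult_distr; unfold Rdiv; ring).
replace (-1 * -1) with 1 by ring. rewrite pow1, Rmult_1_l.
apply Rmult_le_pos; [pos|]. apply Rmult_le_pos; [pos|pos].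
Qed.

Lemma three_four_one_coef_sign s t j : 3 <= s ->
  0 <= (-1) ^ (S j) * (3 * taylor_coef (log_coef const1) s 0 0 j + 4 * taylor_coef (log_coef al) s t 0 j +
    taylor_coef (log_coef const1) s (2 * t) 0 j).
Proof.
intros Hs. set (p1 := fun N => taylor_coefN (log_coef const1) s 0 0 N j).
set (p2 := fun N => taylor_coefN (log_coef al) s t 0 N j).
set (p3 := fun N => taylor_coefN (log_coef const1) s (2 * t) 0 N j).
eapply (is_lim_seq_le (fun _ => 0) (fun N => (-1) ^ (S j) * (3 * p1 N + 4 * p2 N + p3 N)) 0
  (Finite (_ * (3 * _ + 4 * _ + _)))).
- intros N. unfold p1, p2, p3, taylor_coefN. rewrite <- !sum1_scal, <- !sum1_plus, <- sum1_scal. apply sum1_nonneg.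
  intros n _.
  unfold log_coef, const1, taylor_term. set (g := exp_taylor s j (lg n)).
  replace ((-1) ^ S j * (3 * (- (mangoldt n * 1) * (g * cos (0 * lg n + 0))) + 4 *
    (- (mangoldt n * al n) * (g * cos (t * lg n + 0))) +
     - (mangoldt n * 1) * (g * cos (2 * t * lg n + 0)))) with
   (mangoldt n * ((-1) ^ j * g) * (3 * cos (0 * lg n + 0) + 4 * (al n * cos (t * lg n + 0)) + cos (2 * t * lg n + 0)))
     by (simpl pow; ring).
  apply Rmult_le_pos; [apply Rmult_le_pos;
    [apply mangoldt_nonneg|apply exp_taylor_sign, ln_INR_nonneg]|apply three_four_one_nonneg, Hval].
- apply is_lim_seq_const.
- apply is_lim_seq_scal_R, is_lim_seq_plus'; [apply is_lim_seq_plus'; apply is_lim_seq_scal_R|];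
    (apply is_lim_seq_taylor_log_coef; [apply const1_abs || apply sign_value_abs|exact Hs]).
Qed.

Lemma three_four_one_log t y : 0 <= y < 2 ->
  0 <= 3 * taylor_log const1 0 y + 4 * taylor_log al t y + taylor_log const1 (2 * t) y.
Proof.
intros Hy. unfold taylor_log, PSeries.
pose proof (ex_series_taylor_log const1 const1_abs 0 y Hy) as Hzeta.
pose proof (ex_series_taylor_log al sign_value_abs t y Hy) as Hal.
pose proof (ex_series_taylor_log const1 const1_abs (2 * t) y Hy) as Hzeta2.
apply (ex_series_scal (V := R_NormedModule) 3) in Hzeta. apply (ex_series_scal (V := R_NormedModule) 4) in Hal.
pose proof (ex_series_plus (V := R_NormedModule) _ _ Hzeta Hal) as Hsum.
rewrite <- !Series_scal_l, <- !Series_plus by (exact Hzeta || exact Hal || exact Hsum || exact Hzeta2).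
rewrite <- (is_series_unique _ _ is_series_0) at 1.
apply Series_le; [|exact (ex_series_plus (V := R_NormedModule) _ _ Hsum Hzeta2)].
intros k. split; [lra|]. destruct k as [|k]; [simpl; lra|].
pose proof (three_four_one_coef_sign 3 t k ltac:(lra)) as Hsign.
unfold PS_Int. replace (- y) with (-1 * y) by ring. rewrite Rpow_mult_distr. unfold Rdiv.
match type of Hsign with 0 <= ?c => apply Rle_trans with (c * (y ^ S k * / INR (S k))) end; [|right; ring].
apply Rmult_le_pos; [exact Hsign|]. apply Rmult_le_pos; pos.
Qed.

Lemma three_four_one_product t y : 0 <= y < 2 ->
  (1 / 4) ^ 8 <= taylor_norm2 const1 0 y ^ 3 * taylor_norm2 al t y ^ 4 * taylor_norm2 const1 (2 * t) y.
Proof.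
intros Hy. pose proof (three_four_one_log t y Hy) as Hlog.
pose proof (taylor_norm2_lower const1 const1_mult const1_abs eq_refl 0 y Hy) as Hzeta.
pose proof (taylor_norm2_lower al Hmul sign_value_abs H1 t y Hy) as Hal.
pose proof (taylor_norm2_lower const1 const1_mult const1_abs eq_refl (2 * t) y Hy) as Hzeta2.
set (F1 := taylor_log const1 0 y) in *. set (F2 := taylor_log al t y) in *. set (F3 := taylor_log const1 (2 * t) y) in *.
apply Rle_trans with ((1 / 4 * exp (2 * F1)) ^ 3 * (1 / 4 * exp (2 * F2)) ^ 4 * (1 / 4 * exp (2 * F3))).
- replace ((1 / 4 * exp (2 * F1)) ^ 3 * (1 / 4 * exp (2 * F2)) ^ 4 * (1 / 4 * exp (2 * F3)))
    with ((1 / 4) ^ 8 * exp (2 * (3 * F1 + 4 * F2 + F3))).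
  + rewrite <- (Rmult_1_r ((1 / 4) ^ 8)) at 1. apply Rmult_le_compat_l; [pos|].
    rewrite <- exp_0. apply exp_le_compat. lra.
  + rewrite !Rpow_mult_distr, <- !exp_INR_mult.
    replace (2 * (3 * F1 + 4 * F2 + F3)) with (INR 3 * (2 * F1) + INR 4 * (2 * F2) + 2 * F3) by (simpl; ring).
    rewrite !exp_plus. ring.
- pose proof (exp_pos (2 * F1)). pose proof (exp_pos (2 * F2)). pose proof (exp_pos (2 * F3)).
  apply Rmult_le_compat; [apply Rmult_le_pos; apply pow_le; lra|lra| |exact Hzeta2].
  apply Rmult_le_compat; [apply pow_le; lra|apply pow_le; lra|apply pow_incr; lra|apply pow_incr; lra].
Qed.

End ThreeFourOne.

Lemma dirichlet_value_const1_right_of_one t y : 0 <= y < 2 ->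
  is_dirichlet_value const1 (3 - y) t (PSeries (taylor_coef const1 3 t 0) (- y))
    (PSeries (taylor_coef const1 3 t (PI / 2)) (- y)).
Proof.
intros Hy. apply (dirichlet_value_real_shift const1 (1 + / ((2 - y) / 2)) (2 - (2 - y) / 2) 3 t (- y)).
- apply taylor_convergent_abs; [apply const1_abs|lra|lra|lra|lra].
- rewrite Rabs_Ropp, Rabs_pos_eq; lra.
Qed.

Lemma taylor_norm2_zeta_real y : 0 <= y < 2 -> taylor_norm2 const1 0 y <= (1 + / (2 - y)) ^ 2.
Proof.
intros Hy. destruct (dirichlet_value_const1_right_of_one 0 y Hy) as [Hre Him].
unfold taylor_norm2. set (u := PSeries (taylor_coef const1 3 0 0) (- y)) in *.
assert (Hv : PSeries (taylor_coef const1 3 0 (PI / 2)) (- y) = 0).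
{ apply (is_lim_seq_unique_R _ _ _ Him). apply (is_lim_seq_ext (fun _ => 0)); [|apply is_lim_seq_const].
  intros N. unfold dirichlet_sum. rewrite (sum1_ext _ (fun _ => 0)); [symmetry; apply sum1_0|].
  intros n _. rewrite Rmult_0_l, Rplus_0_l, cos_PI2. ring. }
assert (Hu : Rabs u <= 1 + / (2 - y)).
{ apply (is_lim_seq_Rabs_le (dirichlet_sum const1 (3 - y) 0 0)); [|exact Hre]. intros N.
  eapply Rle_trans; [|apply (sum1_pow_neg_le (2 - y) N); lra]. apply Rabs_sum1_le. intros n _.
  rewrite Rmult_0_l, Rplus_0_l, cos_0. unfold const1. rewrite Rmult_1_l, Rmult_1_r, Rabs_pos_eq by (left; apply pow_neg_pos).
  replace (3 - y) with (1 + (2 - y)) by ring. lra. }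
rewrite Hv, <- (pow2_abs u). replace (0 ^ 2) with 0 by ring. rewrite Rplus_0_r. apply pow_incr.
split; [apply Rabs_pos|exact Hu].
Qed.

Lemma is_derive_zero_linear_bound (f : R -> R) (x l : R) : is_derive f x l -> f x = 0 ->
  exists d K, 0 < d /\ 0 <= K /\ forall h, Rabs h < d -> Rabs (f (x + h)) <= K * Rabs h.
Proof.
intros Hf H0. apply is_derive_Reals in Hf. destruct (Hf 1 Rlt_0_1) as [d Hd].
exists d, (Rabs l + 1). split; [apply cond_pos|split; [pose proof (Rabs_pos l); lra|]].
intros h Hh. destruct (Req_dec h 0) as [-> | Hh0]; [rewrite Rplus_0_r, H0, Rabs_R0; lra|].
specialize (Hd h Hh0 Hh). rewrite H0, Rminus_0_r in Hd.
replace (f (x + h)) with ((f (x + h) / h - l + l) * h) by (field; exact Hh0).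
rewrite Rabs_mult. apply Rmult_le_compat_r; [apply Rabs_pos|].
eapply Rle_trans; [apply Rabs_triang|]. lra.
Qed.

Lemma taylor_norm2_double_zero be C r t : taylor_convergent be C r 3 t -> 2 < r -> is_dirichlet_value be 1 t 0 0 ->
  exists d K, 0 < d /\ 0 <= K /\ forall h, 0 <= h < d -> taylor_norm2 be t (2 - h) <= K * h ^ 2.
Proof.
intros Hbe Hr Hzero.
assert (Hx : Rabs (-2) < r) by (rewrite Rabs_left; lra).
pose proof (dirichlet_value_real_shift be C r 3 t (-2) Hbe Hx) as Hval. replace (3 + -2) with 1 in Hval by ring.
destruct (is_dirichlet_value_unique _ _ _ _ _ _ _ Hval Hzero) as [Hre Him].
assert (Hder : forall ph, is_derive (PSeries (taylor_coef be 3 t ph)) (-2)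
  (PSeries (PS_derive (taylor_coef be 3 t ph)) (-2))).
{ intros ph. apply is_derive_PSeries, (geom_bound_radius _ C r);
    [apply Hbe|apply taylor_convergent_coef_bound, Hbe|exact Hx]. }
destruct (is_derive_zero_linear_bound _ _ _ (Hder 0) Hre) as (d1 & K1 & Hd1 & HK1 & Hbound1).
destruct (is_derive_zero_linear_bound _ _ _ (Hder (PI / 2)) Him) as (d2 & K2 & Hd2 & HK2 & Hbound2).
exists (Rmin d1 d2), (K1 ^ 2 + K2 ^ 2). split; [apply Rmin_glb_lt; assumption|split; [nra|]].
intros h Hh. pose proof (Rmin_l d1 d2). pose proof (Rmin_r d1 d2).
assert (Habs : Rabs h = h) by (apply Rabs_pos_eq; lra).
specialize (Hbound1 h ltac:(lra)). specialize (Hbound2 h ltac:(lra)). rewrite Habs in Hbound1, Hbound2.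
unfold taylor_norm2. replace (- (2 - h)) with (-2 + h) by ring.
rewrite Rmult_plus_distr_r, <- !Rpow_mult_distr. apply Rplus_le_compat; apply pow_maj_Rabs; assumption.
Qed.

Lemma three_four_one_no_zero (al be : nat -> R) (t c C r K2 d0 : R) :
  (forall m n, al (m * n)%nat = al m * al n) -> (forall n, al n = -1 \/ al n = 0 \/ al n = 1) -> al 1%nat = 1 ->
  taylor_convergent be C r 3 t -> 2 < r -> 0 < c -> 0 < d0 ->
  (forall y, 2 - d0 < y < 2 -> 0 <= y -> c * taylor_norm2 al t y <= taylor_norm2 be t y) ->
  (forall y, 2 - d0 < y < 2 -> 0 <= y -> taylor_norm2 const1 (2 * t) y <= K2) -> ~ is_dirichlet_value be 1 t 0 0.
Proof.
intros Hmul Hval H1 Hbe Hr Hc Hd0 Hcompare HK2 Hzero.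
destruct (taylor_norm2_double_zero be C r t Hbe Hr Hzero) as (d & K & Hd & HK & Hnorm).
set (Q := 64 * (K / c) ^ 4 * (Rabs K2 + 1)). set (h0 := Rmin d (Rmin d0 1)).
assert (Hh0 : 0 < h0) by (repeat apply Rmin_glb_lt; lra).
assert (Hlow : forall h, 0 < h < h0 -> (1 / 4) ^ 8 <= Q * h ^ 2).
{ intros h Hh. assert (Hh' : h < d /\ h < d0 /\ h < 1).
  { unfold h0 in Hh. pose proof (Rmin_l d (Rmin d0 1)). pose proof (Rmin_r d (Rmin d0 1)).
    pose proof (Rmin_l d0 1). pose proof (Rmin_r d0 1). lra. }
  specialize (Hcompare (2 - h) ltac:(lra) ltac:(lra)). specialize (HK2 (2 - h) ltac:(lra) ltac:(lra)).
  specialize (Hnorm h ltac:(lra)).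
  assert (Hzeta : taylor_norm2 const1 0 (2 - h) <= (2 / h) ^ 2).
  { eapply Rle_trans; [apply taylor_norm2_zeta_real; lra|]. replace (2 - (2 - h)) with h by ring.
    apply pow_incr. assert (1 <= / h) by (rewrite <- Rinv_1; apply Rinv_le_contravar; lra). unfold Rdiv. lra. }
  assert (Hal : taylor_norm2 al t (2 - h) <= K / c * h ^ 2).
  { apply Rmult_le_reg_l with c; [exact Hc|]. replace (c * (K / c * h ^ 2)) with (K * h ^ 2) by (field; lra). lra. }
  assert (Hzeta2 : taylor_norm2 const1 (2 * t) (2 - h) <= Rabs K2 + 1) by (pose proof (Rle_abs K2); lra).
  eapply Rle_trans; [apply (three_four_one_product al Hmul Hval H1 t (2 - h)); lra|].
  replace (Q * h ^ 2) with (((2 / h) ^ 2) ^ 3 * (K / c * h ^ 2) ^ 4 * (Rabs K2 + 1)) by (unfold Q; field; lra).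
  pose proof (taylor_norm2_nonneg const1 0 (2 - h)). pose proof (taylor_norm2_nonneg al t (2 - h)).
  apply Rmult_le_compat; [apply Rmult_le_pos; apply pow_le; assumption|apply taylor_norm2_nonneg| |exact Hzeta2].
  apply Rmult_le_compat; [apply pow_le; assumption|apply pow_le; assumption|apply pow_incr; lra|apply pow_incr; lra]. }
assert (Hlim : - (Q * 0 ^ 2) <= - (1 / 4) ^ 8).
{ apply (continuous_le_left (fun x => - (Q * x ^ 2)) (- h0));
    [lra| |eapply continuous_is_derive; auto_derive; [exact I|reflexivity]].
  intros x Hx. specialize (Hlow (- x) ltac:(lra)). replace ((- x) ^ 2) with (x ^ 2) in Hlow by ring. lra. }
assert (0 < (1 / 4) ^ 8) by pos. lra.
Qed.

(* [alt_coef l] are the coefficients of [(1 - l^(1-s)) zeta(s)]; for [l = 2] this is eta. *)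
Definition alt_coef (l n : nat) : R := 1 - (if Nat.eqb (n mod l) 0 then INR l else 0).

Lemma sum1_alt_coef l N : (2 <= l)%nat -> sum1 (alt_coef l) N = INR (N mod l).
Proof.
intros Hl. induction N as [|N IH]; [rewrite Nat.Div0.mod_0_l; reflexivity|].
rewrite sum1_succ, IH. unfold alt_coef.
pose proof (Nat.div_mod_eq N l) as Hdiv. pose proof (Nat.mod_upper_bound N l ltac:(lia)) as Hmod.
destruct (Nat.eq_dec (S (N mod l)) l) as [Hlast|Hnot].
- replace (S N mod l)%nat with 0%nat by (apply (Nat.mod_unique _ _ (S (N / l))); [lia|rewrite Nat.mul_succ_r; lia]).
  simpl Nat.eqb. cbv iota. rewrite <- Hlast at 2. rewrite S_INR. simpl INR. ring.
- replace (S N mod l)%nat with (S (N mod l)) by (apply (Nat.mod_unique _ _ (N / l)); lia).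
  simpl Nat.eqb. cbv iota. rewrite S_INR. ring.
Qed.

Lemma taylor_convergent_alt_coef l s t r : (2 <= l)%nat -> 3 <= s -> 0 < r < s ->
  taylor_convergent (alt_coef l) (INR l * (1 + (s + Rabs t + r) * (1 + / (s - r)))) r s t.
Proof.
intros Hl Hs Hr. apply (taylor_convergent_of_bounded_sums _ _ (INR l)); [| |exact Hs|exact Hr].
- intros N. rewrite sum1_alt_coef by exact Hl. rewrite Rabs_pos_eq by apply pos_INR.
  apply le_INR. pose proof (Nat.mod_upper_bound N l ltac:(lia)). lia.
- intros n. unfold alt_coef. assert (2 <= INR l) by (apply (le_INR 2); exact Hl).
  destruct (Nat.eqb _ _); [rewrite Rabs_left1; lra|rewrite Rabs_pos_eq; lra].
Qed.

Lemma dirichlet_sum_phase al s t ph d N : dirichlet_sum al s t (ph + d) N = cos d * dirichlet_sum al s t ph N + sin d *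
  dirichlet_sum al s t (ph + PI / 2) N.
Proof.
unfold dirichlet_sum. rewrite <- !sum1_scal, <- sum1_plus. apply sum1_ext. intros n _.
rewrite <- !Rplus_assoc, !cos_plus, cos_PI2, sin_PI2. ring.
Qed.

Lemma dirichlet_sum_half_turn al s t N : dirichlet_sum al s t (PI / 2 + PI / 2) N = - dirichlet_sum al s t 0 N.
Proof.
unfold dirichlet_sum. rewrite <- sum1_opp. apply sum1_ext. intros n _.
replace (t * lg n + (PI / 2 + PI / 2)) with (t * lg n + 0 + PI) by field. rewrite neg_cos. ring.
Qed.

Lemma sum1_multiples_mult f l M : (1 <= l)%nat ->
  sum1 (fun n => if Nat.eqb (n mod l) 0 then f n else 0) (l * M) = sum1 (fun e => f (l * e)%nat) M.
Proof.
intros Hl. rewrite sum1_multiples by exact Hl.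
enough (Hquot : forall K, (M <= K)%nat ->
  sum1 (fun e => if Nat.leb (l * e) (l * M) then f (l * e)%nat else 0) K = sum1 (fun e => f (l * e)%nat) M)
    by (apply Hquot; nia).
intros K HK. induction HK as [|K HK IH].
- apply sum1_ext. intros e He. destruct (Nat.leb_spec (l * e) (l * M)); [reflexivity|nia].
- rewrite sum1_succ, IH. destruct (Nat.leb_spec (l * S K) (l * M)); [nia|ring].
Qed.

Lemma dirichlet_sum_alt_coef l s t ph M : (2 <= l)%nat ->
  dirichlet_sum (alt_coef l) s t ph (l * M) = dirichlet_sum const1 s t ph (l * M) - pow_neg l (s - 1) *
    dirichlet_sum const1 s t (ph + t * lg l) M.
Proof.
intros Hl. assert (HL : 0 < INR l) by pos.
set (f := fun n => INR l * (pow_neg n s * cos (t * lg n + ph))).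
transitivity (dirichlet_sum const1 s t ph (l * M) - sum1 (fun n => if Nat.eqb (n mod l) 0 then f n else 0) (l * M)).
- unfold dirichlet_sum. rewrite <- sum1_minus. apply sum1_ext. intros n _. unfold alt_coef, const1, f.
  destruct (Nat.eqb _ _); ring.
- f_equal. rewrite sum1_multiples_mult by lia. unfold dirichlet_sum. rewrite <- sum1_scal. apply sum1_ext. intros n Hn.
  unfold f, const1.
  rewrite pow_neg_mult, mult_INR, ln_mult, Rmult_1_l by (try apply lt_0_INR; lia).
  replace (t * lg n + (ph + t * lg l)) with (t * (lg l + lg n) + ph) by ring.
  rewrite <- !Rmult_assoc. do 2 f_equal. unfold pow_neg.
  rewrite <- (exp_ln (INR l)) at 1 by exact HL. rewrite <- exp_plus. f_equal. ring.
Qed.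

Lemma is_lim_seq_multiples f (u : R) l : (1 <= l)%nat -> is_lim_seq f u -> is_lim_seq (fun M => f (l * M)%nat) u.
Proof.
intros Hl Hf. apply (is_lim_seq_subseq f u (fun M => (l * M)%nat)); [|exact Hf].
intros P [N HN]. exists N. intros n Hn. apply HN. nia.
Qed.

Lemma alt_coef_zeta_sum l s t M : (2 <= l)%nat -> (1 <= M)%nat ->
  let g := pow_neg l (s - 1) in let d := t * lg l in
  let U := dirichlet_sum (alt_coef l) s t 0 (l * M) in let V := dirichlet_sum (alt_coef l) s t (PI / 2) (l * M) in
  (s - 1) * U - t * V = zeta_sum_re s t (l * M) - g * (cos d * zeta_sum_re s t M + sin d * zeta_sum_im s t M) /\
  (s - 1) * V + t * U = zeta_sum_im s t (l * M) - g * (cos d * zeta_sum_im s t M - sin d * zeta_sum_re s t M).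
Proof.
intros Hl HM g d U V. unfold U, V. rewrite !dirichlet_sum_alt_coef by exact Hl. fold g d.
rewrite (dirichlet_sum_phase const1 s t 0 d), (dirichlet_sum_phase const1 s t (PI / 2) d), Rplus_0_l, dirichlet_sum_half_turn.
unfold zeta_sum_re, zeta_sum_im. rewrite !(pow_neg_mult l M) by lia. fold g.
rewrite !mult_INR, !ln_mult by pos.
rewrite !Rplus_0_r, !(Rmult_plus_distr_l t). fold d.
set (x := t * lg M).
rewrite !(cos_plus _ (PI / 2)), cos_PI2, sin_PI2, cos_plus, sin_plus. split; ring.
Qed.

Lemma alt_coef_zero_of_zeta_zero l s t U V : (2 <= l)%nat -> (s <> 1 \/ t <> 0) ->
  is_lim_seq (zeta_sum_re s t) 0 -> is_lim_seq (zeta_sum_im s t) 0 -> is_dirichlet_value (alt_coef l) s t U V ->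
    U = 0 /\ V = 0.
Proof.
intros Hl Hst Hre Him [HU HV].
apply (is_lim_seq_multiples _ _ l ltac:(lia)) in HU. apply (is_lim_seq_multiples _ _ l ltac:(lia)) in HV.
pose proof (is_lim_seq_multiples _ _ l ltac:(lia) Hre) as Hre_l.
pose proof (is_lim_seq_multiples _ _ l ltac:(lia) Him) as Him_l.
set (g := pow_neg l (s - 1)). set (d := t * lg l).
assert (Hreal : (s - 1) * U - t * V = 0 - g * (cos d * 0 + sin d * 0)).
{ eapply is_lim_seq_unique_R; [apply is_lim_seq_minus'; apply is_lim_seq_scal_R; eassumption|].
  apply (is_lim_seq_ext_loc (fun M => zeta_sum_re s t (l * M) - g * (cos d * zeta_sum_re s t M + sin d * zeta_sum_im s t M))).
  - exists 1%nat. intros M HM. symmetry. apply (proj1 (alt_coef_zeta_sum l s t M Hl HM)).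
  - apply is_lim_seq_minus'; [exact Hre_l|]. apply is_lim_seq_scal_R, is_lim_seq_plus'; apply is_lim_seq_scal_R; assumption. }
assert (Himag : (s - 1) * V + t * U = 0 - g * (cos d * 0 - sin d * 0)).
{ eapply is_lim_seq_unique_R; [apply is_lim_seq_plus'; apply is_lim_seq_scal_R; eassumption|].
  apply (is_lim_seq_ext_loc (fun M => zeta_sum_im s t (l * M) - g * (cos d * zeta_sum_im s t M - sin d * zeta_sum_re s t M))).
  - exists 1%nat. intros M HM. symmetry. apply (proj2 (alt_coef_zeta_sum l s t M Hl HM)).
  - apply is_lim_seq_minus'; [exact Him_l|].
    apply is_lim_seq_scal_R, is_lim_seq_minus'; apply is_lim_seq_scal_R; assumption. }
rewrite !Rmult_0_r, Rplus_0_r, Rmult_0_r, Rminus_0_r in Hreal. rewrite !Rmult_0_r, Rminus_0_r, Rmult_0_r, Rminus_0_r in Himag.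
assert (Hpos : 0 < (s - 1) ^ 2 + t ^ 2).
{ pose proof (pow2_ge_0 (s - 1)). pose proof (pow2_ge_0 t).
  destruct Hst as [Hs|Ht]; [assert (0 < (s - 1) ^ 2) by (apply pow2_gt_0; lra)|assert (0 < t ^ 2)
    by (apply pow2_gt_0; lra)]; lra. }
split; apply (Rmult_eq_reg_l ((s - 1) ^ 2 + t ^ 2)); try lra.
- transitivity ((s - 1) * ((s - 1) * U - t * V) + t * ((s - 1) * V + t * U)); [ring|]. rewrite Hreal, Himag. ring.
- transitivity ((s - 1) * ((s - 1) * V + t * U) - t * ((s - 1) * U - t * V)); [ring|]. rewrite Hreal, Himag. ring.
Qed.

Lemma cos_eq_1_sin_eq_0 x : cos x = 1 -> sin x = 0.
Proof.
intros Hcos. pose proof (sin2_cos2 x) as Hpyth. unfold Rsqr in Hpyth. rewrite Hcos in Hpyth.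
apply Rsqr_0_uniq. unfold Rsqr. lra.
Qed.

Lemma exists_cos_ln_lt_1 t : t <> 0 -> exists l, (2 <= l)%nat /\ cos (t * lg l) < 1.
Proof.
intros Ht. destruct (nfloor_ex (Rabs t)) as [n [_ Hn]]; [apply Rabs_pos|].
set (l := S (S n)). assert (HL : Rabs t < INR l) by (unfold l; rewrite !S_INR in *; lra).
assert (Hl : (2 <= l)%nat) by (unfold l; lia). assert (HLp : 0 < INR l) by pos.
destruct (Rlt_dec (cos (t * lg l)) 1) as [Hlt|Hge]; [exists l; auto|].
exists (S l). split; [lia|]. apply Rnot_le_lt. intros Hge'.
assert (Hcos : cos (t * lg l) = 1) by (pose proof (COS_bound (t * lg l)); lra).
assert (Hcos' : cos (t * lg (S l)) = 1) by (pose proof (COS_bound (t * lg (S l))); lra).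
set (w := t * (lg (S l) - lg l)).
assert (Hcos_w : cos w = 1).
{ unfold w. rewrite Rmult_minus_distr_l, cos_minus, Hcos, Hcos', !cos_eq_1_sin_eq_0 by assumption. ring. }
assert (Hstep : 0 < lg (S l) - lg l <= / INR l).
{ split; [|apply ln_INR_succ_minus; lia].
  assert (lg l < lg (S l)) by (apply ln_increasing; [exact HLp|apply lt_INR; lia]). lra. }
assert (Hw : 0 < Rabs w < 1).
{ unfold w. rewrite Rabs_mult, (Rabs_pos_eq (_ - _)) by lra. split; [apply Rmult_lt_0_compat; [apply Rabs_pos_lt, Ht|lra]|].
  apply Rle_lt_trans with (Rabs t * / INR l); [apply Rmult_le_compat_l; [apply Rabs_pos|lra]|].
  apply (Rlt_div_l (Rabs t)); lra. }
assert (Hcos_abs : cos (Rabs w) = 1) by (unfold Rabs; destruct (Rcase_abs w); [rewrite cos_neg|]; exact Hcos_w).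
assert (Hdecr : cos (Rabs w) < cos 0) by (pose proof PI2_1; apply cos_decreasing_1; lra).
rewrite cos_0 in Hdecr. lra.
Qed.

Lemma ex_taylor_convergent_alt_coef l t : (2 <= l)%nat -> exists C, taylor_convergent (alt_coef l) C (11 / 4) 3 t.
Proof. intros Hl. eexists. apply taylor_convergent_alt_coef; [exact Hl|lra|lra]. Qed.

Lemma dirichlet_value_alt_coef l s t u v U V : (2 <= l)%nat ->
  is_dirichlet_value const1 s t u v -> is_dirichlet_value (alt_coef l) s t U V ->
  let g := pow_neg l (s - 1) in let d := t * lg l in
  U = u - g * (cos d * u + sin d * v) /\ V = v - g * (cos d * v + sin d * - u).
Proof.
intros Hl [Hu Hv] [HU HV] g d.
apply (is_lim_seq_multiples _ _ l ltac:(lia)) in HU. apply (is_lim_seq_multiples _ _ l ltac:(lia)) in HV.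
split; [apply (is_lim_seq_unique_R _ _ _ HU)|apply (is_lim_seq_unique_R _ _ _ HV)];
  (eapply is_lim_seq_ext; [intros M; symmetry; rewrite dirichlet_sum_alt_coef by exact Hl; fold d;
    rewrite dirichlet_sum_phase; reflexivity|]);
  (apply is_lim_seq_minus'; [apply is_lim_seq_multiples; [lia|assumption]|]; apply is_lim_seq_scal_R, is_lim_seq_plus';
    apply is_lim_seq_scal_R).
- exact Hu.
- rewrite Rplus_0_l. exact Hv.
- exact Hv.
- eapply is_lim_seq_ext; [intros M; symmetry; apply dirichlet_sum_half_turn|]. apply (is_lim_seq_opp _ u), Hu.
Qed.

(* [|zeta(s+it)|^2] is controlled by the entire series [alt_coef l] as soon as [l^(it) <> 1]. *)
Lemma zeta_norm2_le_alt_coef l t : (2 <= l)%nat -> cos (t * lg l) < 1 -> exists d c, 0 < d /\ 0 < c /\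
  forall y, 2 - d < y < 2 -> 0 <= y -> c * taylor_norm2 const1 t y <= taylor_norm2 (alt_coef l) t y.
Proof.
intros Hl Hcos. assert (Hln : 0 < lg l) by (rewrite <- ln_1; apply ln_increasing; [lra|apply (lt_INR 1); lia]).
exists (/ (2 * lg l)), (1 - cos (t * lg l)).
split; [pos|split; [lra|]]. intros y Hy Hy0.
pose proof (dirichlet_value_const1_right_of_one t y ltac:(lra)) as Hzeta.
destruct (ex_taylor_convergent_alt_coef l t Hl) as [C HC].
pose proof (dirichlet_value_real_shift (alt_coef l) C (11 / 4) 3 t (- y) HC ltac:(rewrite Rabs_Ropp, Rabs_pos_eq;
  lra)) as Halt.
destruct (dirichlet_value_alt_coef l (3 - y) t _ _ _ _ Hl Hzeta Halt) as [HU HV].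
unfold taylor_norm2. rewrite HU, HV.
set (u := PSeries (taylor_coef const1 3 t 0) (- y)). set (v := PSeries (taylor_coef const1 3 t (PI / 2)) (- y)).
set (g := pow_neg l (3 - y - 1)). set (d := t * lg l) in *.
assert (Hg : 1 / 2 <= g).
{ unfold g, pow_neg. eapply Rle_trans; [|apply exp_ineq1_le].
  assert ((3 - y - 1) * lg l <= / (2 * lg l) * lg l) by (apply Rmult_le_compat_r; lra).
  replace (/ (2 * lg l) * lg l) with (1 / 2) in * by (field; lra). lra. }
replace ((u - g * (cos d * u + sin d * v)) ^ 2 + (v - g * (cos d * v + sin d * - u)) ^ 2)
  with (((1 - g) ^ 2 + 2 * g * (1 - cos d)) * (u ^ 2 + v ^ 2)).
- apply Rmult_le_compat_r; [nra|]. pose proof (pow2_ge_0 (1 - g)). nra.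
- pose proof (sin2_cos2 d) as Hpyth. unfold Rsqr in Hpyth.
  transitivity ((1 - 2 * g * cos d + g ^ 2 * (sin d * sin d + cos d * cos d)) * (u ^ 2 + v ^ 2)); [rewrite Hpyth|]; ring.
Qed.

Lemma taylor_norm2_alt_coef_bounded l t : (2 <= l)%nat -> exists K, forall y, 0 <= y <= 2 ->
  taylor_norm2 (alt_coef l) t y <= K.
Proof.
intros Hl. destruct (ex_taylor_convergent_alt_coef l t Hl) as [C HC]. pose proof (taylor_const_nonneg _ _ _ _ _ HC).
set (D := C / (1 - 2 / (11 / 4))).
assert (Hbound : forall ph y, 0 <= y <= 2 -> Rabs (PSeries (taylor_coef (alt_coef l) 3 t ph) (- y)) <= D).
{ intros ph y Hy. assert (Habs : Rabs (- y) = y) by (rewrite Rabs_Ropp; apply Rabs_pos_eq; lra).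
  eapply Rle_trans; [apply (PSeries_geom_bound _ C (11 / 4)); [lra|assumption|apply taylor_convergent_coef_bound, HC|lra]|].
  rewrite Habs. unfold D, Rdiv at 1 3. apply Rmult_le_compat_l; [assumption|]. apply Rinv_le_contravar; lra. }
exists (D ^ 2 + D ^ 2). intros y Hy. apply Rplus_le_compat; apply pow_maj_Rabs, Hbound, Hy.
Qed.

Lemma zeta_bounded_near_one t : t <> 0 -> exists d K, 0 < d /\ forall y, 2 - d < y < 2 -> 0 <= y ->
  taylor_norm2 const1 t y <= K.
Proof.
intros Ht. destruct (exists_cos_ln_lt_1 t Ht) as (l & Hl & Hc).
destruct (zeta_norm2_le_alt_coef l t Hl Hc) as (d & c & Hd & Hcp & Hcompare).
destruct (taylor_norm2_alt_coef_bounded l t Hl) as [K HK].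
exists d, (K / c). split; [exact Hd|]. intros y Hy Hy0.
apply Rmult_le_reg_l with c; [exact Hcp|]. replace (c * (K / c)) with K by (field; lra).
eapply Rle_trans; [apply Hcompare; assumption|apply HK; lra].
Qed.

Theorem zeta_sum_line_one_nonzero t : t <> 0 -> is_lim_seq (zeta_sum_re 1 t) 0 -> is_lim_seq (zeta_sum_im 1 t) 0 -> False.
Proof.
intros Ht Hre Him. destruct (exists_cos_ln_lt_1 t Ht) as (l & Hl & Hcos).
destruct (zeta_norm2_le_alt_coef l t Hl Hcos) as (d & c & Hd & Hc & Hcompare).
destruct (zeta_bounded_near_one (2 * t) ltac:(lra)) as (d2 & K & Hd2 & HK).
destruct (ex_taylor_convergent_alt_coef l t Hl) as [C HC].
pose proof (Rmin_l d d2). pose proof (Rmin_r d d2).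
apply (three_four_one_no_zero const1 (alt_coef l) t c C (11 / 4) K (Rmin d d2) const1_mult); try assumption.
- intros n. right; right; reflexivity.
- reflexivity.
- lra.
- apply Rmin_glb_lt; assumption.
- intros y Hy Hy0. apply Hcompare; lra.
- intros y Hy Hy0. apply HK; lra.
- pose proof (dirichlet_value_real_shift (alt_coef l) C (11 / 4) 3 t (-2) HC ltac:(rewrite Rabs_left; lra)) as Hval.
  replace (3 + -2) with 1 in Hval by ring.
  destruct (alt_coef_zero_of_zeta_zero l 1 t _ _ Hl (or_intror Ht) Hre Him Hval) as [HU HV].
  rewrite HU, HV in Hval. exact Hval.
Qed.

Lemma taylor_convergent_real_char q ch s t r : real_char q ch -> 3 <= s -> 0 < r < s ->
  taylor_convergent ch (INR q * (1 + (s + Rabs t + r) * (1 + / (s - r)))) r s t.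
Proof.
intros Hch. apply (taylor_convergent_of_bounded_sums _ _ 1);
  [intros; apply real_char_sum_bound, Hch|intros; eapply real_char_abs, Hch].
Qed.

Theorem real_char_line_one_nonzero q ch t : real_char q ch -> t <> 0 -> ~ is_dirichlet_value ch 1 t 0 0.
Proof.
intros Hch Ht. destruct (zeta_bounded_near_one (2 * t) ltac:(lra)) as (d & K & Hd & HK).
apply (three_four_one_no_zero ch ch t 1 _ (11 / 4) K d (real_char_mul q ch Hch) (real_char_values q ch Hch)
  (real_char_1 q ch Hch) (taylor_convergent_real_char q ch 3 t (11 / 4) Hch ltac:(lra) ltac:(lra))); try lra.
- intros y _ _. lra.
- exact HK.
Qed.
(** * Nonvanishing of L(1, chi) *)

Definition divisor_sum (ch : nat -> R) (n : nat) : R := sum1 (fun d => if Nat.eqb (n mod d) 0 then ch d else 0) n.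

Lemma eqb_mod_divide n d : Nat.eqb (n mod d) 0 = true <-> Nat.divide d n.
Proof. rewrite Nat.eqb_eq. apply Nat.Lcm0.mod_divide. Qed.

Lemma divisor_sum_upto ch n N : (1 <= n <= N)%nat -> sum1 (fun d => if Nat.eqb (n mod d) 0 then ch d else 0) N =
  divisor_sum ch n.
Proof.
intros [H1 H]. unfold divisor_sum. induction H as [|N H IH]; [reflexivity|]. rewrite sum1_succ, IH.
rewrite Nat.mod_small by lia. destruct (Nat.eqb_spec n 0); [lia|ring].
Qed.

Lemma eqb_mod_iff n d n' d' : (Nat.divide d n <-> Nat.divide d' n') -> Nat.eqb (n mod d) 0 = Nat.eqb (n' mod d') 0.
Proof. intros H. apply Bool.eq_iff_eq_true. rewrite !eqb_mod_divide. exact H. Qed.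

Lemma gcd_prime_pow p e j : prime (Z.of_nat p) -> ~ Nat.divide p e -> Nat.gcd e (p ^ j) = 1%nat.
Proof.
intros Hp He. induction j as [|j IH]; [apply Nat.divide_1_r, Nat.gcd_divide_r|].
rewrite Nat.pow_succ_r', gcd_mult_eq_1. split; [apply prime_not_divide_gcd; assumption|exact IH].
Qed.

Section PrimePowerDivisors.
Variables (p k m : nat).
Hypothesis Hp : prime (Z.of_nat p).
Hypothesis Hpm : ~ Nat.divide p m.

Lemma prime_pow_neq_0 j : (p ^ j <> 0)%nat.
Proof. apply Nat.pow_nonzero. apply prime_ge_2 in Hp. lia. Qed.

Lemma divide_prime_pow_succ d :
  Nat.divide d (p ^ S k * m) <-> Nat.divide d (p ^ k * m) \/ exists w, d = (w * p ^ S k)%nat /\ Nat.divide w m.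
Proof.
split.
- intros [e He]. destruct (classic (Nat.divide p e)) as [[e' He']|Hpe].
  + left. exists e'. apply (Nat.mul_cancel_l _ _ p); [apply prime_ge_2 in Hp; lia|].
    rewrite Nat.mul_assoc, <- Nat.pow_succ_r', He, He'. ring.
  + right. destruct (Nat.gauss (p ^ S k) e d) as [w Hw].
    * exists m. rewrite <- He. ring.
    * rewrite Nat.gcd_comm. apply gcd_prime_pow; assumption.
    * exists w. split; [exact Hw|]. exists e. apply (Nat.mul_cancel_l _ _ (p ^ S k)); [apply prime_pow_neq_0|].
      rewrite He, Hw. ring.
- intros [[u Hu]|(w & -> & [u ->])].
  + exists (p * u)%nat. rewrite Nat.pow_succ_r', <- Nat.mul_assoc, Hu. ring.
  + exists u. ring.
Qed.

Lemma not_divide_prime_pow w : ~ Nat.divide (w * p ^ S k) (p ^ k * m).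
Proof.
intros [u Hu]. apply Hpm. exists (u * w)%nat. apply (Nat.mul_cancel_l _ _ (p ^ k)); [apply prime_pow_neq_0|].
rewrite Hu, Nat.pow_succ_r'. ring.
Qed.

Lemma divisor_sum_pow_succ ch : (forall a b, ch (a * b)%nat = ch a * ch b) -> (1 <= m)%nat ->
  divisor_sum ch (p ^ S k * m) = divisor_sum ch (p ^ k * m) + ch (p ^ S k)%nat * divisor_sum ch m.
Proof.
intros Hmul Hm. pose proof (prime_pow_neq_0 (S k)) as HP. pose proof (prime_pow_neq_0 k). set (P := (p ^ S k)%nat) in *.
set (N := (P * m)%nat). assert (HN : (p ^ k * m <= N)%nat).
{ unfold N, P. rewrite Nat.pow_succ_r'. apply prime_ge_2 in Hp. nia. }
rewrite <- (divisor_sum_upto ch (p ^ k * m) N), <- (divisor_sum_upto ch m N) by (unfold N in *; nia).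
transitivity (sum1 (fun d => (if Nat.eqb ((p ^ k * m) mod d) 0 then ch d else 0) +
  (if Nat.eqb (d mod P) 0 then (if Nat.eqb (m mod (d / P)) 0 then ch d else 0) else 0)) N).
- apply sum1_ext. intros d Hd. destruct (classic (Nat.divide P d)) as [[w ->]|HPd].
  + rewrite (proj2 (eqb_mod_divide (w * P) P)) by (exists w; reflexivity). rewrite Nat.div_mul by exact HP.
    replace (Nat.eqb ((p ^ k * m) mod (w * P)) 0) with false.
    * rewrite Rplus_0_l. rewrite (eqb_mod_iff N (w * P) m w); [reflexivity|]. unfold N, P. rewrite divide_prime_pow_succ.
      split.
      -- intros [Hlow|(w' & Hw' & Hdiv)]; [destruct (not_divide_prime_pow w Hlow)|].
         apply Nat.mul_cancel_r in Hw'; [subst w'; exact Hdiv|exact HP].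
      -- intros Hdiv. right. exists w. auto.
    * symmetry. apply Bool.not_true_iff_false. rewrite eqb_mod_divide. apply not_divide_prime_pow.
  + replace (Nat.eqb (d mod P) 0) with false by (symmetry; apply Bool.not_true_iff_false; rewrite eqb_mod_divide; exact HPd).
    rewrite Rplus_0_r, (eqb_mod_iff N d (p ^ k * m) d); [reflexivity|]. unfold N, P. rewrite divide_prime_pow_succ.
    split; [|auto].
    intros [Hlow|(w & -> & _)]; [exact Hlow|]. destruct HPd. exists w. reflexivity.
- rewrite sum1_plus. f_equal.
  rewrite (sum1_multiples (fun d => if Nat.eqb (m mod (d / P)) 0 then ch d else 0)), <- sum1_scal by lia.
  apply sum1_ext. intros e He. rewrite (Nat.mul_comm P e), Nat.div_mul, Hmul by exact HP.
  destruct (Nat.eqb (m mod e) 0) eqn:Hdiv; [|destruct (Nat.leb _ _); ring].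
  apply eqb_mod_divide, Nat.divide_pos_le in Hdiv; [|lia].
  destruct (Nat.leb_spec (e * P) N); [ring|unfold N in *; nia].
Qed.

End PrimePowerDivisors.

Lemma sum_pow_sign_value (v : R) k : v = -1 \/ v = 0 \/ v = 1 ->
  0 <= sum_f_R0 (fun i => v ^ i) k /\ (Nat.even k = true -> 1 <= sum_f_R0 (fun i => v ^ i) k).
Proof.
intros [-> | [-> | ->]].
- assert (Halt : 2 * sum_f_R0 (fun i => (-1) ^ i) k = 1 + (-1) ^ k).
  { induction k as [|k IH]; [simpl; ring|]. rewrite tech5, Rmult_plus_distr_l, IH. simpl. ring. }
  split.
  + pose proof (pow_1_abs k) as Habs. pose proof (Rabs_le_between ((-1) ^ k) 1) as Hle. lra.
  + intros Heven. apply Nat.even_spec in Heven. destruct Heven as [j ->]. rewrite pow_1_even in Halt. lra.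
- assert (Hone : sum_f_R0 (fun i => 0 ^ i) k = 1) by (induction k as [|k IH]; [reflexivity|]; rewrite tech5, IH; simpl; ring).
  rewrite Hone. lra.
- assert (Hone : 1 <= sum_f_R0 (fun i => 1 ^ i) k) by (induction k as [|k IH]; [simpl; lra|]; rewrite tech5, pow1; lra).
  lra.
Qed.

Lemma divisor_sum_prime_power ch p m k : (forall a b, ch (a * b)%nat = ch a * ch b) -> ch 1%nat = 1 -> prime (Z.of_nat p) ->
  ~ Nat.divide p m -> (1 <= m)%nat -> divisor_sum ch (p ^ k * m) = sum_f_R0 (fun i => ch p ^ i) k * divisor_sum ch m.
Proof.
intros Hmul H1 Hp Hpm Hm.
assert (Hpow : forall k, ch (p ^ k)%nat = ch p ^ k)
  by (induction k0 as [|j IH]; [exact H1|rewrite Nat.pow_succ_r', Hmul, IH; reflexivity]).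
induction k as [|k IH]; [simpl; rewrite Nat.add_0_r; ring|].
rewrite (divisor_sum_pow_succ p k m) by assumption. rewrite IH, Hpow. simpl. ring.
Qed.

Lemma divisor_sum_nonneg q ch : real_char q ch -> forall n, (1 <= n)%nat -> 0 <= divisor_sum ch n.
Proof.
intros Hch n. induction n as [n IH] using lt_wf_ind. intros Hn.
destruct (Nat.eq_dec n 1) as [-> | Hn1]; [unfold divisor_sum; simpl; rewrite (real_char_1 q ch Hch); lra|].
destruct (exists_prime_factor n ltac:(lia)) as (p & m & k & Hp & Hpm & Hm & ->).
rewrite divisor_sum_prime_power by (apply Hch || apply (real_char_1 q ch Hch) || assumption || lia).
apply Rmult_le_pos; [apply sum_pow_sign_value, Hch|apply IH; lia].
Qed.

Lemma divisor_sum_square q ch : real_char q ch -> forall n, (1 <= n)%nat -> 1 <= divisor_sum ch (n * n).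
Proof.
intros Hch n. induction n as [n IH] using lt_wf_ind. intros Hn.
destruct (Nat.eq_dec n 1) as [-> | Hn1]; [unfold divisor_sum; simpl; rewrite (real_char_1 q ch Hch); lra|].
destruct (exists_prime_factor n ltac:(lia)) as (p & m & k & Hp & Hpm & Hm & ->).
assert (Hpmm : ~ Nat.divide p (m * m)).
{ rewrite prime_not_divide_gcd, Nat.gcd_comm, gcd_mult_eq_1, Nat.gcd_comm by exact Hp.
  rewrite <- prime_not_divide_gcd by exact Hp. auto. }
replace (p ^ S k * m * (p ^ S k * m))%nat with (p ^ (S k + S k) * (m * m))%nat by (rewrite Nat.pow_add_r; ring).
rewrite divisor_sum_prime_power by (apply Hch || apply (real_char_1 q ch Hch) || assumption || nia).
destruct (sum_pow_sign_value (ch p) (S k + S k) (real_char_values q ch Hch p)) as [_ Hsum].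
specialize (Hsum ltac:(apply Nat.even_spec; exists (S k); lia)). specialize (IH m ltac:(lia) ltac:(lia)). nra.
Qed.

Fixpoint geom_sum (x : R) (n : nat) : R := match n with O => 0 | S n' => 1 + x * geom_sum x n' end.

Lemma geom_sum_mult x n : (1 - x) * geom_sum x n = 1 - x ^ n.
Proof. induction n as [|n IH]; simpl; [ring|]. transitivity (1 - x + x * ((1 - x) * geom_sum x n)); [ring|rewrite IH; ring].
Qed.

Lemma geom_sum_succ x n : geom_sum x (S n) = geom_sum x n + x ^ n.
Proof. induction n as [|n IH]; [simpl; ring|]. change (geom_sum x (S (S n))) with (1 + x * geom_sum x (S n)).
rewrite IH at 1. simpl. ring. Qed.

Lemma geom_sum_am_gm z n : 0 < z -> INR (S n) * z ^ n <= geom_sum (z ^ 2) (S n).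
Proof.
intros Hz. enough (Htwo : INR (S n) * z ^ n <= geom_sum (z ^ 2) (S n) /\
  INR (S (S n)) * z ^ S n <= geom_sum (z ^ 2) (S (S n))) by apply Htwo.
induction n as [|n [IH1 IH2]].
- split; [simpl; lra|]. pose proof (pow2_ge_0 (1 - z)) as Hsq. simpl in *. lra.
- split; [exact IH2|]. change (geom_sum (z ^ 2) (S (S (S n)))) with (1 + z ^ 2 * geom_sum (z ^ 2) (S (S n))).
  rewrite geom_sum_succ, Rmult_plus_distr_l. rewrite !S_INR in *.
  replace (z ^ 2 * (z ^ 2) ^ S n) with ((z ^ S (S n)) ^ 2) by (rewrite <- !pow_mult, <- pow_add; f_equal; lia).
  apply (Rmult_le_compat_l (z ^ 2)) in IH1; [|apply pow2_ge_0].
  replace (z ^ 2 * ((INR n + 1) * z ^ n)) with ((INR n + 1) * z ^ S (S n)) in IH1 by (simpl; ring).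
  pose proof (pow2_ge_0 (1 - z ^ S (S n))). set (w := z ^ S (S n)) in *. nra.
Qed.

Lemma geom_sum_pos z n : 0 < z -> 0 < geom_sum (z ^ 2) (S n).
Proof. intros Hz. eapply Rlt_le_trans; [|apply geom_sum_am_gm, Hz]. apply Rmult_lt_0_compat; pos. Qed.

Lemma geom_multiples_tail x n N : 0 < x < 1 -> (1 <= n)%nat ->
  0 <= x ^ n / (1 - x ^ n) - sum1 (fun m => if Nat.eqb (m mod n) 0 then x ^ m else 0) N <= x ^ N / (1 - x).
Proof.
intros Hx Hn. assert (Hxn : x ^ n <= x) by (destruct n as [|n]; [lia|]; simpl;
  assert (x ^ n <= 1) by (apply pow_le_1; lra); nra).
assert (Hpow : forall k, 0 < x ^ k) by (intros; apply pow_lt; lra).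
set (S_N := fun N => sum1 (fun m => if Nat.eqb (m mod n) 0 then x ^ m else 0) N).
assert (Hquot : exists K, (n * K <= N < n * K + n)%nat /\ x ^ n / (1 - x ^ n) - S_N N = x ^ (n * K + n) / (1 - x ^ n)).
{ unfold S_N. induction N as [|N (K & HK & IH)].
  - exists 0%nat. split; [lia|]. rewrite Nat.mul_0_r. simpl. ring.
  - rewrite sum1_succ. destruct (Nat.eq_dec (S N) (n * K + n)) as [Hmult|Hnot].
    + exists (S K). split; [lia|]. rewrite (proj2 (eqb_mod_divide (S N) n)) by (exists (S K); lia).
      rewrite Hmult. replace (n * S K + n)%nat with ((n * K + n) + n)%nat by lia. rewrite (pow_add x (n * K + n)).
      replace (x ^ (n * K + n) * x ^ n / (1 - x ^ n)) with (x ^ (n * K + n) / (1 - x ^ n) - x ^ (n * K + n))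
        by (field; lra). lra.
    + exists K. split; [lia|]. replace (Nat.eqb (S N mod n) 0) with false; [rewrite Rplus_0_r; exact IH|].
      symmetry. apply Bool.not_true_iff_false. rewrite eqb_mod_divide. intros [w Hw].
      assert (K < w)%nat by nia. assert (w < S K)%nat by nia. lia. }
change (0 <= x ^ n / (1 - x ^ n) - S_N N <= x ^ N / (1 - x)).
destruct Hquot as (K & HK & ->). split; [apply Rmult_le_pos; [left; apply Hpow|pos]|].
apply Rmult_le_compat; [left; apply Hpow|pos| |apply Rinv_le_contravar; lra].
replace (n * K + n)%nat with (N + (n * K + n - N))%nat by lia. rewrite pow_add.
assert (x ^ (n * K + n - N) <= 1) by (apply pow_le_1; lra). specialize (Hpow N). nra.
Qed.

Lemma Rabs_sum1_decr_weight (ch b : nat -> R) (B : R) N : (forall M, Rabs (sum1 ch M) <= B) ->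
  (forall n, (1 <= n)%nat -> 0 <= b (S n) <= b n) -> 0 <= b 1%nat -> Rabs (sum1 (fun n => ch n * b n) N) <= B * b 1%nat.
Proof.
intros HB Hb Hb1. assert (HB0 : 0 <= B) by (eapply Rle_trans; [apply Rabs_pos|apply (HB 0%nat)]).
destruct N as [|N]; [simpl; rewrite Rabs_R0; nra|]. rewrite sum1_by_parts.
assert (Htel : sum1 (fun n => B * (b n - b (S n))) N = B * (b 1%nat - b (S N))).
{ rewrite sum1_scal. f_equal. induction N as [|N IH]; [simpl; ring|]. rewrite sum1_succ, IH. ring. }
assert (HbN : 0 <= b (S N)) by (destruct N; [exact Hb1|apply Hb; lia]).
eapply Rle_trans; [apply Rabs_triang|]. rewrite Rabs_mult, (Rabs_pos_eq (b (S N))) by exact HbN.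
assert (Rabs (sum1 (fun n => sum1 ch n * (b n - b (S n))) N) <= B * (b 1%nat - b (S N))).
{ rewrite <- Htel. apply Rabs_sum1_le. intros n Hn. specialize (Hb n ltac:(lia)).
  rewrite Rabs_mult, (Rabs_pos_eq (b n - b (S n))) by lra. apply Rmult_le_compat_r; [lra|apply HB]. }
specialize (HB (S N)). nra.
Qed.

(* Monsky's argument: these coefficients decrease, so [sum ch(n) monsky_coef x n] is [O(1-x)], whereas
   [sum ch(n) x^n/(1-x^n) = sum (sum_(d|n) ch d) x^n] is unbounded as [x -> 1]. *)
Definition monsky_coef (x : R) (n : nat) : R := / INR n - x ^ n / geom_sum x n.

Lemma monsky_coef_decr z n : 0 < z < 1 -> (1 <= n)%nat -> monsky_coef (z ^ 2) (S n) <= monsky_coef (z ^ 2) n.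
Proof.
intros Hz Hn. destruct n as [|n]; [lia|]. unfold monsky_coef. set (x := z ^ 2).
pose proof (geom_sum_am_gm z n ltac:(lra)) as Hg. pose proof (geom_sum_am_gm z (S n) ltac:(lra)) as Hg'.
pose proof (geom_sum_pos z n ltac:(lra)) as Hpos. pose proof (geom_sum_pos z (S n) ltac:(lra)) as Hpos'.
fold x in Hg, Hg', Hpos, Hpos'.
assert (Hrec : geom_sum x (S (S n)) = 1 + x * geom_sum x (S n)) by reflexivity.
set (g := geom_sum x (S n)) in *. set (g' := geom_sum x (S (S n))) in *.
assert (Hk : 0 < INR (S n)) by pos. rewrite (S_INR (S n)) in *. set (k := INR (S n)) in *.
assert (Hprod : k * (k + 1) * x ^ S n <= g * g').
{ apply Rle_trans with (k * z ^ n * ((k + 1) * z ^ S n)).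
  - replace (x ^ S n) with (z ^ n * z ^ S n * z)
      by (unfold x; rewrite <- pow_mult; replace (2 * S n)%nat with (n + S n + 1)%nat by lia; rewrite !pow_add;
      simpl; ring).
    assert (0 < k * (k + 1) * (z ^ n * z ^ S n)) by (repeat apply Rmult_lt_0_compat; pos). nra.
  - apply Rmult_le_compat; [left; apply Rmult_lt_0_compat; pos|left; apply Rmult_lt_0_compat; pos|exact Hg|exact Hg']. }
assert (Hdiff : x ^ S n / g - x ^ S (S n) / g' = x ^ S n / (g * g')).
{ replace (x ^ S (S n)) with (x * x ^ S n) by reflexivity. rewrite Hrec in *. field. split; lra. }
assert (x ^ S n / (g * g') <= / k - / (k + 1)); [|lra].
replace (/ k - / (k + 1)) with (/ (k * (k + 1))) by (field; lra).
apply Rle_div_l; [apply Rmult_lt_0_compat; assumption|].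
apply Rmult_le_reg_l with (k * (k + 1)); [apply Rmult_lt_0_compat; lra|].
rewrite <- Rmult_assoc, Rinv_r, Rmult_1_l by nra. exact Hprod.
Qed.

Lemma monsky_coef_nonneg z n : 0 < z < 1 -> (1 <= n)%nat -> 0 <= monsky_coef (z ^ 2) n.
Proof.
intros Hz Hn. destruct n as [|n]; [lia|]. unfold monsky_coef.
pose proof (geom_sum_am_gm z n ltac:(lra)) as Hg. pose proof (geom_sum_pos z n ltac:(lra)).
assert (Hk : 0 < INR (S n)) by pos. set (g := geom_sum (z ^ 2) (S n)) in *. set (k := INR (S n)) in *.
assert ((z ^ 2) ^ S n / g <= / k); [|lra].
apply Rle_div_l; [assumption|]. apply Rmult_le_reg_l with k; [exact Hk|]. rewrite <- Rmult_assoc, Rinv_r, Rmult_1_l by lra.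
eapply Rle_trans; [|exact Hg]. apply Rmult_le_compat_l; [lra|].
rewrite <- pow_mult. replace (2 * S n)%nat with (n + (n + 2))%nat by lia. rewrite pow_add.
assert (0 < z ^ n) by pos. assert (z ^ (n + 2) <= 1) by (apply pow_le_1; lra). nra.
Qed.

Lemma lambert_bound q ch z N : real_char q ch -> 0 < z < 1 ->
  Rabs (sum1 (fun n => ch n * monsky_coef (z ^ 2) n) N) <= INR q * (1 - z ^ 2).
Proof.
intros Hch Hz. replace (1 - z ^ 2) with (monsky_coef (z ^ 2) 1) by (unfold monsky_coef; simpl; field).
apply Rabs_sum1_decr_weight; [intros M; apply real_char_sum_bound, Hch| |apply monsky_coef_nonneg; [exact Hz|lia]].
intros n Hn. split; [apply monsky_coef_nonneg; [exact Hz|lia]|apply monsky_coef_decr; assumption].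
Qed.

Lemma sum1_monsky_coef ch x N : 0 < x < 1 -> sum1 (fun n => ch n * monsky_coef x n) N =
  sum1 (fun n => ch n * / INR n) N - (1 - x) * sum1 (fun n => ch n * (x ^ n / (1 - x ^ n))) N.
Proof.
intros Hx. rewrite <- sum1_scal, <- sum1_minus. apply sum1_ext. intros n Hn. unfold monsky_coef.
rewrite <- (geom_sum_mult x n).
assert (Hg : geom_sum x n <> 0).
{ intros Hzero. pose proof (geom_sum_mult x n) as Hmult. rewrite Hzero, Rmult_0_r in Hmult.
  assert (x ^ n < 1) by (apply pow_lt_1_compat; [lra|lia]). lra. }
field. repeat split; try lra; try exact Hg. apply not_0_INR; lia.
Qed.

Lemma divisor_sum_series_lower q ch x J0 : real_char q ch -> 0 < x < 1 -> forall J, (J <= J0)%nat ->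
  INR J * x ^ (J0 * J0) <= sum1 (fun m => divisor_sum ch m * x ^ m) (J * J).
Proof.
intros Hch Hx J. induction J as [|J IH]; intros HJ; [simpl; lra|].
specialize (IH ltac:(lia)). rewrite S_INR.
replace (S J * S J)%nat with (S (J * J + 2 * J)) by lia. rewrite sum1_succ.
assert (sum1 (fun m => divisor_sum ch m * x ^ m) (J * J) <= sum1 (fun m => divisor_sum ch m * x ^ m) (J * J + 2 * J)).
{ apply sum1_incr; [lia|]. intros n Hn. apply Rmult_le_pos; [apply (divisor_sum_nonneg q ch Hch); lia|pos]. }
assert (1 <= divisor_sum ch (S (J * J + 2 * J))) by (replace (S (J * J + 2 * J)) with (S J * S J)%nat by lia;
  apply (divisor_sum_square q ch Hch); lia).
assert (x ^ (J0 * J0) <= x ^ S (J * J + 2 * J)).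
{ replace (J0 * J0)%nat with (S (J * J + 2 * J) + (J0 * J0 - S (J * J + 2 * J)))%nat by nia. rewrite pow_add.
  assert (x ^ (J0 * J0 - S (J * J + 2 * J)) <= 1) by (apply pow_le_1; lra).
  assert (0 < x ^ S (J * J + 2 * J)) by pos. nra. }
assert (0 < x ^ (J0 * J0)) by pos. nra.
Qed.

Lemma lambert_lower q ch x J N : real_char q ch -> 0 < x < 1 -> (J * J <= N)%nat ->
  INR J * x ^ (J * J) <= sum1 (fun n => ch n * (x ^ n / (1 - x ^ n))) N + INR N * (x ^ N / (1 - x)).
Proof.
intros Hch Hx HJ. eapply Rle_trans; [apply (divisor_sum_series_lower q ch x J Hch Hx J (Nat.le_refl J))|].
apply Rle_trans with (sum1 (fun m => divisor_sum ch m * x ^ m) N).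
{ apply sum1_incr; [exact HJ|]. intros n Hn. apply Rmult_le_pos; [apply (divisor_sum_nonneg q ch Hch); lia|pos]. }
assert (Hswap : sum1 (fun m => divisor_sum ch m * x ^ m) N =
  sum1 (fun n => ch n * sum1 (fun m => if Nat.eqb (m mod n) 0 then x ^ m else 0) N) N).
{ transitivity (sum1 (fun m => sum1 (fun n => (if Nat.eqb (m mod n) 0 then ch n else 0) * x ^ m) N) N).
  - apply sum1_ext. intros m Hm. rewrite <- (divisor_sum_upto ch m N) by exact Hm. rewrite Rmult_comm, <- sum1_scal.
    apply sum1_ext. intros; ring.
  - rewrite sum1_exchange. apply sum1_ext. intros n _. rewrite <- sum1_scal. apply sum1_ext. intros m _.
    destruct (Nat.eqb _ _); ring. }
rewrite Hswap, <- sum1_const, <- sum1_plus. apply sum1_le. intros n Hn.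
pose proof (geom_multiples_tail x n N Hx ltac:(lia)). set (T := sum1 _ N) in *.
pose proof (real_char_abs q ch n Hch) as Habs. apply Rabs_le_between in Habs. nra.
Qed.

Lemma INR_mult_pow_le z N : 0 < z < 1 -> (1 <= N)%nat ->
  INR N * ((z ^ 2) ^ N / (1 - z ^ 2)) <= z ^ N * / (1 - z ^ 2) ^ 2.
Proof.
intros Hz HN. destruct N as [|N]; [lia|]. set (x := z ^ 2). assert (Hx : 0 < x < 1) by (unfold x; nra).
pose proof (geom_sum_am_gm z N ltac:(lra)) as Hg. fold x in Hg.
assert (Hgeom : geom_sum x (S N) <= / (1 - x)).
{ apply Rmult_le_reg_l with (1 - x); [lra|]. rewrite geom_sum_mult, Rinv_r by lra. assert (0 < x ^ S N) by pos. lra. }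
replace (x ^ S N) with (z ^ N * z * z ^ S N) by (unfold x; rewrite <- pow_mult; replace (2 * S N)%nat with (N + 1 + S N)%nat
  by lia; rewrite !pow_add; simpl; ring).
replace (INR (S N) * (z ^ N * z * z ^ S N / (1 - x))) with (z ^ S N * (/ (1 - x) * (z * (INR (S N) * z ^ N))))
  by (unfold Rdiv; ring).
apply Rmult_le_compat_l; [pos|]. replace (/ (1 - x) ^ 2) with (/ (1 - x) * / (1 - x)) by (field; lra).
apply Rmult_le_compat_l; [pos|].
assert (0 <= INR (S N) * z ^ N) by (apply Rmult_le_pos; pos). nra.
Qed.

Lemma lambert_lower_of_L_one_zero q ch z J : real_char q ch -> is_lim_seq (sum1 (fun n => ch n * / INR n)) 0 -> 0 < z < 1 ->
  INR J * (z ^ 2) ^ (J * J) <= INR q.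
Proof.
intros Hch Hzero Hz. set (x := z ^ 2). assert (Hx : 0 < x < 1) by (unfold x; nra).
assert (Hlim : is_lim_seq (fun N => INR q + / (1 - x) * sum1 (fun n => ch n * / INR n) N + / (1 - x) ^ 2 * z ^ N)
  (INR q + / (1 - x) * 0 + / (1 - x) ^ 2 * 0)).
{ apply is_lim_seq_plus'; [apply is_lim_seq_plus'; [apply is_lim_seq_const|apply is_lim_seq_scal_R, Hzero]|].
  apply is_lim_seq_scal_R, is_lim_seq_geom. rewrite Rabs_pos_eq; lra. }
rewrite !Rmult_0_r, !Rplus_0_r in Hlim.
refine (is_lim_seq_ge_const _ (INR q) _ _ Hlim).
exists (S (J * J)). intros N HN.
pose proof (lambert_lower q ch x J N Hch Hx ltac:(lia)) as Hlow. pose proof (lambert_bound q ch z N Hch Hz) as Hup.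
fold x in Hup. rewrite sum1_monsky_coef in Hup by exact Hx. apply Rabs_le_between in Hup.
pose proof (INR_mult_pow_le z N Hz ltac:(lia)) as Htail. fold x in Htail.
assert (sum1 (fun n => ch n * (x ^ n / (1 - x ^ n))) N <= INR q + / (1 - x) * sum1 (fun n => ch n * / INR n) N).
{ apply Rmult_le_reg_l with (1 - x); [lra|]. rewrite Rmult_plus_distr_l, <- Rmult_assoc, Rinv_r by lra. lra. }
lra.
Qed.

Theorem L_one_nonzero q ch : real_char q ch -> ~ is_lim_seq (sum1 (fun n => ch n * / INR n)) 0.
Proof.
intros Hch Hzero. set (J := (2 * q + 1)%nat). set (e := / (4 * INR (J * J))).
assert (HJJ : 1 <= INR (J * J)) by (apply (le_INR 1); nia).
assert (He : 0 < e <= / 4) by (split; [unfold e; pos|apply Rinv_le_contravar; lra]).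
set (z := 1 - e). assert (Hz : 0 < z < 1) by (unfold z; lra).
assert (HxJ : 1 / 2 <= (z ^ 2) ^ (J * J)).
{ rewrite <- pow_mult.
  assert (Bernoulli : forall n, 1 - INR n * e <= z ^ n).
  { induction n as [|n IH]; [simpl; lra|]. rewrite S_INR. simpl pow. pose proof (pos_INR n). unfold z in *. nra. }
  eapply Rle_trans; [|apply Bernoulli]. rewrite mult_INR. unfold e. simpl (INR 2). right. field. lra. }
pose proof (lambert_lower_of_L_one_zero q ch z J Hch Hzero Hz).
assert (INR J = 2 * INR q + 1) by (unfold J; rewrite plus_INR, mult_INR; simpl; ring).
pose proof (pos_INR q). nra.
Qed.
(** * Consequences of GRH *)

Lemma DS_partial_dirichlet_sum (al : nat -> R) s t N :
  DS_partial (fun n => RtoC (al n)) (s, t) N = (dirichlet_sum al s t 0 N, dirichlet_sum al s t (PI / 2) N).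
Proof.
induction N as [|N IH]; [reflexivity|].
change (DS_partial (fun n => RtoC (al n)) (s, t) (S N)) with
  (Cplus (DS_partial (fun n => RtoC (al n)) (s, t) N) (Cmult (RtoC (al (S N))) (cpow_neg (S N) (s, t)))).
rewrite IH. unfold dirichlet_sum. rewrite !sum1_succ. unfold cpow_neg, Cmult, Cplus, RtoC, pow_neg. cbn [fst snd Re Im].
rewrite Rplus_0_r, cos_plus, cos_PI2, sin_PI2. f_equal; ring.
Qed.

Lemma DS_partial_ext (a b : nat -> C) s N : (forall n, (1 <= n)%nat -> a n = b n) -> DS_partial a s N = DS_partial b s N.
Proof. intros Hab. induction N as [|N IH]; [reflexivity|]. simpl DS_partial. rewrite IH, Hab by lia. reflexivity. Qed.

Lemma is_DSval_dirichlet_value (a : nat -> C) (al : nat -> R) s t u v : (forall n, (1 <= n)%nat -> a n = RtoC (al n)) ->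
  is_dirichlet_value al s t u v -> is_DSval a (s, t) (u, v).
Proof.
intros Ha [Hu Hv]. unfold is_DSval. apply filterlim_locally. intros eps.
apply is_lim_seq_spec in Hu. apply is_lim_seq_spec in Hv.
destruct (Hu eps) as [N1 HN1]. destruct (Hv eps) as [N2 HN2].
exists (N1 + N2)%nat. intros n Hn. rewrite (DS_partial_ext a (fun n => RtoC (al n))) by exact Ha.
rewrite DS_partial_dirichlet_sum.
split; [apply HN1; lia|apply HN2; lia].
Qed.

Theorem nonvanishing_char q ch s t : GRH -> real_char q ch -> 1 / 2 < s -> ~ is_dirichlet_value ch s t 0 0.
Proof.
intros [_ HGRH] Hch Hs Hzero. destruct (Rtotal_order s 1) as [Hlt|[-> | Hgt]].
- destruct (real_char_dirichlet_char q ch Hch) as [Hdir Hnonpr].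
  apply (HGRH q _ Hdir Hnonpr (s, t) (0, 0)); [simpl; lra| |reflexivity].
  apply (is_DSval_dirichlet_value _ ch); [intros; reflexivity|exact Hzero].
- destruct (Req_dec t 0) as [-> | Ht]; [|exact (real_char_line_one_nonzero q ch t Hch Ht Hzero)].
  apply (L_one_nonzero q ch Hch). eapply is_lim_seq_ext; [|exact (proj1 Hzero)].
  intros N. unfold dirichlet_sum. apply sum1_ext. intros n Hn. rewrite pow_neg_1_r, Rmult_0_l, Rplus_0_l, cos_0 by lia. ring.
- destruct (dirichlet_value_right_of_one ch (real_char_mul q ch Hch) (fun n => real_char_abs q ch n Hch)
    (real_char_1 q ch Hch) s t Hgt)
    as (u & v & Hval & Hpos).
  destruct (is_dirichlet_value_unique _ _ _ _ _ _ _ Hval Hzero) as [-> ->]. simpl in Hpos. lra.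
Qed.

Lemma alt_coef_2 n : (1 <= n)%nat -> alt_coef 2 n = (-1) ^ (n - 1).
Proof.
intros Hn. unfold alt_coef. destruct (Nat.Even_or_Odd n) as [[j ->]|[j ->]].
- rewrite Nat.mul_comm, Nat.Div0.mod_mul. simpl (Nat.eqb 0 0). cbv iota.
  replace (j * 2 - 1)%nat with (S (2 * (j - 1))) by lia. rewrite pow_1_odd. simpl. ring.
- rewrite Nat.add_comm, Nat.mul_comm, Nat.Div0.mod_add. simpl (Nat.eqb _ _). cbv iota.
  replace (1 + j * 2 - 1)%nat with (2 * j)%nat by lia. rewrite pow_1_even. ring.
Qed.

Lemma zeta_sum_right_of_one_nonzero s t : 1 < s -> is_lim_seq (zeta_sum_re s t) 0 -> is_lim_seq (zeta_sum_im s t) 0 -> False.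
Proof.
intros Hs Hre Him. destruct (dirichlet_value_right_of_one const1 const1_mult const1_abs eq_refl s t Hs)
  as (u & v & [Hu Hv] & Hpos).
assert (Hpole : forall ph, is_lim_seq (fun N => pow_neg N (s - 1) * cos (t * lg N + ph)) 0).
{ intros ph. apply is_lim_seq_abs_0.
  apply (is_lim_seq_le_le (fun _ => 0) _ (fun N => pow_neg N (s - 1)));
    [|apply is_lim_seq_const|apply is_lim_seq_pow_neg; lra].
  intros N. split; [apply Rabs_pos|]. rewrite Rabs_mult, (Rabs_pos_eq (pow_neg _ _)) by (left; apply pow_neg_pos).
  pose proof (Rabs_cos_le (t * lg N + ph)). pose proof (pow_neg_pos N (s - 1)). nra. }
assert (Hreal : (s - 1) * u - t * v + 0 = 0).
{ apply (is_lim_seq_unique_R (zeta_sum_re s t)); [|exact Hre].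
  apply is_lim_seq_plus'; [apply is_lim_seq_minus'; apply is_lim_seq_scal_R; assumption|apply Hpole]. }
assert (Himag : (s - 1) * v + t * u + 0 = 0).
{ apply (is_lim_seq_unique_R (zeta_sum_im s t)); [|exact Him].
  apply is_lim_seq_plus'; [apply is_lim_seq_plus'; apply is_lim_seq_scal_R; assumption|apply Hpole]. }
assert (Hprod : ((s - 1) ^ 2 + t ^ 2) * (u ^ 2 + v ^ 2) = 0).
{ transitivity (((s - 1) * u - t * v) ^ 2 + ((s - 1) * v + t * u) ^ 2); [ring|].
  replace ((s - 1) * u - t * v) with 0 by lra. replace ((s - 1) * v + t * u) with 0 by lra. ring. }
assert (0 < (s - 1) ^ 2) by pos. pose proof (pow2_ge_0 t). apply Rmult_integral in Hprod. destruct Hprod; lra.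
Qed.

Theorem nonvanishing_zeta s t : GRH -> 1 / 2 < s -> is_lim_seq (zeta_sum_re s t) 0 -> is_lim_seq (zeta_sum_im s t) 0 -> False.
Proof.
intros [HGRH _] Hs Hre Him. destruct (Rtotal_order s 1) as [Hlt|[-> | Hgt]].
- pose proof (taylor_convergent_alt_coef 2 3 t (11 / 4) ltac:(lia) ltac:(lra) ltac:(lra)) as Halt.
  pose proof (dirichlet_value_real_shift (alt_coef 2) _ (11 / 4) 3 t (s - 3) Halt ltac:(rewrite Rabs_left; lra)) as Hval.
  replace (3 + (s - 3)) with s in Hval by ring.
  destruct (alt_coef_zero_of_zeta_zero 2 s t _ _ ltac:(lia) ltac:(left; lra) Hre Him Hval) as [HU HV]. rewrite HU, HV in Hval.
  apply (HGRH (s, t) (0, 0)); [simpl; lra| |reflexivity].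
  apply (is_DSval_dirichlet_value _ (alt_coef 2)); [|exact Hval].
  intros n Hn. unfold eta_coef. rewrite alt_coef_2 by exact Hn. reflexivity.
- destruct (Req_dec t 0) as [-> | Ht]; [|exact (zeta_sum_line_one_nonzero t Ht Hre Him)].
  assert (1 = 0); [|lra]. apply (is_lim_seq_unique_R (zeta_sum_re 1 0)); [|exact Hre].
  apply (is_lim_seq_ext (fun _ => 1)); [|apply is_lim_seq_const].
  intros N. unfold zeta_sum_re, pow_neg. replace (0 * lg N + 0) with 0 by ring.
  replace (- (1 - 1) * lg N) with 0 by ring. rewrite exp_0, cos_0. ring.
- exact (zeta_sum_right_of_one_nonzero s t Hgt Hre Him).
Qed.

Definition derivative_bound (f : nat -> R) (A r : R) : Prop := forall j, Rabs (f j) <= 2 * INR (S j) * A / r ^ S j.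

Lemma half_plane_coef_bound a b p q C0 C s B : 3 <= s -> 0 < C0 -> 0 <= C ->
  geom_bound a C0 (s - 1 / 4) -> geom_bound b C0 (s - 1 / 4) -> geom_bound p C (s - 2) -> geom_bound q C (s - 2) ->
  is_log_derivative a b p q ->
  (forall x th, 0 <= x < s - 1 / 2 -> ~ (PSeries (rot a b th) x = 0 /\ PSeries (rot b (oppseq a) th) x = 0)) ->
  0 < a 0%nat ^ 2 + b 0%nat ^ 2 -> 0 < B -> (16 * C0 * (s - 1 / 4)) ^ 2 <= B ^ 2 * (a 0%nat ^ 2 + b 0%nat ^ 2) ->
  derivative_bound p (ln B) (s - 1 / 2) /\ derivative_bound q (ln B) (s - 1 / 2).
Proof.
intros Hs HC0 HC Ba Bb Bp Bq Hlog Hnonzero H0 HB HBn.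
enough (Hboth : forall j, Rabs (p j) <= 2 * INR (S j) * ln B / (s - 1 / 2) ^ S j /\
  Rabs (q j) <= 2 * INR (S j) * ln B / (s - 1 / 2) ^ S j)
  by (split; intros j; apply Hboth).
intros j. destruct (log_derivative_coef_bound a b p q C0 (s - 1 / 4) C (s - 2) (s - 1 / 2) ltac:(lra) HC0 Ba Bb ltac:(lra)
  HC Bp Bq Hlog Hnonzero j H0) as [Hp Hq].
cbv zeta in Hp, Hq. set (n0 := a 0%nat ^ 2 + b 0%nat ^ 2) in *.
replace (4 * C0 * (s - 1 / 4) / (s - 1 / 4 - (s - 1 / 2))) with (16 * C0 * (s - 1 / 4)) in Hp, Hq by (field; lra).
set (X := 16 * C0 * (s - 1 / 4)) in *. assert (HX : 0 < X) by (unfold X; pos).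
assert (Hln : ln X - / 2 * ln n0 <= ln B).
{ apply ln_le in HBn; [|pos]. rewrite ln_mult, !ln_pow in HBn by pos. simpl INR in HBn. lra. }
assert (Hle : 2 * INR (S j) * (ln X - / 2 * ln n0) / (s - 1 / 2) ^ S j <= 2 * INR (S j) * ln B / (s - 1 / 2) ^ S j).
{ apply Rmult_le_compat_r; [pos|]. apply Rmult_le_compat_l; [pose proof (pos_INR (S j)); lra|exact Hln]. }
split; (eapply Rle_trans; [eassumption|exact Hle]).
Qed.

Theorem char_coef_bound q ch s t : GRH -> real_char q ch -> 3 <= s ->
  let A := lg q + ln (32 * s * (11 * s + 5 * Rabs t)) in
  derivative_bound (taylor_coef (log_coef ch) s t 0) A (s - 1 / 2) /\
  derivative_bound (taylor_coef (log_coef ch) s t (PI / 2)) A (s - 1 / 2).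
Proof.
intros HG Hch Hs. pose proof (taylor_convergent_real_char q ch s t (s - 1 / 4) Hch Hs ltac:(lra)) as Hconv.
set (C0 := INR q * _) in Hconv. assert (Hq : 1 <= INR q) by (apply (le_INR 1), (real_char_modulus q ch Hch)).
pose proof (Rabs_pos t).
assert (HC0 : C0 = INR q * (1 + 5 * (2 * s + Rabs t - 1 / 4))) by (unfold C0; field; lra). clearbody C0.
assert (Habs : forall n, Rabs (ch n) <= 1) by (intros; eapply real_char_abs, Hch).
pose proof (taylor_coef_0_lower ch s t (real_char_1 q ch Hch) Habs Hs).
set (a := taylor_coef ch s t 0) in *. set (b := taylor_coef ch s t (PI / 2)).
assert (Hnorm : 1 / 4 <= a 0%nat ^ 2 + b 0%nat ^ 2) by (pose proof (pow2_ge_0 (b 0%nat)); nra).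
cbv zeta. rewrite <- ln_mult by (try lra; pos).
apply (half_plane_coef_bound a b _ _ C0 (/ (1 / 2) * (1 + / (1 / 2)))); try lra.
- rewrite HC0. pos.
- apply taylor_convergent_coef_bound, Hconv.
- apply taylor_convergent_coef_bound, Hconv.
- apply taylor_log_coef_bound; try assumption; lra.
- apply taylor_log_coef_bound; try assumption; lra.
- apply dirichlet_log_derivative; [apply Hch|exact Habs|exact Hs].
- intros x th Hx [Hre Him].
  pose proof (dirichlet_value_polar ch C0 (s - 1 / 4) s t x th Hconv ltac:(rewrite Rabs_pos_eq; lra)) as Hval.
  cbv zeta in Hval. fold a b in Hval. rewrite Hre, Him in Hval. revert Hval.
  apply (nonvanishing_char q ch _ _ HG Hch). pose proof (COS_bound th). nra.
- pos.
- set (Y := INR q * (32 * s * (11 * s + 5 * Rabs t))).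
  apply Rle_trans with (Y ^ 2 * (1 / 4)); [|apply Rmult_le_compat_l; [apply pow2_ge_0|exact Hnorm]].
  replace (Y ^ 2 * (1 / 4)) with ((Y / 2) ^ 2) by field. apply pow_incr. split; [rewrite HC0; pos|]. rewrite HC0. unfold Y.
  replace (16 * (INR q * (1 + 5 * (2 * s + Rabs t - 1 / 4))) * (s - 1 / 4))
    with (16 * INR q * ((s - 1 / 4) * (1 + 5 * (2 * s + Rabs t - 1 / 4)))) by ring.
  replace (INR q * (32 * s * (11 * s + 5 * Rabs t)) / 2) with (16 * INR q * (s * (11 * s + 5 * Rabs t))) by field.
  apply Rmult_le_compat_l; [lra|]. apply Rmult_le_compat; lra.
Qed.

Lemma zeta_log_coef_geom_bound s : 3 <= s -> geom_bound (zeta_log_coef s) 7 (s - 2).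
Proof.
intros Hs m. unfold zeta_log_coef. eapply Rle_trans; [apply Rabs_triang|].
pose proof (taylor_log_coef_bound const1 const1_abs s 0 0 (s - 2) (1 / 2) Hs ltac:(lra) ltac:(lra) ltac:(lra) m) as Hzeta.
assert (Hpole : Rabs ((-1) ^ m / (s - 1) ^ S m) <= 1 / (s - 2) ^ m).
{ unfold Rdiv. rewrite Rabs_mult, pow_1_abs, !Rmult_1_l, Rabs_pos_eq by pos.
  apply Rinv_le_contravar; [pos|].
  apply Rle_trans with ((s - 1) ^ m); [apply pow_incr; lra|]. simpl. assert (0 < (s - 1) ^ m) by pos. nra. }
apply Rle_trans with (/ (1 / 2) * (1 + / (1 / 2)) / (s - 2) ^ m + 1 / (s - 2) ^ m); [apply Rplus_le_compat; assumption|].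
right. field. apply pow_nonzero; lra.
Qed.

Lemma zeta_taylor_const_bounds s : 3 <= s -> 0 < zeta_taylor_const s (s - 1 / 4) <= 21 * s ^ 2.
Proof.
intros Hs. replace (zeta_taylor_const s (s - 1 / 4)) with (1 + (2 * s - 5 / 4) + 5 * ((2 * s - 5 / 4) * (2 * s - 1 / 4))).
- nra.
- unfold zeta_taylor_const. field. lra.
Qed.

Lemma is_lim_seq_zeta_sum s x th : 3 <= s -> Rabs x < s - 1 / 4 ->
  is_lim_seq (zeta_sum_re (s + x * cos th) (x * sin th)) (PSeries (rot (zeta_taylor s) zero_seq th) x) /\
  is_lim_seq (zeta_sum_im (s + x * cos th) (x * sin th)) (PSeries (rot zero_seq (oppseq (zeta_taylor s)) th) x).
Proof.
intros Hs Hx. set (C0 := zeta_taylor_const s (s - 1 / 4)).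
assert (HC0 : 0 <= C0) by (left; apply (zeta_taylor_const_bounds s Hs)).
pose proof (fun N => zeta_taylorN_bound s (s - 1 / 4) N ltac:(lra) ltac:(lra)) as HN. fold C0 in HN.
pose proof (geom_bound_zero C0 (s - 1 / 4) HC0 ltac:(lra)) as Hzero.
split; (eapply is_lim_seq_ext; [intros N; apply zeta_sum_PSeries|]);
  apply (is_lim_seq_PSeries_dominated (fun N => rot _ _ th) _ (2 * C0) (s - 1 / 4) x); try (exact Hx || lra).
- intros N. apply rot_bound; [apply HN|exact Hzero].
- intros m. apply (is_lim_seq_rot (zeta_taylorN s) (fun _ => zero_seq));
    [apply is_lim_seq_zeta_taylor, Hs|apply is_lim_seq_const].
- intros N. apply rot_bound; [exact Hzero|apply geom_bound_opp, HN].
- intros m. apply (is_lim_seq_rot (fun _ => zero_seq) (fun N => oppseq (zeta_taylorN s N))); [apply is_lim_seq_const|].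
  apply (is_lim_seq_opp _ (zeta_taylor s m)), is_lim_seq_zeta_taylor, Hs.
Qed.

Theorem zeta_coef_bound s : GRH -> 3 <= s -> derivative_bound (zeta_log_coef s) (ln (336 * s ^ 3)) (s - 1 / 2).
Proof.
intros HG Hs. set (C0 := zeta_taylor_const s (s - 1 / 4)).
pose proof (zeta_taylor_const_bounds s Hs) as HC0. fold C0 in HC0.
assert (H0 : 1 <= zeta_taylor s 0 ^ 2 + zero_seq 0 ^ 2).
{ pose proof (taylor_coef_0_lower const1 s 0 eq_refl const1_abs Hs).
  replace (zeta_taylor s 0) with ((s - 1) * taylor_coef const1 s 0 0 0)
    by (unfold zeta_taylor, linear_factor; simpl; unfold zero; simpl; ring).
  assert (1 <= (s - 1) * taylor_coef const1 s 0 0 0) by nra. unfold zero_seq. nra. }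
apply (half_plane_coef_bound (zeta_taylor s) zero_seq _ zero_seq C0 7); try lra.
- apply (geom_bound_lim (zeta_taylorN s));
    [intros N; apply zeta_taylorN_bound; lra|intros m; apply is_lim_seq_zeta_taylor, Hs].
- apply geom_bound_zero; lra.
- apply zeta_log_coef_geom_bound, Hs.
- apply geom_bound_zero; lra.
- apply zeta_log_derivative, Hs.
- intros x th Hx [Hre Him]. destruct (is_lim_seq_zeta_sum s x th Hs ltac:(rewrite Rabs_pos_eq; lra)) as [Hlim_re Hlim_im].
  rewrite Hre in Hlim_re. rewrite Him in Hlim_im. revert Hlim_re Hlim_im.
  apply nonvanishing_zeta; [exact HG|]. pose proof (COS_bound th). nra.
- pos.
- apply Rle_trans with ((336 * s ^ 3) ^ 2 * 1); [|apply Rmult_le_compat_l; [apply pow2_ge_0|exact H0]].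
  rewrite Rmult_1_r. apply pow_incr. split; [pos|].
  replace (336 * s ^ 3) with (16 * (21 * s ^ 2) * s) by ring. apply Rmult_le_compat; lra.
Qed.
(** * Smooth cutoffs *)

Definition exp_sum (K : nat) (x : R) : R := sum1 (fun i => x ^ (i - 1) / INR (fact (i - 1))) K.

Lemma exp_term_nonneg x j : 0 <= x -> 0 <= x ^ j / INR (fact j).
Proof. intros Hx. apply Rmult_le_pos; pos. Qed.

Lemma is_lim_seq_exp_sum x : is_lim_seq (fun K => exp_sum K x) (exp x).
Proof.
pose proof (is_exp_Reals x) as Hexp. unfold is_pseries in Hexp.
assert (Hseries : is_series (fun k => x ^ k / INR (fact k)) (exp x)).
{ eapply is_series_ext_R; [|exact Hexp]. intros n. cbv beta. rewrite pow_n_pow. unfold scal; simpl. unfold mult; simpl.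
  unfold Rdiv. reflexivity. }
apply (is_lim_seq_incr_1 (fun K => exp_sum K x)). eapply is_lim_seq_ext; [|exact Hseries].
intros n. induction n as [|n IH]; [unfold exp_sum; rewrite sum_O; simpl; field|].
rewrite sum_Sn, IH. unfold exp_sum. rewrite (sum1_succ _ (S n)). replace (S (S n) - 1)%nat with (S n) by lia. reflexivity.
Qed.

Lemma exp_sum_le_exp K x : 0 <= x -> exp_sum K x <= exp x.
Proof.
intros Hx. apply (is_lim_seq_ge_const (fun M => exp_sum M x)); [|apply is_lim_seq_exp_sum].
exists K. intros M HM. apply sum1_incr; [exact HM|]. intros n _. apply exp_term_nonneg, Hx.
Qed.

Lemma exp_sum_scal_upper K r y : 0 <= y -> 1 <= r -> exp_sum K (r * y) <= r ^ K * exp y.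
Proof.
intros Hy Hr. apply Rle_trans with (r ^ K * exp_sum K y); [|apply Rmult_le_compat_l; [pos|apply exp_sum_le_exp, Hy]].
unfold exp_sum. rewrite <- sum1_scal. apply sum1_le. intros i Hi. rewrite Rpow_mult_distr. unfold Rdiv. rewrite Rmult_assoc.
apply Rmult_le_compat_r; [apply exp_term_nonneg, Hy|]. apply Rle_pow; [exact Hr|lia].
Qed.

Lemma exp_sum_scal_tail K r y : 0 <= y -> 0 <= r <= 1 -> exp (r * y) - exp_sum K (r * y) <= r ^ K * exp y.
Proof.
intros Hy Hr. apply (is_lim_seq_le_const (fun M => exp_sum M (r * y) - exp_sum K (r * y))).
- exists K. intros M HM. apply Rle_trans with (r ^ K * (exp_sum M y - exp_sum K y)).
  + unfold exp_sum. induction HM as [|M HM IH]; [lra|]. rewrite !sum1_succ.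
    assert ((r * y) ^ (S M - 1) / INR (fact (S M - 1)) <= r ^ K * (y ^ (S M - 1) / INR (fact (S M - 1)))).
    { rewrite Rpow_mult_distr. unfold Rdiv. rewrite Rmult_assoc. apply Rmult_le_compat_r; [apply exp_term_nonneg, Hy|].
      replace (S M - 1)%nat with (K + (M - K))%nat by lia. rewrite pow_add.
      assert (0 <= r ^ K) by pos. assert (r ^ (M - K) <= 1) by (apply pow_le_1; lra).
      nra. }
    lra.
  + apply Rmult_le_compat_l; [pos|]. pose proof (exp_sum_le_exp M y Hy).
    assert (0 <= exp_sum K y) by (apply sum1_nonneg; intros; apply exp_term_nonneg, Hy). lra.
- apply is_lim_seq_minus'; [apply is_lim_seq_exp_sum|apply is_lim_seq_const].
Qed.

(* A smooth approximation of the indicator function of [log n <= K / D]. *)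
Definition smooth_cutoff (D : R) (K n : nat) : R := pow_neg n D * exp_sum K (D * lg n).

Lemma smooth_cutoff_nonneg D K n : 0 <= D -> 0 <= smooth_cutoff D K n.
Proof.
intros HD. apply Rmult_le_pos; [pos|]. apply sum1_nonneg. intros.
apply exp_term_nonneg, Rmult_le_pos; [exact HD|apply ln_INR_nonneg].
Qed.

Lemma smooth_cutoff_upper D K n s : 0 <= s < D -> smooth_cutoff D K n <= (D / (D - s)) ^ K * pow_neg n s.
Proof.
intros Hs. unfold smooth_cutoff. pose proof (ln_INR_nonneg n).
replace (D * lg n) with (D / (D - s) * ((D - s) * lg n)) by (field; lra).
apply Rle_trans with (pow_neg n D * ((D / (D - s)) ^ K * exp ((D - s) * lg n))).
- apply Rmult_le_compat_l; [pos|]. apply exp_sum_scal_upper; [nra|]. apply Rle_div_r; lra.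
- right. unfold pow_neg. replace (- s * lg n) with (- D * lg n + (D - s) * lg n) by ring. rewrite exp_plus. ring.
Qed.

Lemma smooth_cutoff_le_1 D K n : 0 < D -> smooth_cutoff D K n <= 1.
Proof.
intros HD. eapply Rle_trans; [apply (smooth_cutoff_upper D K n 0); lra|]. rewrite Rminus_0_r.
replace (D / D) with 1 by (field; lra). rewrite pow1. unfold pow_neg. rewrite Ropp_0, Rmult_0_l, exp_0. lra.
Qed.

Lemma smooth_cutoff_lower D K n s : 0 < D -> 0 <= s -> 1 - smooth_cutoff D K n <= (D / (D + s)) ^ K * pow_neg n (- s).
Proof.
intros HD Hs. unfold smooth_cutoff. pose proof (ln_INR_nonneg n) as Hl.
assert (Hratio : 0 <= D / (D + s) <= 1) by (split; [pos|apply Rle_div_l; lra]).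
pose proof (exp_sum_scal_tail K (D / (D + s)) ((D + s) * lg n) ltac:(nra) Hratio) as Htail.
replace (D / (D + s) * ((D + s) * lg n)) with (D * lg n) in Htail by (field; lra).
apply Rle_trans with (pow_neg n D * (exp (D * lg n) - exp_sum K (D * lg n))).
- right. unfold pow_neg. rewrite Rmult_minus_distr_l, <- exp_plus. replace (- D * lg n + D * lg n) with 0 by ring.
  rewrite exp_0. ring.
- apply Rle_trans with (pow_neg n D * ((D / (D + s)) ^ K * exp ((D + s) * lg n)));
    [apply Rmult_le_compat_l; [pos|exact Htail]|].
  right. unfold pow_neg. replace (- - s * lg n) with (- D * lg n + (D + s) * lg n) by ring. rewrite exp_plus. ring.
Qed.

Lemma is_lim_seq_sum1 (f : nat -> nat -> R) (l : nat -> R) K :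
  (forall i, is_lim_seq (fun N => f N i) (l i)) -> is_lim_seq (fun N => sum1 (f N) K) (sum1 l K).
Proof.
intros Hf. induction K as [|K IH]; [apply is_lim_seq_const|]. simpl. apply is_lim_seq_plus'; [exact IH|apply Hf].
Qed.

Definition exp_poly (c : nat -> R) (K : nat) (x : R) : R :=
  sum1 (fun i => c (i - 1)%nat * (x ^ (i - 1) / INR (fact (i - 1)))) K.

(* The sign [- (-1)^j] cancels those of [log_coef] and of [(- log n)^j] in [taylor_term]. *)
Definition signed_sum (c f : nat -> R) (K : nat) : R :=
  sum1 (fun i => c (i - 1)%nat * (- (-1) ^ (i - 1) * f (i - 1)%nat)) K.

Lemma sign_square i : (-1) ^ i * (-1) ^ i = 1.
Proof. rewrite <- Rpow_mult_distr. replace (-1 * -1) with 1 by ring. apply pow1. Qed.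

Lemma log_coef_taylor_term al s t j n :
  - (-1) ^ j * (log_coef al n * taylor_term s t 0 j n) =
      mangoldt n * al n * cos (t * lg n) * (pow_neg n s * (lg n ^ j / INR (fact j))).
Proof.
unfold log_coef, taylor_term, exp_taylor, pow_neg. rewrite Rplus_0_r. replace (- lg n) with (-1 * lg n) by ring.
rewrite Rpow_mult_distr.
transitivity ((-1) ^ j * (-1) ^ j * (mangoldt n * al n * cos (t * lg n) * (exp (- s * lg n) * (lg n ^ j / INR (fact j)))));
  [unfold Rdiv; ring|].
rewrite sign_square. ring.
Qed.

Lemma is_lim_seq_weighted_mangoldt al s t (c : nat -> R) K : (forall n, Rabs (al n) <= 1) -> 3 <= s ->
  is_lim_seq (sum1 (fun n => mangoldt n * al n * cos (t * lg n) * (pow_neg n s * exp_poly c K (lg n))))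
    (signed_sum c (taylor_coef (log_coef al) s t 0) K).
Proof.
intros Hal Hs. apply (is_lim_seq_ext (fun N => signed_sum c (taylor_coefN (log_coef al) s t 0 N) K)).
- intros N. unfold signed_sum, taylor_coefN.
  rewrite (sum1_ext _ (fun i => sum1 (fun n => c (i - 1)%nat *
    (- (-1) ^ (i - 1) * (log_coef al n * taylor_term s t 0 (i - 1) n))) N))
    by (intros; rewrite !sum1_scal; ring).
  rewrite sum1_exchange. apply sum1_ext. intros n _. unfold exp_poly. rewrite <- !sum1_scal. apply sum1_ext. intros i _.
  rewrite log_coef_taylor_term. ring.
- apply is_lim_seq_sum1. intros i. do 2 apply is_lim_seq_scal_R. apply is_lim_seq_taylor_log_coef; assumption.
Qed.

Lemma smooth_cutoff_exp_poly D K n : smooth_cutoff D K n = pow_neg n D * exp_poly (pow D) K (lg n).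
Proof.
unfold smooth_cutoff, exp_sum, exp_poly. f_equal. apply sum1_ext. intros i _. rewrite Rpow_mult_distr. unfold Rdiv. ring.
Qed.

Lemma is_lim_seq_smooth_cutoff al D K : (forall n, Rabs (al n) <= 1) -> 3 <= D ->
  is_lim_seq (sum1 (fun n => mangoldt n * al n * smooth_cutoff D K n))
    (signed_sum (pow D) (taylor_coef (log_coef al) D 0 0) K).
Proof.
intros Hal HD. eapply is_lim_seq_ext; [|exact (is_lim_seq_weighted_mangoldt al D 0 (pow D) K Hal HD)].
intros N. apply sum1_ext. intros n _. rewrite Rmult_0_l, cos_0, Rmult_1_r, smooth_cutoff_exp_poly. reflexivity.
Qed.

Lemma Rabs_opp_sign i : Rabs (- (-1) ^ i) = 1.
Proof. rewrite Rabs_Ropp. apply pow_1_abs. Qed.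

Lemma signed_sum_bound (f : nat -> R) A D K : 3 <= D -> 0 <= A -> derivative_bound f A (D - 1 / 2) ->
  Rabs (signed_sum (pow D) f K) <= 2 * A * INR K ^ 2 * (D / (D - 1 / 2)) ^ K.
Proof.
intros HD HA Hf. set (B := 2 * A * INR K * (D / (D - 1 / 2)) ^ K).
replace (2 * A * INR K ^ 2 * (D / (D - 1 / 2)) ^ K) with (INR K * B) by (unfold B; ring).
rewrite <- sum1_const. apply Rabs_sum1_le. intros i Hi.
rewrite !Rabs_mult, Rabs_opp_sign, Rmult_1_l, Rabs_pos_eq by pos.
specialize (Hf (i - 1)%nat). replace (S (i - 1)) with i in Hf by lia.
apply Rle_trans with (D ^ (i - 1) * (2 * INR i * A / (D - 1 / 2) ^ i)); [apply Rmult_le_compat_l; [pos|exact Hf]|].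
replace (D ^ (i - 1) * (2 * INR i * A / (D - 1 / 2) ^ i)) with (2 * A * INR i * (D ^ (i - 1) / (D - 1 / 2) ^ i))
  by (unfold Rdiv; ring).
assert (HiK : INR i <= INR K) by (apply le_INR; lia). pose proof (pos_INR i).
unfold B. apply Rmult_le_compat; [nra|pos|nra|].
apply Rle_trans with ((D / (D - 1 / 2)) ^ i).
- unfold Rdiv. rewrite Rpow_mult_distr, pow_inv. apply Rmult_le_compat_r; [pos|]. apply Rle_pow; [lra|lia].
- apply Rle_pow; [|lia]. apply Rle_div_r; lra.
Qed.

Theorem smooth_mangoldt_char q ch D K : GRH -> real_char q ch -> 3 <= D ->
  exists l : R, is_lim_seq (sum1 (fun n => mangoldt n * ch n * smooth_cutoff D K n)) l /\
    Rabs l <= 2 * (lg q + ln (352 * D ^ 2)) * INR K ^ 2 * (D / (D - 1 / 2)) ^ K.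
Proof.
intros HG Hch HD. eexists. split; [apply is_lim_seq_smooth_cutoff; [intros; eapply real_char_abs, Hch|exact HD]|].
apply signed_sum_bound; [exact HD| |].
- pose proof (ln_INR_nonneg q).
  assert (0 <= ln (352 * D ^ 2)) by (apply ln_nonneg; simpl; nra). lra.
- destruct (char_coef_bound q ch D 0 HG Hch HD) as [Hbound _]. rewrite Rabs_R0 in Hbound.
  replace (32 * D * (11 * D + 5 * 0)) with (352 * D ^ 2) in Hbound by ring. exact Hbound.
Qed.

Lemma geom_sum_ratio D K : 1 < D -> (D / (D - 1)) ^ K - 1 = sum1 (fun i => D ^ (i - 1) / (D - 1) ^ i) K.
Proof.
intros HD. induction K as [|K IH]; [simpl; ring|]. rewrite sum1_succ, <- IH. replace (S K - 1)%nat with K by lia.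
simpl pow. unfold Rdiv. rewrite Rpow_mult_distr, pow_inv. field. split; [apply pow_nonzero; lra|lra].
Qed.

(* The main term [(D / (D - 1))^K - 1] is the contribution of the pole at [1]. *)
Theorem smooth_mangoldt_zeta D K : GRH -> 3 <= D ->
  exists l : R, is_lim_seq (sum1 (fun n => mangoldt n * smooth_cutoff D K n)) l /\
    Rabs (l - ((D / (D - 1)) ^ K - 1)) <= 2 * ln (336 * D ^ 3) * INR K ^ 2 * (D / (D - 1 / 2)) ^ K.
Proof.
intros HG HD. eexists. split.
{ eapply is_lim_seq_ext; [|exact (is_lim_seq_smooth_cutoff const1 D K const1_abs HD)]. intros N. apply sum1_ext. intros n _.
  unfold const1. ring. }
rewrite geom_sum_ratio by lra. unfold signed_sum. rewrite <- sum1_minus.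
rewrite (sum1_ext _ (fun i => D ^ (i - 1) * (- (-1) ^ (i - 1) * zeta_log_coef D (i - 1)))).
- apply signed_sum_bound; [exact HD| |apply zeta_coef_bound; assumption].
  apply ln_nonneg. assert (1 <= D ^ 3) by (apply pow_R1_Rle; lra). lra.
- intros i Hi. unfold zeta_log_coef. replace (S (i - 1)) with i by lia.
  replace (D ^ (i - 1) / (D - 1) ^ i) with ((-1) ^ (i - 1) * (-1) ^ (i - 1) * (D ^ (i - 1) / (D - 1) ^ i))
    by (rewrite sign_square; ring).
  unfold Rdiv. ring.
Qed.

Lemma INR_succ_mult_pow_le y j : 0 <= y < 1 -> INR (S j) * y ^ j <= / (1 - y).
Proof.
intros Hy. apply Rle_trans with (geom_sum y (S j)).
- induction j as [|j IH]; [simpl; lra|]. rewrite geom_sum_succ, S_INR, Rmult_plus_distr_r, Rmult_1_l.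
  apply Rplus_le_compat; [|lra].
  eapply Rle_trans; [|exact IH]. apply Rmult_le_compat_l; [apply pos_INR|]. simpl. assert (0 <= y ^ j) by pos. nra.
- apply Rmult_le_reg_l with (1 - y); [lra|]. rewrite geom_sum_mult, Rinv_r by lra. assert (0 <= y ^ S j) by pos. lra.
Qed.

Lemma geom_bound_of_derivative_bound f A r r' : 0 < r' < r -> 0 <= A -> derivative_bound f A r ->
  geom_bound f (2 * A / (r * (1 - r' / r))) r'.
Proof.
intros Hr HA Hf j. eapply Rle_trans; [apply Hf|].
assert (Hy : 0 <= r' / r < 1) by (split; [pos|apply Rlt_div_l; lra]).
replace (2 * INR (S j) * A / r ^ S j) with (2 * A / r * / r' ^ j * (INR (S j) * (r' / r) ^ j)).
- replace (2 * A / (r * (1 - r' / r)) / r' ^ j) with (2 * A / r * / r' ^ j * / (1 - r' / r)).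
  + apply Rmult_le_compat_l; [apply Rmult_le_pos; pos|apply INR_succ_mult_pow_le, Hy].
  + field. repeat split; try apply pow_nonzero; lra.
- unfold Rdiv. rewrite Rpow_mult_distr, pow_inv. simpl (r ^ S j). field. repeat split; try apply pow_nonzero; lra.
Qed.

Lemma sum_f_R0_sum1 f K : sum_f_R0 f K = f 0%nat + sum1 f K.
Proof. induction K as [|K IH]; simpl; [ring|rewrite IH; ring]. Qed.

(* [log n * log_weight lam K n] approximates [n^(lam - 3) - n^(-3)]. *)
Definition log_weight (lam : R) (K n : nat) : R := pow_neg n 3 * exp_poly (fun j => lam ^ S j / INR (S j)) K (lg n).

Lemma PS_Int_truncation f A r x K : 0 <= A -> Rabs x < r -> derivative_bound f A r ->
  Rabs (PSeries (PS_Int f) x - sum1 (fun i => f (i - 1)%nat / INR i * x ^ i) K) <=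
    2 * A * (Rabs x / r) ^ S K / (1 - Rabs x / r).
Proof.
intros HA Hx Hf. pose proof (Rabs_pos x).
assert (Hint : geom_bound (PS_Int f) (2 * A) r).
{ intros [|j]; unfold PS_Int; [rewrite Rabs_R0; simpl; lra|].
  unfold Rdiv at 1. rewrite Rabs_mult, (Rabs_pos_eq (/ INR (S j))) by pos.
  apply Rle_trans with (2 * INR (S j) * A / r ^ S j * / INR (S j)); [apply Rmult_le_compat_r; [pos|apply Hf]|].
  right. field. split; [apply pow_nonzero; lra|apply not_0_INR; lia]. }
pose proof (PSeries_geom_tail (PS_Int f) (2 * A) r x ltac:(lra) Hint Hx K) as Htail.
rewrite sum_f_R0_sum1 in Htail. unfold PS_Int at 2 in Htail. rewrite Rmult_0_l, Rplus_0_l in Htail.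
rewrite (sum1_ext _ (fun i => PS_Int f i * x ^ i)); [exact Htail|].
intros [|i] Hi; [lia|]. unfold PS_Int. replace (S i - 1)%nat with i by lia. reflexivity.
Qed.

Lemma signed_sum_log_weight f lam K :
  signed_sum (fun j => lam ^ S j / INR (S j)) f K = sum1 (fun i => f (i - 1)%nat / INR i * (- lam) ^ i) K.
Proof.
apply sum1_ext. intros [|i] Hi; [lia|]. replace (S i - 1)%nat with i by lia.
replace (- lam) with (-1 * lam) by ring. rewrite Rpow_mult_distr. simpl ((-1) ^ S i). unfold Rdiv. ring.
Qed.

Lemma ln2_bounds : 1 / 2 < ln 2 < 1.
Proof.
split; [pose proof ln_lt_2; lra|]. apply exp_lt_inv. rewrite exp_ln by lra. pose proof (exp_ineq1 1 ltac:(lra)). lra.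
Qed.

Lemma half_ln_taylor_norm2_0 al s t : al 1%nat = 1 -> (forall n, Rabs (al n) <= 1) -> 3 <= s ->
  Rabs (/ 2 * ln (taylor_coef al s t 0 0 ^ 2 + taylor_coef al s t (PI / 2) 0 ^ 2)) <= 2.
Proof.
intros H1 Hal Hs. set (a0 := taylor_coef al s t 0 0%nat). set (b0 := taylor_coef al s t (PI / 2) 0%nat).
assert (Hupper : forall ph, taylor_coef al s t ph 0%nat ^ 2 <= 2 ^ 2).
{ intros ph. rewrite <- pow2_abs. apply pow_incr. split; [apply Rabs_pos|].
  pose proof (taylor_coef_bound al Hal s t ph 1 1 ltac:(lra) ltac:(lra) ltac:(lra) ltac:(lra) 0%nat) as Hbound.
  simpl in Hbound. lra. }
pose proof (Hupper 0) as Ha. pose proof (Hupper (PI / 2)) as Hb. fold a0 in Ha. fold b0 in Hb.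
pose proof (taylor_coef_0_lower al s t H1 Hal Hs) as Hlower. fold a0 in Hlower.
assert (Hmin : / 2 ^ 2 <= a0 ^ 2 + b0 ^ 2).
{ pose proof (pow2_ge_0 b0). assert ((/ 2) ^ 2 <= a0 ^ 2) by (apply pow_incr; lra). rewrite <- pow_inv. lra. }
assert (Hmax : a0 ^ 2 + b0 ^ 2 <= 2 ^ 3) by (simpl in *; lra). pose proof ln2_bounds.
apply ln_le in Hmin; [|pos]. apply ln_le in Hmax; [|nra].
rewrite ln_Rinv, ln_pow in Hmin by pos. rewrite ln_pow in Hmax by lra. simpl INR in *. apply Rabs_le. lra.
Qed.

Lemma dirichlet_value_log_modulus q ch sigma t : GRH -> real_char q ch -> 1 / 2 < sigma < 1 ->
  exists u v : R, is_dirichlet_value ch sigma t u v /\ u ^ 2 + v ^ 2 =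
    (taylor_coef ch 3 t 0 0 ^ 2 + taylor_coef ch 3 t (PI / 2) 0 ^ 2) *
    exp (2 * PSeries (PS_Int (taylor_coef (log_coef ch) 3 t 0)) (- (3 - sigma))).
Proof.
intros HG Hch Hsigma. set (lam := 3 - sigma).
assert (Habs : forall n, Rabs (ch n) <= 1) by (intros; eapply real_char_abs, Hch).
pose proof (taylor_convergent_real_char q ch 3 t (11 / 4) Hch ltac:(lra) ltac:(lra)) as Hconv. set (C0 := INR q * _) in Hconv.
assert (Hlam : Rabs (- lam) = lam) by (rewrite Rabs_Ropp, Rabs_pos_eq; unfold lam; lra).
exists (PSeries (taylor_coef ch 3 t 0) (- lam)), (PSeries (taylor_coef ch 3 t (PI / 2)) (- lam)). split.
{ replace sigma with (3 + - lam) by (unfold lam; ring).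
  apply (dirichlet_value_real_shift ch C0 (11 / 4)); [exact Hconv|rewrite Hlam; unfold lam; lra]. }
destruct (char_coef_bound q ch 3 t HG Hch ltac:(lra)) as [Hp Hq]. set (A := lg q + _) in *.
assert (HA : 0 <= A).
{ pose proof (ln_INR_nonneg q). pose proof (Rabs_pos t).
  assert (0 <= ln (32 * 3 * (11 * 3 + 5 * Rabs t))) by (apply ln_nonneg; lra). unfold A. lra. }
set (rho := (lam + 5 / 2) / 2). assert (Hrho : lam < rho < 5 / 2) by (unfold rho, lam; lra).
replace (3 - 1 / 2) with (5 / 2) in Hp, Hq by field.
apply (geom_bound_of_derivative_bound _ A (5 / 2) rho ltac:(unfold lam in *; lra) HA) in Hp, Hq.
set (C1 := 2 * A / _) in *. assert (HC0 : 0 <= C0) by apply Hconv.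
assert (HC1 : 0 <= C1) by (apply Rmult_le_pos; [lra|]; left; apply Rinv_0_lt_compat; lra).
apply (modulus_along_ray _ _ _ (taylor_coef (log_coef ch) 3 t (PI / 2)) (C0 + C1) rho); [|rewrite Hlam; lra].
split; [unfold lam in *; lra|lra| | | | |apply dirichlet_log_derivative; [apply Hch|exact Habs|lra]].
- apply (geom_bound_weaken _ C0 _ (11 / 4)); [unfold lam in *; lra|lra|apply taylor_convergent_coef_bound, Hconv].
- apply (geom_bound_weaken _ C0 _ (11 / 4)); [unfold lam in *; lra|lra|apply taylor_convergent_coef_bound, Hconv].
- apply (geom_bound_weaken _ C1 _ rho); [unfold lam in *; lra|lra|exact Hp].
- apply (geom_bound_weaken _ C1 _ rho); [unfold lam in *; lra|lra|exact Hq].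
Qed.

Theorem log_L_truncated q ch sigma t K : GRH -> real_char q ch -> 1 / 2 < sigma < 1 ->
  let rho := (3 - sigma) / (5 / 2) in
  exists u v l : R, is_dirichlet_value ch sigma t u v /\ 0 < u ^ 2 + v ^ 2 /\
    is_lim_seq (sum1 (fun n => mangoldt n * ch n * cos (t * lg n) * log_weight (3 - sigma) K n)) l /\
    Rabs (/ 2 * ln (u ^ 2 + v ^ 2) - l) <= 2 + 2 * (lg q + ln (32 * 3 * (11 * 3 + 5 * Rabs t))) * rho ^ S K / (1 - rho).
Proof.
intros HG Hch Hsigma rho. assert (Habs : forall n, Rabs (ch n) <= 1) by (intros; eapply real_char_abs, Hch).
destruct (dirichlet_value_log_modulus q ch sigma t HG Hch Hsigma) as (u & v & Hval & Hmod).
set (lam := 3 - sigma) in *. set (f := taylor_coef (log_coef ch) 3 t 0) in *.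
exists u, v, (signed_sum (fun j => lam ^ S j / INR (S j)) f K). split; [exact Hval|].
rewrite Hmod. set (I := PSeries (PS_Int f) (- lam)).
pose proof (taylor_coef_0_lower ch 3 t (real_char_1 q ch Hch) Habs ltac:(lra)) as Hlower.
pose proof (half_ln_taylor_norm2_0 ch 3 t (real_char_1 q ch Hch) Habs ltac:(lra)) as Hln.
set (n0 := taylor_coef ch 3 t 0 0 ^ 2 + taylor_coef ch 3 t (PI / 2) 0 ^ 2) in *.
assert (Hn0 : 0 < n0) by (assert (0 < taylor_coef ch 3 t 0 0 ^ 2) by (apply pow_lt; lra);
  pose proof (pow2_ge_0 (taylor_coef ch 3 t (PI / 2) 0)); unfold n0; lra).
split; [apply Rmult_lt_0_compat; [exact Hn0|apply exp_pos]|].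
split; [exact (is_lim_seq_weighted_mangoldt ch 3 t _ K Habs ltac:(lra))|].
destruct (char_coef_bound q ch 3 t HG Hch ltac:(lra)) as [Hf _]. replace (3 - 1 / 2) with (5 / 2) in Hf by field.
fold f in Hf.
assert (Hlam : Rabs (- lam) = lam) by (rewrite Rabs_Ropp, Rabs_pos_eq; unfold lam; lra).
assert (HA : 0 <= lg q + ln (32 * 3 * (11 * 3 + 5 * Rabs t))).
{ pose proof (ln_INR_nonneg q). pose proof (Rabs_pos t).
  assert (0 <= ln (32 * 3 * (11 * 3 + 5 * Rabs t))) by (apply ln_nonneg; lra). lra. }
pose proof (PS_Int_truncation f _ (5 / 2) (- lam) K HA ltac:(rewrite Hlam; unfold lam; lra) Hf) as Htrunc.
rewrite Hlam, <- signed_sum_log_weight in Htrunc. fold I rho in Htrunc.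
rewrite ln_mult, ln_exp by (try exact Hn0; apply exp_pos).
set (Q := signed_sum _ f K) in *. replace (/ 2 * (ln n0 + 2 * I) - Q) with (/ 2 * ln n0 + (I - Q)) by field.
eapply Rle_trans; [apply Rabs_triang|]. lra.
Qed.
(** * The prime number theorem *)

Definition prime_ind (n : nat) : R := if prime_dec (Z.of_nat n) then 1 else 0.

Definition mangoldt_powers (n : nat) : R := mangoldt n - prime_ind n * lg n.

Lemma prime_ind_bounds n : 0 <= prime_ind n <= 1. Proof. unfold prime_ind. destruct prime_dec; lra. Qed.

Lemma mangoldt_powers_nonneg n : 0 <= mangoldt_powers n.
Proof.
unfold mangoldt_powers, prime_ind. destruct (prime_dec (Z.of_nat n)) as [Hn|Hn]; [rewrite mangoldt_prime by exact Hn; lra|].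
pose proof (mangoldt_nonneg n). lra.
Qed.

Lemma mangoldt_powers_neq_0 n : mangoldt_powers n <> 0 ->
  exists p k, (2 <= p)%nat /\ (1 <= k)%nat /\ n = (p ^ S k)%nat /\ mangoldt_powers n <= lg p.
Proof.
unfold mangoldt_powers, prime_ind. destruct (prime_dec (Z.of_nat n)) as [Hn|Hn]; [rewrite mangoldt_prime by exact Hn; lra|].
rewrite Rmult_0_l, Rminus_0_r. intros Hneq. destruct (mangoldt_prime_power_nat n Hneq) as (p & k & Hp & Hk & Hpow & Hval).
destruct k as [|[|k]]; [lia| |].
- rewrite Nat.pow_1_r in Hpow. subst. contradiction.
- exists p, (S k). apply prime_ge_2 in Hp. split; [lia|split; [lia|split; [exact Hpow|lra]]].
Qed.

Lemma pow_neg_pow p k s : (1 <= p)%nat -> pow_neg (p ^ k) s = pow_neg p s ^ k.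
Proof.
intros Hp. induction k as [|k IH]; [apply pow_neg_1_l|]. rewrite Nat.pow_succ_r', pow_neg_mult, IH; [reflexivity|exact Hp|].
assert (p ^ k <> 0)%nat by (apply Nat.pow_nonzero; lia). lia.
Qed.

Lemma sum1_delta_le m c N : 0 <= c -> sum1 (fun n => if Nat.eqb n m then c else 0) N <= c.
Proof.
intros Hc. enough (Hsum : sum1 (fun n => if Nat.eqb n m then c else 0) N <= c /\
  ((N < m)%nat -> sum1 (fun n => if Nat.eqb n m then c else 0) N = 0)) by apply Hsum.
induction N as [|N [IH1 IH2]]; [simpl; split; [lra|reflexivity]|]. rewrite sum1_succ.
destruct (Nat.eqb_spec (S N) m); split; intros; try lra; try lia; rewrite IH2 by lia; lra.
Qed.

Lemma sum1_ge_term f k N : (1 <= k <= N)%nat -> (forall n, 0 <= f n) -> f k <= sum1 f N.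
Proof.
intros Hk Hf. destruct k as [|k]; [lia|]. apply Rle_trans with (sum1 f (S k)).
- rewrite sum1_succ. assert (0 <= sum1 f k) by (apply sum1_nonneg; auto). lra.
- apply sum1_incr; [lia|auto].
Qed.

Definition prime_power_term (s : R) (p k : nat) : R := if Nat.leb 2 p then lg p * pow_neg p s ^ S k else 0.

Lemma prime_power_term_nonneg s p k : 0 <= prime_power_term s p k.
Proof. unfold prime_power_term. destruct (Nat.leb 2 p); [|lra]. apply Rmult_le_pos; [apply ln_INR_nonneg|pos]. Qed.

Lemma mangoldt_powers_le_double_sum s n N : (n <= N)%nat -> mangoldt_powers n * pow_neg n s <=
  sum1 (fun p => sum1 (fun k => if Nat.eqb n (p ^ S k) then prime_power_term s p k else 0) N) N.
Proof.
intros Hn. set (f := fun p k => if Nat.eqb n (p ^ S k) then prime_power_term s p k else 0).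
assert (Hf : forall p k, 0 <= f p k) by (intros; unfold f; destruct (Nat.eqb _ _); [apply prime_power_term_nonneg|lra]).
assert (Hsum : forall p, 0 <= sum1 (f p) N) by (intros; apply sum1_nonneg; auto).
destruct (Req_dec (mangoldt_powers n) 0) as [Hz|Hnz]; [rewrite Hz, Rmult_0_l; apply sum1_nonneg; intros p _; apply Hsum|].
destruct (mangoldt_powers_neq_0 n Hnz) as (p & k & Hp & Hk & Hpow & Hle).
assert (Hkp : (k < p ^ k)%nat) by (apply Nat.pow_gt_lin_r; lia).
assert (Hpn : (p <= n /\ k <= n)%nat) by (rewrite Hpow, Nat.pow_succ_r'; nia).
eapply Rle_trans; [|apply (sum1_ge_term (fun p => sum1 (f p) N) p N ltac:(lia) Hsum)].
eapply Rle_trans; [|apply (sum1_ge_term (f p) k N ltac:(lia) (Hf p))].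
unfold f, prime_power_term. rewrite (proj2 (Nat.eqb_eq n (p ^ S k)) Hpow), (proj2 (Nat.leb_le 2 p) Hp).
rewrite Hpow at 2. rewrite pow_neg_pow by lia. apply Rmult_le_compat_r; [pos|exact Hle].
Qed.

Lemma geom_sum_le y N : 0 <= y < 1 -> 0 <= geom_sum y N <= / (1 - y).
Proof.
intros Hy. split; [induction N as [|N IH]; simpl; nra|].
apply Rmult_le_reg_l with (1 - y); [lra|]. rewrite geom_sum_mult, Rinv_r by lra. assert (0 <= y ^ N) by pos. lra.
Qed.

Lemma sum1_pow_succ y N : sum1 (fun k => y ^ S k) N = y * y * geom_sum y N.
Proof. induction N as [|N IH]; [simpl; ring|]. rewrite sum1_succ, IH, geom_sum_succ. simpl. ring. Qed.

Lemma pow_neg_2_lt_1 s : 0 < s -> 0 < pow_neg 2 s < 1.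
Proof.
intros Hs. split; [apply pow_neg_pos|]. unfold pow_neg. rewrite <- exp_0. apply exp_increasing.
assert (0 < lg 2) by (rewrite <- ln_1; apply ln_increasing; simpl; lra). nra.
Qed.

Lemma sum1_prime_power_term_le e p N : 0 < e ->
  sum1 (prime_power_term (1 / 2 + e) p) N <= / (1 - pow_neg 2 (1 / 2 + e)) * (/ e * pow_neg p (1 + e)).
Proof.
intros He. set (s := 1 / 2 + e). destruct (pow_neg_2_lt_1 s ltac:(unfold s; lra)) as [Hr0 Hr1]. set (r := pow_neg 2 s) in *.
pose proof (pow_neg_pos p (1 + e)). unfold prime_power_term. destruct (Nat.leb_spec 2 p) as [Hp|Hp].
2: { rewrite sum1_0. assert (0 < / (1 - r)) by pos. pos. }
set (y := pow_neg p s). assert (Hy : 0 < y <= r) by (split; [apply pow_neg_pos|apply pow_neg_decr; [unfold s; lra|lia]]).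
rewrite sum1_scal, sum1_pow_succ. destruct (geom_sum_le y N ltac:(lra)) as [Hgeom0 Hgeom].
assert (Hgeom_r : geom_sum y N <= / (1 - r))
  by (apply Rle_trans with (/ (1 - y)); [exact Hgeom|apply Rinv_le_contravar; lra]).
assert (Hlog : lg p * (y * y) <= / e * pow_neg p (1 + e)).
{ unfold y. rewrite <- pow_neg_plus. replace (/ e * pow_neg p (1 + e)) with (/ e * pow_neg p (- e) * pow_neg p (s + s)).
  - apply Rmult_le_compat_r; [pos|apply ln_INR_le_pow_neg, He].
  - rewrite Rmult_assoc, <- pow_neg_plus. do 2 f_equal. unfold s. field. }
replace (lg p * (y * y * geom_sum y N)) with (geom_sum y N * (lg p * (y * y))) by ring.
apply Rmult_le_compat; [exact Hgeom0|apply Rmult_le_pos; [apply ln_INR_nonneg|nra]|exact Hgeom_r|exact Hlog].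
Qed.

Lemma sum1_mangoldt_powers_bounded s : 1 / 2 < s -> exists C, 0 <= C /\
  forall N, sum1 (fun n => mangoldt_powers n * pow_neg n s) N <= C.
Proof.
intros Hs. set (e := s - 1 / 2). assert (He : 0 < e) by (unfold e; lra). assert (Hes : 1 / 2 + e = s) by (unfold e; ring).
set (r := pow_neg 2 s). assert (Hr : 0 < / (1 - r)) by (apply Rinv_0_lt_compat; pose proof (pow_neg_2_lt_1 s); unfold r; lra).
assert (0 < / e) by pos. exists (/ (1 - r) * (/ e * (1 + / e))). split; [pos|]. intros N.
apply Rle_trans with (sum1 (fun n => sum1
  (fun p => sum1 (fun k => if Nat.eqb n (p ^ S k) then prime_power_term s p k else 0) N) N) N).
{ apply sum1_le. intros n Hn. apply mangoldt_powers_le_double_sum. lia. }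
rewrite sum1_exchange. apply Rle_trans with (sum1 (fun p => / (1 - r) * (/ e * pow_neg p (1 + e))) N).
- apply sum1_le. intros p _. rewrite sum1_exchange. apply Rle_trans with (sum1 (prime_power_term s p) N).
  + apply sum1_le. intros k _. apply sum1_delta_le, prime_power_term_nonneg.
  + unfold r. rewrite <- Hes. apply sum1_prime_power_term_le, He.
- rewrite !sum1_scal. do 2 (apply Rmult_le_compat_l; [lra|]). apply sum1_pow_neg_le, He.
Qed.

Lemma at_infinity_ge c : Rbar_locally p_infty (fun x => c <= x).
Proof. exists c. intros x. apply Rlt_le. Qed.

Lemma at_infinity_ln (P : R -> Prop) : Rbar_locally p_infty P -> Rbar_locally p_infty (fun x => P (ln x)).
Proof. exact (is_lim_ln_p P). Qed.

Lemma eventually_ln_INR (P : R -> Prop) : Rbar_locally p_infty P -> eventually (fun N => (1 <= N)%nat /\ P (lg N)).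
Proof. intros HP. apply filter_and; [exists 1%nat; auto|exact (is_lim_seq_INR _ (at_infinity_ln P HP))]. Qed.

Lemma at_infinity_pow_le_exp c m e : 0 < e -> Rbar_locally p_infty (fun x => c * x ^ m <= exp (e * x)).
Proof.
intros He. set (F := INR (fact (S m))). assert (HF : 0 < F) by pos. assert (Hem : 0 < e ^ S m) by pos.
apply (filter_imp (fun x => 0 <= x /\ Rabs c * F / e ^ S m <= x)); [|apply filter_and; apply at_infinity_ge].
intros x [Hx0 Hx]. eapply Rle_trans; [|apply (exp_term_le (e * x) (S m)); nra]. fold F.
apply (proj1 (Rle_div_r (c * x ^ m) _ F HF)). rewrite Rpow_mult_distr. simpl (x ^ S m).
apply Rle_div_l in Hx; [|exact Hem]. assert (0 <= x ^ m) by pos. pose proof (Rle_abs c).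
apply Rle_trans with (x ^ m * (Rabs c * F)).
- replace (c * x ^ m * F) with (x ^ m * (c * F)) by ring. apply Rmult_le_compat_l; [assumption|apply Rmult_le_compat_r; lra].
- apply Rle_trans with (x ^ m * (x * e ^ S m)); [apply Rmult_le_compat_l; assumption|]. right. ring.
Qed.

Ltac at_infinity := repeat apply filter_and; first [apply at_infinity_ge | apply at_infinity_pow_le_exp; lra].

Lemma pow_exp_ln r K : 0 < r -> r ^ K = exp (INR K * ln r).
Proof. intros Hr. rewrite <- (exp_ln r Hr) at 1. rewrite <- exp_INR_mult. reflexivity. Qed.

Lemma ratio_pow_upper D T s K : INR K = D * T -> 0 < T -> 0 <= s -> 2 * s <= D -> 0 < D ->
  (D / (D - s)) ^ K <= exp (T * s + 2 * T * s ^ 2 / D).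
Proof.
intros HK HT Hs HD HD0. assert (0 < D / (D - s)) by pos.
rewrite pow_exp_ln by assumption. apply exp_le_compat. rewrite HK.
assert (Hln : ln (D / (D - s)) <= s / (D - s)).
{ eapply Rle_trans; [apply ln_le_minus_1; assumption|]. right. field. lra. }
apply Rle_trans with (D * T * (s / (D - s))); [apply Rmult_le_compat_l; [nra|exact Hln]|].
replace (D * T * (s / (D - s))) with (T * s + T * s ^ 2 / (D - s)) by (field; lra).
apply Rplus_le_compat_l. unfold Rdiv. rewrite (Rmult_comm 2 T), !Rmult_assoc. apply Rmult_le_compat_l; [lra|].
replace (2 * (s ^ 2 * / D)) with (s ^ 2 * (2 * / D)) by ring. apply Rmult_le_compat_l; [apply pow2_ge_0|].
replace (2 * / D) with (/ (D / 2)) by (field; lra). apply Rinv_le_contravar; lra.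
Qed.

Lemma ratio_pow_lower D T s K : INR K = D * T -> 0 < T -> 0 <= s < D -> exp (T * s) <= (D / (D - s)) ^ K.
Proof.
intros HK HT Hs. assert (0 < D / (D - s)) by pos.
rewrite pow_exp_ln by assumption. apply exp_le_compat. rewrite HK.
assert (Hln : s / D <= ln (D / (D - s))).
{ replace (D / (D - s)) with (/ ((D - s) / D)) by (field; lra). rewrite ln_Rinv by pos.
  assert (ln ((D - s) / D) <= (D - s) / D - 1) by (apply ln_le_minus_1, Rdiv_lt_0_compat; lra).
  assert ((D - s) / D - 1 = - (s / D)) by (field; lra). lra. }
apply Rle_trans with (D * T * (s / D)); [right; field; lra|]. apply Rmult_le_compat_l; [nra|exact Hln].
Qed.

Lemma ratio_plus_pow_upper D T s K : INR K = D * T -> 0 < T -> 0 <= s -> 0 < D ->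
  (D / (D + s)) ^ K <= exp (- (T * s) + T * s ^ 2 / D).
Proof.
intros HK HT Hs HD0. assert (0 < D / (D + s)) by pos.
rewrite pow_exp_ln by assumption. apply exp_le_compat. rewrite HK.
assert (Hln : ln (D / (D + s)) <= - (s / (D + s))).
{ eapply Rle_trans; [apply ln_le_minus_1; assumption|]. right. field. lra. }
apply Rle_trans with (D * T * - (s / (D + s))); [apply Rmult_le_compat_l; [nra|exact Hln]|].
replace (D * T * - (s / (D + s))) with (- (T * s) + T * s ^ 2 / (D + s)) by (field; lra).
apply Rplus_le_compat_l. unfold Rdiv. apply Rmult_le_compat_l; [pose proof (pow2_ge_0 s); nra|]. apply Rinv_le_contravar; lra.
Qed.

Lemma smooth_cutoff_tail D K s N M : 3 <= s < D -> (1 <= N <= M)%nat ->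
  sum1 (fun n => lg n * smooth_cutoff D K n) M - sum1 (fun n => lg n * smooth_cutoff D K n) N <=
    (D / (D - s)) ^ K * pow_neg N (s - 2).
Proof.
intros Hs HN. set (r := (D / (D - s)) ^ K). assert (Hr : 0 < r) by pos. set (f := fun n => lg n * smooth_cutoff D K n).
assert (Htail : Rabs (sum1 f M - sum1 f N) <= r * (/ (s - 2) * pow_neg N (s - 2))).
{ apply sum1_tail_le; [lra|lra|exact HN|]. intros n Hn. unfold f.
  pose proof (smooth_cutoff_nonneg D K n ltac:(lra)). pose proof (ln_INR_nonneg n).
  rewrite Rabs_pos_eq by (apply Rmult_le_pos; assumption).
  pose proof (ln_INR_le_pow_neg n 1 ltac:(lra)) as Hln. rewrite Rinv_1, Rmult_1_l in Hln.
  apply Rle_trans with (pow_neg n (-1) * (r * pow_neg n s)).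
  - apply Rmult_le_compat; try assumption. apply smooth_cutoff_upper; lra.
  - right. replace (1 + (s - 2)) with (-1 + s) by ring. rewrite pow_neg_plus. ring. }
eapply Rle_trans; [apply Rle_abs|]. eapply Rle_trans; [exact Htail|]. apply Rmult_le_compat_l; [lra|].
pose proof (pow_neg_pos N (s - 2)). assert (/ (s - 2) <= / 1) by (apply Rinv_le_contravar; lra). rewrite Rinv_1 in *. nra.
Qed.

(* Smoothing at [log n = T], where [T] is comparable to a large [L], with the order of smoothing a power of [L]. *)
Record smoothing_level (L T D : R) (K : nat) : Prop := {
  smoothing_large : 10 <= L;
  smoothing_length : L / 2 <= T <= 2 * L;
  smoothing_ratio : INR K = D * T;
  smoothing_scale : L ^ 4 / 2 <= D <= 4 * L ^ 4;
  smoothing_scale_large : 500 * L <= D;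
  smoothing_order : INR K <= 2 * L ^ 5
}.

Lemma exists_smoothing_level L T : 10 <= L -> L / 2 <= T <= 2 * L -> exists K D, smoothing_level L T D K.
Proof.
intros HL HT. assert (HL5 : 1 <= L ^ 5) by (apply pow_R1_Rle; lra).
assert (HL3 : 1000 <= L ^ 3) by (replace 1000 with (10 ^ 3) by ring; apply pow_incr; lra).
destruct (nfloor_ex (L ^ 5)) as [n [Hn1 Hn2]]; [lra|].
set (k := INR (S n)). assert (Hk : L ^ 5 < k <= 2 * L ^ 5) by (unfold k; rewrite S_INR; lra).
assert (HD : L ^ 4 / 2 <= k / T <= 4 * L ^ 4).
{ split; apply Rmult_le_reg_r with T; try lra; replace (k / T * T) with k by (field; lra); nra. }
exists (S n), (k / T). fold k. split; try assumption; [fold k; field; lra|nra|apply Hk].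
Qed.

Lemma smoothing_error L T D K A : smoothing_level L T D K -> 0 <= A ->
  2 * A * INR K ^ 2 * (D / (D - 1 / 2)) ^ K <= 24 * A * L ^ 10 * exp (T / 2).
Proof.
intros [HL HT HK _ HD HK2] HA.
assert (Hratio : (D / (D - 1 / 2)) ^ K <= 3 * exp (T / 2)).
{ eapply Rle_trans; [apply (ratio_pow_upper D T (1 / 2) K HK); lra|]. apply Rle_trans with (exp (1 + T / 2)).
  - apply exp_le_compat. assert (2 * T * (1 / 2) ^ 2 / D <= 1) by (apply Rle_div_l; lra). lra.
  - rewrite exp_plus. apply Rmult_le_compat_r; [pos|apply exp_le_3]. }
assert (Horder : INR K ^ 2 <= 4 * L ^ 10).
{ replace (4 * L ^ 10) with ((2 * L ^ 5) ^ 2) by ring. apply pow_incr. split; [apply pos_INR|exact HK2]. }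
replace (24 * A * L ^ 10 * exp (T / 2)) with ((2 * A * (4 * L ^ 10)) * (3 * exp (T / 2))) by ring.
apply Rmult_le_compat; [pose proof (pow2_ge_0 (INR K)); nra|pos| |exact Hratio].
apply Rmult_le_compat_l; lra.
Qed.

Lemma zeta_smoothing_error L T D K : smoothing_level L T D K ->
  2 * ln (336 * D ^ 3) * INR K ^ 2 * (D / (D - 1 / 2)) ^ K <= 600000 * L ^ 22 * exp (T / 2).
Proof.
intros Hlevel. pose proof (smoothing_large _ _ _ _ Hlevel) as HL. pose proof (smoothing_scale_large _ _ _ _ Hlevel) as HD.
assert (D1 : 1 <= D ^ 3) by (apply pow_R1_Rle; lra).
assert (D3 : D ^ 3 <= 64 * L ^ 12).
{ replace (64 * L ^ 12) with ((4 * L ^ 4) ^ 3) by ring. apply pow_incr. split; [lra|apply Hlevel]. }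
assert (Hln0 : 0 <= ln (336 * D ^ 3)) by (apply ln_nonneg; lra).
assert (Hln1 : ln (336 * D ^ 3) <= 336 * D ^ 3 - 1) by (apply ln_le_minus_1; lra).
eapply Rle_trans; [apply (smoothing_error L T D K _ Hlevel Hln0)|]. apply Rmult_le_compat_r; [pos|].
replace (600000 * L ^ 22) with (600000 * L ^ 12 * L ^ 10) by ring. apply Rmult_le_compat_r; [pos|lra].
Qed.

Definition chebyshev_theta (N : nat) : R := sum1 (fun n => prime_ind n * lg n) N.

Lemma chebyshev_psi_smoothing L T d : GRH -> 0 < d <= 1 / 4 -> 10 <= L -> 72 / d ^ 2 <= L -> L - d <= T <= L + d ->
  exists (K : nat) (D s l : R), 5000 <= D /\ INR K = D * T /\ 3 <= s /\ s * d = 3 * L /\ 2 * s <= D /\ 2 * T * s ^ 2 <= D /\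
    2 * T <= d * D /\
    is_lim_seq (sum1 (fun n => mangoldt n * smooth_cutoff D K n)) l /\ Rabs (l - ((D / (D - 1)) ^ K - 1)) <=
      600000 * L ^ 22 * exp (T / 2).
Proof.
intros HG Hd HL HLd HT. assert (Hd2 : 0 < d ^ 2) by pos. apply Rle_div_l in HLd; [|exact Hd2].
destruct (exists_smoothing_level L T HL ltac:(lra)) as (K & D & Hlevel). pose proof Hlevel as [_ _ HK HD HD5 HK2].
set (s := 3 * L / d). assert (Hsd : s * d = 3 * L) by (unfold s; field; lra). assert (Hs3 : 3 <= s) by nra.
assert (HsD : 2 * T * s ^ 2 <= D).
{ apply Rmult_le_reg_r with (d ^ 2); [exact Hd2|].
  replace (2 * T * s ^ 2 * d ^ 2) with (2 * T * (s * d) ^ 2) by ring. rewrite Hsd.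
  apply Rle_trans with (36 * L ^ 3); [assert (0 < L ^ 2) by pos; replace (L ^ 3) with (L * L ^ 2) by ring; nra|].
  apply Rle_trans with (L ^ 4 / 2 * d ^ 2); [replace (L ^ 4) with (L * L ^ 3) by ring; nra|apply Rmult_le_compat_r; lra]. }
destruct (smooth_mangoldt_zeta D K HG ltac:(lra)) as (l & Hlim & Herr).
exists K, D, s, l. repeat (split; [first [assumption | lra | nra]|]). eapply Rle_trans; [exact Herr|].
apply zeta_smoothing_error, Hlevel.
Qed.

Lemma chebyshev_psi_lower N d : GRH -> 0 < d <= 1 / 4 -> let L := lg N in (1 <= N)%nat -> 10 <= L -> 72 / d ^ 2 <= L ->
  exp (L - d) - 2 - 600000 * L ^ 22 * exp (L / 2) <= sum1 mangoldt N.
Proof.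
intros HG Hd L HN HL HLd.
destruct (chebyshev_psi_smoothing L (L - d) d HG Hd HL HLd ltac:(lra))
  as (K & D & s & l & HD & HK & Hs3 & Hsd & HsD2 & HsD & _ & Hlim & Herr).
set (T := L - d) in *. assert (HT : 1 <= T) by (unfold T; lra).
pose proof (ratio_pow_lower D T 1 K HK ltac:(lra) ltac:(lra)) as Hmain. rewrite Rmult_1_r in Hmain.
assert (Htail : (D / (D - s)) ^ K * pow_neg N (s - 2) <= 1).
{ apply Rle_trans with (exp (T * s + 1) * pow_neg N (s - 2)).
  - apply Rmult_le_compat_r; [pos|]. eapply Rle_trans; [apply (ratio_pow_upper D T s K HK); lra|]. apply exp_le_compat.
    assert (2 * T * s ^ 2 / D <= 1) by (apply Rle_div_l; lra). lra.
  - unfold pow_neg. rewrite <- exp_plus. apply Rle_trans with (exp 0);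
      [apply exp_le_compat; fold L; unfold T|rewrite exp_0; lra].
    replace ((L - d) * s + 1 + - (s - 2) * L) with (2 * L + 1 - s * d) by ring. lra. }
assert (Hup : l <= sum1 mangoldt N + 1).
{ apply (is_lim_seq_le_const (sum1 (fun n => mangoldt n * smooth_cutoff D K n))); [|exact Hlim].
  exists N. intros M HM. pose proof (smooth_cutoff_tail D K s N M ltac:(lra) ltac:(lia)).
  assert (sum1 (fun n => mangoldt n * smooth_cutoff D K n) N <= sum1 mangoldt N).
  { apply sum1_le. intros n _. pose proof (mangoldt_nonneg n). pose proof (smooth_cutoff_le_1 D K n ltac:(lra)). nra. }
  assert (Hincr : sum1 (fun n => lg n * smooth_cutoff D K n - mangoldt n * smooth_cutoff D K n) N <=
    sum1 (fun n => lg n * smooth_cutoff D K n - mangoldt n * smooth_cutoff D K n) M).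
  { apply sum1_incr; [exact HM|]. intros n _. pose proof (mangoldt_le_ln n).
    pose proof (smooth_cutoff_nonneg D K n ltac:(lra)). nra. }
  rewrite !sum1_minus in Hincr. lra. }
apply Rabs_le_between in Herr.
assert (600000 * L ^ 22 * exp (T / 2) <= 600000 * L ^ 22 * exp (L / 2))
  by (apply Rmult_le_compat_l; [pos|apply exp_le_compat; unfold T; lra]).
lra.
Qed.

Lemma exp_le_inv_one_minus x : 0 <= x < 1 -> exp x <= / (1 - x).
Proof.
intros Hx. rewrite <- (Rinv_inv (exp x)), <- exp_Ropp. apply Rinv_le_contravar; [lra|]. pose proof (exp_ineq1_le (- x)). lra.
Qed.

Lemma chebyshev_psi_upper_smooth D T s d L K N : 5000 <= D -> 1 <= T -> INR K = D * T -> 3 <= s -> 2 * T * s ^ 2 <= D ->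
  (1 <= N)%nat -> L = lg N -> T = L + d -> 2 * L + 1 <= s * d ->
  sum1 mangoldt N <= sum1 (fun n => mangoldt n * smooth_cutoff D K n) N + 1.
Proof.
intros HD HT HK Hs HsD HN HL HTd Hsd.
assert (HNL : INR N = exp L) by (rewrite HL, exp_ln; [reflexivity|pos]).
assert (Hdiff : sum1 (fun n => mangoldt n * (1 - smooth_cutoff D K n)) N <=
  INR N * (exp L * (exp (- (T * s) + 1) * exp (s * L)))).
{ rewrite <- sum1_const. apply sum1_le. intros n Hn.
  assert (Hln : lg n <= L) by (rewrite HL; apply ln_le; [pos|apply le_INR; lia]).
  apply Rmult_le_compat; [apply mangoldt_nonneg|pose proof (smooth_cutoff_le_1 D K n ltac:(lra)); lra| |].
  - eapply Rle_trans; [apply mangoldt_le_ln|]. pose proof (exp_ineq1_le L). lra.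
  - eapply Rle_trans; [apply (smooth_cutoff_lower D K n s); lra|]. apply Rmult_le_compat; [pos|pos| |].
    + eapply Rle_trans; [apply (ratio_plus_pow_upper D T s K HK); lra|]. apply exp_le_compat.
      assert (T * s ^ 2 / D <= 1); [|lra]. apply Rle_div_l; [lra|]. pose proof (pow2_ge_0 s). nra.
    + unfold pow_neg. apply exp_le_compat. nra. }
assert (Hsmall : INR N * (exp L * (exp (- (T * s) + 1) * exp (s * L))) <= 1).
{ rewrite HNL, <- !exp_plus. apply Rle_trans with (exp 0); [apply exp_le_compat; rewrite HTd|rewrite exp_0; lra].
  replace (L + (L + (- ((L + d) * s) + 1 + s * L))) with (2 * L + 1 - s * d) by ring. lra. }
rewrite (sum1_ext _ (fun n => mangoldt n - mangoldt n * smooth_cutoff D K n)), sum1_minus in Hdiff by (intros; ring). lra.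
Qed.

Lemma chebyshev_psi_upper N d : GRH -> 0 < d <= 1 / 4 -> let L := lg N in (1 <= N)%nat -> 10 <= L -> 72 / d ^ 2 <= L ->
  sum1 mangoldt N <= exp (L + 2 * d) + 1 + 1200000 * L ^ 22 * exp (L / 2).
Proof.
intros HG Hd L HN HL HLd.
destruct (chebyshev_psi_smoothing L (L + d) d HG Hd HL HLd ltac:(lra))
  as (K & D & s & l & HD & HK & Hs3 & Hsd & _ & HsD & HTd & Hlim & Herr).
set (T := L + d) in *. assert (HT : 1 <= T) by (unfold T; lra).
assert (Hmain : (D / (D - 1)) ^ K <= exp (L + 2 * d)).
{ eapply Rle_trans; [apply (ratio_pow_upper D T 1 K HK); lra|]. apply exp_le_compat.
  assert (2 * T * 1 ^ 2 / D <= d) by (apply Rle_div_l; lra). unfold T in *. lra. }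
assert (Hlimit : sum1 (fun n => mangoldt n * smooth_cutoff D K n) N <= l).
{ set (f := fun n => _). apply (is_lim_seq_ge_const (sum1 f)); [|exact Hlim].
  exists N. intros M HM. apply sum1_incr; [exact HM|]. intros n _.
  apply Rmult_le_pos; [apply mangoldt_nonneg|apply smooth_cutoff_nonneg; lra]. }
pose proof (chebyshev_psi_upper_smooth D T s d L K N HD HT HK Hs3 HsD HN eq_refl eq_refl ltac:(lra)).
apply Rabs_le_between in Herr.
assert (Hexp : exp (T / 2) <= 2 * exp (L / 2)).
{ unfold T. replace ((L + d) / 2) with (d / 2 + L / 2) by field. rewrite exp_plus. apply Rmult_le_compat_r; [pos|].
  eapply Rle_trans; [apply exp_le_inv_one_minus; lra|]. replace 2 with (/ (1 / 2)) by field. apply Rinv_le_contravar; lra. }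
assert (600000 * L ^ 22 * exp (T / 2) <= 600000 * L ^ 22 * (2 * exp (L / 2))) by (apply Rmult_le_compat_l; [pos|exact Hexp]).
lra.
Qed.

Lemma sum1_mangoldt_powers_le s C N : 0 <= s -> (1 <= N)%nat ->
  (forall N, sum1 (fun n => mangoldt_powers n * pow_neg n s) N <= C) ->
  sum1 mangoldt_powers N <= C * exp (s * lg N).
Proof.
intros Hs HN HC. apply Rle_trans with (exp (s * lg N) * sum1 (fun n => mangoldt_powers n * pow_neg n s) N).
- rewrite <- sum1_scal. apply sum1_le. intros n Hn. rewrite (Rmult_comm (mangoldt_powers n)), <- Rmult_assoc.
  assert (1 <= exp (s * lg N) * pow_neg n s).
  { unfold pow_neg. rewrite <- exp_plus, <- exp_0. apply exp_le_compat.
    assert (lg n <= lg N) by (apply ln_le; [pos|apply le_INR; lia]). nra. }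
  pose proof (mangoldt_powers_nonneg n). nra.
- rewrite Rmult_comm. apply Rmult_le_compat_r; [pos|apply HC].
Qed.

Lemma chebyshev_theta_eq N : chebyshev_theta N = sum1 mangoldt N - sum1 mangoldt_powers N.
Proof. unfold chebyshev_theta. rewrite <- sum1_minus. apply sum1_ext. intros. unfold mangoldt_powers. ring. Qed.

Theorem prime_number_theorem delta : GRH -> 0 < delta <= 1 ->
  eventually (fun N => (1 - delta) * INR N <= chebyshev_theta N <= (1 + delta) * INR N).
Proof.
intros HG Hdelta. set (d := delta / 8). assert (Hd : 0 < d <= 1 / 8) by (unfold d; lra).
destruct (sum1_mangoldt_powers_bounded (3 / 4) ltac:(lra)) as (C & HC & HCN).
assert (Hlarge : Rbar_locally p_infty (fun L => 10 <= L /\ 72 / d ^ 2 <= L /\ 1200000 / d * L ^ 22 <= exp (1 / 2 * L) /\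
  2 / d * L ^ 0 <= exp (1 * L) /\ C / d * L ^ 0 <= exp (1 / 4 * L))) by at_infinity.
apply eventually_ln_INR in Hlarge. revert Hlarge. apply filter_imp. intros N (HN & HL10 & HLd & Herror & Hconst & Hpowers).
pose proof (chebyshev_psi_lower N d HG ltac:(lra) HN HL10 HLd) as Hlower.
pose proof (chebyshev_psi_upper N d HG ltac:(lra) HN HL10 HLd) as Hupper.
pose proof (sum1_mangoldt_powers_le (3 / 4) C N ltac:(lra) HN HCN) as Hsum.
assert (0 <= sum1 mangoldt_powers N) by (apply sum1_nonneg; intros; apply mangoldt_powers_nonneg).
set (L := lg N) in *. assert (HNL : INR N = exp L) by (unfold L; rewrite exp_ln; [reflexivity|pos]).
cbv zeta in Hlower, Hupper.
assert (Herror' : 1200000 * L ^ 22 * exp (L / 2) <= d * exp L).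
{ replace L with (1 / 2 * L + L / 2) at 3 by field. rewrite exp_plus, <- Rmult_assoc. apply Rmult_le_compat_r; [pos|].
  apply (Rmult_le_compat_l d) in Herror; [|lra].
  replace (d * (1200000 / d * L ^ 22)) with (1200000 * L ^ 22) in Herror by (field; lra). exact Herror. }
assert (Hconst' : 2 <= d * exp L).
{ apply (Rmult_le_compat_l d) in Hconst; [|lra]. replace (d * (2 / d * L ^ 0)) with 2 in Hconst by (simpl; field; lra).
  rewrite Rmult_1_l in Hconst. exact Hconst. }
assert (Hpowers' : C * exp (3 / 4 * L) <= d * exp L).
{ replace (exp L) with (exp (1 / 4 * L) * exp (3 / 4 * L)) by (rewrite <- exp_plus; f_equal; field). rewrite <- Rmult_assoc.
  apply Rmult_le_compat_r; [pos|].
  apply (Rmult_le_compat_l d) in Hpowers; [|lra]. replace (d * (C / d * L ^ 0)) with C in Hpowers by (simpl; field; lra).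
  exact Hpowers. }
pose proof (exp_pos L).
assert ((1 - d) * exp L <= exp (L - d)).
{ unfold Rminus. rewrite exp_plus, Rmult_comm. apply Rmult_le_compat_l; [lra|apply exp_ineq1_le]. }
assert (exp (L + 2 * d) <= (1 + 4 * d) * exp L).
{ rewrite exp_plus, Rmult_comm. apply Rmult_le_compat_r; [lra|]. eapply Rle_trans; [apply exp_le_inv_one_minus; lra|].
  apply Rmult_le_reg_r with (1 - 2 * d); [lra|]. rewrite Rinv_l by lra. nra. }
rewrite HNL, chebyshev_theta_eq. replace delta with (8 * d) by (unfold d; field).
split; nra.
Qed.

(** * Averages over primes *)

Definition odd_prime_ind (n : nat) : R := if Nat.leb 3 n then prime_ind n else 0.
Definition legendreR (p q : nat) : R := IZR (legendre p q).

Lemma odd_prime_ind_cases n : (odd_prime_ind n = 1 /\ odd_prime n) \/ (odd_prime_ind n = 0 /\ ~ odd_prime n).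
Proof.
unfold odd_prime_ind, prime_ind, odd_prime. destruct (Nat.leb_spec 3 n); [|right; split; [reflexivity|lia]].
destruct (prime_dec (Z.of_nat n)); [left; split; [reflexivity|split; [assumption|lia]]|right; tauto].
Qed.

Lemma odd_prime_ind_bounds n : 0 <= odd_prime_ind n <= 1.
Proof. destruct (odd_prime_ind_cases n) as [[-> _]|[-> _]]; lra. Qed.

Lemma odd_prime_ind_neq_0 n : odd_prime_ind n <> 0 -> odd_prime n.
Proof. destruct (odd_prime_ind_cases n) as [[_ Hn]|[-> _]]; [auto|lra]. Qed.

Lemma legendreR_values p q : legendreR p q = 1 \/ legendreR p q = 0 \/ legendreR p q = -1.
Proof. unfold legendreR. destruct (legendre_values p q) as [-> | [-> | ->]]; auto. Qed.

Lemma legendreR_abs p q : Rabs (legendreR p q) <= 1.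
Proof. destruct (legendreR_values p q) as [-> | [-> | ->]]; [rewrite Rabs_R1|rewrite Rabs_R0|rewrite Rabs_left]; lra. Qed.

Lemma recip_symbol_cons q I p : List.Forall odd_prime (q :: I) -> odd_prime p ->
  IZR (recip_symbol (q :: I) p) = legendreR p q * IZR (recip_symbol I p).
Proof.
intros HI Hp. inversion HI; subst. rewrite !recip_symbol_prime by assumption. simpl. unfold legendreR. rewrite <- mult_IZR.
reflexivity.
Qed.

Lemma eventually_forall_le (P : nat -> nat -> Prop) Z :
  (forall q, (q <= Z)%nat -> eventually (P q)) -> eventually (fun N => forall q, (q <= Z)%nat -> P q N).
Proof.
induction Z as [|Z IH]; intros HP.
- apply (filter_imp (P 0%nat)); [|apply HP; lia]. intros N HN q Hq. replace q with 0%nat by lia. exact HN.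
- apply (filter_imp (fun N => (forall q, (q <= Z)%nat -> P q N) /\ P (S Z) N));
    [|apply filter_and; [apply IH; intros; apply HP; lia|apply HP; lia]].
  intros N [HN HNZ] q Hq. destruct (Nat.eq_dec q (S Z)) as [-> | Hne]; [exact HNZ|apply HN; lia].
Qed.

Record prime_list (Z k : nat) (I : list nat) : Prop := {
  prime_list_NoDup : NoDup I;
  prime_list_odd : List.Forall odd_prime I;
  prime_list_le : forall q, In q I -> (q <= Z)%nat;
  prime_list_length : (length I <= k)%nat
}.

Lemma prime_list_weaken Z k k' I : (k <= k')%nat -> prime_list Z k I -> prime_list Z k' I.
Proof. intros Hk [Hdup Hodd Hle Hlen]. split; try assumption. lia. Qed.

Lemma prime_list_perm Z k I J : Permutation I J -> prime_list Z k I -> prime_list Z k J.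
Proof.
intros Hperm [Hdup Hodd Hle Hlen]. split.
- exact (Permutation_NoDup Hperm Hdup).
- rewrite <- Hperm. exact Hodd.
- intros q Hq. apply Hle, (Permutation_in _ (Permutation_sym Hperm) Hq).
- rewrite <- (Permutation_length Hperm). exact Hlen.
Qed.

Lemma prime_list_cons Z k q I : odd_prime q -> (q <= Z)%nat -> ~ In q I -> prime_list Z k I -> prime_list Z (S k) (q :: I).
Proof.
intros Hq HqZ Hin [Hdup Hodd Hle Hlen]. split; [constructor; assumption|constructor; assumption| |simpl; lia].
intros z [<- | Hz]; [exact HqZ|apply Hle, Hz].
Qed.

Lemma prime_list_tail Z k q I : prime_list Z k (q :: I) -> prime_list Z k I.
Proof.
intros [Hdup Hodd Hle Hlen]. inversion Hdup. inversion Hodd.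
split; try assumption; [intros z Hz; apply Hle; right; exact Hz|simpl in Hlen; lia].
Qed.

Definition prime_weight (v : nat -> R) (n : nat) : R := odd_prime_ind n * lg n * v n.
Definition legendre_sum (a : nat -> R) (Z n : nat) : R := sum1 (fun q => a q * legendreR n q) Z.

Section Selection.
Variables (v : nat -> R) (E : R) (Z m : nat) (eps : nat -> R).
Hypothesis Hv : forall n, 0 <= v n <= 1.
Hypothesis HE0 : 0 <= E.
Hypothesis Heps : forall q, eps q = 1 \/ eps q = -1.
Hypothesis HE : forall I, prime_list Z (m + 2) I -> I <> nil ->
  eventually (fun N => Rabs (sum1 (fun n => prime_weight v n * IZR (recip_symbol I n)) N) <= E).

(* Equals [2^(length Q)] if [legendreR p q = eps q] for all [q] in [Q], and vanishes for the other primes [p] outside [Q]. *)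
Definition sign_weight (Q : list nat) (p : nat) : R := fold_right (fun q z => (1 + eps q * legendreR p q) * z) 1 Q.

Definition twisted_sum (Q I : list nat) : nat -> R :=
  sum1 (fun n => prime_weight v n * sign_weight Q n * IZR (recip_symbol I n)).

Lemma prime_weight_nonneg n : 0 <= prime_weight v n.
Proof.
apply Rmult_le_pos; [|apply Hv]. apply Rmult_le_pos; [apply odd_prime_ind_bounds|apply ln_INR_nonneg].
Qed.

Lemma Rabs_sign q : Rabs (eps q) = 1.
Proof. destruct (Heps q) as [-> | ->]; [apply Rabs_R1|rewrite Rabs_left; lra]. Qed.

Lemma sign_weight_bounds Q p : 0 <= sign_weight Q p <= 2 ^ length Q.
Proof.
induction Q as [|q Q IH]; simpl; [lra|]. fold (sign_weight Q p). pose proof (legendreR_abs p q) as Habs.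
apply Rabs_le_between in Habs.
assert (0 <= 1 + eps q * legendreR p q <= 2) by (destruct (Heps q) as [-> | ->]; lra).
split; [pos|apply Rmult_le_compat; lra].
Qed.

Lemma twisted_sum_cons q Q I N : List.Forall odd_prime (q :: I) ->
  twisted_sum (q :: Q) I N = twisted_sum Q I N + eps q * twisted_sum Q (q :: I) N.
Proof.
intros HI. unfold twisted_sum. rewrite <- sum1_scal, <- sum1_plus. apply sum1_ext. intros n _.
destruct (odd_prime_ind_cases n) as [[_ Hn]|[Hn _]]; [|unfold prime_weight; rewrite Hn; ring].
rewrite recip_symbol_cons by assumption. simpl. ring.
Qed.

Lemma twisted_sum_small Q : forall I, prime_list Z (m + 2) (Q ++ I) -> I <> nil ->
  eventually (fun N => Rabs (twisted_sum Q I N) <= 2 ^ length Q * E).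
Proof.
induction Q as [|q Q IH]; intros I HI Hnil.
- generalize (HE I HI Hnil). apply filter_imp. intros N HN. simpl pow. rewrite Rmult_1_l. unfold twisted_sum.
  erewrite sum1_ext; [exact HN|]. intros n _. simpl. ring.
- assert (Hmiddle : prime_list Z (m + 2) (Q ++ q :: I))
    by (apply (prime_list_perm _ _ (q :: Q ++ I)); [apply Permutation_middle|exact HI]).
  assert (Hodd : List.Forall odd_prime (q :: I)) by (apply (Forall_app odd_prime Q), Hmiddle).
  generalize (filter_and _ _ (IH I (prime_list_tail _ _ _ _ HI) Hnil) (IH (q :: I) Hmiddle ltac:(discriminate))).
  apply filter_imp. intros N [Hsum Htwist]. rewrite twisted_sum_cons by exact Hodd.
  eapply Rle_trans; [apply Rabs_triang|]. rewrite Rabs_mult, Rabs_sign. simpl pow. lra.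
Qed.

Lemma twisted_sum_main Q : prime_list Z m Q ->
  eventually (fun N => Rabs (twisted_sum Q nil N - sum1 (prime_weight v) N) <= 2 ^ length Q * E).
Proof.
intros HQ. enough (Hsharp : eventually (fun N => Rabs (twisted_sum Q nil N - sum1 (prime_weight v) N) <=
  (2 ^ length Q - 1) * E)).
{ revert Hsharp. apply filter_imp. intros N HN. simpl in HN. lra. }
induction Q as [|q Q IH].
- exists 0%nat. intros N _. unfold twisted_sum. rewrite (sum1_ext _ (prime_weight v)) by (intros; simpl; ring).
  rewrite Rminus_diag, Rabs_R0. simpl. lra.
- assert (Hlast : prime_list Z (m + 2) (Q ++ q :: nil)).
  { apply (prime_list_perm _ _ (q :: Q)); [apply Permutation_cons_append|]. apply (prime_list_weaken _ m); [lia|exact HQ]. }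
  assert (Hodd : List.Forall odd_prime (q :: nil)) by (apply (Forall_app odd_prime Q), Hlast).
  generalize (filter_and _ _ (IH (prime_list_tail _ _ _ _ HQ)) (twisted_sum_small Q (q :: nil) Hlast ltac:(discriminate))).
  apply filter_imp. intros N [Hsum Htwist]. rewrite twisted_sum_cons by exact Hodd.
  replace (twisted_sum Q nil N + eps q * twisted_sum Q (q :: nil) N - sum1 (prime_weight v) N)
    with (twisted_sum Q nil N - sum1 (prime_weight v) N + eps q * twisted_sum Q (q :: nil) N) by ring.
  eapply Rle_trans; [apply Rabs_triang|]. rewrite Rabs_mult, Rabs_sign. simpl pow. lra.
Qed.

Lemma odd_prime_legendreR_eq_0 p q : odd_prime p -> odd_prime q -> legendreR p q = 0 -> q = p.
Proof.
intros Hp Hq Hz. apply eq_IZR in Hz. apply legendre_eq_0 in Hz; [|exact Hp]. destruct Hz as [w Hw]. destruct Hq as [Hq _].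
destruct Hp as [Hp Hp2].
destruct (prime_divisors _ Hq (Z.of_nat p)) as [Hdiv|[Hdiv|[Hdiv|Hdiv]]]; try lia. exists (Z.of_nat w). lia.
Qed.

Lemma sign_weight_neq_0 Q p : odd_prime p -> List.Forall odd_prime Q -> sign_weight Q p <> 0 ->
  forall q, In q Q -> legendreR p q = eps q \/ q = p.
Proof.
intros Hp Hodd. induction Hodd as [|q0 I Hq0 HI IH]; intros Hneq q [].
- subst q0. simpl in Hneq.
  assert (Hfactor : 1 + eps q * legendreR p q <> 0) by (intros Hz; apply Hneq; rewrite Hz; ring).
  destruct (legendreR_values p q) as [Hval|[Hval|Hval]];
    [|right; apply odd_prime_legendreR_eq_0; assumption|]; left; rewrite Hval in *; destruct (Heps q) as [Hsign|Hsign];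
      rewrite Hsign in *; lra.
- apply IH; [|assumption]. intros Hz. apply Hneq. simpl. fold (sign_weight I p). rewrite Hz. ring.
Qed.

Variables (Q : list nat) (a : nat -> R).
Hypothesis HQ : prime_list Z m Q.
Hypothesis Ha : forall q, Rabs (a q) <= 1.
Hypothesis Hsupport : forall q, a q <> 0 -> odd_prime q /\ ~ In q Q.

Definition selection_weight (n : nat) : R := prime_weight v n * sign_weight Q n.

Lemma selection_weight_nonneg n : 0 <= selection_weight n.
Proof. apply Rmult_le_pos; [apply prime_weight_nonneg|apply sign_weight_bounds]. Qed.

Lemma twisted_sum_nil N : twisted_sum Q nil N = sum1 selection_weight N.
Proof. apply sum1_ext. intros n _. simpl. unfold selection_weight. ring. Qed.

Lemma second_moment_diagonal q N :
  sum1 (fun n => selection_weight n * (a q * legendreR n q * (a q * legendreR n q))) N <= a q ^ 2 * sum1 selection_weight N.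
Proof.
rewrite <- sum1_scal. apply sum1_le. intros n _. pose proof (selection_weight_nonneg n) as Hw.
assert (Hsq : legendreR n q ^ 2 <= 1).
{ rewrite <- pow2_abs. pose proof (legendreR_abs n q). pose proof (Rabs_pos (legendreR n q)). simpl. nra. }
replace (selection_weight n * (a q * legendreR n q * (a q * legendreR n q)))
  with (a q ^ 2 * selection_weight n * legendreR n q ^ 2) by ring.
assert (0 <= a q ^ 2 * selection_weight n) by (apply Rmult_le_pos; [apply pow2_ge_0|exact Hw]). nra.
Qed.

Lemma second_moment_off_diagonal q q' : (q <= Z)%nat -> (q' <= Z)%nat -> q <> q' ->
  eventually (fun N => sum1 (fun n => selection_weight n * (a q * legendreR n q * (a q' * legendreR n q'))) N <=
    2 ^ length Q * E).
Proof.
intros Hq Hq' Hne. destruct (Req_dec (a q * a q') 0) as [Hz|Hnz].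
{ exists 0%nat. intros N _. rewrite (sum1_ext _ (fun _ => 0)), sum1_0; [apply Rmult_le_pos; [pos|exact HE0]|].
  intros n _. transitivity (a q * a q' * (selection_weight n * legendreR n q * legendreR n q')); [ring|rewrite Hz; ring]. }
destruct (Hsupport q) as [Hodd Hin]; [intros Hz; apply Hnz; rewrite Hz; ring|].
destruct (Hsupport q') as [Hodd' Hin']; [intros Hz; apply Hnz; rewrite Hz; ring|].
assert (HI : prime_list Z (m + 2) (Q ++ q :: q' :: nil)).
{ apply (prime_list_perm _ _ ((q :: q' :: nil) ++ Q)); [apply Permutation_app_comm|]. rewrite Nat.add_comm. simpl.
  apply prime_list_cons; [exact Hodd|exact Hq| |apply prime_list_cons; assumption].
  intros [Heq|Hin2]; [congruence|contradiction]. }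
generalize (twisted_sum_small Q (q :: q' :: nil) HI ltac:(discriminate)). apply filter_imp. intros N HN.
rewrite (sum1_ext _ (fun n => a q * a q' * (prime_weight v n * sign_weight Q n * IZR (recip_symbol (q :: q' :: nil) n)))).
- rewrite sum1_scal. fold (twisted_sum Q (q :: q' :: nil)). eapply Rle_trans; [apply Rle_abs|]. rewrite !Rabs_mult.
  pose proof (Ha q). pose proof (Ha q'). pose proof (Rabs_pos (a q)).
  pose proof (Rabs_pos (twisted_sum Q (q :: q' :: nil) N)).
  assert (Rabs (a q) * Rabs (a q') <= 1) by nra. nra.
- intros n _. unfold selection_weight. destruct (odd_prime_ind_cases n) as [[_ Hn]|[Hn _]];
    [|unfold prime_weight; rewrite Hn; ring].
  rewrite !recip_symbol_cons by auto. simpl. ring.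
Qed.

Lemma second_moment : eventually (fun N => sum1 (fun n => selection_weight n * legendre_sum a Z n ^ 2) N <=
  sum1 (fun q => a q ^ 2) Z * sum1 selection_weight N + INR Z ^ 2 * (2 ^ length Q * E)).
Proof.
set (P := 2 ^ length Q * E). assert (HP : 0 <= P) by (apply Rmult_le_pos; [pos|exact HE0]).
assert (Hcross : eventually (fun N => forall q, (q <= Z)%nat -> forall q', (q' <= Z)%nat ->
   sum1 (fun n => selection_weight n * (a q * legendreR n q * (a q' * legendreR n q'))) N <=
   (if Nat.eqb q q' then a q ^ 2 * sum1 selection_weight N else 0) + P)).
{ apply eventually_forall_le. intros q Hq. apply eventually_forall_le. intros q' Hq'.
  destruct (Nat.eqb_spec q q') as [<- | Hne].
  - exists 0%nat. intros N _. pose proof (second_moment_diagonal q N). lra.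
  - generalize (second_moment_off_diagonal q q' Hq Hq' Hne). apply filter_imp. intros N HN. fold P in HN. lra. }
revert Hcross. apply filter_imp. intros N HN.
rewrite (sum1_ext _ (fun n => sum1 (fun q => sum1 (fun q' => selection_weight n *
  (a q * legendreR n q * (a q' * legendreR n q'))) Z) Z)).
- rewrite sum1_exchange. apply Rle_trans with (sum1 (fun q => sum1 selection_weight N * a q ^ 2 + INR Z * P) Z).
  + apply sum1_le. intros q Hq. rewrite sum1_exchange.
    eapply Rle_trans; [apply sum1_le; intros q' Hq'; apply HN; lia|]. rewrite sum1_plus, sum1_const. apply Rplus_le_compat_r.
    rewrite (sum1_single _ q); [rewrite Nat.eqb_refl; lra|lia|]. intros q' _ Hne.
    destruct (Nat.eqb_spec q q'); [congruence|reflexivity].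
  + rewrite sum1_plus, sum1_scal, sum1_const. right. ring.
- intros n _. replace (legendre_sum a Z n ^ 2) with (legendre_sum a Z n * legendre_sum a Z n) by ring.
  unfold legendre_sum. rewrite sum1_mult, <- sum1_scal. apply sum1_ext. intros q _. rewrite <- sum1_scal. reflexivity.
Qed.

Lemma sum1_filter_le (b : nat -> bool) (f : nat -> R) (B : R) X : (forall n, (1 <= n <= X)%nat -> b n = true -> f n <= B) ->
  sum1 (fun n => if b n then f n else 0) X <= INR (length (filter b (seq 1 X))) * B.
Proof.
induction X as [|X IH]; intros H; [simpl; lra|].
rewrite sum1_succ, seq_S, filter_app, length_app, plus_INR, Rmult_plus_distr_r.
apply Rplus_le_compat; [apply IH; intros; apply H; [lia|assumption]|]. simpl (filter b _).
replace (1 + X)%nat with (S X) by lia.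
destruct (b (S X)) eqn:Eb; simpl; [|lra]. rewrite Rmult_1_l. apply H; [lia|exact Eb].
Qed.

Definition is_selected (n : nat) : bool :=
  if Rlt_dec 0 (selection_weight n) then if Rle_dec (legendre_sum a Z n ^ 2) 1 then true else false else false.

Lemma is_selected_spec p : is_selected p = true ->
  odd_prime p /\ (forall q, In q Q -> legendreR p q = eps q \/ q = p) /\ legendre_sum a Z p ^ 2 <= 1.
Proof.
unfold is_selected. destruct (Rlt_dec 0 (selection_weight p)) as [Hw|]; [|discriminate].
destruct (Rle_dec (legendre_sum a Z p ^ 2) 1) as [Hsum|]; [|discriminate]. intros _. unfold selection_weight in Hw.
assert (Hp : odd_prime p).
{ apply odd_prime_ind_neq_0. intros Hz. unfold prime_weight in Hw. rewrite Hz in Hw. lra. }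
split; [exact Hp|split; [|exact Hsum]]. apply sign_weight_neq_0; [exact Hp|apply HQ|]. intros Hz. rewrite Hz in Hw. lra.
Qed.

Lemma selected_count X : sum1 (fun n => if is_selected n then selection_weight n else 0) X <=
  INR (length (filter is_selected (seq 1 X))) * (lg X * 2 ^ length Q).
Proof.
apply sum1_filter_le. intros n Hn _. apply Rmult_le_compat;
  [apply prime_weight_nonneg|apply sign_weight_bounds| |apply sign_weight_bounds].
assert (lg n <= lg X) by (apply ln_le; [pos|apply le_INR; lia]). unfold prime_weight.
pose proof (ln_INR_nonneg n). pose proof (Hv n).
destruct (odd_prime_ind_cases n) as [[-> _]|[-> _]]; [rewrite Rmult_1_l; nra|rewrite !Rmult_0_l; lra].
Qed.

Lemma sum1_selection_weight_le X : sum1 selection_weight X <=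
  sum1 (fun n => if is_selected n then selection_weight n else 0) X +
    sum1 (fun n => selection_weight n * legendre_sum a Z n ^ 2) X.
Proof.
rewrite <- sum1_plus. apply sum1_le. intros n _. pose proof (pow2_ge_0 (legendre_sum a Z n)).
pose proof (selection_weight_nonneg n).
unfold is_selected. destruct (Rlt_dec 0 (selection_weight n)); [destruct (Rle_dec (legendre_sum a Z n ^ 2) 1)|]; nra.
Qed.

Lemma selection_weight_tail X N tau : (X <= N)%nat -> sum1 (prime_weight v) N - sum1 (prime_weight v) X <= tau ->
  sum1 selection_weight N - sum1 selection_weight X <= 2 ^ length Q * tau.
Proof.
intros HXN Htau. set (f := fun n => 2 ^ length Q * prime_weight v n - selection_weight n).
assert (Hincr : sum1 f X <= sum1 f N).
{ apply sum1_incr; [exact HXN|]. intros n _. unfold f, selection_weight. pose proof (prime_weight_nonneg n).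
  pose proof (sign_weight_bounds Q n). nra. }
unfold f in Hincr. rewrite !sum1_minus, !sum1_scal in Hincr. assert (0 < 2 ^ length Q) by pos. nra.
Qed.

Theorem selection X M0 tau : sum1 (fun q => a q ^ 2) Z <= 1 / 2 -> eventually (fun N => M0 <= sum1 (prime_weight v) N) ->
  (forall N, (X <= N)%nat -> sum1 (prime_weight v) N - sum1 (prime_weight v) X <= tau) ->
  exists l, NoDup l /\
    (forall p, In p l -> (p <= X)%nat /\ odd_prime p /\ (forall q, In q Q -> legendreR p q = eps q \/ q = p) /\
      legendre_sum a Z p ^ 2 <= 1) /\
    M0 / 2 <= 2 ^ length Q * (INR (length l) * lg X + (INR Z ^ 2 + 1) * E + tau).
Proof.
intros Hnorm HM Htau. exists (filter is_selected (seq 1 X)). split; [apply NoDup_filter, seq_NoDup|split].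
- intros p Hp. apply filter_In in Hp. destruct Hp as [Hp Hsel]. apply in_seq in Hp. split; [lia|apply is_selected_spec, Hsel].
- pose proof (selected_count X) as Hcount. pose proof (sum1_selection_weight_le X) as Hsplit.
  set (cnt := INR (length _)) in *. set (P := 2 ^ length Q) in *.
  destruct (filter_and _ _ HM (filter_and _ _ (twisted_sum_main Q HQ) second_moment)) as [N0 HN].
  destruct (HN (N0 + X)%nat ltac:(lia)) as [HMN [Hmain Hmoment]]. set (N := (N0 + X)%nat) in *.
  pose proof (selection_weight_tail X N tau ltac:(unfold N; lia) (Htau N ltac:(unfold N; lia))) as Htail.
  assert (Hmono : sum1 (fun n => selection_weight n * legendre_sum a Z n ^ 2) X <=
    sum1 (fun n => selection_weight n * legendre_sum a Z n ^ 2) N).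
  { apply sum1_incr; [unfold N; lia|]. intros n _. apply Rmult_le_pos; [apply selection_weight_nonneg|apply pow2_ge_0]. }
  rewrite twisted_sum_nil in Hmain. fold P in Hmain, Hmoment, Htail. apply Rabs_le_between in Hmain.
  assert (HW : 0 <= sum1 selection_weight N) by (apply sum1_nonneg; intros; apply selection_weight_nonneg).
  assert (sum1 (fun q => a q ^ 2) Z * sum1 selection_weight N <= 1 / 2 * sum1 selection_weight N)
    by (apply Rmult_le_compat_r; assumption).
  replace (P * (cnt * lg X + (INR Z ^ 2 + 1) * E + tau))
    with (cnt * (lg X * P) + INR Z ^ 2 * (P * E) + P * E + P * tau) by ring.
  lra.
Qed.

End Selection.
(** * Sums of p^(-sigma) cos^2 (t log p) *)

Definition cos_sq_density (a t : R) : R := if Req_EM_T t 0 then 1 else t ^ 2 / (a ^ 2 + 4 * t ^ 2).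

Section PrimeSum.
Variables (sigma t : R).
Hypothesis Hsig : 1 / 2 < sigma < 1.

Let a := 1 - sigma.
Let D := sigma + 2 * Rabs t.
Definition cos_sq_term (x : R) : R := exp (- sigma * x) * cos (t * x) ^ 2.
Definition cos_sq_primitive (x : R) : R :=
  exp (a * x) * (/ (2 * a) + (a * cos (2 * t * x) + 2 * t * sin (2 * t * x)) / (2 * (a ^ 2 + 4 * t ^ 2))).

Lemma cos_sq_denominator_pos : 0 < a ^ 2 + 4 * t ^ 2.
Proof. assert (0 < a ^ 2) by (apply pow_lt; unfold a; lra). pose proof (pow2_ge_0 t). lra. Qed.

Lemma cos_sq_half_angle u : cos u ^ 2 = (1 + cos (2 * u)) / 2.
Proof. rewrite cos_2a_cos. field. Qed.

Lemma is_derive_cos_sq_primitive x : is_derive cos_sq_primitive x (exp (a * x) * cos (t * x) ^ 2).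
Proof.
pose proof cos_sq_denominator_pos. assert (Ha : 0 < a) by (unfold a; lra).
unfold cos_sq_primitive. auto_derive; [exact I|]. rewrite cos_sq_half_angle. replace (2 * (t * x)) with (2 * t * x) by ring.
field. split; lra.
Qed.

Lemma cos_sq_bounds u : 0 <= cos u ^ 2 <= 1.
Proof.
split; [apply pow2_ge_0|]. rewrite <- pow2_abs. pose proof (Rabs_cos_le u). pose proof (Rabs_pos (cos u)). simpl. nra.
Qed.

Lemma cos_sq_term_bounds x : 0 <= cos_sq_term x <= exp (- sigma * x).
Proof. unfold cos_sq_term. pose proof (exp_pos (- sigma * x)). pose proof (cos_sq_bounds (t * x)). nra. Qed.

Lemma cos_sq_term_variation n y : (1 <= n)%nat -> lg n <= y <= lg (S n) ->
  Rabs (cos_sq_term (lg n) - cos_sq_term y) <= D * pow_neg n (1 + sigma).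
Proof.
intros Hn Hy. pose proof (Rabs_pos t).
apply (variation_bound cos_sq_term (fun x => - sigma * (exp (- sigma * x) * cos (t * x) ^ 2) - exp (- sigma * x) *
  (2 * t * (sin (t * x) * cos (t * x)))) sigma D n Hn);
  [lra|unfold D; lra| | |exact Hy].
- intros x. unfold cos_sq_term. auto_derive; [exact I|]. ring.
- intros x Hx. pose proof (exp_pos (- sigma * x)). pose proof (cos_sq_bounds (t * x)).
  eapply Rle_trans; [unfold Rminus; apply Rabs_triang|]. rewrite Rabs_Ropp.
  assert (Hdecay : Rabs (- sigma * (exp (- sigma * x) * cos (t * x) ^ 2)) <= sigma * exp (- sigma * x)).
  { set (e := exp (- sigma * x)) in *. set (c := cos (t * x) ^ 2) in *. assert (0 <= e * c <= e) by (split; nra).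
    rewrite Rabs_left1; nra. }
  assert (Hangle : Rabs (exp (- sigma * x) * (2 * t * (sin (t * x) * cos (t * x)))) <= 2 * Rabs t * exp (- sigma * x)).
  { rewrite !Rabs_mult, (Rabs_pos_eq (exp _)), (Rabs_pos_eq 2) by lra.
    pose proof (Rabs_cos_le (t * x)). pose proof (Rabs_sin_le (t * x)). pose proof (Rabs_pos (cos (t * x))).
    assert (Rabs (sin (t * x)) * Rabs (cos (t * x)) <= 1) by nra. assert (0 <= exp (- sigma * x) * (2 * Rabs t)) by nra.
    nra. }
  unfold D. lra.
Qed.

Lemma cos_sq_density_bounds : 0 <= cos_sq_density a t <= 1.
Proof.
unfold cos_sq_density. pose proof cos_sq_denominator_pos. destruct (Req_EM_T t 0); [lra|]. pose proof (pow2_ge_0 a).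
split; [pos|].
apply Rle_div_l; lra.
Qed.

Lemma cos_sq_primitive_lower x : cos_sq_density a t / a * exp (a * x) <= cos_sq_primitive x.
Proof.
pose proof cos_sq_denominator_pos. assert (Ha : 0 < a) by (unfold a; lra). unfold cos_sq_primitive, cos_sq_density.
rewrite (Rmult_comm _ (exp (a * x))).
apply Rmult_le_compat_l; [pos|]. destruct (Req_EM_T t 0) as [-> | Ht].
- replace (2 * 0 * x) with 0 by ring. rewrite cos_0, sin_0. right. field. lra.
- set (c := cos (2 * t * x)). set (s := sin (2 * t * x)).
  assert (Hcs : c * c + s * s = 1) by (pose proof (sin2_cos2 (2 * t * x)) as Hsq; unfold Rsqr in Hsq; fold c s in Hsq; lra).
  set (A := sqrt (a ^ 2 + 4 * t ^ 2)). assert (HA : A * A = a ^ 2 + 4 * t ^ 2) by (apply sqrt_sqrt; lra).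
  assert (A0 : 0 < A) by (apply sqrt_lt_R0; lra).
  assert (Hphase : - A <= a * c + 2 * t * s).
  { assert (Hsq : (a * c + 2 * t * s) ^ 2 <= A ^ 2).
    { replace (A ^ 2) with ((a ^ 2 + 4 * t ^ 2) * (c * c + s * s)) by (rewrite Hcs; simpl; lra).
      assert (0 <= (a * s - 2 * t * c) ^ 2) by apply pow2_ge_0. simpl in *. nra. }
    apply sqrt_le_1_alt in Hsq. rewrite (sqrt_pow2 A), <- (pow2_abs (_ + _)), sqrt_pow2 in Hsq by (lra || apply Rabs_pos).
    apply Rabs_le_between in Hsq. lra. }
  apply Rle_trans with (/ (2 * a) + - A / (2 * (a ^ 2 + 4 * t ^ 2))).
  + rewrite <- HA. replace (t ^ 2) with ((A * A - a * a) / 4) by (simpl in *; lra).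
    apply Rmult_le_reg_r with (4 * a * (A * A)); [apply Rmult_lt_0_compat; [lra|nra]|].
    replace ((A * A - a * a) / 4 / (A * A) / a * (4 * a * (A * A))) with (A * A - a * a) by (field; lra).
    replace ((/ (2 * a) + - A / (2 * (A * A))) * (4 * a * (A * A))) with (2 * (A * A) - 2 * a * A) by (field; lra). nra.
  + apply Rplus_le_compat_l. apply Rmult_le_compat_r; [pos|exact Hphase].
Qed.

Lemma cos_sq_primitive_0 : cos_sq_primitive 0 <= / a.
Proof.
pose proof cos_sq_denominator_pos. assert (Ha : 0 < a) by (unfold a; lra). unfold cos_sq_primitive.
rewrite !Rmult_0_r, exp_0, cos_0, sin_0, Rmult_1_l, Rmult_1_r, Rmult_0_r, Rplus_0_r.
assert (a / (2 * (a ^ 2 + 4 * t ^ 2)) <= a / (2 * a ^ 2)).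
{ apply Rmult_le_compat_l; [lra|]. assert (0 < a ^ 2) by pos. pose proof (pow2_ge_0 t). apply Rinv_le_contravar; lra. }
replace (/ a) with (/ (2 * a) + a / (2 * a ^ 2)) by (field; lra). lra.
Qed.

Lemma ln_INR_le_succ n : (1 <= n)%nat -> lg n <= lg (S n).
Proof. intros Hn. apply ln_le; [pos|apply le_INR; lia]. Qed.

Lemma cos_sq_primitive_increment n : (1 <= n)%nat ->
  cos_sq_primitive (lg (S n)) - cos_sq_primitive (lg n) <= cos_sq_term (lg n) + (D + 1) * pow_neg n (1 + sigma).
Proof.
intros Hn. pose proof (ln_INR_le_succ n Hn) as Hln. assert (Hnp : 0 < INR n) by pos.
destruct (MVT_gen cos_sq_primitive (lg n) (lg (S n)) (fun x => exp (a * x) * cos (t * x) ^ 2)) as (xi & Hxi & Hmvt).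
- intros x _. apply is_derive_cos_sq_primitive.
- intros x _. apply continuity_pt_filterlim. apply (continuous_is_derive cos_sq_primitive x _ (is_derive_cos_sq_primitive x)).
- rewrite Rmin_left, Rmax_right in Hxi by exact Hln. rewrite Hmvt.
  replace (exp (a * xi) * cos (t * xi) ^ 2) with (exp xi * cos_sq_term xi)
    by (unfold cos_sq_term; rewrite <- Rmult_assoc, <- exp_plus; f_equal; f_equal; unfold a; ring).
  pose proof (cos_sq_term_variation n xi Hn Hxi) as Hvar. apply Rabs_le_between in Hvar.
  destruct (cos_sq_term_bounds xi) as [Hterm0 Hterm].
  assert (Hexp : exp xi <= INR n + 1).
  { rewrite <- S_INR, <- (exp_ln (INR (S n))) by pos. apply exp_le_compat. lra. }
  pose proof (ln_INR_succ_minus n Hn) as Hstep. pose proof (exp_pos xi).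
  apply Rle_trans with ((INR n + 1) * cos_sq_term xi * / INR n).
  { apply Rmult_le_compat; [nra|lra|apply Rmult_le_compat_r; lra|exact Hstep]. }
  replace ((INR n + 1) * cos_sq_term xi * / INR n) with (cos_sq_term xi + cos_sq_term xi * / INR n) by (field; lra).
  assert (cos_sq_term xi * / INR n <= pow_neg n (1 + sigma)).
  { rewrite Rplus_comm, pow_neg_plus, pow_neg_1_r by exact Hn. apply Rmult_le_compat_r; [pos|].
    eapply Rle_trans; [exact Hterm|]. apply exp_le_compat. nra. }
  lra.
Qed.

Lemma sum1_cos_sq_term_lower Y : (1 <= Y)%nat ->
  cos_sq_density a t / a * exp (a * lg Y) - / a - (D + 1) * (1 + / sigma) <= sum1 (fun n => cos_sq_term (lg n)) Y.
Proof.
intros HY. assert (Ha : 0 < a) by (unfold a; lra).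
assert (Htel : cos_sq_primitive (lg (S Y)) - cos_sq_primitive 0 <=
  sum1 (fun n => cos_sq_term (lg n) + (D + 1) * pow_neg n (1 + sigma)) Y).
{ clear HY. induction Y as [|Y IH]; [simpl; rewrite ln_1; lra|].
  rewrite sum1_succ. pose proof (cos_sq_primitive_increment (S Y) ltac:(lia)). lra. }
rewrite sum1_plus, sum1_scal in Htel. pose proof (sum1_pow_neg_le sigma Y ltac:(lra)).
assert (0 <= D + 1) by (unfold D; pose proof (Rabs_pos t); lra).
assert ((D + 1) * sum1 (fun n => pow_neg n (1 + sigma)) Y <= (D + 1) * (1 + / sigma))
  by (apply Rmult_le_compat_l; assumption).
pose proof (cos_sq_primitive_lower (lg (S Y))). pose proof cos_sq_primitive_0.
assert (cos_sq_density a t / a * exp (a * lg Y) <= cos_sq_density a t / a * exp (a * lg (S Y))).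
{ apply Rmult_le_compat_l; [apply Rmult_le_pos; [apply cos_sq_density_bounds|pos]|]. apply exp_le_compat.
  apply Rmult_le_compat_l; [lra|apply ln_INR_le_succ, HY]. }
lra.
Qed.

Lemma sum1_pow_neg_upper Y : (1 <= Y)%nat -> sum1 (fun n => pow_neg n sigma) Y <= / a * exp (a * lg Y).
Proof.
intros HY. assert (Ha : 0 < a < 1) by (unfold a; lra). assert (1 <= / a) by (rewrite <- Rinv_1; apply Rinv_le_contravar; lra).
induction HY as [|Y HY IH]; [simpl; rewrite ln_1, Rmult_0_r, exp_0, pow_neg_1_l; lra|].
rewrite sum1_succ. assert (HYp : 0 < INR Y) by pos.
destruct (MVT_gen (fun u => exp (a * ln u)) (INR Y) (INR (S Y)) (fun u => a * exp (- sigma * ln u))) as (xi & Hxi & Hmvt).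
- rewrite S_INR, Rmin_left, Rmax_right by lra. intros u Hu. auto_derive; [lra|].
  replace (- sigma * ln u) with (a * ln u + - ln u) by (unfold a; ring). rewrite exp_plus, exp_Ropp, exp_ln by lra. field.
  lra.
- rewrite S_INR, Rmin_left, Rmax_right by lra. intros u Hu. apply derivable_continuous_pt. exists (a * / u * exp (a * ln u)).
  apply is_derive_Reals. auto_derive; [lra|]. field. lra.
- rewrite S_INR in Hmvt, Hxi. rewrite Rmin_left, Rmax_right in Hxi by lra. replace (INR Y + 1 - INR Y) with 1 in Hmvt by ring.
  assert (pow_neg (S Y) sigma <= exp (- sigma * ln xi)).
  { unfold pow_neg. rewrite S_INR. apply exp_le_compat. assert (ln xi <= ln (INR Y + 1)) by (apply ln_le; lra). nra. }
  rewrite S_INR.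
  assert (/ a * exp (a * ln (INR Y + 1)) = / a * exp (a * lg Y) + exp (- sigma * ln xi)).
  { replace (exp (a * ln (INR Y + 1))) with (exp (a * lg Y) + a * exp (- sigma * ln xi)) by lra. field. lra. }
  lra.
Qed.

Lemma INR_mult_pow_neg n s : (1 <= n)%nat -> INR n * pow_neg n (1 + s) = pow_neg n s.
Proof.
intros Hn. rewrite pow_neg_plus, pow_neg_1_r, <- Rmult_assoc, Rinv_r, Rmult_1_l by (try exact Hn; apply not_0_INR; lia).
reflexivity.
Qed.

Lemma chebyshev_theta_error delta : GRH -> 0 < delta <= 1 ->
  exists C, 0 <= C /\ forall n, Rabs (chebyshev_theta n - INR n) <= delta * INR n + C.
Proof.
intros HG Hdelta. destruct (prime_number_theorem delta HG Hdelta) as [N0 HP].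
assert (Hpos : forall n, 0 <= prime_ind n * lg n)
  by (intros n; apply Rmult_le_pos; [apply prime_ind_bounds|apply ln_INR_nonneg]).
assert (Htheta : forall n, 0 <= chebyshev_theta n) by (intros n; apply sum1_nonneg; auto).
exists (chebyshev_theta N0 + INR N0). split; [pose proof (Htheta N0); pose proof (pos_INR N0); lra|].
intros n. pose proof (pos_INR n). pose proof (pos_INR N0). pose proof (Htheta n). pose proof (Htheta N0).
destruct (le_lt_dec N0 n) as [Hn|Hn].
- specialize (HP n Hn). apply Rabs_le. nra.
- assert (chebyshev_theta n <= chebyshev_theta N0) by (apply sum1_incr; [lia|auto]).
  assert (INR n <= INR N0) by (apply le_INR; lia). apply Rabs_le. nra.
Qed.

Section ChebyshevError.
Variables (delta C : R) (Y : nat).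
Hypothesis Hdelta : 0 <= delta.
Hypothesis HC : 0 <= C.
Hypothesis Herror : forall n, Rabs (chebyshev_theta n - INR n) <= delta * INR n + C.
Let V := exp (a * lg (S Y)).

Lemma cos_sq_boundary_bound : Rabs ((chebyshev_theta (S Y) - INR (S Y)) * cos_sq_term (lg (S Y))) <= delta * V + C.
Proof.
rewrite Rabs_mult. destruct (cos_sq_term_bounds (lg (S Y))) as [Hterm0 Hterm].
rewrite (Rabs_pos_eq (cos_sq_term _)) by exact Hterm0.
change (exp (- sigma * lg (S Y))) with (pow_neg (S Y) sigma) in Hterm.
apply Rle_trans with ((delta * INR (S Y) + C) * pow_neg (S Y) sigma);
  [apply Rmult_le_compat; [apply Rabs_pos|exact Hterm0|apply Herror|exact Hterm]|].
assert (INR (S Y) * pow_neg (S Y) sigma = V).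
{ unfold V, pow_neg. rewrite <- (exp_ln (INR (S Y))) at 1 by pos. rewrite <- exp_plus. f_equal. unfold a. ring. }
pose proof (pow_neg_le_1 (S Y) sigma ltac:(lra)). nra.
Qed.

Lemma cos_sq_variation_sum_bound :
  Rabs (sum1 (fun n => (chebyshev_theta n - INR n) * (cos_sq_term (lg n) - cos_sq_term (lg (S n)))) Y) <=
    delta * D * (/ a * V) + C * D * (1 + / sigma).
Proof.
assert (HD : 0 <= D) by (unfold D; pose proof (Rabs_pos t); lra).
apply Rle_trans with (sum1 (fun n => delta * D * pow_neg n sigma + C * D * pow_neg n (1 + sigma)) Y).
- apply Rabs_sum1_le. intros n Hn. rewrite Rabs_mult.
  pose proof (cos_sq_term_variation n (lg (S n)) ltac:(lia) ltac:(pose proof (ln_INR_le_succ n ltac:(lia)); lra)) as Hvar.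
  apply Rle_trans with ((delta * INR n + C) * (D * pow_neg n (1 + sigma)));
    [apply Rmult_le_compat; [apply Rabs_pos|apply Rabs_pos|apply Herror|exact Hvar]|].
  rewrite <- (INR_mult_pow_neg n sigma) by lia. right. ring.
- rewrite sum1_plus, !sum1_scal. apply Rplus_le_compat.
  + apply Rmult_le_compat_l; [apply Rmult_le_pos; assumption|]. eapply Rle_trans; [|apply (sum1_pow_neg_upper (S Y)); lia].
    apply sum1_incr; [lia|]. intros; left; apply pow_neg_pos.
  + apply Rmult_le_compat_l; [apply Rmult_le_pos; assumption|apply sum1_pow_neg_le; lra].
Qed.

Lemma sum1_prime_cos_sq_by_parts : sum1 (fun n => prime_ind n * lg n * cos_sq_term (lg n)) (S Y) =
  sum1 (fun n => cos_sq_term (lg n)) (S Y) + ((chebyshev_theta (S Y) - INR (S Y)) * cos_sq_term (lg (S Y)) +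
    sum1 (fun n => (chebyshev_theta n - INR n) * (cos_sq_term (lg n) - cos_sq_term (lg (S n)))) Y).
Proof.
assert (Hsum : forall n, sum1 (fun k => prime_ind k * lg k - 1) n = chebyshev_theta n - INR n).
{ intros n. rewrite sum1_minus, sum1_const. unfold chebyshev_theta. ring. }
pose proof (sum1_by_parts (fun k => prime_ind k * lg k - 1) (fun n => cos_sq_term (lg n)) Y) as Hparts.
rewrite Hsum in Hparts.
rewrite (sum1_ext _ (fun n => (chebyshev_theta n - INR n) * (cos_sq_term (lg n) - cos_sq_term (lg (S n)))) Y) in Hparts
  by (intros; rewrite Hsum; reflexivity).
rewrite <- Hparts, <- sum1_plus. apply sum1_ext. intros. ring.
Qed.

Lemma sum1_prime_cos_sq_lower_error :
  cos_sq_density a t / a * V - / a - (D + 1) * (1 + / sigma) - (delta * V + C) -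
    (delta * D * (/ a * V) + C * D * (1 + / sigma)) <=
    sum1 (fun n => prime_ind n * lg n * cos_sq_term (lg n)) (S Y).
Proof.
rewrite sum1_prime_cos_sq_by_parts. pose proof (sum1_cos_sq_term_lower (S Y) ltac:(lia)) as Hmain. fold V in Hmain.
pose proof cos_sq_boundary_bound as Hboundary. pose proof cos_sq_variation_sum_bound as Hvar.
apply Rabs_le_between in Hboundary. apply Rabs_le_between in Hvar. lra.
Qed.

End ChebyshevError.

Theorem sum1_prime_cos_sq_lower eps : GRH -> 0 < eps ->
  eventually (fun Y => (cos_sq_density a t - eps) / a * exp (a * lg Y) <=
    sum1 (fun n => prime_ind n * lg n * cos_sq_term (lg n)) Y).
Proof.
intros HG Heps. assert (Ha : 0 < a < 1) by (unfold a; lra). assert (HD : 0 < D) by (unfold D; pose proof (Rabs_pos t); lra).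
set (delta := Rmin 1 (eps / (2 * (a + D)))).
assert (Hdelta : 0 < delta <= 1) by (split; [apply Rmin_glb_lt; [lra|pos]|apply Rmin_l]).
assert (Hsmall : delta * (a + D) <= eps / 2).
{ apply Rle_trans with (eps / (2 * (a + D)) * (a + D)); [apply Rmult_le_compat_r; [lra|apply Rmin_r]|]. right. field. lra. }
destruct (chebyshev_theta_error delta HG Hdelta) as (C & HC & Herror).
set (C2 := C + C * D * (1 + / sigma) + / a + (D + 1) * (1 + / sigma)).
generalize (eventually_ln_INR _ (at_infinity_pow_le_exp (2 * a * C2 / eps) 0 a ltac:(lra))). apply filter_imp.
intros [|Y] [HY Hlarge]; [lia|]. set (V := exp (a * lg (S Y))) in *. simpl pow in Hlarge. rewrite Rmult_1_r in Hlarge.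
assert (HV : C2 <= eps / (2 * a) * V).
{ apply (Rmult_le_compat_l (eps / (2 * a))) in Hlarge; [|pos].
  replace (eps / (2 * a) * (2 * a * C2 / eps)) with C2 in Hlarge by (field; lra). exact Hlarge. }
pose proof (sum1_prime_cos_sq_lower_error delta C Y ltac:(lra) HC Herror) as Hlower. fold V in Hlower.
assert (Hloss : delta * V + delta * D * (/ a * V) <= eps / (2 * a) * V).
{ replace (delta * V + delta * D * (/ a * V)) with (delta * (a + D) * (V * / a)) by (field; lra).
  replace (eps / (2 * a) * V) with (eps / 2 * (V * / a)) by (field; lra). apply Rmult_le_compat_r; [|exact Hsmall].
  apply Rmult_le_pos; [unfold V; pos|pos]. }
replace ((cos_sq_density a t - eps) / a * V) with (cos_sq_density a t / a * V - eps / (2 * a) * V - eps / (2 * a) * V)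
  by (field; lra).
unfold C2 in HV. lra.
Qed.

End PrimeSum.

(** * Truncated expansion of log |L| *)

Lemma exp_sum_succ K x : exp_sum (S K) x = 1 + sum1 (fun i => x ^ i / INR (fact i)) K.
Proof.
unfold exp_sum. induction K as [|K IH]; [simpl; field|]. rewrite sum1_succ, IH, (sum1_succ (fun i => x ^ i / INR (fact i))).
replace (S (S K) - 1)%nat with (S K) by lia. ring.
Qed.

Lemma log_weight_nonneg lam K n : 0 <= lam -> 0 <= log_weight lam K n.
Proof.
intros Hlam. apply Rmult_le_pos; [pos|]. apply sum1_nonneg. intros i Hi.
apply Rmult_le_pos; [|apply exp_term_nonneg, ln_INR_nonneg].
apply Rmult_le_pos; pos.
Qed.

Lemma ln_mult_log_weight lam K n : lg n * log_weight lam K n = pow_neg n 3 * (exp_sum (S K) (lam * lg n) - 1).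
Proof.
rewrite exp_sum_succ. unfold log_weight, exp_poly.
transitivity (pow_neg n 3 * (lg n * sum1 (fun i => lam ^ S (i - 1) / INR (S (i - 1)) *
  (lg n ^ (i - 1) / INR (fact (i - 1)))) K)); [ring|].
f_equal. rewrite <- sum1_scal. replace (1 + sum1 _ K - 1) with (sum1 (fun i => (lam * lg n) ^ i / INR (fact i)) K) by ring.
apply sum1_ext. intros [|i] Hi; [lia|]. replace (S i - 1)%nat with i by lia. rewrite Rpow_mult_distr, fact_simpl, mult_INR.
simpl (lg n ^ S i).
field. split; [apply INR_fact_neq_0|apply not_0_INR; lia].
Qed.

Lemma ln_mult_log_weight_upper sigma K n : sigma <= 3 -> lg n * log_weight (3 - sigma) K n <= pow_neg n sigma.
Proof.
intros Hs. rewrite ln_mult_log_weight. pose proof (ln_INR_nonneg n).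
pose proof (exp_sum_le_exp (S K) ((3 - sigma) * lg n) ltac:(nra)).
apply Rle_trans with (pow_neg n 3 * exp ((3 - sigma) * lg n)); [apply Rmult_le_compat_l; [pos|lra]|].
right. unfold pow_neg. rewrite <- exp_plus. f_equal. ring.
Qed.

Lemma ln_mult_log_weight_lower sigma K n : 0 <= sigma <= 3 ->
  pow_neg n sigma - pow_neg n 3 - ((3 - sigma) / 3) ^ S K <= lg n * log_weight (3 - sigma) K n.
Proof.
intros Hs. rewrite ln_mult_log_weight. pose proof (ln_INR_nonneg n).
pose proof (exp_sum_scal_tail (S K) ((3 - sigma) / 3) (3 * lg n) ltac:(nra) ltac:(lra)) as Htail.
replace ((3 - sigma) / 3 * (3 * lg n)) with ((3 - sigma) * lg n) in Htail by field.
assert (Hsigma : pow_neg n sigma = pow_neg n 3 * exp ((3 - sigma) * lg n))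
  by (unfold pow_neg; rewrite <- exp_plus; f_equal; ring).
assert (Hinv : pow_neg n 3 * exp (3 * lg n) = 1) by (unfold pow_neg; rewrite <- exp_plus, <- exp_0; f_equal; ring).
apply (Rmult_le_compat_l (pow_neg n 3)) in Htail; [|pos].
replace (pow_neg n 3 * (((3 - sigma) / 3) ^ S K * exp (3 * lg n)))
  with (((3 - sigma) / 3) ^ S K * (pow_neg n 3 * exp (3 * lg n))) in Htail by ring.
rewrite Hinv in Htail. rewrite Hsigma. lra.
Qed.

Lemma ln_mult_log_weight_tail lam K n : 1 / 2 <= lam <= 5 / 2 -> lg n * log_weight lam K n <= 5 ^ S K * pow_neg n (1 + 3 / 2).
Proof.
intros Hlam. rewrite ln_mult_log_weight. pose proof (ln_INR_nonneg n).
pose proof (exp_sum_scal_upper (S K) (2 * lam) (lg n / 2) ltac:(lra) ltac:(lra)) as Hupper.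
replace (2 * lam * (lg n / 2)) with (lam * lg n) in Hupper by field.
assert (Hpow : (2 * lam) ^ S K <= 5 ^ S K) by (apply pow_incr; lra).
apply Rle_trans with (pow_neg n 3 * (5 ^ S K * exp (lg n / 2))).
- apply Rmult_le_compat_l; [pos|]. pose proof (exp_pos (lg n / 2)). nra.
- right. rewrite <- Rmult_assoc, (Rmult_comm (pow_neg n 3)), Rmult_assoc. f_equal. unfold pow_neg. rewrite <- exp_plus.
  f_equal. field.
Qed.

Definition mangoldt_rest (n : nat) : R := mangoldt n - odd_prime_ind n * lg n.

Lemma mangoldt_rest_eq n : mangoldt_rest n = mangoldt_powers n + (if Nat.eqb n 2 then ln 2 else 0).
Proof.
unfold mangoldt_rest, mangoldt_powers, odd_prime_ind.
destruct (Nat.leb_spec 3 n); destruct (Nat.eqb_spec n 2); try lia; try (unfold prime_ind; ring).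
- subst n. unfold prime_ind. destruct (prime_dec (Z.of_nat 2)) as [_|Hnp]; [replace (INR 2) with 2 by (simpl; ring); ring|].
  exfalso. apply Hnp, prime_2.
- destruct n as [|[|n]]; [| |lia]; unfold prime_ind; destruct prime_dec as [Hp|_]; try (apply prime_ge_2 in Hp; lia); ring.
Qed.

Lemma mangoldt_rest_nonneg n : 0 <= mangoldt_rest n.
Proof. rewrite mangoldt_rest_eq. pose proof (mangoldt_powers_nonneg n). pose proof ln2_bounds. destruct (Nat.eqb n 2); lra.
Qed.

Lemma mangoldt_powers_1 : mangoldt_powers 1 = 0.
Proof.
pose proof (mangoldt_le_ln 1) as Hle. pose proof (mangoldt_nonneg 1). simpl in Hle. rewrite ln_1 in Hle.
unfold mangoldt_powers. simpl. rewrite ln_1. lra.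
Qed.

Lemma mangoldt_rest_log_weight sigma K n : 0 <= sigma <= 3 -> (1 <= n)%nat ->
  mangoldt_rest n * log_weight (3 - sigma) K n <= 2 * (mangoldt_powers n * pow_neg n sigma) + (if Nat.eqb n 2 then 1 else 0).
Proof.
intros Hs Hn. rewrite mangoldt_rest_eq, Rmult_plus_distr_r. pose proof ln2_bounds.
pose proof (ln_mult_log_weight_upper sigma K n ltac:(lra)) as Hupper.
pose proof (log_weight_nonneg (3 - sigma) K n ltac:(lra)).
pose proof (mangoldt_powers_nonneg n). apply Rplus_le_compat.
- destruct (Nat.eq_dec n 1) as [-> | Hn1]; [rewrite mangoldt_powers_1; lra|].
  assert (ln 2 <= lg n) by (apply ln_le; [lra|apply (le_INR 2); lia]).
  assert (log_weight (3 - sigma) K n <= 2 * pow_neg n sigma) by nra. nra.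
- destruct (Nat.eqb_spec n 2) as [-> | _]; [|lra]. simpl (INR 2) in Hupper. replace (1 + 1) with 2 in Hupper by ring.
  pose proof (pow_neg_le_1 2 sigma ltac:(lra)). lra.
Qed.

Definition tail_coef (sigma t : R) (K Y q : nat) : R :=
  if Nat.ltb Y q then odd_prime_ind q * cos (t * lg q) * (lg q * log_weight (3 - sigma) K q) else 0.

Definition main_sum (sigma t : R) (Y : nat) :
  R := sum1 (fun q => odd_prime_ind q * (Rabs (cos (t * lg q)) * pow_neg q sigma)) Y.

Lemma sum1_truncate f Y Z : (Y <= Z)%nat -> sum1 (fun n => if Nat.ltb Y n then 0 else f n) Z = sum1 f Y.
Proof.
intros HYZ. induction HYZ as [|Z HYZ IH].
- apply sum1_ext. intros n Hn. destruct (Nat.ltb_spec Y n); [lia|reflexivity].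
- rewrite sum1_succ, IH. destruct (Nat.ltb_spec Y (S Z)); [ring|lia].
Qed.

Lemma sign_mult_lower kp x b : kp = 1 \/ kp = -1 -> Rabs x <= b -> - b <= kp * x.
Proof. intros Hkp Hx. apply Rabs_le_between in Hx. destruct Hkp as [-> | ->]; lra. Qed.

Section PrimeTerms.
Variables (sigma t : R) (p K : nat).
Hypothesis Hsigma : 1 / 2 < sigma < 1.
Let lam := 3 - sigma.

Definition prime_term (n : nat) : R := odd_prime_ind n * (lg n * log_weight (3 - sigma) K n) *
  (cos (t * lg n) * legendreR p n).

Lemma ln_mult_log_weight_nonneg n : 0 <= lg n * log_weight lam K n.
Proof. apply Rmult_le_pos; [apply ln_INR_nonneg|apply log_weight_nonneg; unfold lam; lra]. Qed.

Lemma Rabs_cos_legendreR_le n : Rabs (cos (t * lg n) * legendreR p n) <= 1.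
Proof.
rewrite Rabs_mult. pose proof (Rabs_cos_le (t * lg n)). pose proof (legendreR_abs p n).
pose proof (Rabs_pos (cos (t * lg n))). nra.
Qed.

Lemma prime_term_bound n : Rabs (prime_term n) <= lg n * log_weight lam K n.
Proof.
pose proof (Rabs_cos_legendreR_le n). pose proof (ln_mult_log_weight_nonneg n).
unfold prime_term. rewrite Rabs_mult, (Rabs_mult (odd_prime_ind n)), (Rabs_pos_eq (lg n * _)) by assumption. fold lam.
pose proof (odd_prime_ind_bounds n). rewrite (Rabs_pos_eq (odd_prime_ind n)) by lra.
assert (0 <= odd_prime_ind n * (lg n * log_weight lam K n) <= lg n * log_weight lam K n) by nra. nra.
Qed.

Lemma prime_term_mangoldt C N : (forall N, sum1 (fun n => mangoldt_powers n * pow_neg n sigma) N <= C) ->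
  Rabs (sum1 (fun n => mangoldt n * legendreR p n * cos (t * lg n) * log_weight lam K n) N - sum1 prime_term N) <= 2 * C + 1.
Proof.
intros HC. rewrite <- sum1_minus. apply Rle_trans
  with (sum1 (fun n => 2 * (mangoldt_powers n * pow_neg n sigma) + (if Nat.eqb n 2 then 1 else 0)) N).
- apply Rabs_sum1_le. intros n Hn. eapply Rle_trans; [|apply (mangoldt_rest_log_weight sigma K n); [lra|lia]].
  replace (mangoldt n * legendreR p n * cos (t * lg n) * log_weight lam K n - prime_term n)
    with (mangoldt_rest n * log_weight lam K n * (cos (t * lg n) * legendreR p n))
      by (unfold prime_term, mangoldt_rest, lam; ring).
  assert (Hpos : 0 <= mangoldt_rest n * log_weight lam K n)
    by (apply Rmult_le_pos; [apply mangoldt_rest_nonneg|apply log_weight_nonneg; unfold lam; lra]).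
  rewrite Rabs_mult, (Rabs_pos_eq (mangoldt_rest n * _)) by exact Hpos. fold lam. pose proof (Rabs_cos_legendreR_le n). nra.
- rewrite sum1_plus, sum1_scal. pose proof (HC N). pose proof (sum1_delta_le 2 1 N ltac:(lra)). lra.
Qed.

Lemma prime_term_tail Z N : 5 ^ S K <= INR Z -> (Z <= N)%nat -> Rabs (sum1 prime_term N - sum1 prime_term Z) <= 1.
Proof.
intros HZ HN. assert (Hf : 1 <= 5 ^ S K) by (apply pow_R1_Rle; lra).
assert (HZ1 : (1 <= Z)%nat) by (apply INR_le; simpl; lra). set (f := 5 ^ S K) in *.
apply Rle_trans with (f * (/ (3 / 2) * pow_neg Z (3 / 2))).
- apply sum1_tail_le; [lra|lra|lia|]. intros n Hn. eapply Rle_trans; [apply prime_term_bound|].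
  apply ln_mult_log_weight_tail. unfold lam. lra.
- assert (Hpow : pow_neg Z (3 / 2) <= / f).
  { apply Rle_trans with (pow_neg Z 1); [apply pow_neg_antitone; lra|]. rewrite pow_neg_1_r by exact HZ1.
    apply Rinv_le_contravar; lra. }
  apply (Rmult_le_compat_l f) in Hpow; [|lra]. rewrite Rinv_r in Hpow by lra. pose proof (pow_neg_pos Z (3 / 2)). nra.
Qed.

Lemma prime_term_split Y Z : (Y <= Z)%nat -> sum1 prime_term Z = sum1 prime_term Y + legendre_sum (tail_coef sigma t K Y) Z p.
Proof.
intros HYZ. unfold legendre_sum. rewrite <- (sum1_truncate prime_term Y Z HYZ), <- sum1_plus. apply sum1_ext. intros n _.
unfold tail_coef. destruct (Nat.ltb Y n); unfold prime_term; ring.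
Qed.

Variables (kp : R) (eps : nat -> R).
Hypothesis Hp : odd_prime p.
Hypothesis Hkp : kp = 1 \/ kp = -1.
Hypothesis Heps : forall q, eps q * cos (t * lg q) = kp * Rabs (cos (t * lg q)).

Lemma legendreR_same : legendreR p p = 0.
Proof. unfold legendreR. rewrite (proj2 (legendre_eq_0 p p Hp) (Nat.divide_refl p)). reflexivity. Qed.

Lemma prime_term_main Y : INR Y * (lam / 3) ^ S K <= 1 ->
  (forall q, odd_prime q -> (q <= Y)%nat -> legendreR p q = eps q \/ q = p) ->
    main_sum sigma t Y - 4 <= kp * sum1 prime_term Y.
Proof.
intros HY Hsel. rewrite <- sum1_scal.
apply Rle_trans with (sum1 (fun q => odd_prime_ind q * (Rabs (cos (t * lg q)) * pow_neg q sigma) - pow_neg q (1 + 2) -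
  (lam / 3) ^ S K - (if Nat.eqb q p then 1 else 0)) Y).
- rewrite !sum1_minus, sum1_const. fold (main_sum sigma t Y). pose proof (sum1_delta_le p 1 Y ltac:(lra)).
  pose proof (sum1_pow_neg_le 2 Y ltac:(lra)). lra.
- apply sum1_le. intros q Hq. unfold prime_term. pose proof (ln_mult_log_weight_lower sigma K q ltac:(lra)) as Hlower.
  pose proof (ln_mult_log_weight_upper sigma K q ltac:(lra)) as Hupper. fold lam in Hlower, Hupper |- *.
  replace (1 + 2) with 3 by ring.
  pose proof (pow_neg_le_1 q sigma ltac:(lra)). pose proof (ln_mult_log_weight_nonneg q). pose proof (Rabs_cos_le (t * lg q)).
  pose proof (Rabs_pos (cos (t * lg q))). pose proof (pow_neg_pos q 3). assert (0 < (lam / 3) ^ S K) by (unfold lam; pos).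
  destruct (odd_prime_ind_cases q) as [[-> Hodd]|[-> _]]; [|destruct (Nat.eqb q p); lra].
  destruct (Nat.eqb_spec q p) as [-> | Hne]; [rewrite legendreR_same; nra|].
  destruct (Hsel q Hodd ltac:(lia)) as [-> | Heq]; [|congruence].
  replace (kp * (1 * (lg q * log_weight lam K q) * (cos (t * lg q) * eps q)))
    with (lg q * log_weight lam K q * (kp * (eps q * cos (t * lg q)))) by ring.
  rewrite Heps. replace (kp * (kp * Rabs (cos (t * lg q)))) with (Rabs (cos (t * lg q)))
    by (destruct Hkp as [-> | ->]; ring). nra.
Qed.

End PrimeTerms.

Theorem log_L_lower_selected sigma t : GRH -> 1 / 2 < sigma < 1 ->
  exists C2, forall (p K Y Z : nat) (kp : R) (eps : nat -> R),
  odd_prime p -> (kp = 1 \/ kp = -1) -> (forall q, eps q * cos (t * lg q) = kp * Rabs (cos (t * lg q))) ->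
  ((3 - sigma) / (5 / 2)) ^ S K * lg p <= 1 -> INR Y * ((3 - sigma) / 3) ^ S K <= 1 -> 5 ^ S K <= INR Z -> (Y <= Z)%nat ->
  (forall q, odd_prime q -> (q <= Y)%nat -> legendreR p q = eps q \/ q = p) ->
  legendre_sum (tail_coef sigma t K Y) Z p ^ 2 <= 1 ->
  exists u v : R, is_dirichlet_value (legendreR p) sigma t u v /\ 0 < u ^ 2 + v ^ 2 /\
    main_sum sigma t Y - C2 <= kp * (/ 2 * ln (u ^ 2 + v ^ 2)).
Proof.
intros HG Hsigma. destruct (sum1_mangoldt_powers_bounded sigma ltac:(lra)) as (C & HC & HCN).
set (rho := (3 - sigma) / (5 / 2)). assert (Hrho : 0 < rho < 1) by (unfold rho; lra).
set (ct := ln (32 * 3 * (11 * 3 + 5 * Rabs t))).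
assert (Hct : 0 <= ct) by (pose proof (Rabs_pos t); unfold ct; apply ln_nonneg; lra).
exists (2 * C + 9 + 2 * (1 + ct) / (1 - rho)). intros p K Y Z kp eps Hp Hkp Heps Hlgp HY HZ HYZ Hsel Htail.
destruct (log_L_truncated p (legendreR p) sigma t K HG (real_char_legendre p Hp) Hsigma)
  as (u & v & l & Hval & Hnorm & Hlim & Htrunc).
cbv zeta in Htrunc. fold rho ct in Htrunc. exists u, v. split; [exact Hval|split; [exact Hnorm|]].
set (f := fun n => mangoldt n * legendreR p n * cos (t * lg n) * log_weight (3 - sigma) K n) in *.
assert (Htail1 : Rabs (legendre_sum (tail_coef sigma t K Y) Z p) <= 1).
{ rewrite <- Rabs_R1. apply Rsqr_le_abs_0. unfold Rsqr. simpl in Htail. lra. }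
assert (Hpartial : forall N, (Z <= N)%nat -> main_sum sigma t Y - (2 * C + 7) <= kp * sum1 f N).
{ intros N HN. pose proof (prime_term_main sigma t p K Hsigma kp eps Hp Hkp Heps Y HY Hsel).
  pose proof (sign_mult_lower _ _ _ Hkp (prime_term_mangoldt sigma t p K Hsigma C N HCN)) as Hpowers. fold f in Hpowers.
  pose proof (sign_mult_lower _ _ _ Hkp (prime_term_tail sigma t p K Hsigma Z N HZ HN)) as Hterm.
  rewrite (prime_term_split sigma t p K Y Z HYZ) in Hterm. pose proof (sign_mult_lower _ _ _ Hkp Htail1). lra. }
assert (Hlimit : main_sum sigma t Y - (2 * C + 7) <= kp * l).
{ apply (is_lim_seq_ge_const (fun N => kp * sum1 f N)); [exists Z; exact Hpartial|apply is_lim_seq_scal_R, Hlim]. }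
apply (sign_mult_lower _ _ _ Hkp) in Htrunc.
assert (2 * (lg p + ct) * rho ^ S K / (1 - rho) <= 2 * (1 + ct) / (1 - rho)).
{ apply Rmult_le_compat_r; [pos|]. assert (0 <= rho ^ S K <= 1) by (split; [pos|apply pow_le_1; lra]). nra. }
lra.
Qed.

Lemma ln_list_product_le Z k I : prime_list Z k I -> lg (list_product I) <= INR k * lg Z.
Proof.
intros [_ Hodd HZ Hlen]. pose proof (ln_INR_nonneg Z).
apply Rle_trans with (INR (length I) * lg Z); [|apply Rmult_le_compat_r; [assumption|apply le_INR, Hlen]].
clear Hlen. induction Hodd as [|q I [_ Hq] HI IH]; [simpl; rewrite ln_1; lra|].
change (list_product (q :: I)) with (q * list_product I)%nat. pose proof (list_product_pos I HI).
rewrite mult_INR, ln_mult by pos. change (length (q :: I)) with (S (length I)). rewrite S_INR.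
assert (lg q <= lg Z) by (apply ln_le; [pos|apply le_INR, HZ; simpl; auto]).
assert (lg (list_product I) <= INR (length I) * lg Z) by (apply IH; intros; apply HZ; simpl; auto). lra.
Qed.

Lemma sum1_mangoldt_powers_smooth s C D K N : 1 / 2 < s < D ->
  (forall N, sum1 (fun n => mangoldt_powers n * pow_neg n s) N <= C) ->
  sum1 (fun n => mangoldt_powers n * smooth_cutoff D K n) N <= (D / (D - s)) ^ K * C.
Proof.
intros Hs HC. apply Rle_trans with ((D / (D - s)) ^ K * sum1 (fun n => mangoldt_powers n * pow_neg n s) N).
- rewrite <- sum1_scal. apply sum1_le. intros n _. pose proof (mangoldt_powers_nonneg n).
  pose proof (smooth_cutoff_upper D K n s ltac:(lra)). nra.
- apply Rmult_le_compat_l; [pos|apply HC].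
Qed.

Lemma eventually_dist_le_1 f (l : R) : is_lim_seq f l -> eventually (fun N => Rabs (f N - l) <= 1).
Proof.
intros Hlim. apply is_lim_seq_spec in Hlim. generalize (Hlim (mkposreal 1 Rlt_0_1)). apply filter_imp. intros N HN. left.
exact HN.
Qed.

Lemma real_char_even_0 q ch n : real_char q ch -> Nat.divide 2 q -> Nat.divide 2 n -> ch n = 0.
Proof.
intros Hch Hq Hn. apply NNPP. intros Hneq. apply (real_char_neq_0 q ch Hch) in Hneq.
pose proof (Nat.gcd_greatest n q 2 Hn Hq) as Hdiv. rewrite Hneq in Hdiv. apply Nat.divide_1_r in Hdiv. lia.
Qed.

Lemma ln_4_list_product_le I Z m : prime_list Z (m + 2) I -> lg (4 * list_product I) <= 2 + (INR m + 2) * lg Z.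
Proof.
intros HI. pose proof (list_product_pos I (prime_list_odd _ _ _ HI)). pose proof (ln_list_product_le Z (m + 2) I HI) as Hprod.
rewrite plus_INR in Hprod. simpl (INR 2) in Hprod. pose proof ln2_bounds.
rewrite mult_INR, ln_mult by (try apply lt_0_INR; lia). replace (INR 4) with (2 * 2) by (simpl; ring).
rewrite ln_mult by lra. lra.
Qed.

Definition char_average_error (s C D : R) (K m Z : nat) : R :=
  2 * (2 + (INR m + 2) * lg Z + ln (352 * D ^ 2)) * INR K ^ 2 * (D / (D - 1 / 2)) ^ K + 1 + (D / (D - s)) ^ K * C.

Lemma char_average I Z m s C D K : GRH -> prime_list Z (m + 2) I -> I <> nil ->
  1 / 2 < s < 1 -> 3 <= D -> (forall N, sum1 (fun n => mangoldt_powers n * pow_neg n s) N <= C) ->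
  eventually (fun N => Rabs (sum1 (fun n => prime_weight (smooth_cutoff D K) n * IZR (recip_symbol I n)) N) <=
    char_average_error s C D K m Z).
Proof.
intros HG HI Hnil Hs HD HC. pose proof (real_char_recip_symbol I (prime_list_odd _ _ _ HI) (prime_list_NoDup _ _ _ HI)
  Hnil) as Hch.
destruct (smooth_mangoldt_char _ _ D K HG Hch HD) as (l & Hlim & Hl).
pose proof (ln_4_list_product_le I Z m HI) as Hconductor.
set (ch := fun n => IZR (recip_symbol I n)) in *. set (v := smooth_cutoff D K) in *.
assert (Htwo : ch 2%nat = 0).
{ apply (real_char_even_0 _ ch 2 Hch); [exists (2 * list_product I)%nat; lia|apply Nat.divide_refl]. }
assert (Hsum : forall N, sum1 (fun n => prime_weight v n * ch n) N = sum1 (fun n => mangoldt n * ch n * v n) N -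
  sum1 (fun n => mangoldt_powers n * ch n * v n) N).
{ intros N. rewrite <- sum1_minus. apply sum1_ext. intros n _. pose proof (mangoldt_rest_eq n) as Hrest.
  unfold mangoldt_rest in Hrest. unfold prime_weight.
  destruct (Nat.eqb_spec n 2) as [Hn|_]; [rewrite Hn, Htwo; ring|].
  replace (odd_prime_ind n * lg n) with (mangoldt n - mangoldt_powers n) by lra. ring. }
generalize (eventually_dist_le_1 _ _ Hlim). apply filter_imp. intros N HN.
change (fun n => prime_weight v n * IZR (recip_symbol I n)) with (fun n => prime_weight v n * ch n).
rewrite Hsum. unfold Rminus. eapply Rle_trans; [apply Rabs_triang|]. rewrite Rabs_Ropp. apply Rplus_le_compat.
- replace (sum1 (fun n => mangoldt n * ch n * v n) N) with (l + (sum1 (fun n => mangoldt n * ch n * v n) N - l)) by ring.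
  eapply Rle_trans; [apply Rabs_triang|]. apply Rplus_le_compat; [|exact HN]. eapply Rle_trans; [exact Hl|].
  apply Rmult_le_compat_r; [pos|]. apply Rmult_le_compat_r; [apply pow2_ge_0|]. lra.
- eapply Rle_trans; [|apply (sum1_mangoldt_powers_smooth s C D K N ltac:(lra) HC)]. apply Rabs_sum1_le. intros n _. fold v.
  pose proof (mangoldt_powers_nonneg n). pose proof (smooth_cutoff_nonneg D K n ltac:(lra)) as Hv. fold v in Hv.
  rewrite !Rabs_mult, (Rabs_pos_eq (mangoldt_powers n)), (Rabs_pos_eq (v n)) by assumption.
  pose proof (real_char_abs _ _ n Hch). assert (0 <= mangoldt_powers n * v n) by (apply Rmult_le_pos; assumption). nra.
Qed.

Definition main_average_lower (s C D : R) (K : nat) : R :=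
  (D / (D - 1)) ^ K - 3 - 2 * ln (336 * D ^ 3) * INR K ^ 2 * (D / (D - 1 / 2)) ^ K - (D / (D - s)) ^ K * C.

Lemma main_average s C D K : GRH -> 1 / 2 < s < 1 -> 3 <= D ->
  (forall N, sum1 (fun n => mangoldt_powers n * pow_neg n s) N <= C) ->
  eventually (fun N => main_average_lower s C D K <= sum1 (prime_weight (smooth_cutoff D K)) N).
Proof.
intros HG Hs HD HC. destruct (smooth_mangoldt_zeta D K HG HD) as (l & Hlim & Hl). apply Rabs_le_between in Hl.
set (v := smooth_cutoff D K) in *.
generalize (eventually_dist_le_1 _ _ Hlim). apply filter_imp. intros N HN. apply Rabs_le_between in HN.
assert (Hsum : sum1 (prime_weight v) N = sum1 (fun n => mangoldt n * v n) N - sum1 (fun n => mangoldt_rest n * v n) N).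
{ rewrite <- sum1_minus. apply sum1_ext. intros n _. unfold mangoldt_rest, prime_weight. ring. }
assert (Hrest : sum1 (fun n => mangoldt_rest n * v n) N <= (D / (D - s)) ^ K * C + 1).
{ apply Rle_trans with (sum1 (fun n => mangoldt_powers n * v n + (if Nat.eqb n 2 then 1 else 0)) N).
  - apply sum1_le. intros n _. rewrite mangoldt_rest_eq, Rmult_plus_distr_r. apply Rplus_le_compat_l.
    pose proof (smooth_cutoff_le_1 D K n ltac:(lra)). pose proof ln2_bounds. unfold v. destruct (Nat.eqb n 2); nra.
  - rewrite sum1_plus. apply Rplus_le_compat; [apply sum1_mangoldt_powers_smooth; [lra|exact HC]|apply sum1_delta_le; lra]. }
unfold main_average_lower. lra.
Qed.

Definition odd_primes_upto (Y : nat) : list nat :=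
  filter (fun n => if Req_EM_T (odd_prime_ind n) 1 then true else false) (seq 1 Y).

Lemma In_odd_primes_upto Y q : In q (odd_primes_upto Y) <-> odd_prime q /\ (q <= Y)%nat.
Proof.
unfold odd_primes_upto. rewrite filter_In, in_seq.
destruct (odd_prime_ind_cases q) as [[-> Hq]|[-> Hq]]; destruct Req_EM_T; try lra.
- split; [intros; split; [exact Hq|lia]|intros [_ Hle]; destruct Hq; split; [lia|reflexivity]].
- split; [intros [_ Hfalse]; discriminate|tauto].
Qed.

Lemma prime_list_odd_primes_upto Y Z : (Y <= Z)%nat -> prime_list Z (length (odd_primes_upto Y)) (odd_primes_upto Y).
Proof.
intros HYZ. split; [apply NoDup_filter, seq_NoDup| | |lia].
- apply Forall_forall. intros q Hq. apply In_odd_primes_upto in Hq. apply Hq.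
- intros q Hq. apply In_odd_primes_upto in Hq. lia.
Qed.

Lemma length_odd_primes_upto Y : INR (length (odd_primes_upto Y)) = sum1 odd_prime_ind Y.
Proof.
unfold odd_primes_upto. induction Y as [|Y IH]; [reflexivity|].
rewrite seq_S, filter_app, length_app, plus_INR, IH, sum1_succ. f_equal.
simpl. destruct (odd_prime_ind_cases (S Y)) as [[-> _]|[-> _]]; destruct Req_EM_T; simpl; lra.
Qed.

Lemma exp_pow2 m : exp (INR m * ln 2) = 2 ^ m.
Proof. rewrite exp_INR_mult, exp_ln by lra. reflexivity. Qed.

Lemma ln_5_le_2 : ln 5 <= 2.
Proof.
rewrite <- (ln_exp 2). apply ln_le; [lra|]. replace 2 with (1 / 2 + 1 / 2 + (1 / 2 + 1 / 2)) by field. rewrite !exp_plus.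
pose proof (exp_ineq1_le (1 / 2)). set (y := exp (1 / 2)) in *. assert (9 / 4 <= y * y) by nra. nra.
Qed.

Lemma truncation_level rho dl : 0 < rho < 1 -> 0 < dl ->
  Rbar_locally p_infty (fun L => exists K : nat, rho ^ S K * L ^ 2 <= 1 /\ 5 ^ S K <= exp (dl * L)).
Proof.
intros Hrho Hdl. set (c := - ln rho). assert (Hc : 0 < c)
  by (unfold c; pose proof (ln_increasing rho 1 (proj1 Hrho) (proj2 Hrho)) as Hln; rewrite ln_1 in Hln; lra).
assert (Hlarge : Rbar_locally p_infty (fun L => 1 + 4 / dl <= L /\ 1 * L ^ 1 <= exp (c * dl / 8 * L))).
{ apply filter_and; [apply at_infinity_ge|apply at_infinity_pow_le_exp, Rdiv_lt_0_compat; nra]. }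
revert Hlarge. apply filter_imp. intros L [HL Hexp]. rewrite pow_1, Rmult_1_l in Hexp. assert (0 < 4 / dl) by pos.
assert (Hln : ln L <= c * dl / 8 * L) by (rewrite <- (ln_exp (c * dl / 8 * L)); apply ln_le; [lra|exact Hexp]).
assert (Hln0 : 0 <= ln L) by (apply ln_nonneg; lra).
destruct (nfloor_ex (2 * ln L / c)) as [K [HK HSK]]; [pos|]. rewrite <- S_INR in HSK. exists K. rewrite !pow_exp_ln by lra.
split.
- apply Rlt_div_l in HSK; [|exact Hc]. rewrite <- exp_plus, <- exp_0.
  apply exp_le_compat. simpl (INR 2). unfold c in HSK. lra.
- apply exp_le_compat. rewrite S_INR. pose proof ln_5_le_2. pose proof (pos_INR K).
  assert (0 <= ln 5) by (apply ln_nonneg; lra).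
  assert (INR K <= dl * L / 4) by (eapply Rle_trans; [exact HK|]; apply Rle_div_l; lra).
  assert (4 <= dl * L) by (apply Rle_trans with (dl * (1 + 4 / dl));
    [replace (dl * (1 + 4 / dl)) with (dl + 4) by (field; lra); lra|apply Rmult_le_compat_l; lra]).
  nra.
Qed.

Definition cos_sign (kp t : R) (q : nat) : R := if Rle_dec 0 (cos (t * lg q)) then kp else - kp.

Lemma cos_sign_values kp t : kp = 1 \/ kp = -1 -> forall q, cos_sign kp t q = 1 \/ cos_sign kp t q = -1.
Proof. intros Hkp q. unfold cos_sign. destruct Rle_dec; destruct Hkp as [-> | ->]; lra. Qed.

Lemma cos_sign_mult kp t q : cos_sign kp t q * cos (t * lg q) = kp * Rabs (cos (t * lg q)).
Proof. unfold cos_sign. destruct Rle_dec; [rewrite Rabs_pos_eq by assumption; ring|rewrite Rabs_left by lra; ring]. Qed.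

Lemma tail_coef_bound sigma t K Y q : 1 / 2 < sigma < 1 -> Rabs (tail_coef sigma t K Y q) <= pow_neg q sigma.
Proof.
intros Hs. unfold tail_coef. pose proof (pow_neg_pos q sigma). destruct (Nat.ltb Y q); [|rewrite Rabs_R0; lra].
pose proof (ln_mult_log_weight_upper sigma K q ltac:(lra)). pose proof (ln_mult_log_weight_nonneg sigma K Hs q).
rewrite !Rabs_mult, <- (Rabs_mult (ln _)), (Rabs_pos_eq (lg q * _)) by assumption. pose proof (Rabs_cos_le (t * lg q)).
pose proof (odd_prime_ind_bounds q). pose proof (Rabs_pos (cos (t * lg q))). rewrite (Rabs_pos_eq (odd_prime_ind q)) by lra.
assert (odd_prime_ind q * Rabs (cos (t * lg q)) <= 1) by nra.
nra.
Qed.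

Lemma tail_coef_support sigma t K Y q : tail_coef sigma t K Y q <> 0 -> odd_prime q /\ ~ In q (odd_primes_upto Y).
Proof.
unfold tail_coef. destruct (Nat.ltb_spec Y q) as [Hq|Hq]; [|lra]. intros Hneq. split.
- apply odd_prime_ind_neq_0. intros Hz. apply Hneq. rewrite Hz. ring.
- intros Hin. apply In_odd_primes_upto in Hin. lia.
Qed.

Lemma tail_coef_square_sum sigma t K Y Z : 1 / 2 < sigma < 1 -> (1 <= Y <= Z)%nat ->
  sum1 (fun q => tail_coef sigma t K Y q ^ 2) Z <= / (2 * sigma - 1) * pow_neg Y (2 * sigma - 1).
Proof.
intros Hs HY. assert (Hhead : sum1 (fun q => tail_coef sigma t K Y q ^ 2) Y = 0).
{ rewrite (sum1_ext _ (fun _ => 0)); [apply sum1_0|]. intros q Hq. unfold tail_coef.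
  destruct (Nat.ltb_spec Y q); [lia|ring]. }
assert (Htail : Rabs (sum1 (fun q => tail_coef sigma t K Y q ^ 2) Z - sum1 (fun q => tail_coef sigma t K Y q ^ 2) Y) <=
  1 * (/ (2 * sigma - 1) * pow_neg Y (2 * sigma - 1))).
{ apply sum1_tail_le; [lra|lra|exact HY|]. intros q Hq. rewrite <- RPow_abs, Rmult_1_l.
  replace (1 + (2 * sigma - 1)) with (sigma + sigma) by ring.
  rewrite pow_neg_plus. replace (pow_neg q sigma * pow_neg q sigma) with (pow_neg q sigma ^ 2) by ring.
  apply pow_incr. split; [apply Rabs_pos|apply tail_coef_bound, Hs]. }
rewrite Hhead, Rminus_0_r in Htail. apply Rabs_le_between in Htail. lra.
Qed.

Lemma ratio_pow_upper_exp L T D K s : smoothing_level L T D K -> 0 <= s -> 8 * s ^ 2 <= L ->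
  2 * s <= D /\ (D / (D - s)) ^ K <= exp (T * s + 1).
Proof.
intros [HL HT HK HD HD5 _] Hs HsL. pose proof (pow2_ge_0 (s - 1)). assert (Hs2 : 2 * s <= D) by (simpl in *; lra).
split; [exact Hs2|]. eapply Rle_trans; [apply (ratio_pow_upper D T s K HK); lra|]. apply exp_le_compat.
assert (2 * T * s ^ 2 / D <= 1); [|lra]. apply Rle_div_l; [lra|].
pose proof (pow2_ge_0 s). apply Rle_trans with (4 * L * s ^ 2); [apply Rmult_le_compat_r; lra|].
replace (L ^ 4) with (L ^ 2 * L ^ 2) in HD by ring. apply Rle_trans with (L ^ 2 / 2); nra.
Qed.

Lemma exp_ge_1 x : 0 <= x -> 1 <= exp x.
Proof. intros Hx. pose proof (exp_ineq1_le x). lra. Qed.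

Lemma exp_plus_1_le x : exp (x + 1) <= 3 * exp x.
Proof. rewrite exp_plus, Rmult_comm. apply Rmult_le_compat_r; [pos|apply exp_le_3]. Qed.

Lemma exists_floor_exp L : 10 <= L -> exists X, (1 <= X)%nat /\ INR X <= exp L /\ L - 2 <= lg X <= L.
Proof.
intros HL. destruct (nfloor_ex (exp L)) as [X [HX HSX]]; [pos|]. assert (11 <= exp L) by (pose proof (exp_ineq1_le L); lra).
exists X. split; [apply INR_le; simpl; lra|split; [exact HX|split]].
- assert (Hln : ln (exp L / 3) <= lg X) by (apply ln_le; lra). unfold Rdiv in Hln.
  rewrite ln_mult, ln_exp, ln_Rinv in Hln by (try apply exp_pos; lra).
  assert (ln 3 <= 2) by (eapply Rle_trans; [apply ln_le_minus_1|]; lra). lra.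
- rewrite <- (ln_exp L). apply ln_le; lra.
Qed.

(** * Primes with prescribed Legendre symbols *)

Definition tail_exponent (delta : R) : R := 8 / delta + 4.

(* How large [L = log x] has to be for a selection with [2^(length Q)] up to [exp ((1/2 - delta) L)]. *)
Record selection_level (delta C L : R) : Prop := {
  selection_large : 10 <= L;
  selection_large_tail : 8 * tail_exponent delta ^ 2 <= L;
  selection_large_delta : 2 * tail_exponent delta / delta <= L;
  selection_large_main : 2 * (600003 + 3 * C) * L ^ 22 <= exp (1 / 4 * L);
  selection_large_error : 32 * (144001 + 3 * C) * L ^ 18 <= exp (7 * delta / 16 * L);
  selection_large_const : 16 * L ^ 0 <= exp (3 * delta / 4 * L);
  selection_large_log : 8 * L ^ 1 <= exp (3 * delta / 4 * L)
}.

Lemma at_infinity_selection_level delta C : 0 < delta -> Rbar_locally p_infty (selection_level delta C).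
Proof.
intros Hdelta. set (S0 := tail_exponent delta).
assert (Hlarge : Rbar_locally p_infty (fun L => 10 <= L /\ 8 * S0 ^ 2 <= L /\ 2 * S0 / delta <= L /\
  2 * (600003 + 3 * C) * L ^ 22 <= exp (1 / 4 * L) /\ 32 * (144001 + 3 * C) * L ^ 18 <= exp (7 * delta / 16 * L) /\
  16 * L ^ 0 <= exp (3 * delta / 4 * L) /\ 8 * L ^ 1 <= exp (3 * delta / 4 * L))) by at_infinity.
revert Hlarge. apply filter_imp. intros L (? & ? & ? & ? & ? & ? & ?). split; assumption.
Qed.

Section SelectionLevel.
Variables (delta C L D : R) (K : nat).
Hypothesis Hdelta : 0 < delta <= 1 / 8.
Hypothesis HC : 0 <= C.
Hypothesis Hlevel : selection_level delta C L.
Let s := 1 / 2 + delta / 4.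
Let T := (1 - delta / 4) * L.
Let M := exp (s * L).
Hypothesis Hsmooth : smoothing_level L T D K.

Lemma exp_half_smoothing_length : exp (T / 2) <= M.
Proof. pose proof (selection_large _ _ _ Hlevel). apply exp_le_compat. unfold T, s. nra. Qed.

Lemma selection_ratio_pow : (D / (D - s)) ^ K * C <= 3 * C * M.
Proof.
pose proof (selection_large _ _ _ Hlevel) as HL. apply Rle_trans with (3 * M * C); [|lra].
apply Rmult_le_compat_r; [exact HC|].
destruct (ratio_pow_upper_exp L T D K s Hsmooth) as [_ Hratio];
  [unfold s; lra|assert (s ^ 2 <= 1) by (unfold s; simpl; nra); lra|].
eapply Rle_trans; [exact Hratio|]. eapply Rle_trans; [apply exp_plus_1_le|]. apply Rmult_le_compat_l; [lra|].
apply exp_le_compat. unfold T, s. nra.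
Qed.

Lemma le_pow_mult_exp k c : 0 <= c -> c <= c * (L ^ k * M) /\ c * M <= c * (L ^ k * M).
Proof.
intros Hc. pose proof (selection_large _ _ _ Hlevel). assert (HLk : 1 <= L ^ k) by (apply pow_R1_Rle; lra).
assert (HM : 1 <= M) by (apply exp_ge_1; unfold s; nra).
assert (M <= L ^ k * M) by (rewrite <- (Rmult_1_l M) at 1; apply Rmult_le_compat_r; lra).
split; nra.
Qed.

Lemma char_average_log_bound m Z : INR m <= L -> lg Z <= L -> 0 <= 2 + (INR m + 2) * lg Z + ln (352 * D ^ 2) <= 6000 * L ^ 8.
Proof.
intros Hm HZ. destruct Hsmooth as [HL _ _ HD HD5 _]. pose proof (pos_INR m). pose proof (ln_INR_nonneg Z).
assert (1 <= D ^ 2) by (apply pow_R1_Rle; lra).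
assert (0 <= ln (352 * D ^ 2)) by (apply ln_nonneg; lra).
assert (ln (352 * D ^ 2) <= 352 * D ^ 2) by (eapply Rle_trans; [apply ln_le_minus_1|]; lra).
assert (D ^ 2 <= 16 * L ^ 8) by (replace (16 * L ^ 8) with ((4 * L ^ 4) ^ 2) by ring; apply pow_incr; lra).
assert (0 <= (INR m + 2) * lg Z) by (apply Rmult_le_pos; lra).
assert ((INR m + 2) * lg Z <= 2 * L * L) by (apply Rmult_le_compat; lra).
assert (1 <= L ^ 2) by (apply pow_R1_Rle; lra).
assert (L ^ 2 <= L ^ 8) by (apply Rle_pow; [lra|lia]).
replace (2 * L * L) with (2 * L ^ 2) in * by ring. lra.
Qed.

Lemma char_average_error_bounds m Z : INR m <= L -> lg Z <= L ->
  0 <= char_average_error s C D K m Z <= (144001 + 3 * C) * (L ^ 18 * M).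
Proof.
intros Hm HZ. destruct (char_average_log_bound m Z Hm HZ) as [HA0 HA]. unfold char_average_error. set (A := 2 + _ + _) in *.
pose proof (smoothing_error L T D K A Hsmooth HA0) as Herror. pose proof exp_half_smoothing_length as Hhalf.
pose proof selection_ratio_pow as Hpowers.
destruct Hsmooth as [HL _ _ _ HD _].
assert (Hupper : 24 * A * L ^ 10 * exp (T / 2) <= 144000 * (L ^ 18 * M)).
{ apply Rle_trans with (24 * (6000 * L ^ 8) * L ^ 10 * M); [|right; ring].
  apply Rmult_le_compat; [pos|pos| |exact Hhalf]. apply Rmult_le_compat_r; [pos|lra]. }
destruct (le_pow_mult_exp 18 1 ltac:(lra)). destruct (le_pow_mult_exp 18 (3 * C) ltac:(lra)).
assert (0 <= 2 * A * INR K ^ 2 * (D / (D - 1 / 2)) ^ K)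
  by (apply Rmult_le_pos; [apply Rmult_le_pos; [lra|apply pow2_ge_0]|pos]).
assert (0 <= (D / (D - s)) ^ K * C) by (apply Rmult_le_pos; [unfold s; pos|exact HC]). lra.
Qed.

Lemma main_average_lower_bound : exp T / 2 <= main_average_lower s C D K.
Proof.
pose proof (zeta_smoothing_error L T D K Hsmooth) as Hzeta. pose proof exp_half_smoothing_length as Hhalf.
pose proof selection_ratio_pow.
destruct (le_pow_mult_exp 22 3 ltac:(lra)). destruct (le_pow_mult_exp 22 (3 * C) ltac:(lra)).
pose proof (selection_large_main _ _ _ Hlevel) as Hmain. destruct Hsmooth as [HL HT HK _ HD _].
pose proof (ratio_pow_lower D T 1 K HK ltac:(lra) ltac:(lra)) as Hratio. rewrite Rmult_1_r in Hratio.
assert (600000 * L ^ 22 * exp (T / 2) <= 600000 * L ^ 22 * M) by (apply Rmult_le_compat_l; [pos|exact Hhalf]).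
assert ((600003 + 3 * C) * (L ^ 22 * M) <= exp T / 2).
{ replace (exp T) with (M * exp ((1 / 2 - delta / 2) * L)) by (unfold M; rewrite <- exp_plus; f_equal; unfold T, s; field).
  assert (exp (1 / 4 * L) <= exp ((1 / 2 - delta / 2) * L)) by (apply exp_le_compat; nra).
  replace ((600003 + 3 * C) * (L ^ 22 * M)) with (M * (2 * (600003 + 3 * C) * L ^ 22) / 2) by field.
  apply Rmult_le_compat_r; [lra|]. apply Rmult_le_compat_l; [unfold M; pos|lra]. }
unfold main_average_lower. lra.
Qed.

Lemma prime_weight_smooth_tail X N : (1 <= X <= N)%nat -> L - 2 <= lg X ->
  sum1 (prime_weight (smooth_cutoff D K)) N - sum1 (prime_weight (smooth_cutoff D K)) X <= 1.
Proof.
intros HXN HX. set (S0 := tail_exponent delta).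
assert (HS0 : 4 <= S0) by (unfold S0, tail_exponent; assert (0 < 8 / delta) by pos; lra).
destruct (ratio_pow_upper_exp L T D K S0 Hsmooth ltac:(lra) (selection_large_tail _ _ _ Hlevel)) as [HS0D Hratio].
pose proof (smooth_cutoff_tail D K S0 X N ltac:(lra) HXN) as Htail.
set (f := fun n => lg n * smooth_cutoff D K n) in *. assert (HD : 0 <= D) by lra.
assert (Hincr : sum1 (fun n => f n - prime_weight (smooth_cutoff D K) n) X <=
  sum1 (fun n => f n - prime_weight (smooth_cutoff D K) n) N).
{ apply sum1_incr; [lia|]. intros n _. unfold f, prime_weight.
  assert (0 <= lg n * smooth_cutoff D K n) by (apply Rmult_le_pos; [apply ln_INR_nonneg|apply smooth_cutoff_nonneg, HD]).
  pose proof (odd_prime_ind_bounds n). rewrite Rmult_assoc. nra. }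
rewrite !sum1_minus in Hincr.
assert ((D / (D - S0)) ^ K * pow_neg X (S0 - 2) <= 1).
{ apply Rle_trans with (exp (T * S0 + 1) * pow_neg X (S0 - 2)); [apply Rmult_le_compat_r; [pos|exact Hratio]|].
  unfold pow_neg. rewrite <- exp_plus. apply Rle_trans with (exp 0); [apply exp_le_compat|rewrite exp_0; lra].
  pose proof (selection_large_delta _ _ _ Hlevel) as HL. fold S0 in HL. apply Rle_div_l in HL; [|lra].
  assert (HS0d : delta * S0 = 8 + 4 * delta) by (unfold S0, tail_exponent; field; lra).
  assert (T * S0 = S0 * L - (2 + delta) * L).
  { unfold T. replace ((1 - delta / 4) * L * S0) with (S0 * L - delta * S0 / 4 * L) by field. rewrite HS0d. field. }
  assert ((S0 - 2) * (L - 2) <= (S0 - 2) * lg X) by (apply Rmult_le_compat_l; lra). lra. }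
lra.
Qed.

(* The mean [exp T / 2] of the weights exceeds all errors by the factor [exp (3 delta L / 4 + L / 2)], even
   after dividing by [P]. *)
Lemma selected_count_lower P M0 E z c x : 0 < P <= exp ((1 / 2 - delta) * L) -> exp T / 2 <= M0 ->
  0 <= E <= (144001 + 3 * C) * (L ^ 18 * M) ->
  0 <= z <= exp (delta / 32 * L) -> 0 <= c -> 0 <= x <= L -> M0 / 2 <= P * (c * x + (z ^ 2 + 1) * E + 1) -> exp (L / 2) <= c.
Proof.
intros HP HM0 HE Hz Hc Hx Hcount. pose proof (selection_large _ _ _ Hlevel) as HL.
pose proof (selection_large_error _ _ _ Hlevel) as Herror. pose proof (selection_large_const _ _ _ Hlevel) as Hconst.
pose proof (selection_large_log _ _ _ Hlevel) as Hlog. rewrite pow_O, Rmult_1_r in Hconst. rewrite pow_1 in Hlog.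
set (U := exp ((1 / 2 + 3 * delta / 4) * L)).
assert (HU : U / 4 <= c * x + (z ^ 2 + 1) * E + 1).
{ assert (0 <= c * x) by (apply Rmult_le_pos; lra).
  assert (0 <= (z ^ 2 + 1) * E) by (apply Rmult_le_pos; [pose proof (pow2_ge_0 z)|]; lra).
  apply Rmult_le_reg_r with (exp ((1 / 2 - delta) * L)); [pos|]. rewrite (Rmult_comm (_ + 1)).
  apply Rle_trans with (P * (c * x + (z ^ 2 + 1) * E + 1)); [|apply Rmult_le_compat_r; lra].
  assert (exp T = U * exp ((1 / 2 - delta) * L)) by (unfold U; rewrite <- exp_plus; f_equal; unfold T; field). lra. }
set (z2 := exp (delta / 16 * L)). assert (HzE : (z ^ 2 + 1) * E <= U / 16).
{ assert (z ^ 2 <= z2).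
  { unfold z2. replace (delta / 16 * L) with (INR 2 * (delta / 32 * L)) by (simpl; field). rewrite exp_INR_mult.
    apply pow_incr, Hz. }
  assert (1 <= z2) by (apply exp_ge_1; nra). pose proof (pow2_ge_0 z).
  apply Rle_trans with (2 * z2 * ((144001 + 3 * C) * (L ^ 18 * M))); [apply Rmult_le_compat; lra|].
  replace U with (exp (7 * delta / 16 * L) * (z2 * M)) by (unfold U, z2, M; rewrite <- !exp_plus; f_equal; unfold s; field).
  replace (2 * z2 * ((144001 + 3 * C) * (L ^ 18 * M))) with (32 * (144001 + 3 * C) * L ^ 18 * (z2 * M) / 16) by field.
  apply Rmult_le_compat_r; [lra|]. apply Rmult_le_compat_r; [unfold z2, M; pos|exact Herror]. }
assert (HU2 : U = exp (3 * delta / 4 * L) * exp (L / 2)) by (unfold U; rewrite <- exp_plus; f_equal; field).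
assert (Hhalf : 1 <= exp (L / 2)) by (apply exp_ge_1; lra).
assert (16 <= U) by (rewrite HU2; nra).
assert (8 * L * exp (L / 2) <= U) by (rewrite HU2; apply Rmult_le_compat_r; lra).
assert (c * x <= c * L) by (apply Rmult_le_compat_l; lra). apply Rmult_le_reg_r with L; lra.
Qed.

End SelectionLevel.

Lemma INR_le_of_pow2_le m L : 0 <= L -> 2 ^ m <= exp (L / 2) -> INR m <= L.
Proof.
intros HL Hm. apply ln_le in Hm; [|pos]. rewrite ln_pow, ln_exp in Hm by lra. pose proof ln2_bounds. pose proof (pos_INR m).
nra.
Qed.

Theorem exists_primes_with_signs delta : GRH -> 0 < delta <= 1 / 8 ->
  Rbar_locally p_infty (fun L => forall (Z : nat) (Q : list nat) (eps a : nat -> R),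
    prime_list Z (length Q) Q -> (forall q, eps q = 1 \/ eps q = -1) ->
    2 ^ length Q <= exp ((1 / 2 - delta) * L) -> INR Z <= exp (delta / 32 * L) ->
    (forall q, Rabs (a q) <= 1) -> (forall q, a q <> 0 -> odd_prime q /\ ~ In q Q) -> sum1 (fun q => a q ^ 2) Z <= 1 / 2 ->
    exists l, NoDup l /\ exp (L / 2) <= INR (length l) /\ forall p, In p l -> odd_prime p /\ INR p <= exp L /\
      (forall q, In q Q -> legendreR p q = eps q \/ q = p) /\ legendre_sum a Z p ^ 2 <= 1).
Proof.
intros HG Hdelta. set (s := 1 / 2 + delta / 4). assert (Hs : 1 / 2 < s < 1) by (unfold s; lra).
destruct (sum1_mangoldt_powers_bounded s ltac:(lra)) as (C & HC & HCN).
generalize (at_infinity_selection_level delta C (proj1 Hdelta)). apply filter_imp.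
intros L Hlevel Z Q eps a HQ Heps HP HZ Ha Hsupport Hnorm. pose proof (selection_large _ _ _ Hlevel) as HL.
set (T := (1 - delta / 4) * L). assert (HT : L / 2 <= T <= 2 * L) by (unfold T; nra).
destruct (exists_smoothing_level L T HL HT) as (K & D & Hsmooth).
assert (HD : 3 <= D) by (pose proof (smoothing_scale_large _ _ _ _ Hsmooth); lra).
destruct (exists_floor_exp L HL) as (X & HX1 & HX & HlnX). set (m := length Q) in *. set (v := smooth_cutoff D K).
assert (Hm : INR m <= L).
{ apply INR_le_of_pow2_le; [lra|]. eapply Rle_trans; [exact HP|]. apply exp_le_compat. nra. }
assert (HlnZ : lg Z <= L).
{ destruct (Nat.eq_dec Z 0) as [-> | HZ0]; [simpl; rewrite ln_0; lra|].
  rewrite <- (ln_exp L). apply ln_le; [pos|]. eapply Rle_trans; [exact HZ|]. apply exp_le_compat. nra. }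
pose proof (char_average_error_bounds delta C L D K Hdelta HC Hlevel Hsmooth m Z Hm HlnZ) as HE.
set (E := char_average_error _ C D K m Z) in *.
assert (Hv : forall n, 0 <= v n <= 1) by (intros; split; [apply smooth_cutoff_nonneg; lra|apply smooth_cutoff_le_1; lra]).
destruct (selection v E Z m eps Hv (proj1 HE) Heps (fun I HI Hnil => char_average I Z m s C D K HG HI Hnil Hs HD HCN)
  Q a HQ Ha Hsupport X (main_average_lower s C D K) 1 Hnorm (main_average s C D K HG Hs HD HCN)
  (fun N HN => prime_weight_smooth_tail delta C L D K Hdelta Hlevel Hsmooth X N (conj HX1 HN) (proj1 HlnX)))
    as (l & Hdup & Hsel & Hcount).
exists l. split; [exact Hdup|split].
- apply (selected_count_lower delta C L Hdelta Hlevel (2 ^ m) (main_average_lower s C D K) E (INR Z) (INR (length l))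
    (lg X)); try exact Hcount.
  + split; [pos|exact HP].
  + exact (main_average_lower_bound delta C L D K Hdelta HC Hlevel Hsmooth).
  + exact HE.
  + split; [pos|exact HZ].
  + pos.
  + split; [apply ln_INR_nonneg|apply HlnX].
- intros p Hp. destruct (Hsel p Hp) as (HpX & Hodd & Hsigns & Hsum). split; [exact Hodd|split; [|split; assumption]].
  apply Rle_trans with (INR X); [apply le_INR, HpX|exact HX].
Qed.

Theorem exists_selected_primes sigma t delta : GRH -> 1 / 2 < sigma < 1 -> 0 < delta <= 1 / 8 -> exists C2,
  Rbar_locally p_infty (fun L => forall (Y : nat) (kp : R), (1 <= Y)%nat -> INR Y <= L ^ 2 ->
    / (2 * sigma - 1) * pow_neg Y (2 * sigma - 1) <= 1 / 2 ->
    sum1 odd_prime_ind Y * ln 2 <= (1 / 2 - delta) * L -> (kp = 1 \/ kp = -1) ->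
    exists l, NoDup l /\ exp (L / 2) <= INR (length l) /\ forall p, In p l -> odd_prime p /\ INR p <= exp L /\
      exists u v : R, is_dirichlet_value (legendreR p) sigma t u v /\ 0 < u ^ 2 + v ^ 2 /\
        main_sum sigma t Y - C2 <= kp * (/ 2 * ln (u ^ 2 + v ^ 2))).
Proof.
intros HG Hsigma Hdelta. destruct (log_L_lower_selected sigma t HG Hsigma) as [C2 HC2]. exists C2.
set (rho := (3 - sigma) / (5 / 2)) in *. assert (Hrho : 4 / 5 <= rho < 1) by (unfold rho; lra).
pose proof (truncation_level rho (delta / 32) ltac:(lra) ltac:(lra)) as Htrunc.
generalize (filter_and _ _ (at_infinity_ge 1) (filter_and _ _ Htrunc (exists_primes_with_signs delta HG Hdelta))).
apply filter_imp. intros L (HL & (K & HrhoK & HK) & Hprimes) Y kp HY HYL HYtail Hcount Hkp.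
set (Z := (5 ^ S K)%nat). assert (HZ : INR Z = 5 ^ S K) by (unfold Z; rewrite pow_INR; f_equal; simpl; ring).
assert (Hpow : 0 < rho ^ S K) by pos. assert (HL2 : L <= L ^ 2) by (simpl; nra).
assert (HYZ : (Y <= Z)%nat).
{ apply INR_le. rewrite HZ. apply Rle_trans with (L ^ 2); [exact HYL|].
  assert (Hfive : 1 <= (5 * rho) ^ S K) by (apply pow_R1_Rle; lra). rewrite Rpow_mult_distr in Hfive. nra. }
assert (Hweight : 2 ^ length (odd_primes_upto Y) <= exp ((1 / 2 - delta) * L)).
{ rewrite <- exp_pow2. apply exp_le_compat. rewrite length_odd_primes_upto. exact Hcount. }
destruct (Hprimes Z (odd_primes_upto Y) (cos_sign kp t) (tail_coef sigma t K Y) (prime_list_odd_primes_upto Y Z HYZ)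
  (cos_sign_values kp t Hkp) Hweight ltac:(rewrite HZ; exact HK)) as (l & Hdup & Hlen & Hl).
- intros q. eapply Rle_trans; [apply tail_coef_bound, Hsigma|apply pow_neg_le_1; lra].
- intros q. apply tail_coef_support.
- eapply Rle_trans; [apply tail_coef_square_sum; [exact Hsigma|lia]|exact HYtail].
- exists l. split; [exact Hdup|split; [exact Hlen|]]. intros p Hp. destruct (Hl p Hp) as (Hodd & HpL & Hsel & Htail).
  split; [exact Hodd|split; [exact HpL|]].
  apply (HC2 p K Y Z kp (cos_sign kp t) Hodd Hkp (cos_sign_mult kp t)); [| |rewrite HZ; lra|exact HYZ| |exact Htail].
  + assert (lg p <= L) by (rewrite <- (ln_exp L); apply ln_le; [destruct Hodd; pos|exact HpL]).
    apply Rle_trans with (rho ^ S K * L ^ 2); [|exact HrhoK]. apply Rmult_le_compat_l; lra.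
  + apply Rle_trans with (L ^ 2 * rho ^ S K); [|lra].
    apply Rmult_le_compat; [apply pos_INR|pos|exact HYL|apply pow_incr; unfold rho; lra].
  + intros q Hq HqY. apply Hsel, In_odd_primes_upto. auto.
Qed.
(** * Choice of parameters *)

Lemma odd_prime_ind_le n : 0 <= odd_prime_ind n <= prime_ind n.
Proof. unfold odd_prime_ind. pose proof (prime_ind_bounds n). destruct (Nat.leb 3 n); lra. Qed.

Lemma sum1_cutoff_le c W Y : 0 <= c -> sum1 (fun n => if Nat.leb n W then c else 0) Y <= INR W * c.
Proof.
intros Hc. apply Rle_trans with (INR (Nat.min Y W) * c); [|apply Rmult_le_compat_r; [exact Hc|apply le_INR; lia]].
induction Y as [|Y IH]; [simpl; lra|]. rewrite sum1_succ. destruct (Nat.leb_spec (S Y) W).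
- replace (Nat.min (S Y) W) with (S (Nat.min Y W)) by lia. rewrite S_INR. lra.
- replace (Nat.min (S Y) W) with (Nat.min Y W) by lia. lra.
Qed.

Lemma odd_prime_count_le_theta Y W : sum1 odd_prime_ind Y * lg W <= INR W * lg W + chebyshev_theta Y.
Proof.
pose proof (ln_INR_nonneg W) as HW.
apply Rle_trans with (sum1 (fun n => (if Nat.leb n W then lg W else 0) + prime_ind n * lg n) Y).
- rewrite Rmult_comm, <- sum1_scal. apply sum1_le. intros n Hn. destruct (odd_prime_ind_le n).
  pose proof (prime_ind_bounds n). pose proof (ln_INR_nonneg n).
  assert (0 <= prime_ind n * lg n) by pos. destruct (Nat.leb_spec n W) as [HnW|HWn].
  { assert (lg W * odd_prime_ind n <= lg W * 1) by (apply Rmult_le_compat_l; lra). lra. }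
  assert (Hle : lg W <= lg n).
  { destruct (Nat.eq_dec W 0) as [-> | HW0];
      [change (INR 0) with 0; rewrite ln_0; assumption|apply ln_le; [pos|apply le_INR; lia]]. }
  assert (lg W * odd_prime_ind n <= lg n * prime_ind n) by (apply Rmult_le_compat; lra). lra.
- rewrite sum1_plus. apply Rplus_le_compat_r, sum1_cutoff_le, HW.
Qed.

Lemma main_sum_lower sigma t Y : 0 <= sigma ->
  sum1 (fun n => prime_ind n * lg n * cos_sq_term sigma t (lg n)) Y - 1 <= main_sum sigma t Y * lg Y.
Proof.
intros Hs. apply Rle_trans with (sum1 (fun n => prime_ind n * lg n * cos_sq_term sigma t (lg n) -
  (if Nat.eqb n 2 then 1 else 0)) Y).
{ rewrite sum1_minus. pose proof (sum1_delta_le 2 1 Y ltac:(lra)). lra. }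
rewrite Rmult_comm. unfold main_sum. rewrite <- sum1_scal. apply sum1_le. intros n Hn.
pose proof ln2_bounds. pose proof (ln_INR_nonneg n). pose proof (pow_neg_pos n sigma).
pose proof (Rabs_cos_le (t * lg n)). pose proof (Rabs_pos (cos (t * lg n))).
assert (Hle : lg n <= lg Y) by (apply ln_le; [pos|apply le_INR; lia]).
assert (Hterm : 0 <= cos_sq_term sigma t (lg n) <= Rabs (cos (t * lg n)) * pow_neg n sigma).
{ unfold cos_sq_term. change (exp (- sigma * lg n)) with (pow_neg n sigma). rewrite <- pow2_abs.
  set (c := Rabs (cos (t * lg n))) in *.
  rewrite (Rmult_comm (pow_neg n sigma)). split; [apply Rmult_le_pos; [apply pow2_ge_0|lra]|].
  apply Rmult_le_compat_r; [lra|]. simpl. nra. }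
assert (Htwo : (prime_ind n - odd_prime_ind n) * lg n * cos_sq_term sigma t (lg n) <= (if Nat.eqb n 2 then 1 else 0)).
{ pose proof (mangoldt_rest_eq n) as Hrest. unfold mangoldt_rest, mangoldt_powers in Hrest.
  replace ((prime_ind n - odd_prime_ind n) * lg n) with (if Nat.eqb n 2 then ln 2 else 0) by lra.
  pose proof (pow_neg_le_1 n sigma Hs). assert (cos_sq_term sigma t (lg n) <= 1) by nra. destruct (Nat.eqb n 2); [nra|lra]. }
destruct (odd_prime_ind_le n).
assert (odd_prime_ind n * lg n * cos_sq_term sigma t (lg n) <=
  odd_prime_ind n * (lg Y * (Rabs (cos (t * lg n)) * pow_neg n sigma))).
{ rewrite Rmult_assoc. apply Rmult_le_compat_l; [assumption|]. apply Rmult_le_compat; lra. }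
lra.
Qed.

Lemma main_sum_nonneg sigma t Y : 0 <= main_sum sigma t Y.
Proof. apply sum1_nonneg. intros n _. apply Rmult_le_pos; [apply odd_prime_ind_le|].
apply Rmult_le_pos; [apply Rabs_pos|pos]. Qed.

Definition log_scale (sigma L : R) : R := Rpower L (1 - sigma) * Rpower (ln L) (- sigma).

Lemma le_Rpower a c : 0 < a < 1 -> 0 < c <= 1 -> c <= Rpower c a.
Proof.
intros Ha Hc. unfold Rpower. rewrite <- (exp_ln c) at 1 by lra. apply exp_le_compat.
assert (ln c <= 0) by (rewrite <- ln_1; apply ln_le; lra). nra.
Qed.

Record cutoff_level (delta L : R) : Prop := {
  cutoff_large : 1 / delta <= L;
  cutoff_large_ln : 4 + 1 / delta <= ln L;
  cutoff_large_ln_ln : 1 * ln L ^ 1 <= exp (delta * ln L);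
  cutoff_large_const : 2 / delta * ln L ^ 0 <= exp (delta * ln L)
}.

Lemma at_infinity_cutoff_level delta : 0 < delta -> Rbar_locally p_infty (cutoff_level delta).
Proof.
intros Hdelta. assert (Hln : Rbar_locally p_infty (fun ell => 4 + 1 / delta <= ell /\ 1 * ell ^ 1 <= exp (delta * ell) /\
  2 / delta * ell ^ 0 <= exp (delta * ell)))
  by at_infinity.
generalize (filter_and _ _ (at_infinity_ge (1 / delta)) (at_infinity_ln _ Hln)). apply filter_imp. intros L (? & ? & ? & ?).
split; assumption.
Qed.

(* Chosen so that [2^(pi(y))] stays below [exp ((1/2 - delta) L)]. *)
Definition prime_cutoff (delta L : R) : R := (1 - 6 * delta) * L * ln L / (2 * ln 2).

Section Cutoff.
Variables (delta L : R) (Y : nat).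
Hypothesis Hdelta : 0 < delta <= 1 / 16.
Hypothesis Hlevel : cutoff_level delta L.
Let ell := ln L.
Let y := prime_cutoff delta L.

Lemma cutoff_ln_bounds : 4 <= ell /\ 1 <= delta * ell /\ 1 <= delta * L /\ exp ell = L /\ ell <= L.
Proof.
destruct Hlevel as [HL Hell _ _]. fold ell in Hell. assert (0 < 1 / delta) by pos.
assert (Hexp : exp ell = L) by (apply exp_ln; lra).
assert (Hell' : 1 / delta <= ell) by lra. apply Rle_div_l in HL, Hell'; try lra.
repeat split; try lra. rewrite <- Hexp. pose proof (exp_ineq1_le ell). lra.
Qed.

Lemma prime_cutoff_bounds : y * (2 * ln 2) = (1 - 6 * delta) * L * ell /\ L <= y <= L * ell.
Proof.
destruct cutoff_ln_bounds as (Hell & _ & HdL & _ & HellL). pose proof ln2_bounds.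
assert (Hy : y * (2 * ln 2) = (1 - 6 * delta) * L * ell) by (unfold y, prime_cutoff; fold ell; field; lra).
split; [exact Hy|]. assert (4 * L <= L * ell) by nra.
split; apply Rmult_le_reg_r with (2 * ln 2); try lra; rewrite Hy; nra.
Qed.

Hypothesis HY : INR Y <= y < INR Y + 1.

Lemma cutoff_lower : (1 - delta) * y <= INR Y.
Proof. destruct prime_cutoff_bounds as [_ Hy]. destruct cutoff_ln_bounds as (_ & _ & HdL & _). nra. Qed.

Lemma ln_cutoff_upper : 0 < INR Y /\ lg Y <= (1 + delta) * ell.
Proof.
destruct cutoff_ln_bounds as (Hell & _ & _ & Hexp & HellL). destruct prime_cutoff_bounds as [_ Hy]. pose proof cutoff_lower.
assert (HY0 : 0 < INR Y) by nra. split; [exact HY0|].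
apply Rle_trans with (ln (L * ell)); [apply ln_le; lra|]. rewrite ln_mult by lra. fold ell.
pose proof (cutoff_large_ln_ln _ _ Hlevel) as Hln. rewrite pow_1, Rmult_1_l in Hln. fold ell in Hln.
assert (ln ell <= delta * ell) by (rewrite <- (ln_exp (delta * ell)); apply ln_le; lra). lra.
Qed.

Lemma cutoff_prime_count : chebyshev_theta Y <= (1 + delta) * INR Y -> sum1 odd_prime_ind Y * ln 2 <= (1 / 2 - delta) * L.
Proof.
intros Htheta. destruct cutoff_ln_bounds as (Hell & Hdell & HdL & Hexp & HellL). destruct prime_cutoff_bounds as [Hy HyL].
pose proof ln2_bounds.
set (w := exp ((1 - delta) * ell)).
assert (Hw : 2 <= w) by (pose proof (exp_ineq1_le ((1 - delta) * ell)); unfold w; nra).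
assert (HwL : w <= delta / 2 * L).
{ unfold w. replace ((1 - delta) * ell) with (ell + - (delta * ell)) by ring. rewrite exp_plus, exp_Ropp, Hexp, Rmult_comm.
  apply Rmult_le_compat_r; [lra|].
  replace (delta / 2) with (/ (2 / delta)) by (field; lra). apply Rinv_le_contravar; [pos|].
  pose proof (cutoff_large_const _ _ Hlevel) as Hconst. rewrite pow_O, Rmult_1_r in Hconst. exact Hconst. }
destruct (nfloor_ex w) as [W [HW1 HW2]]; [lra|].
assert (HlnW : (1 - 2 * delta) * ell <= lg W).
{ assert (Hln : ln (w / 2) <= lg W) by (apply ln_le; lra). unfold w, Rdiv in Hln.
  rewrite ln_mult, ln_exp, ln_Rinv in Hln by (try apply exp_pos; lra). lra. }
pose proof (odd_prime_count_le_theta Y W). set (s := sum1 odd_prime_ind Y) in *.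
destruct (Rle_dec s (INR W)) as [HsW|HsW]; [nra|].
assert (Hell0 : 0 < (1 - 2 * delta) * ell) by nra.
assert (Hexcess : (s - INR W) * ((1 - 2 * delta) * ell) <= (1 + delta) * y).
{ apply Rle_trans with ((s - INR W) * lg W); [apply Rmult_le_compat_l; lra|nra]. }
assert (Hcount : (s - INR W) * (2 * ln 2) <= (1 - 3 * delta) * L).
{ apply Rmult_le_reg_r with ((1 - 2 * delta) * ell); [exact Hell0|]. apply Rle_trans with ((1 + delta) * (y * (2 * ln 2))).
  - replace ((s - INR W) * (2 * ln 2) * ((1 - 2 * delta) * ell))
      with ((s - INR W) * ((1 - 2 * delta) * ell) * (2 * ln 2)) by ring.
    rewrite <- (Rmult_assoc (1 + delta)). apply Rmult_le_compat_r; lra.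
  - rewrite Hy. replace ((1 + delta) * ((1 - 6 * delta) * L * ell)) with (L * ell * ((1 + delta) * (1 - 6 * delta))) by ring.
    replace ((1 - 3 * delta) * L * ((1 - 2 * delta) * ell)) with (L * ell * ((1 - 3 * delta) * (1 - 2 * delta))) by ring.
    apply Rmult_le_compat_l; nra. }
assert (INR W * ln 2 <= w * 1) by (apply Rmult_le_compat; try lra; apply pos_INR). lra.
Qed.

Lemma cutoff_Rpower_lower a : 0 < a < 1 -> (1 - 7 * delta) * (Rpower L a * Rpower ell a * Rpower (2 * ln 2) (- a)) <=
  Rpower (INR Y) a.
Proof.
intros Ha. destruct cutoff_ln_bounds as (Hell & _ & _ & _ & HellL). pose proof ln2_bounds. pose proof cutoff_lower.
set (c := (1 - delta) * (1 - 6 * delta)). assert (Hc : 0 < c <= 1) by (unfold c; split; nra).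
assert (Hy : (1 - delta) * y = c * (L * ell * / (2 * ln 2))) by (unfold y, prime_cutoff, c; fold ell; field; lra).
assert (Hinv : Rpower (2 * ln 2) (- a) = Rpower (/ (2 * ln 2)) a) by (unfold Rpower; rewrite ln_Rinv by lra; f_equal; ring).
assert (Hinv0 : 0 < / (2 * ln 2)) by pos. assert (Hell0 : 0 < L * ell) by nra.
rewrite Hinv, !Rpower_mult_distr by lra. set (z := L * ell * / (2 * ln 2)) in *.
assert (Hz : 0 < z) by (apply Rmult_lt_0_compat; assumption).
apply Rle_trans with (Rpower (c * z) a).
- rewrite <- Rpower_mult_distr by lra. apply Rmult_le_compat_r; [apply Rlt_le, exp_pos|].
  pose proof (le_Rpower a c Ha Hc). unfold c in *. nra.
- apply Rle_Rpower_l; [lra|]. split; [apply Rmult_lt_0_compat; lra|lra].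
Qed.

Lemma main_sum_cutoff_lower sigma t k : 1 / 2 < sigma < 1 -> 0 <= k ->
  k / (1 - sigma) * exp ((1 - sigma) * lg Y) <= sum1 (fun n => prime_ind n * lg n * cos_sq_term sigma t (lg n)) Y ->
  k * (1 - 8 * delta) * beta_sigma sigma * log_scale sigma L - 1 <= main_sum sigma t Y.
Proof.
intros Hs Hk Hprimes. set (a := 1 - sigma) in *. assert (Ha : 0 < a < 1) by (unfold a; lra).
destruct cutoff_ln_bounds as (Hell & _). pose proof (main_sum_lower sigma t Y ltac:(lra)).
pose proof (main_sum_nonneg sigma t Y) as Hnonneg.
destruct ln_cutoff_upper as [_ HlnY]. apply (Rmult_le_compat_l _ _ _ Hnonneg) in HlnY.
set (P := Rpower L a * Rpower ell a * Rpower (2 * ln 2) (- a)). assert (HP : 0 < P) by (unfold P, Rpower; pos).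
assert (Hpow : k / a * ((1 - 7 * delta) * P) <= k / a * exp (a * lg Y))
  by (apply Rmult_le_compat_l; [pos|apply cutoff_Rpower_lower, Ha]).
assert (Hscale : beta_sigma sigma * log_scale sigma L * ell = P / a).
{ assert (Hpower : Rpower ell (- sigma) * ell = Rpower ell a).
  { rewrite <- (Rpower_1 ell) at 2 by lra. rewrite <- Rpower_plus. f_equal. unfold a. ring. }
  unfold P. rewrite <- Hpower. unfold beta_sigma, log_scale. fold a ell. replace (sigma - 1) with (- a) by (unfold a; ring).
  field. lra. }
set (X := k * (P / a)). assert (HX : 0 <= X) by (apply Rmult_le_pos; [exact Hk|]; left; apply Rdiv_lt_0_compat; lra).
apply Rmult_le_reg_r with ((1 + delta) * ell); [nra|].
replace ((k * (1 - 8 * delta) * beta_sigma sigma * log_scale sigma L - 1) * ((1 + delta) * ell))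
  with (k * (beta_sigma sigma * log_scale sigma L * ell) * ((1 - 8 * delta) * (1 + delta)) - (1 + delta) * ell) by ring.
rewrite Hscale. fold X. replace (k / a * ((1 - 7 * delta) * P)) with (X * (1 - 7 * delta)) in Hpow by (unfold X; field; lra).
nra.
Qed.

End Cutoff.

Lemma exists_prime_cutoff sigma t delta Y0 : GRH -> 1 / 2 < sigma < 1 -> 0 < delta <= 1 / 16 ->
  delta <= cos_sq_density (1 - sigma) t ->
  Rbar_locally p_infty (fun L => exists Y, (Y0 <= Y)%nat /\ (1 <= Y)%nat /\ INR Y <= L ^ 2 /\
    sum1 odd_prime_ind Y * ln 2 <= (1 / 2 - delta) * L /\
    (cos_sq_density (1 - sigma) t - delta) * (1 - 8 * delta) * beta_sigma sigma * log_scale sigma L - 1 <=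
      main_sum sigma t Y).
Proof.
intros HG Hs Hd Hk. destruct (prime_number_theorem delta HG ltac:(lra)) as [N1 HN1].
destruct (sum1_prime_cos_sq_lower sigma t Hs delta HG ltac:(lra)) as [N2 HN2].
generalize (filter_and _ _ (at_infinity_ge (2 * INR (Y0 + N1 + N2 + 1))) (at_infinity_cutoff_level delta (proj1 Hd))).
apply filter_imp. intros L [HL Hlevel]. destruct (prime_cutoff_bounds delta L Hd Hlevel) as [_ Hy].
destruct (cutoff_ln_bounds delta L Hd Hlevel) as (Hell & _ & _ & _ & HellL).
destruct (nfloor_ex (prime_cutoff delta L)) as [Y HY]; [lra|].
pose proof (cutoff_lower delta L Y Hd Hlevel HY). assert (HYL : L / 2 <= INR Y) by nra.
assert (HYbig : (Y0 + N1 + N2 + 1 <= Y)%nat) by (apply INR_le; lra).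
exists Y. split; [lia|split; [lia|split; [apply Rle_trans with (L * ln L); [lra|simpl; nra]|split]]].
- apply (cutoff_prime_count delta L Y Hd Hlevel HY), HN1. lia.
- apply (main_sum_cutoff_lower delta L Y Hd Hlevel HY sigma t); [exact Hs|lra|apply HN2; lia].
Qed.

Definition large_values (sigma t kp x e : R) : Prop :=
  exists S : list nat, NoDup S /\ sqrt x <= INR (length S) /\ forall p, In p S -> prime (Z.of_nat p) /\ (2 < p)%nat /\
    INR p <= x /\
    exists l : C, is_DSval (chi_leg p) (sigma, t) l /\ (beta sigma t - e) * scale sigma x <= kp * ln (Cmod l).

Lemma beta_cos_sq_density sigma t : beta sigma t = cos_sq_density (1 - sigma) t * beta_sigma sigma.
Proof. unfold beta, cos_sq_density. destruct (Req_EM_T t 0); [ring|]. unfold Rdiv. ring. Qed.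

Lemma log_scale_unbounded sigma M : 1 / 2 < sigma < 1 -> Rbar_locally p_infty (fun L => M <= log_scale sigma L).
Proof.
intros Hs. set (a := 1 - sigma). assert (Ha : 0 < a < 1) by (unfold a; lra).
assert (Hlarge : Rbar_locally p_infty (fun ell => 1 <= ell /\ 1 * ell ^ 1 <= exp (a / 2 * ell) /\
  M * ell ^ 0 <= exp (a / 2 * ell))) by at_infinity.
apply at_infinity_ln in Hlarge. revert Hlarge. apply filter_imp. intros L (Hell & Hln & HM). unfold log_scale, Rpower. fold a.
set (ell := ln L) in *. rewrite pow_1, Rmult_1_l in Hln. rewrite pow_O, Rmult_1_r in HM.
eapply Rle_trans; [exact HM|]. rewrite <- exp_plus. apply exp_le_compat.
pose proof (ln_nonneg ell ltac:(lra)).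
assert (ln ell <= a / 2 * ell) by (rewrite <- (ln_exp (a / 2 * ell)); apply ln_le; lra). nra.
Qed.

Lemma pow_neg_eventually_small c M : 0 < c -> eventually (fun Y => M * pow_neg Y c <= 1 / 2).
Proof.
intros Hc. generalize (eventually_ln_INR _ (at_infinity_pow_le_exp (2 * M) 0 c Hc)). apply filter_imp. intros Y [_ HY].
rewrite pow_O, Rmult_1_r in HY. unfold pow_neg. replace (- c * lg Y) with (- (c * lg Y)) by ring. rewrite exp_Ropp.
pose proof (exp_pos (c * lg Y)).
apply Rle_div_l; [assumption|lra].
Qed.

Lemma ln_Cmod u v : 0 < u ^ 2 + v ^ 2 -> ln (Cmod (u, v)) = / 2 * ln (u ^ 2 + v ^ 2).
Proof. intros Huv. unfold Cmod. simpl (fst _). simpl (snd _). rewrite <- Rpower_sqrt by exact Huv. unfold Rpower.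
apply ln_exp. Qed.

Lemma cos_sq_density_pos sigma t : 1 / 2 < sigma < 1 -> 0 < cos_sq_density (1 - sigma) t.
Proof.
intros Hs. unfold cos_sq_density. destruct (Req_EM_T t 0) as [Ht|Ht]; [lra|].
apply Rdiv_lt_0_compat; [apply pow2_gt_0, Ht|apply (cos_sq_denominator_pos sigma t Hs)].
Qed.

Lemma density_loss k d b e s C : 0 <= k <= 1 -> 0 < d -> 0 < b -> d <= e / (18 * b) -> Rabs C + 1 <= e / 2 * s -> 0 <= s ->
  (k * b - e) * s <= (k - d) * (1 - 8 * d) * b * s - 1 - C.
Proof.
intros Hk Hd Hb Hde HC Hs. pose proof (Rle_abs C).
assert (Hloss : 9 * d * b <= e / 2).
{ apply (Rmult_le_compat_r (9 * b)) in Hde; [|lra]. replace (e / (18 * b) * (9 * b)) with (e / 2) in Hde by (field; lra).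
  lra. }
assert (k * b - 9 * d * b <= (k - d) * (1 - 8 * d) * b)
  by (rewrite <- Rmult_minus_distr_r; apply Rmult_le_compat_r; [lra|nra]).
assert ((k * b - e / 2) * s <= (k - d) * (1 - 8 * d) * b * s) by (apply Rmult_le_compat_r; lra). lra.
Qed.

Theorem large_values_eventually sigma t kp e : GRH -> 1 / 2 < sigma < 1 -> (kp = 1 \/ kp = -1) -> 0 < e ->
  Rbar_locally p_infty (fun x => large_values sigma t kp x e).
Proof.
intros HG Hs Hkp He. set (b := beta_sigma sigma). assert (Hb : 0 < b) by (apply Rdiv_lt_0_compat; [apply exp_pos|lra]).
set (k := cos_sq_density (1 - sigma) t).
assert (Hk : 0 < k <= 1) by (split; [apply cos_sq_density_pos, Hs|apply (cos_sq_density_bounds sigma t Hs)]).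
set (delta := Rmin (Rmin (1 / 16) k) (e / (18 * b))).
assert (Hd : 0 < delta <= 1 / 16 /\ delta <= k /\ delta <= e / (18 * b)).
{ unfold delta. pose proof (Rmin_l (Rmin (1 / 16) k) (e / (18 * b))). pose proof (Rmin_l (1 / 16) k).
  pose proof (Rmin_r (1 / 16) k).
  repeat split; try lra; [|apply Rmin_r]. repeat apply Rmin_glb_lt; try lra. apply Rdiv_lt_0_compat; lra. }
clearbody delta. destruct Hd as (Hd & Hdk & Hde).
destruct (pow_neg_eventually_small (2 * sigma - 1) (/ (2 * sigma - 1)) ltac:(lra)) as [Y0 HY0].
destruct (exists_selected_primes sigma t delta HG Hs ltac:(lra)) as [C2 HC2].
pose proof (exists_prime_cutoff sigma t delta Y0 HG Hs Hd Hdk) as Hcutoff. fold k b in Hcutoff.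
pose proof (log_scale_unbounded sigma ((Rabs C2 + 1) / (e / 2)) Hs) as Hscale.
generalize (filter_and _ _ (at_infinity_ge 1) (at_infinity_ln _ (filter_and _ _ HC2 (filter_and _ _ Hcutoff Hscale)))).
apply filter_imp. intros x (Hx & Hprimes & (Y & HYY0 & HY1 & HYL & Hcount & Hmain) & Hsc).
destruct (Hprimes Y kp HY1 HYL (HY0 Y HYY0) Hcount Hkp) as (l & Hdup & Hlen & Hl).
assert (Hexp : exp (ln x) = x) by (apply exp_ln; lra).
exists l. split; [exact Hdup|split].
- rewrite <- Rpower_sqrt by lra. unfold Rpower. replace (/ 2 * ln x) with (ln x / 2) by field. exact Hlen.
- intros p Hp. destruct (Hl p Hp) as ([Hprime Hp2] & Hpx & u & v & Hval & Huv & Hlog). rewrite Hexp in Hpx.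
  split; [exact Hprime|split; [exact Hp2|split; [exact Hpx|]]]. exists (u, v).
  split; [apply (is_DSval_dirichlet_value _ (legendreR p)); [reflexivity|exact Hval]|].
  rewrite ln_Cmod by exact Huv. eapply Rle_trans; [|exact Hlog]. rewrite beta_cos_sq_density. fold k b.
  change (scale sigma x) with (log_scale sigma (ln x)). apply (proj1 (Rle_div_l _ _ (e / 2) ltac:(lra))) in Hsc.
  rewrite Rmult_comm in Hsc.
  assert (0 <= log_scale sigma (ln x)) by (apply Rmult_le_pos; apply Rlt_le, exp_pos).
  pose proof (density_loss k delta b e _ C2 ltac:(lra) ltac:(lra) Hb Hde Hsc ltac:(assumption)). lra.
Qed.

Lemma exists_greatest_le (P : nat -> Prop) M : P 0%nat -> exists n, P n /\ forall k, (k <= M)%nat -> P k -> (k <= n)%nat.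
Proof.
intros H0. induction M as [|M (n & Hn & Hmax)]; [exists 0%nat; split; auto|].
destruct (classic (P (S M))) as [HSM|HSM]; [exists (S M); auto|]. exists n. split; [exact Hn|].
intros k Hk Pk. destruct (Nat.eq_dec k (S M)) as [-> | Hne]; [contradiction|apply Hmax; [lia|exact Pk]].
Qed.

Lemma exists_vanishing_error (P : R -> R -> Prop) : (forall e, 0 < e -> Rbar_locally p_infty (fun x => P x e)) ->
  exists eta : R -> R, filterlim eta (Rbar_locally p_infty) (locally 0) /\ exists X0, forall x, X0 <= x -> P x (- eta x).
Proof.
intros HP. assert (Hpos : forall n, 0 < / INR (S n)) by (intros; pos).
set (Q := fun x n => P x (/ INR (S n))).
assert (Hsel : forall x, exists n, Q x 0%nat -> Q x n /\ forall k, INR k <= x -> Q x k -> (k <= n)%nat).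
{ intros x. destruct (classic (Q x 0%nat)) as [H0|H0]; [|exists 0%nat; tauto].
  destruct (Rle_dec 0 x) as [Hx|Hx]; [|exists 0%nat; intros _; split; [exact H0|intros k Hk; pose proof (pos_INR k); lra]].
  destruct (nfloor_ex x Hx) as [M [_ HM]]. destruct (exists_greatest_le (Q x) M H0) as (n & Hn & Hmax). exists n. intros _.
  split; [exact Hn|].
  intros k Hk Qk. apply Hmax; [|exact Qk]. rewrite <- S_INR in HM. apply Nat.lt_succ_r, INR_lt. lra. }
set (best := fun x => proj1_sig (constructive_indefinite_description _ (Hsel x))).
assert (Hbest : forall x, Q x 0%nat -> Q x (best x) /\ forall k, INR k <= x -> Q x k -> (k <= best x)%nat)
  by (intros x; apply (proj2_sig (constructive_indefinite_description _ (Hsel x)))).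
clearbody best. exists (fun x => - / INR (S (best x))). split.
- apply filterlim_locally. intros eps. destruct (nfloor_ex (/ eps)) as [k [_ Hk]]; [left; apply Rinv_0_lt_compat, cond_pos|].
  generalize (filter_and _ _ (at_infinity_ge (INR k)) (filter_and _ _ (HP _ (Hpos 0%nat)) (HP _ (Hpos k)))).
  apply filter_imp. intros x (Hxk & H0 & HQk). destruct (Hbest x H0) as [_ Hmax]. specialize (Hmax k Hxk HQk).
  change (Rabs (- / INR (S (best x)) - 0) < eps). rewrite Rminus_0_r, Rabs_Ropp, Rabs_pos_eq by (left; apply Hpos).
  apply Rle_lt_trans with (/ INR (S k)); [apply Rinv_le_contravar; [pos|apply le_INR; lia]|].
  rewrite <- S_INR in Hk. rewrite <- (Rinv_inv eps). apply Rinv_lt_contravar; [|exact Hk].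
  apply Rmult_lt_0_compat; [apply Rinv_0_lt_compat, cond_pos|pos].
- destruct (HP _ (Hpos 0%nat)) as [X0 HX0]. exists (X0 + 1). intros x Hx. rewrite Ropp_involutive. apply Hbest, HX0. lra.
Qed.

Theorem exists_large_values sigma t kp : GRH -> 1 / 2 < sigma < 1 -> (kp = 1 \/ kp = -1) ->
  exists eta : R -> R, filterlim eta (Rbar_locally p_infty) (locally 0) /\
    exists X0, forall x, X0 <= x -> large_values sigma t kp x (- eta x).
Proof. intros HG Hs Hkp. apply exists_vanishing_error. intros e. apply large_values_eventually; assumption. Qed.

Theorem theorem1p8 :
  GRH ->
  forall sigma t : R, 1/2 < sigma < 1 ->
  (exists c : R, 0 < c /\
   exists eta : R -> R, filterlim eta (Rbar_locally p_infty) (locally 0) /\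
   exists X0 : R, forall x : R, X0 <= x ->
     exists S : list nat, NoDup S /\ c * sqrt x <= INR (length S) /\
       forall p, In p S ->
         prime (Z.of_nat p) /\ (2 < p)%nat /\ INR p <= x /\
         exists l : C, is_DSval (chi_leg p) (sigma, t) l /\
           ln (Cmod l) >= (beta sigma t + eta x) * scale sigma x)
  /\
  (exists c : R, 0 < c /\
   exists eta : R -> R, filterlim eta (Rbar_locally p_infty) (locally 0) /\
   exists X0 : R, forall x : R, X0 <= x ->
     exists S : list nat, NoDup S /\ c * sqrt x <= INR (length S) /\
       forall q, In q S ->
         prime (Z.of_nat q) /\ (2 < q)%nat /\ INR q <= x /\
         exists l : C, is_DSval (chi_leg q) (sigma, t) l /\
           ln (Cmod l) <= - (beta sigma t + eta x) * scale sigma x).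
Proof.
intros HG sigma t Hs. split.
- destruct (exists_large_values sigma t 1 HG Hs (or_introl eq_refl)) as (eta & Heta & X0 & HX0).
  exists 1. split; [lra|]. exists eta. split; [exact Heta|]. exists X0. intros x Hx.
  destruct (HX0 x Hx) as (S & Hdup & Hlen & HS).
  exists S. split; [exact Hdup|split; [lra|]]. intros p Hp. destruct (HS p Hp) as (Hprime & Hodd & Hle & l & Hval & Hlog).
  split; [exact Hprime|split; [exact Hodd|split; [exact Hle|]]]. exists l. split; [exact Hval|].
  unfold Rminus in Hlog. rewrite Ropp_involutive in Hlog. lra.
- destruct (exists_large_values sigma t (-1) HG Hs (or_intror eq_refl)) as (eta & Heta & X0 & HX0).
  exists 1. split; [lra|]. exists eta. split; [exact Heta|]. exists X0. intros x Hx.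
  destruct (HX0 x Hx) as (S & Hdup & Hlen & HS).
  exists S. split; [exact Hdup|split; [lra|]]. intros q Hq. destruct (HS q Hq) as (Hprime & Hodd & Hle & l & Hval & Hlog).
  split; [exact Hprime|split; [exact Hodd|split; [exact Hle|]]]. exists l. split; [exact Hval|].
  unfold Rminus in Hlog. rewrite Ropp_involutive in Hlog. lra.
Qed.
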